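(* Let $n\ge 1$ and let $b_1,\dots,b_n$ be deterministic nonzero real numbers. For each $N\ge 1$, let $U_{N,1},\dots,U_{N,n}$ be independent random matrices, each distributed according to the Haar probability measure on the special unitary group $SU(N)$, and set $$F_N(z):=\sum_{j=1}^n b_j\,\Phi_{U_{N,j}}(z),\qquad z\in\mathbb{C}.$$ Then the expected number of zeros of $F_N$ on the unit circle satisfies $$\mathbb{E}\Big[\,\big|\{z\in\mathbb{U}:\ F_N(z)=0\}\big|\,\Big]=N-o(N)\qquad (N\to\infty),$$ i.e. the expected proportion of zeros of $F_N$ lying on the unit circle tends to $1$.
   Context: For a unitary matrix $U$ of order $N$, $\Phi_U(z)=\det(I_N-zU)$ denotes its characteristic polynomial. $\mathbb{U}=\{z\in\mathbb{C}:|z|=1\}$ is the unit circle, and $|\{\cdots\}|$ denotes the number of elements of a finite set. *)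

(* Defs.v *)
From HB Require Import structures.
From mathcomp Require Import all_boot all_order all_algebra.
From mathcomp Require Import all_classical all_reals all_analysis.
From mathcomp Require Import complex.
Set Implicit Arguments.
Unset Strict Implicit.
Unset Printing Implicit Defensive.
Import Order.TTheory GRing.Theory Num.Theory.
Local Open Scope classical_set_scope.
Local Open Scope ring_scope.

Section Defs.
Variable R : realType.

Definition adjmx (N : nat) (A : 'M[R[i]]_N) : 'M[R[i]]_N :=
  (map_mx (@Num.conj _) A)^T.

Definition SU (N : nat) : set 'M[R[i]]_N :=
  [set U | U *m adjmx U = 1%:M /\ \det U = 1].

Definition charpoly_det (N : nat) (U : 'M[R[i]]_N) (z : R[i]) : R[i] :=
  \det (1%:M - z *: U).

(* Borel sigma-algebra on N x N complex matrices (identified with R^(2 N^2)):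
   generated by the sets {A | Re (A i j) \in B} and {A | Im (A i j) \in B}
   for Borel sets B of R. *)
Definition mx_generators (N : nat) : set (set 'M[R[i]]_N) :=
  [set S | exists (k l : 'I_N) (B : set R), measurable B /\
     (S = [set A : 'M[R[i]]_N | B (complex.Re (A k l))] \/ S = [set A : 'M[R[i]]_N | B (complex.Im (A k l))])].

Definition mx_borel (N : nat) : set (set 'M[R[i]]_N) := <<s (@mx_generators N) >>.

Section RandomMatrices.
Context (d : measure_display) (Omega : measurableType d)
  (P : probability Omega R) (N : nat).

Definition random_mx (X : Omega -> 'M[R[i]]_N) : Prop :=
  forall B, @mx_borel N B -> measurable (X @^-1` B).

(* The law of X is the Haar probability measure of SU(N): the law is
   carried by SU(N) and is invariant under left multiplication by elements
   of SU(N) (the Haar probability measure of the compact group SU(N) is the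
   unique such probability measure). *)
Definition haar_SU_distributed (X : Omega -> 'M[R[i]]_N) : Prop :=
  random_mx X /\
  P (X @^-1` @SU N) = 1%E /\
  forall V, @SU N V -> forall B, @mx_borel N B ->
    P (X @^-1` [set A | B (V *m A)]) = P (X @^-1` B).

Definition mutually_independent (n : nat) (X : 'I_n -> Omega -> 'M[R[i]]_N) : Prop :=
  forall B : 'I_n -> set 'M[R[i]]_N, (forall j, @mx_borel N (B j)) ->
    P (\bigcap_(j in [set: 'I_n]) (X j @^-1` B j)) =
      (\prod_(j < n) P (X j @^-1` B j))%E.

End RandomMatrices.

(* The number of elements of a set of complex numbers, +oo if infinite:
   the supremum of the lengths of duplicate-free lists of its elements. *)
Definition ncard (A : set R[i]) : \bar R :=
  ereal_sup [set ((size s)%:R)%:E | s in [set s : seq R[i] | uniq s /\ forall z, z \in s -> A z]].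

Definition unit_circle : set R[i] := [set z | `|z| = 1].

Definition nzeros_circle (F : R[i] -> R[i]) : \bar R :=
  ncard [set z | unit_circle z /\ F z = 0].

End Defs.

(* Main.v *)
Require Import Defs.
From HB Require Import structures.
From mathcomp Require Import all_boot all_order all_algebra.
From mathcomp Require Import fingroup perm.
From mathcomp Require Import all_classical all_reals all_analysis.
From mathcomp Require Import complex.
From mathcomp Require Import measurable_realfun ftc spectral ring lra.
Set Implicit Arguments.
Unset Strict Implicit.
Unset Printing Implicit Defensive.
Import Order.TTheory GRing.Theory Num.Theory.
Import numFieldNormedType.Exports.
Local Open Scope classical_set_scope.
Local Open Scope ring_scope.

(** For [U] in SU(N) let [A(z) = det(1 - z d)], where [d] is [U] without its
first row and column.  On the unit circle
[Phi_U(z) = A(z) - (-1)^(N-1) z^N conj(A(z))], so that a zero of [F_N] is an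
angle at which the phase of [z^(-N/2) AA(z)], [AA = sum_j b_j A_j], hits a
fixed line, and the zeros are at least as many as the sign changes of a real
function.  Multiplying every [U_j] by the scalar [e^(i theta)], corrected in
the first row so as to stay in SU(N), only rotates [z]; averaging the sign
changes over a fine grid and applying Fatou's lemma gives the Kac-Rice bound
E(number of zeros) >= E|N - 2 Re (AA'(1) / AA(1))|.

When one of the [|b_j A_j(1)|] exceeds the others by a large factor, the phase
speed of [AA] at 1 is close to that of [A_j], i.e. to [Re q_j] with
[q_j = N - 2 A_j'(1) / A_j(1)].  The pair [(ln |A(1)|, q)] is a Markov chain in
[N]: the step is a Verblunsky-type recursion whose coefficient is a matrix
entry of a Haar matrix, independent of the past.  Along this chain
[ln |A(1)|] is anticoncentrated (its characteristic function tends to 0),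
[Re q] has mean [N] and is asymptotically uncorrelated from slowly varying
functions of [ln |A(1)|], [Re q / N] is uniformly integrable, and [|q| / N] is
tight.  Hence with high probability one index dominates, and the expected phase
speed is [N - o(N)].

The reverse inequality only needs [F_N] not to be the zero polynomial: rotating
two rows of [U_1] in opposite directions shows that [sum_j b_j tr U_j] is almost
surely nonzero. *)

(** * The real-valued modulus and the points e^(it) of the unit circle *)

Section ComplexNumbers.
Variable R : realType.
Local Notation C := R[i].
Implicit Types (z w : C) (t : R).

(** Removing a row and a column serves twice. A scalar e^(i theta) leaves SU(N), but the correction
    of its determinant sits in the first row, which [pA] does not see, so [pA] is rotated exactly.
    And the truncated block of a unitary matrix differs from a unitary one in a single singular
    value, which is what makes a recursion in N possible.

    No density is computed. Of the recursion coefficient mu at order m the proof uses only that its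
    law is rotation invariant and carried by the open disc, that E|mu|^2 = 1/m and that E|mu|^4 <=
    2/m^2. Rotation invariance acts as the mean value property of harmonic functions: on balls, ln
    |1 - mu| has mean 0 and the Poisson kernel has mean 1. Errors of order 1/m per step add up to
    harmonic numbers: these are o(N), yet unbounded, and it is their divergence that spreads ln
    |A(1)|.

    The obstacle is a selection bias: which index dominates depends on ln |A_j(1)|, which is built
    from the same coefficients as q_j, so the mean of Re q_j alone is not enough. Decorrelation
    removes the bias; uniform integrability controls the rare events that are discarded. *)

Definition cmod z : R := Normc.normc z.

Lemma cmodE z : `|z| = (cmod z)%:C%C.
Proof. by []. Qed.

Lemma cmod_sqr z : cmod z ^+ 2 = complex.Re z ^+ 2 + complex.Im z ^+ 2.
Proof. by case: z => a b; rewrite /cmod /= sqr_sqrtr // addr_ge0 // sqr_ge0. Qed.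

Lemma cmod_ge0 z : 0 <= cmod z.
Proof. by case: z => a b; exact: sqrtr_ge0. Qed.

Lemma cmodM z w : cmod (z * w) = cmod z * cmod w.
Proof. exact: Normc.normcM. Qed.

Lemma cmod1 : cmod 1 = 1.
Proof. exact: Normc.normc1. Qed.

Lemma cmod0 : cmod 0 = 0.
Proof. exact: Normc.normc0. Qed.

Lemma cmodN z : cmod (- z) = cmod z.
Proof. exact: normcN. Qed.

Lemma cmodV z : cmod z^-1 = (cmod z)^-1.
Proof. exact: Normc.normcV. Qed.

Lemma cmodX z k : cmod (z ^+ k) = cmod z ^+ k.
Proof. by elim: k => [|k ih]; rewrite ?expr0 ?cmod1// !exprS cmodM ih. Qed.

Lemma cmodD z w : cmod (z + w) <= cmod z + cmod w.
Proof. exact: le_normcD. Qed.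

Lemma cmodB z w : cmod (z - w) <= cmod z + cmod w.
Proof. by rewrite -(cmodN w) cmodD. Qed.

Lemma cmod_eq0 z : (cmod z == 0) = (z == 0).
Proof.
apply/eqP/eqP => [|->]; last exact: cmod0.
exact: Normc.eq0_normc.
Qed.

Lemma cmod_gt0 z : (0 < cmod z) = (z != 0).
Proof. by rewrite lt_def cmod_ge0 andbT cmod_eq0. Qed.

Lemma cmodB_ge z w : cmod z - cmod w <= cmod (z - w).
Proof. by rewrite lerBlDr (le_trans _ (cmodD _ _))// subrK. Qed.

Lemma cmod_conj z : cmod (conjc z) = cmod z.
Proof. by case: z => a b; rewrite /cmod /= sqrrN. Qed.

Lemma cmod_real (x : R) : cmod x%:C%C = `|x|.
Proof. by rewrite /cmod /= expr0n addr0 sqrtr_sqr. Qed.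

Lemma mul_conjc z : z * conjc z = (cmod z ^+ 2)%:C%C.
Proof.
rewrite cmod_sqr; case: z => a b; apply/eqP; rewrite eq_complex /=.
by apply/andP; split; apply/eqP; ring.
Qed.

Lemma RecD z w : complex.Re (z + w) = complex.Re z + complex.Re w.
Proof. by case: z w => [a b] [c e]. Qed.

Lemma ImcD z w : complex.Im (z + w) = complex.Im z + complex.Im w.
Proof. by case: z w => [a b] [c e]. Qed.

Lemma RecM z w : complex.Re (z * w) =
  complex.Re z * complex.Re w - complex.Im z * complex.Im w.
Proof. by case: z w => [a b] [c e]. Qed.

Lemma ImcM z w : complex.Im (z * w) =
  complex.Re z * complex.Im w + complex.Im z * complex.Re w.
Proof. by case: z w => [a b] [c e]. Qed.

Lemma RecN z : complex.Re (- z) = - complex.Re z. Proof. by case: z. Qed.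
Lemma ImcN z : complex.Im (- z) = - complex.Im z. Proof. by case: z. Qed.
Lemma RecJ z : complex.Re (conjc z) = complex.Re z. Proof. by case: z. Qed.
Lemma ImcJ z : complex.Im (conjc z) = - complex.Im z. Proof. by case: z. Qed.

Lemma complexP z w : complex.Re z = complex.Re w -> complex.Im z = complex.Im w ->
  z = w.
Proof. by case: z w => [a b] [c e] /= -> ->. Qed.

Lemma Re_le_cmod z : `|complex.Re z| <= cmod z.
Proof.
rewrite -(@ler_pXn2r _ 2)// ?nnegrE ?cmod_ge0// cmod_sqr real_normK ?num_real//.
by rewrite lerDl sqr_ge0.
Qed.

Definition expi t : C := (cos t +i* sin t)%C.

Lemma expi0 : expi 0 = 1.
Proof. by rewrite /expi cos0 sin0. Qed.

Lemma expiD s t : expi (s + t) = expi s * expi t.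
Proof.
rewrite /expi cosD sinD; apply/eqP; rewrite eq_complex /=.
by apply/andP; split; apply/eqP; ring.
Qed.

Lemma expiN t : expi (- t) = conjc (expi t).
Proof. by rewrite /expi cosN sinN. Qed.

Lemma cmod_expi t : cmod (expi t) = 1.
Proof. by rewrite /cmod /= cos2Dsin2 sqrtr1. Qed.

Lemma expiMN t : expi t * expi (- t) = 1.
Proof. by rewrite -expiD subrr expi0. Qed.

Lemma expiMn t k : expi (t *+ k) = expi t ^+ k.
Proof. by elim: k => [|k ih]; rewrite ?mulr0n ?expi0// mulrSr exprSr expiD ih. Qed.

Lemma expi_2pi : expi (pi *+ 2) = 1.
Proof. by rewrite /expi cos2pi sin2pi. Qed.

Lemma expi_pi : expi pi = -1.
Proof. by rewrite /expi cospi sinpi; apply/eqP; rewrite eq_complex /= oppr0 !eqxx. Qed.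

Lemma cmod1_expi z : cmod z = 1 -> exists t, [/\ - pi <= t, t <= pi & z = expi t].
Proof.
move=> z1; have := cmod_sqr z; rewrite z1 expr1n => h.
have re1 : -1 <= complex.Re z <= 1.
  by rewrite -ler_norml -z1 Re_le_cmod.
have [i0|i0] := leP 0 (complex.Im z).
  exists (acos (complex.Re z)); rewrite acos_lepi// (le_trans _ (acos_ge0 re1)) ?oppr_le0 ?pi_ge0//.
  split=> //; apply: complexP; rewrite /= ?acosK//.
  by rewrite sin_acos// -(ger0_norm i0) -sqrtr_sqr; congr (Num.sqrt _); lra.
exists (- acos (complex.Re z)); rewrite lerN2 acos_lepi//.
rewrite (@le_trans _ _ 0) ?pi_ge0 ?oppr_le0 ?acos_ge0//; split=> //.
apply: complexP; rewrite /= ?cosN ?sinN ?acosK// sin_acos//.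
rewrite -[LHS]opprK -(ltr0_norm i0) -sqrtr_sqr; congr (- Num.sqrt _); lra.
Qed.

End ComplexNumbers.

(** * Measurability of complex-valued and polynomial-valued maps *)

Section ComplexMeasurability.
Variable R : realType.
Local Notation C := R[i].

(** Stated through real and imaginary parts, so as to match the generators of [mx_borel]. *)
Definition cmeas d (T : measurableType d) (f : T -> C) :=
  measurable_fun setT (fun x => complex.Re (f x)) /\
  measurable_fun setT (fun x => complex.Im (f x)).

Section Closure.
Context d (T : measurableType d).
Implicit Types (f g : T -> C).

Lemma cmeas_cst (c : C) : cmeas (fun _ : T => c).
Proof. by split; exact: measurable_cst. Qed.

Lemma cmeas_real (f : T -> R) : measurable_fun setT f -> cmeas (fun x => (f x)%:C%C).
Proof. by move=> mf; split => //=; exact: measurable_cst. Qed.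

Lemma cmeas_pair (f g : T -> R) : measurable_fun setT f -> measurable_fun setT g ->
  cmeas (fun x => (f x +i* g x)%C).
Proof. by move=> mf mg; split. Qed.

Lemma cmeasD f g : cmeas f -> cmeas g -> cmeas (fun x => f x + g x).
Proof.
move=> [f1 f2] [g1 g2]; split.
  by under eq_fun do rewrite RecD; exact: measurable_funD.
by under eq_fun do rewrite ImcD; exact: measurable_funD.
Qed.

Lemma cmeasN f : cmeas f -> cmeas (fun x => - f x).
Proof.
move=> [f1 f2]; split.
  by under eq_fun do rewrite RecN; exact: measurableT_comp.
by under eq_fun do rewrite ImcN; exact: measurableT_comp.
Qed.

Lemma cmeasB f g : cmeas f -> cmeas g -> cmeas (fun x => f x - g x).
Proof. by move=> mf mg; apply: cmeasD => //; exact: cmeasN. Qed.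

Lemma cmeasM f g : cmeas f -> cmeas g -> cmeas (fun x => f x * g x).
Proof.
move=> [f1 f2] [g1 g2]; split.
  under eq_fun do rewrite RecM.
  by apply: measurable_funB; exact: measurable_funM.
under eq_fun do rewrite ImcM.
by apply: measurable_funD; exact: measurable_funM.
Qed.

Lemma cmeasJ f : cmeas f -> cmeas (fun x => conjc (f x)).
Proof.
move=> [f1 f2]; split.
  by under eq_fun do rewrite RecJ.
by under eq_fun do rewrite ImcJ; exact: measurableT_comp.
Qed.

Lemma cmeas_sum (I : Type) (r : seq I) (Q : pred I) (f : I -> T -> C) :
  (forall i, cmeas (f i)) -> cmeas (fun x => \sum_(i <- r | Q i) f i x).
Proof.
move=> mf; elim: r => [|i r ih].
  by under eq_fun do rewrite big_nil; exact: cmeas_cst.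
under eq_fun do rewrite big_cons.
by case: (Q i) => //; exact: cmeasD.
Qed.

Lemma cmeas_prod (I : Type) (r : seq I) (Q : pred I) (f : I -> T -> C) :
  (forall i, cmeas (f i)) -> cmeas (fun x => \prod_(i <- r | Q i) f i x).
Proof.
move=> mf; elim: r => [|i r ih].
  by under eq_fun do rewrite big_nil; exact: cmeas_cst.
under eq_fun do rewrite big_cons.
by case: (Q i) => //; exact: cmeasM.
Qed.

Lemma cmeasX f k : cmeas f -> cmeas (fun x => f x ^+ k).
Proof.
move=> mf; elim: k => [|k ih].
  by under eq_fun do rewrite expr0; exact: cmeas_cst.
by under eq_fun do rewrite exprS; exact: cmeasM.
Qed.

Lemma measurable_sqrtr : measurable_fun setT (@Num.sqrt R).
Proof. by apply: continuous_measurable_fun; exact: sqrt_continuous. Qed.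

Lemma measurable_invr : measurable_fun setT (@GRing.inv R).
Proof.
have -> : [set: R] = [set 0] `|` ~` [set 0] by rewrite setUv.
apply/measurable_funU => //; first by apply: measurableC.
split; first exact: measurable_fun_set1.
apply: open_continuous_measurable_fun => //.
  by apply: closed_openC; apply: accessible_closed_set1; apply: hausdorff_accessible; exact: Rhausdorff.
by move=> x /=; rewrite inE /= => /eqP x0; exact: inv_continuous.
Qed.

Lemma measurable_cmod f : cmeas f -> measurable_fun setT (fun x => cmod (f x)).
Proof.
move=> [f1 f2].
have -> : (fun x => cmod (f x)) = (fun x =>
    Num.sqrt (complex.Re (f x) ^+ 2 + complex.Im (f x) ^+ 2)).
  by apply/funext => x; case: (f x).
apply: (measurableT_comp measurable_sqrtr).
by apply: measurable_funD; apply: measurable_funX.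
Qed.

Lemma cmeasV f : cmeas f -> cmeas (fun x => (f x)^-1).
Proof.
move=> mf.
have -> : (fun x => (f x)^-1) = (fun x => conjc (f x) * ((cmod (f x) ^+ 2)^-1)%:C%C).
  apply/funext => x.
  have [->|fx0] := eqVneq (f x) 0; first by rewrite conjc0 mul0r invr0.
  apply: (mulfI fx0); rewrite mulfV// mulrA mul_conjc -rmorphM mulfV ?rmorph1//.
  by rewrite sqrf_eq0 cmod_eq0.
apply: cmeasM; first exact: cmeasJ.
apply: cmeas_real; apply: (measurableT_comp measurable_invr).
by apply: measurable_funX; exact: measurable_cmod.
Qed.

Lemma measurable_eqr (f g : T -> R) : measurable_fun setT f -> measurable_fun setT g ->
  measurable [set x | f x = g x].
Proof.
move=> mf mg; rewrite (_ : [set x | _] = (fun x => f x == g x) @^-1` [set true]).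
  rewrite -[_ @^-1` _]setTI; apply: measurable_fun_eqr => //.
by apply/seteqP; split => x /= /eqP.
Qed.

Lemma measurable_eqc f g : cmeas f -> cmeas g -> measurable [set x | f x = g x].
Proof.
move=> [f1 f2] [g1 g2].
rewrite (_ : [set x | _] = [set x | complex.Re (f x) = complex.Re (g x)] `&`
                           [set x | complex.Im (f x) = complex.Im (g x)]).
  by apply: measurableI; exact: measurable_eqr.
apply/seteqP; split => x /=; first by move=> ->.
by move=> [h1 h2]; exact: complexP.
Qed.

End Closure.

Lemma cmeas_comp d (T : measurableType d) d' (T' : measurableType d') (h : T' -> T)
  (f : T -> C) : measurable_fun setT h -> cmeas f -> cmeas (f \o h).
Proof. by move=> mh [f1 f2]; split; [exact: (measurableT_comp f1)|exact: (measurableT_comp f2)]. Qed.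

(** Measurability coefficient by coefficient. Evaluation then needs a bound on the size that is
    uniform in the sample point, as in [cmeas_horner], to become a sum of fixed length. *)
Definition pmeas d (T : measurableType d) (f : T -> {poly C}) :=
  forall i, cmeas (fun x => (f x)`_i).

Section PolyClosure.
Context d (T : measurableType d).
Implicit Types (f g : T -> {poly C}).

Lemma pmeas_cst (p : {poly C}) : pmeas (fun _ : T => p).
Proof. by move=> i; exact: cmeas_cst. Qed.

Lemma pmeas_polyC (f : T -> C) : cmeas f -> pmeas (fun x => (f x)%:P).
Proof.
move=> mf i; under eq_fun do rewrite coefC.
by case: (i == 0)%N => //; exact: cmeas_cst.
Qed.

Lemma pmeasD f g : pmeas f -> pmeas g -> pmeas (fun x => f x + g x).
Proof. by move=> mf mg i; under eq_fun do rewrite coefD; exact: cmeasD. Qed.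

Lemma pmeasN f : pmeas f -> pmeas (fun x => - f x).
Proof. by move=> mf i; under eq_fun do rewrite coefN; exact: cmeasN. Qed.

Lemma pmeasB f g : pmeas f -> pmeas g -> pmeas (fun x => f x - g x).
Proof. by move=> mf mg; apply: pmeasD => //; exact: pmeasN. Qed.

Lemma pmeasM f g : pmeas f -> pmeas g -> pmeas (fun x => f x * g x).
Proof.
move=> mf mg i; under eq_fun do rewrite coefM.
by apply: cmeas_sum => j; exact: cmeasM.
Qed.

Lemma pmeasZ (c : T -> C) f : cmeas c -> pmeas f -> pmeas (fun x => c x *: f x).
Proof. by move=> mc mf i; under eq_fun do rewrite coefZ; exact: cmeasM. Qed.

Lemma pmeas_sum (I : Type) (r : seq I) (Q : pred I) (f : I -> T -> {poly C}) :
  (forall i, pmeas (f i)) -> pmeas (fun x => \sum_(i <- r | Q i) f i x).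
Proof.
move=> mf; elim: r => [|i r ih].
  by under eq_fun do rewrite big_nil; exact: pmeas_cst.
under eq_fun do rewrite big_cons.
by case: (Q i) => //; exact: pmeasD.
Qed.

Lemma pmeas_prod (I : Type) (r : seq I) (Q : pred I) (f : I -> T -> {poly C}) :
  (forall i, pmeas (f i)) -> pmeas (fun x => \prod_(i <- r | Q i) f i x).
Proof.
move=> mf; elim: r => [|i r ih].
  by under eq_fun do rewrite big_nil; exact: pmeas_cst.
under eq_fun do rewrite big_cons.
by case: (Q i) => //; exact: pmeasM.
Qed.

Lemma pmeas_det n (f : T -> 'M[{poly C}]_n) : (forall i j, pmeas (fun x => f x i j)) ->
  pmeas (fun x => \det (f x)).
Proof.
move=> mf; apply: pmeas_sum => s; apply: pmeasM; first exact: pmeas_cst.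
by apply: pmeas_prod => i; exact: mf.
Qed.

Lemma pmeas_deriv f : pmeas f -> pmeas (fun x => (f x)^`()).
Proof.
move=> mf i; under eq_fun do rewrite coef_deriv -mulr_natr.
by apply: cmeasM => //; exact: cmeas_cst.
Qed.

Lemma cmeas_horner k f (z : T -> C) : (forall x, (size (f x) <= k)%N) ->
  pmeas f -> cmeas z -> cmeas (fun x => (f x).[z x]).
Proof.
move=> fk mf mz; under eq_fun => x do rewrite (horner_coef_wide _ (fk x)).
by apply: cmeas_sum => i; apply: cmeasM => //; exact: cmeasX.
Qed.

End PolyClosure.

End ComplexMeasurability.

(** * The Borel structure on complex matrices *)

Section MatrixMeasurability.
Variable R : realType.
Local Notation C := R[i].

(** An alias of the matrix type which carries the sigma-algebra [mx_borel] as its canonical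
    measurable structure. *)
Definition mxT (N : nat) : Type := 'M[C]_N.
HB.instance Definition _ N := Choice.on (mxT N).
HB.instance Definition _ N := isPointed.Build (mxT N) (0 : 'M[C]_N).

Lemma mxT_measurableC N (A : set (mxT N)) : @mx_borel R N A -> @mx_borel R N (~` A).
Proof. by move=> mA; rewrite -setTD; exact: sigma_algebraCD. Qed.

HB.instance Definition _ N := @isMeasurable.Build (sigma_display (@mx_generators R N))
  (mxT N) (@mx_borel R N) (@sigma_algebra0 _ setT _) (@mxT_measurableC N)
  (@sigma_algebra_bigcup _ setT _).

Lemma cmeas_entry N k l : cmeas (fun A : mxT N => (A : 'M[C]_N) k l).
Proof.
split=> _ B mB; rewrite setTI; apply: sub_sigma_algebra; exists k, l, B; split => //.
  by left.
by right.
Qed.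

Lemma measurable_mxP d (T : measurableType d) N (f : T -> mxT N) :
  (forall k l, cmeas (fun x => (f x : 'M[C]_N) k l)) -> measurable_fun setT f.
Proof.
move=> mf; apply: (@measurability _ _ T (mxT N) setT f (@mx_generators R N) erefl).
move=> _ [B [k [l [B' [mB' [->|->]]]]] <-]; have [h1 h2] := mf k l.
- exact: h1.
- exact: h2.
Qed.

Lemma cmeas_mulmx d (T : measurableType d) m n p (f : T -> 'M[C]_(m, n)) (g : T -> 'M[C]_(n, p)) :
  (forall k l, cmeas (fun x => f x k l)) -> (forall k l, cmeas (fun x => g x k l)) ->
  forall k l, cmeas (fun x => (f x *m g x) k l).
Proof.
move=> mf mg k l; under eq_fun do rewrite mxE.
by apply: cmeas_sum => i; exact: cmeasM.
Qed.

Lemma cmeas_adjmx d (T : measurableType d) n (f : T -> 'M[C]_n) :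
  (forall k l, cmeas (fun x => f x k l)) -> forall k l, cmeas (fun x => (adjmx (f x)) k l).
Proof.
by move=> mf k l; under eq_fun do rewrite mxE mxE; exact: cmeasJ.
Qed.

Lemma cmeas_det d (T : measurableType d) n (f : T -> 'M[C]_n) :
  (forall k l, cmeas (fun x => f x k l)) -> cmeas (fun x => \det (f x)).
Proof.
move=> mf; apply: cmeas_sum => s; apply: cmeasM; first exact: cmeas_cst.
by apply: cmeas_prod => i; exact: mf.
Qed.

Lemma measurable_eqmx d (T : measurableType d) m n (f g : T -> 'M[C]_(m, n)) :
  (forall k l, cmeas (fun x => f x k l)) -> (forall k l, cmeas (fun x => g x k l)) ->
  measurable [set x | f x = g x].
Proof.
move=> mf mg.
rewrite (_ : [set x | _] = \big[setI/setT]_(p : 'I_m * 'I_n)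
   [set x | f x p.1 p.2 = g x p.1 p.2]).
  by apply: bigsetI_measurable => p _; exact: measurable_eqc.
apply/seteqP; split => x /=.
  move=> fg; rewrite -bigcap_seq /= => p _; by rewrite /= fg.
rewrite -bigcap_seq /= => h; apply/matrixP => i j.
exact: (h (i, j) (mem_index_enum _)).
Qed.

Lemma measurable_SU N : measurable (@SU R N : set (mxT N)).
Proof.
rewrite (_ : @SU R N = [set A : mxT N | (A : 'M[C]_N) *m adjmx A = 1%:M] `&`
   [set A : mxT N | \det (A : 'M[C]_N) = 1]) //.
apply: measurableI.
  apply: measurable_eqmx => k l; last exact: cmeas_cst.
  by apply: cmeas_mulmx => k' l'; [exact: cmeas_entry|apply: cmeas_adjmx; exact: cmeas_entry].
apply: measurable_eqc; last exact: cmeas_cst.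
by apply: cmeas_det; exact: cmeas_entry.
Qed.

End MatrixMeasurability.

(** * The adjoint and the group SU(N) *)

Section SpecialUnitaryGroup.
Variable R : realType.
Local Notation C := R[i].
Context (N : nat).
Implicit Types (A B V : 'M[C]_N).

Lemma adjmxM A B : adjmx (A *m B) = adjmx B *m adjmx A.
Proof. by rewrite /adjmx map_mxM trmx_mul. Qed.

Lemma adjmxK A : adjmx (adjmx A) = A.
Proof. by apply/matrixP => i j; rewrite !mxE conjCK. Qed.

Lemma adjmx1 : adjmx (1%:M : 'M[C]_N) = 1%:M.
Proof. by rewrite /adjmx map_mx1 trmx1. Qed.

Lemma det_adjmx A : \det (adjmx A) = conjc (\det A).
Proof. by rewrite /adjmx det_tr det_map_mx. Qed.

Lemma SU_mulV V : SU V -> V *m adjmx V = 1%:M.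
Proof. by case. Qed.

Lemma SU_Vmul V : SU V -> adjmx V *m V = 1%:M.
Proof. by case=> /mulmx1C. Qed.

Lemma SU_det V : SU V -> \det V = 1.
Proof. by case. Qed.

Lemma SU_adj V : SU V -> SU (adjmx V).
Proof.
move=> sV; split; first by rewrite adjmxK SU_Vmul.
by rewrite det_adjmx SU_det// conjc1.
Qed.

Lemma SU1 : SU (1%:M : 'M[C]_N).
Proof. by split; [rewrite adjmx1 mulmx1|exact: det1]. Qed.

End SpecialUnitaryGroup.

(** * Left invariance of the Haar law, in integral form *)

Section HaarInvariance.
Variable R : realType.
Local Notation C := R[i].
Context d (T : measurableType d) (P : probability T R) (N : nat) (X : T -> 'M[C]_N).
Hypothesis hX : haar_SU_distributed P X.

Lemma haar_measurable : measurable_fun setT (X : T -> mxT R N).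
Proof. by case: hX => mX _ _ B mB; rewrite setTI; exact: mX. Qed.

Lemma haar_cmeas k l : cmeas (fun w => X w k l).
Proof. have [h1 h2] := @cmeas_entry R N k l.
by split; [exact: (measurableT_comp h1 haar_measurable)|exact: (measurableT_comp h2 haar_measurable)]. Qed.

Lemma haar_SU : {ae P, forall w, SU (X w)}.
Proof.
exists (~` (X @^-1` @SU R N)); split; last by [].
  by apply: measurableC; rewrite -[_ @^-1` _]setTI; apply: haar_measurable => //; exact: measurable_SU.
rewrite -[LHS]fineK ?fin_num_measure//.
  case: hX => _ [h _]; rewrite probability_setC ?h ?subee//.
  by rewrite -[_ @^-1` _]setTI; apply: haar_measurable => //; exact: measurable_SU.
by apply: measurableC; rewrite -[_ @^-1` _]setTI; apply: haar_measurable => //; exact: measurable_SU.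
Qed.

Lemma haar_left (V : 'M[C]_N) (g : mxT R N -> \bar R) : SU V ->
  measurable_fun setT g -> (forall A, 0 <= g A)%E ->
  (\int[P]_w g (V *m X w) = \int[P]_w g (X w))%E.
Proof.
move=> sV mg g0.
have mV : measurable_fun setT (fun A : mxT R N => (V *m A : mxT R N)).
  apply: measurable_mxP; apply: cmeas_mulmx => k l; [exact: cmeas_cst|exact: cmeas_entry].
have mVX : measurable_fun setT (fun w => (V *m X w : mxT R N)).
  exact: (measurableT_comp mV haar_measurable).
transitivity (\int[pushforward P (fun w => (V *m X w : mxT R N))]_A g A)%E.
  by rewrite ge0_integral_pushforward// preimage_setT.
transitivity (\int[pushforward P (X : T -> mxT R N)]_A g A)%E; last first.
  by rewrite ge0_integral_pushforward//; exact: haar_measurable.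
apply: eq_measure_integral; first exact: haar_measurable.
move=> mX B mB _; case: hX => _ [_ h]; exact: h.
Qed.

Lemma ae_SU_ge0_integral (f g : T -> \bar R) : measurable_fun setT f -> measurable_fun setT g ->
  (forall w, 0 <= f w)%E -> (forall w, 0 <= g w)%E ->
  (forall w, SU (X w) -> f w = g w) -> (\int[P]_w f w = \int[P]_w g w)%E.
Proof.
move=> mf mg f0 g0 fg; apply: ge0_ae_eq_integral => //.
by apply: filterS haar_SU => w sw _; exact: fg.
Qed.

End HaarInvariance.

(** * Invariance under the adjoint and under right multiplication *)

Section HaarBiinvariance.
Variable R : realType.
Local Notation C := R[i].
Context d (T : measurableType d) (P : probability T R) (N : nat) (X : T -> 'M[C]_N).
Hypothesis hX : haar_SU_distributed P X.

(* The law of X1^* X2 for independent copies X1, X2 is that of X, and it is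
   also that of (X2^* X1)^*, hence of X^*. *)
Lemma haar_adj (g : mxT R N -> \bar R) : measurable_fun setT g -> (forall A, 0 <= g A)%E ->
  (\int[P]_w g (adjmx (X w)) = \int[P]_w g (X w))%E.
Proof.
move=> mg g0.
have mX1 : forall k l, cmeas (fun p : T * T => X p.1 k l).
  by move=> k l; exact: (cmeas_comp measurable_fst (haar_cmeas hX k l)).
have mX2 : forall k l, cmeas (fun p : T * T => X p.2 k l).
  by move=> k l; exact: (cmeas_comp measurable_snd (haar_cmeas hX k l)).
have madj : measurable_fun setT (fun A : mxT R N => (adjmx A : mxT R N)).
  by apply: measurable_mxP; apply: cmeas_adjmx; exact: cmeas_entry.
have m12 : measurable_fun setT (fun p : T * T => (adjmx (X p.1) *m X p.2 : mxT R N)).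
  by apply: measurable_mxP; apply: cmeas_mulmx => //; exact: cmeas_adjmx.
pose f (p : T * T) := g (adjmx (X p.1) *m X p.2).
have mf : measurable_fun setT f by exact: (measurableT_comp mg m12).
have f0 p : (0 <= f p)%E by exact: g0.
have E1 : (\int[P]_x \int[P]_y f (x, y) = \int[P]_w g (X w))%E.
  transitivity (\int[P]_x (cst (\int[P]_w g (X w)) x))%E; last first.
    by rewrite integral_cst//= probability_setT mule1.
  apply: (ae_SU_ge0_integral hX) => //.
  - exact: (measurable_fun_fubini_tonelli_F _ mf f0).
  - by move=> w; exact: integral_ge0.
  - by move=> w; exact: integral_ge0.
  - by move=> w sw; rewrite /f /= (haar_left hX (SU_adj sw) mg g0).
have E2 : (\int[P]_y \int[P]_x f (x, y) = \int[P]_w g (adjmx (X w)))%E.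
  transitivity (\int[P]_x (cst (\int[P]_w g (adjmx (X w))) x))%E; last first.
    by rewrite integral_cst//= probability_setT mule1.
  apply: (ae_SU_ge0_integral hX) => //.
  - exact: (measurable_fun_fubini_tonelli_G _ mf f0).
  - by move=> w; exact: integral_ge0.
  - by move=> w; exact: integral_ge0.
  - move=> w sw; rewrite /f /=.
    under eq_integral do rewrite -(adjmxK (X w)) -adjmxM.
    exact: (haar_left hX (SU_adj sw) (measurableT_comp mg madj) (fun A => g0 _)).
by rewrite -E1 -E2; exact/esym/fubini_tonelli.
Qed.

(** Taking adjoints exchanges right and left multiplication, so [haar_adj] reduces this to left
    invariance. *)
Lemma haar_right (V : 'M[C]_N) (g : mxT R N -> \bar R) : SU V ->
  measurable_fun setT g -> (forall A, 0 <= g A)%E ->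
  (\int[P]_w g (X w *m V) = \int[P]_w g (X w))%E.
Proof.
move=> sV mg g0.
have madj : measurable_fun setT (fun A : mxT R N => (adjmx A : mxT R N)).
  by apply: measurable_mxP; apply: cmeas_adjmx; exact: cmeas_entry.
have mV : measurable_fun setT (fun A : mxT R N => (A *m V : mxT R N)).
  apply: measurable_mxP; apply: cmeas_mulmx => k l; [exact: cmeas_entry|exact: cmeas_cst].
rewrite -(haar_adj (measurableT_comp mg mV))//=.
under eq_integral do rewrite -[V in _ *m V]adjmxK -adjmxM.
rewrite (haar_left hX (SU_adj sV) (measurableT_comp mg madj))//=.
exact: haar_adj.
Qed.

Lemma haar_bi (V W : 'M[C]_N) (g : mxT R N -> \bar R) : SU V -> SU W ->
  measurable_fun setT g -> (forall A, 0 <= g A)%E ->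
  (\int[P]_w g (V *m X w *m W) = \int[P]_w g (X w))%E.
Proof.
move=> sV sW mg g0.
have mV : measurable_fun setT (fun A : mxT R N => (A *m W : mxT R N)).
  apply: measurable_mxP; apply: cmeas_mulmx => k l; [exact: cmeas_entry|exact: cmeas_cst].
rewrite (haar_left hX sV (measurableT_comp mg mV))//=.
exact: haar_right.
Qed.

End HaarBiinvariance.

(** * The truncated characteristic polynomial and its reversal *)

Section TruncatedCharacteristicPolynomial.
Variable R : realType.
Local Notation C := R[i].
Local Notation "A ^t*" := ((map_mx (@Num.conj C) A)^T).

(** A nonzero difference would have the roots 1, 2, 3, ..., as many as its size. The point 0 is left
    out because the identities below divide by z. *)
Lemma poly_eq_off0 (p q : {poly C}) : (forall z, z != 0 -> p.[z] = q.[z]) -> p = q.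
Proof.
move=> h; apply/eqP; rewrite -subr_eq0; apply/negPn/negP => pq0.
pose s : seq C := [seq i.+1%:R | i <- iota 0 (size (p - q)%R)].
have : (size s < size (p - q)%R)%N.
  apply: max_poly_roots => //.
    by apply/allP => _ /mapP[i _ ->]; rewrite /root hornerD hornerN h ?subrr// pnatr_eq0.
  rewrite map_inj_uniq ?iota_uniq// => i j /eqP; rewrite eqr_nat => /eqP [].
  by [].
by rewrite size_map size_iota ltnn.
Qed.

(* [revp k p] is the reversed conjugate polynomial z^k * conj (p (1 / conj z)). *)
Definition revp k (p : {poly C}) : {poly C} := \poly_(i < k.+1) conjc p`_(k - i).

Lemma coef_revp k p i : (revp k p)`_i = if (i < k.+1)%N then conjc p`_(k - i) else 0.
Proof. by rewrite coef_poly. Qed.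

Lemma size_revp k p : (size (revp k p) <= k.+1)%N.
Proof. exact: size_poly. Qed.

Lemma conjc_sum (I : Type) (r : seq I) (Q : pred I) (F : I -> C) :
  conjc (\sum_(i <- r | Q i) F i) = \sum_(i <- r | Q i) conjc (F i).
Proof. exact: (rmorph_sum (@Num.conj C)). Qed.

Lemma conjcM (z w : C) : conjc (z * w) = conjc z * conjc w.
Proof. exact: (rmorphM (@Num.conj C)). Qed.

Lemma conjcX (z : C) k : conjc (z ^+ k) = conjc z ^+ k.
Proof. exact: (rmorphXn (@Num.conj C)). Qed.

Lemma conjcB (z w : C) : conjc (z - w) = conjc z - conjc w.
Proof. exact: (rmorphB (@Num.conj C)). Qed.

Lemma horner_revp k (p : {poly C}) z : (size p <= k.+1)%N -> z != 0 ->
  (revp k p).[z] = z ^+ k * conjc p.[(conjc z)^-1].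
Proof.
move=> pk z0; rewrite horner_poly (horner_coef_wide _ pk) conjc_sum mulr_sumr.
rewrite (reindex_inj rev_ord_inj) /=; apply: eq_bigr => i _.
have ik : (i <= k)%N by rewrite -ltnS.
rewrite subSS subKn// conjcM conjcX conjc_inv conjcK mulrCA exprVn; congr (_ * _).
by rewrite expfB_cond// (negbTE z0).
Qed.

Lemma unit_conjV (z : C) : cmod z = 1 -> (conjc z)^-1 = z.
Proof.
move=> z1; have zc0 : conjc z != 0 by rewrite -cmod_gt0 cmod_conj z1.
by apply: (mulIf zc0); rewrite mulVf// mul_conjc z1 expr1n.
Qed.

Lemma unit_neq0 (z : C) : cmod z = 1 -> z != 0.
Proof. by move=> z1; rewrite -cmod_gt0 z1. Qed.

Lemma horner_revp_circle k (p : {poly C}) z : (size p <= k.+1)%N -> cmod z = 1 ->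
  (revp k p).[z] = z ^+ k * conjc p.[z].
Proof. by move=> pk z1; rewrite horner_revp ?unit_neq0// unit_conjV. Qed.

(** Written with the Euler operator z d/dz, which is diagonal on monomials and hence compatible with
    the reversal of coefficients. *)
Lemma horner_deriv_wide k (p : {poly C}) z : (size p <= k)%N ->
  z * p^`().[z] = \sum_(i < k) i%:R * p`_i * z ^+ i.
Proof.
case: k => [|k] pk.
  by move: pk; rewrite leqn0 size_poly_eq0 => /eqP ->; rewrite derivC horner0 mulr0 big_ord0.
have dk : (size p^`() <= k)%N.
  apply/leq_sizeP => j kj; rewrite coef_deriv.
  by rewrite (leq_sizeP _ _ pk) ?mul0rn// ltnS.
rewrite (horner_coef_wide _ dk) mulr_sumr big_ord_recl /= mul0r mul0r add0r.
apply: eq_bigr => i _; rewrite coef_deriv -mulr_natl /bump /= add1n exprS; ring.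
Qed.

Lemma deriv_revp_circle k (p : {poly C}) z : (size p <= k.+1)%N -> cmod z = 1 ->
  z * (revp k p)^`().[z] = z ^+ k * (k%:R * conjc p.[z] - conjc (z * p^`().[z])).
Proof.
move=> pk z1.
have zc : conjc z = z^-1 by rewrite -[in RHS](unit_conjV z1) invrK.
have z0 := unit_neq0 z1.
rewrite (horner_deriv_wide _ (size_revp k p)) (horner_deriv_wide _ pk).
rewrite (horner_coef_wide _ pk) !conjc_sum mulr_sumr -sumrB mulr_sumr.
rewrite (reindex_inj rev_ord_inj) /=; apply: eq_bigr => i _.
have ik : (i <= k)%N by rewrite -ltnS.
rewrite coef_revp subSS ltnS leq_subr subKn// !conjcM conjcX conjc_nat zc exprVn.
by rewrite expfB_cond ?(negbTE z0)//= natrB//; ring.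
Qed.

Lemma pmeas_revp d (T : measurableType d) k (f : T -> {poly C}) : pmeas f ->
  pmeas (fun x => revp k (f x)).
Proof.
move=> mf i; under eq_fun do rewrite coef_revp.
by case: (i < k.+1)%N; [exact: cmeasJ|exact: cmeas_cst].
Qed.

Definition rdet n (d : 'M[C]_n) : {poly C} := \det (1%:M - 'X *: map_mx polyC d).

Lemma horner_rdet n (d : 'M[C]_n) z : (rdet d).[z] = \det (1%:M - z *: d).
Proof.
rewrite /rdet -[LHS]/(horner_eval z _) -det_map_mx; congr (\det _).
apply/matrixP => i j; rewrite !mxE /= /horner_eval hornerD hornerN hornerM hornerX hornerC.
by rewrite -polyC_natr hornerC.
Qed.

Lemma size_rdet n (d : 'M[C]_n) : (size (rdet d) <= n.+1)%N.
Proof.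
apply: (leq_trans (size_sum _ _ _)); apply/bigmax_leqP => s _.
set p := \prod_(i < n) _; apply: (@leq_trans (size p)).
  by case: (perm.odd_perm s); rewrite ?expr0 ?mul1r// expr1 mulN1r size_polyN.
apply: (leq_trans (size_prod_leq _ _)); rewrite leq_subLR.
rewrite cardE size_enum_ord addnS ltnS addnn -mul2n mulnC.
rewrite -[n in (_ <= n * 2)%N]card_ord -sum_nat_const; apply: leq_sum => i _.
rewrite !mxE (leq_trans (size_polyD _ _))// geq_max size_polyN.
rewrite -polyC_natr (leq_trans (size_polyC_leq1 _))//=.
rewrite (leq_trans (size_polyMleq _ _))// size_polyX.
move: (size_polyC_leq1 (d i (perm.fun_of_perm.body s i))).
by case: (size _) => [|[|]].
Qed.

Lemma pmeas_rdet d (T : measurableType d) n (f : T -> 'M[C]_n) :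
  (forall k l, cmeas (fun x => f x k l)) -> pmeas (fun x => rdet (f x)).
Proof.
move=> mf; apply: pmeas_det => i j; under eq_fun do rewrite !mxE.
apply: pmeasB; first exact: pmeas_cst.
by apply: pmeasM; [exact: pmeas_cst|exact: pmeas_polyC].
Qed.

(** From B (1 - z A B) = (1 - z B A) B, cancelling the determinant of B. *)
Lemma rdet_mulC n (A B : 'M[C]_n) : \det B != 0 -> rdet (A *m B) = rdet (B *m A).
Proof.
move=> B0; have dB : \det (map_mx polyC B) != 0 by rewrite det_map_mx polyC_eq0.
apply: (mulfI dB); rewrite /rdet -det_mulmx [in RHS]mulrC -det_mulmx; congr (\det _).
rewrite mulmxBr mulmxBl mulmx1 mul1mx !map_mxM -!scalemxAr -!scalemxAl.
by rewrite mulmxA.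
Qed.

Definition pA N (M : 'M[C]_N.+1) : {poly C} := rdet (drsubmx (M : 'M[C]_(1 + N))).

Definition Dmx N (mu : C) : 'M[C]_(1 + N) := block_mx mu%:M 0 0 1%:M.

Lemma size_pA N (M : 'M[C]_N.+1) : (size (pA M) <= N.+1)%N.
Proof. exact: size_rdet. Qed.

Lemma pmeas_pA d (T : measurableType d) N (f : T -> 'M[C]_N.+1) :
  (forall k l, cmeas (fun x => f x k l)) -> pmeas (fun x => pA (f x)).
Proof.
move=> mf; apply: pmeas_rdet => k l; under eq_fun do rewrite !mxE.
exact: mf.
Qed.

Lemma det_Dmx N mu : \det (Dmx N mu) = mu.
Proof. by rewrite /Dmx det_ublock det1 mulr1 det_scalar1. Qed.

Lemma DmxM N a b : Dmx N a *m Dmx N b = Dmx N (a * b).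
Proof. by rewrite /Dmx mulmx_block !mulmx0 !mul0mx !addr0 add0r mulmx1 -scalar_mxM. Qed.

Lemma adj_Dmx N a : adjmx (Dmx N a) = Dmx N (conjc a).
Proof.
rewrite /adjmx /Dmx map_block_mx tr_block_mx !map_mx0 !trmx0 map_scalar_mx map_mx1.
by rewrite tr_scalar_mx trmx1.
Qed.

Lemma Dmx1 N : Dmx N 1 = 1%:M.
Proof. by rewrite /Dmx -scalar_mx_block. Qed.

(** The exponent is the order of the truncated block, one less than that of the matrix: it is the
    sign in det(-E) for E of order N. *)
Definition csgn N : C := (-1) ^+ N.

Lemma adj_dr N (W : 'M[C]_(1 + N)) : drsubmx (adjmx W) = adjmx (drsubmx W).
Proof. by apply/matrixP => i j; rewrite !mxE. Qed.

(* The determinant is affine in mu; multiplying its slope by the adjoint of W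
   makes it block triangular. *)
Lemma rdet_Dmx N (W : 'M[C]_(1 + N)) mu : SU W ->
  rdet (W *m Dmx N mu) = pA W - (mu * csgn N) *: revp N.+1 (pA W).
Proof.
move=> sW.
pose E := drsubmx W.
have Wb : W = block_mx (ulsubmx W) (ursubmx W)
   (dlsubmx W) E by rewrite submxK.
suff H : forall z, z != 0 -> \det (1%:M - z *: (W *m Dmx N mu)) =
    \det (1%:M - z *: E) - mu * (z * \det (adjmx E - z%:M)).
  apply: poly_eq_off0 => z z0; rewrite horner_rdet H// hornerD hornerN hornerZ.
  rewrite horner_revp ?size_pA ?(leq_trans (size_pA _))//.
  rewrite /pA !horner_rdet -det_adjmx; congr (_ - _).
  rewrite -mulrA; congr (_ * _); rewrite exprS mulrCA -!mulrA; congr (_ * _).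
  rewrite -detZ -detZ; congr (\det _).
  apply/matrixP => i j; rewrite !mxE; set e := W _ _.
  rewrite [Num.conj (_ - _)]conjcB conjcM conjc_inv conjcK conjc_nat eq_sym.
  rewrite [Num.conj e]/(conjc e) mulN1r mulrN mulrBr mulrA mulfV// mul1r opprB.
  by case: (j == i); rewrite ?mulr1 ?mulr0 ?mulr1n ?mulr0n.
move=> z z0.
have e mu' : \det (1%:M - z *: (W *m Dmx N mu')) = \det (adjmx W - z *: Dmx N mu').
  rewrite -[LHS]mul1r -[X in X * _](SU_det (SU_adj sW)) -det_mulmx mulmxBr mulmx1 -scalemxAr mulmxA.
  by rewrite (SU_Vmul sW) mul1mx.
have eb mu' : adjmx W - z *: Dmx N mu' = block_mx (ulsubmx (adjmx W) - (z * mu')%:M)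
    (ursubmx (adjmx W)) (dlsubmx (adjmx W)) (adjmx E - z%:M).
  rewrite -adj_dr -[in LHS](submxK (adjmx W)) /Dmx scale_block_mx opp_block_mx add_block_mx.
  by rewrite !scale_scalar_mx mulr1 !scaler0 !subr0.
have e0 : \det (1%:M - z *: (W *m Dmx N 0)) = \det (1%:M - z *: E).
  rewrite [in LHS]Wb /Dmx mulmx_block !mulmx0 !mulmx1 !addr0 !add0r raddf0 !mulmx0.
  rewrite scale_block_mx (scalar_mx_block 1 N) opp_block_mx add_block_mx !scaler0 !subr0.
  by rewrite det_ublock det1 mul1r.
have {}e0 : \det (1%:M - z *: E) = \det (block_mx (ulsubmx (adjmx W))
    (ursubmx (adjmx W)) (dlsubmx (adjmx W)) (adjmx E - z%:M)).
  rewrite -e0 e eb mulr0; congr (\det (block_mx _ _ _ _)).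
  by apply/matrixP => i j; rewrite !mxE mul0rn subr0.
rewrite (e mu) (eb mu) e0.
set u := ulsubmx _; set v := ursubmx _; set w := dlsubmx _; set K := adjmx E - _.
rewrite (@determinant_multilinear _ _ _ (block_mx u v w K : 'M[C]_(1 + N))
   (block_mx (z * mu)%:M 0 w K : 'M[C]_(1 + N)) (lshift N 0) 1 (-1)).
- by rewrite det_lblock det_scalar1 mul1r mulN1r; congr (_ - _); ring.
- rewrite /block_mx !rowKu; apply/rowP => j; rewrite !mxE.
  by case: splitP => k _; rewrite !mxE; ring.
- apply/matrixP => i j; rewrite !mxE; case: splitP => k /= hk.
    by move: hk; rewrite [k]ord1 /= /bump /=; case: i.
  by rewrite !mxE.
- apply/matrixP => i j; rewrite !mxE; case: splitP => k /= hk.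
    by move: hk; rewrite [k]ord1 /= /bump /=; case: i.
  by rewrite !mxE.
Qed.

Lemma charpoly_pA N (W : 'M[C]_(1 + N)) z : SU W ->
  charpoly_det W z = (pA W - csgn N *: revp N.+1 (pA W)).[z].
Proof.
move=> sW; rewrite /charpoly_det -horner_rdet -[W in rdet W]mulmx1 -Dmx1 rdet_Dmx//.
by rewrite mul1r.
Qed.

Lemma charpoly_circle N (W : 'M[C]_(1 + N)) z : SU W -> cmod z = 1 ->
  charpoly_det W z = (pA W).[z] - csgn N * z ^+ N.+1 * conjc (pA W).[z].
Proof.
move=> sW z1; rewrite charpoly_pA// hornerD hornerN hornerZ.
by rewrite horner_revp_circle ?(leq_trans (size_pA W))// mulrA.
Qed.

(** Jacobi's identity for complementary minors. [Y] shares its last columns with U, so the adjoint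
    of U times [Y] is block lower triangular with diagonal blocks conj(U 0 0) and 1. *)
Lemma det_drsubmx_SU N (U : 'M[C]_(1 + N)) : SU U -> \det (drsubmx U) = conjc (U 0 0).
Proof.
move=> sU; pose Y := block_mx 1%:M (ursubmx U) 0 (drsubmx U).
have <- : \det Y = \det (drsubmx U) by rewrite /Y det_ublock det1 mul1r.
rewrite -[LHS]mul1r -(SU_det (SU_adj sU)) -det_mulmx.
have := SU_Vmul sU.
rewrite -[X in X *m _](submxK (adjmx U)) -[X in _ *m X]submxK mulmx_block (scalar_mx_block 1 N).
move=> /eq_block_mx [_ h1 _ h2].
rewrite -[X in X *m _](submxK (adjmx U)) /Y mulmx_block h1 h2 det_lblock det1 mulr1.
rewrite !mulmx1 mulmx0 addr0 [ulsubmx _]mx11_scalar det_scalar1 !mxE.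
by congr (conjc (U _ _)); apply/val_inj.
Qed.

Lemma unitary_det_cmod n (Q : 'M[C]_n) : Q *m adjmx Q = 1%:M -> cmod (\det Q) = 1.
Proof.
move=> /(congr1 determinant); rewrite det_mulmx det_adjmx det1 mul_conjc => -[/eqP].
by rewrite sqrf_eq1 => /orP[/eqP//|/eqP h]; have := cmod_ge0 (\det Q); rewrite h; lra.
Qed.

Lemma unitary_Dmx N (z : C) : cmod z = 1 -> Dmx N z *m adjmx (Dmx N z) = 1%:M.
Proof. by move=> z1; rewrite adj_Dmx DmxM mul_conjc z1 expr1n Dmx1. Qed.

Lemma unitaryM n (A B : 'M[C]_n) : A *m adjmx A = 1%:M -> B *m adjmx B = 1%:M ->
  (A *m B) *m adjmx (A *m B) = 1%:M.
Proof. by move=> hA hB; rewrite adjmxM mulmxA -(mulmxA A) hB mulmx1 hA. Qed.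

Lemma conj_unit_mul (z : C) : cmod z = 1 -> conjc z * z = 1.
Proof. by move=> z1; rewrite mulrC mul_conjc z1 expr1n. Qed.

Lemma mulmx_Dmx3 N (X Y : 'M[C]_(1 + N)) a b c :
  X *m Dmx N a *m Dmx N b *m (Dmx N c *m Y) = X *m Dmx N (a * b * c) *m Y.
Proof.
by rewrite -(mulmxA X (Dmx N a)) DmxM mulmxA -(mulmxA X (Dmx N (a * b))) DmxM.
Qed.

(* [d^* d = 1 - b^* b] has rank one defect, hence the decomposition. *)
Lemma SU_trunc_decomp N (U : 'M[C]_(1 + (1 + N))) : SU U -> U 0 0 != 0 ->
  exists Q1 Q2 : 'M[C]_(1 + N), [/\ SU Q1, SU Q2 &
    drsubmx U = Q1 *m Dmx N (conjc (U 0 0)) *m Q2].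
Proof.
move=> sU a0; pose d := drsubmx U; pose b := ursubmx U; pose a := U 0 0.
(* Gram-Schmidt applied to the matrix all of whose rows are b gives a unitary [S] whose first row is
   parallel to b. The case b = 0 is covered, with [kap] = 0. *)
pose S := schmidt (\matrix_(i < 1 + N) b).
have uS : S *m adjmx S = 1%:M.
  have /unitarymxP := schmidt_unitarymx (\matrix_(i < 1 + N) b) (leqnn _).
  by rewrite /adjmx map_trmx.
have uS' : adjmx S *m S = 1%:M by exact: mulmx1C.
have [kap bk] : exists kap, b = kap *: row 0 S.
  have := row_schmidt_sub (\matrix_(i < 1 + N) b) 0.
  rewrite rowK (big_pred1 0) => [|i]; last by rewrite /= leqn0.
  by rewrite genmxE => /sub_rVP.
have bS : b *m adjmx S = kap *: row_mx 1%:M 0.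
  rewrite bk -scalemxAl -row_mul uS; congr (_ *: _).
  apply/rowP => j; rewrite !mxE; case: splitP => k hk; rewrite !mxE -val_eqE /= hk//=.
have hU := SU_mulV sU.
have hV := SU_Vmul sU.
have dd : adjmx d *m d = 1%:M - b^t* *m b.
  have hb : b^t* = dlsubmx (adjmx U) by apply/matrixP => i j; rewrite !mxE.
  move: hV; rewrite -[X in X *m _](submxK (adjmx U)) -[X in _ *m X]submxK mulmx_block.
  rewrite (scalar_mx_block 1 (1 + N)) => /eq_block_mx [_ _ _]; rewrite hb adj_dr -/d -/b.
  by move: (dlsubmx _ *m b) (adjmx d *m d) => x y <-; rewrite [x + y]addrC addrK.
have kk : kap * conjc kap = 1 - (cmod a ^+ 2)%:C%C.
  have : b *m b^t* = 1%:M - (cmod a ^+ 2)%:C%C%:M.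
    have hb : b^t* = dlsubmx (adjmx U) by apply/matrixP => i j; rewrite !mxE.
    have ha : ulsubmx U *m ulsubmx (adjmx U) = (cmod a ^+ 2)%:C%C%:M.
      rewrite [ulsubmx U]mx11_scalar [ulsubmx (adjmx U)]mx11_scalar -scalar_mxM.
      congr (_%:M); rewrite -mul_conjc !mxE.
      have -> : lshift (1 + N) 0 = 0 :> 'I_(1 + (1 + N)) by exact/val_inj.
      by [].
    move: hU; rewrite -[X in X *m _]submxK -[X in _ *m X](submxK (adjmx U)) mulmx_block.
    rewrite (scalar_mx_block 1 (1 + N)) => /eq_block_mx [+ _ _ _]; rewrite hb -/b ha.
    by move: (b *m _) (_%:M) => x y <-; rewrite [y + x]addrC addrK.
  have : b *m b^t* = (b *m adjmx S) *m (b *m adjmx S)^t*.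
    rewrite map_mxM trmx_mul -[(adjmx S)^t*]/(adjmx (adjmx S)) adjmxK.
    by rewrite mulmxA -(mulmxA b) uS' mulmx1.
  rewrite bS map_mxZ linearZ /= -scalemxAl -scalemxAr.
  rewrite map_row_mx tr_row_mx map_mx1 map_mx0 trmx1 trmx0 mul_row_col mulmx1 mulmx0 addr0.
  by move=> -> /matrixP/(_ 0 0); rewrite !mxE eqxx !mulr1n mulr1.
pose G := d *m adjmx S.
have GG : adjmx G *m G = Dmx N ((cmod a ^+ 2)%:C%C).
  rewrite /G adjmxM adjmxK mulmxA -(mulmxA S) dd mulmxBr mulmx1 mulmxBl uS.
  have -> : S *m (b^t* *m b) *m adjmx S = (b *m adjmx S)^t* *m (b *m adjmx S).
    by rewrite map_mxM trmx_mul -[(adjmx S)^t*]/(adjmx (adjmx S)) adjmxK !mulmxA.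
  have trZ k (M : 'rV[C]_(1 + N)) : (k *: M)^T = k *: M^T by exact: linearZ.
  rewrite bS map_mxZ trZ -scalemxAr -scalemxAl scalerA kk.
  rewrite map_row_mx tr_row_mx map_mx1 map_mx0 trmx1 trmx0 mul_col_row !mulmx0 !mul0mx mulmx1.
  rewrite scale_block_mx !scaler0 (scalar_mx_block 1 N) opp_block_mx add_block_mx !subr0.
  by rewrite scalemx1 -raddfB /= opprB addrC subrK.
have r0 : cmod a != 0 by rewrite cmod_eq0.
pose r := (cmod a)%:C%C.
have rc : conjc r^-1 = r^-1 by rewrite conjc_inv conjc_real.
have rn0 : r != 0 by rewrite /r -(rmorph0 (real_complex R)) (inj_eq (@complexI R)).
(* The columns of G are orthogonal with norms |a|, 1, ..., 1. Rescaling the first one makes G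
   unitary; this is where a must be nonzero. *)
pose Q1' := G *m Dmx N r^-1.
have uQ1' : adjmx Q1' *m Q1' = 1%:M.
  rewrite /Q1' adjmxM adj_Dmx rc mulmxA -(mulmxA (Dmx N r^-1)) GG !DmxM.
  rewrite (_ : _ * _ = 1) ?Dmx1// rmorphXn /= -/r expr2 mulrA mulVf// mul1r mulfV//.
have uQ1 : Q1' *m adjmx Q1' = 1%:M by exact: mulmx1C.
have dE : d = Q1' *m Dmx N r *m S.
  by rewrite /Q1' -(mulmxA G) DmxM mulVf// Dmx1 mulmx1 /G -mulmxA uS' mulmx1.
have u1 := unitary_det_cmod uQ1; have u2 := unitary_det_cmod uS.
(* The determinants of the two unitary factors are moved into the diagonal factor. *)
pose Q1 := Q1' *m Dmx N (conjc (\det Q1')).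
pose Q2 := Dmx N (conjc (\det S)) *m S.
have sQ1 : SU Q1.
  split; first by apply: unitaryM => //; apply: unitary_Dmx; rewrite cmod_conj.
  by rewrite det_mulmx det_Dmx mulrC conj_unit_mul.
have sQ2 : SU Q2.
  split; first by apply: unitaryM => //; apply: unitary_Dmx; rewrite cmod_conj.
  by rewrite det_mulmx det_Dmx conj_unit_mul.
have dQ : d = Q1 *m Dmx N (\det Q1' * r * \det S) *m Q2.
  rewrite dE /Q1 /Q2 mulmx_Dmx3; congr (_ *m Dmx N _ *m _).
  rewrite !mulrA conj_unit_mul// mul1r -mulrA [_ * conjc _]mulrC conj_unit_mul// mulr1.
  by [].
exists Q1, Q2; split=> //; rewrite -/d {1}dQ; congr (_ *m Dmx N _ *m _).
(* The diagonal coefficient collected in this way is the determinant of d, which Jacobi's identity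
   computes. *)
by rewrite -det_drsubmx_SU// -/d {1}dE !det_mulmx !det_Dmx.
Qed.

End TruncatedCharacteristicPolynomial.

(** * One step of the recursion in the order of the matrix *)

Section Chain.
Variable R : realType.
Local Notation C := R[i].

(** Polynomials are given no sigma-algebra: a functional is tested along every coefficientwise
    measurable family of size at most k. *)
Definition polymeas k (F : {poly C} -> R) := forall (d : measure_display)
  (T : measurableType d) (f : T -> {poly C}), pmeas f ->
  (forall x, (size (f x) <= k)%N) -> measurable_fun setT (fun x => F (f x)).

(** The Szego recursion for reversed orthogonal polynomials on the unit circle, with Verblunsky
    coefficient [mu * csgn R N]. *)
Definition chain_step N (mu : C) (p : {poly C}) : {poly C} :=
  p - (mu * csgn R N) *: revp N.+1 p.

Lemma size_chain_step N mu (p : {poly C}) : (size p <= N.+1)%N -> (size (chain_step N mu p) <= N.+2)%N.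
Proof.
move=> pN; rewrite (leq_trans (size_polyD _ _))// geq_max size_polyN (leq_trans pN)//=.
by rewrite (leq_trans (size_scale_leq _ _))// (leq_trans (size_revp _ _)).
Qed.

Lemma pmeas_chain_step d (T : measurableType d) N (mu : T -> C) (f : T -> {poly C}) :
  cmeas mu -> pmeas f -> pmeas (fun x => chain_step N (mu x) (f x)).
Proof.
move=> mmu mf; apply: pmeasB => //; apply: pmeasZ; last exact: pmeas_revp.
by apply: cmeasM => //; exact: cmeas_cst.
Qed.

Lemma SU_block1 N (W : 'M[C]_N) : SU W -> SU (block_mx 1%:M 0 0 W : 'M[C]_(1 + N)).
Proof.
move=> sW; split; last by rewrite det_ublock det1 mul1r SU_det.
rewrite /adjmx map_block_mx tr_block_mx !map_mx0 !trmx0 map_mx1 trmx1 mulmx_block.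
by rewrite !mulmx0 !mul0mx !mulmx1 !addr0 add0r -/(adjmx W) SU_mulV// -scalar_mx_block.
Qed.

Lemma rdet_mul4 n (A B D Q : 'M[C]_n) : \det Q != 0 ->
  rdet (A *m (B *m D *m Q)) = rdet (Q *m A *m B *m D).
Proof. by move=> q0; rewrite mulmxA rdet_mulC// !mulmxA. Qed.

Section OneStep.
Context (N : nat) d1 (T1 : measurableType d1) (P1 : probability T1 R)
  (U : T1 -> 'M[C]_(1 + (1 + N))) d0 (T0 : measurableType d0) (P0 : probability T0 R)
  (W : T0 -> 'M[C]_(1 + N)).
Hypotheses (hU : haar_SU_distributed P1 U) (hW : haar_SU_distributed P0 W).
Hypothesis hU0 : {ae P1, forall u, U u 0 0 != 0}.

(** Multiplying U by the block matrix of 1 and an independent W keeps its law and turns its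
    truncation d into W d. Write d = Q1 D Q2 with D diagonal: bi-invariance of W absorbs Q1 and Q2,
    and what is left is [rdet_Dmx]. *)
Lemma haar_chain (F : {poly C} -> R) : polymeas N.+2 F -> (forall p, 0 <= F p) ->
  (\int[P1]_u (F (pA (U u)))%:E =
   \int[P1]_u \int[P0]_w (F (chain_step N (conjc (U u 0 0)) (pA (W w))))%:E)%E.
Proof.
move=> mF F0.
have mU1 k l : cmeas (fun p : T1 * T0 => U p.1 k l).
  exact: (cmeas_comp measurable_fst (haar_cmeas hU k l)).
have mW2 k l : cmeas (fun p : T1 * T0 => W p.2 k l).
  exact: (cmeas_comp measurable_snd (haar_cmeas hW k l)).
have mF' d (T : measurableType d) (f : T -> {poly C}) : pmeas f ->
    (forall x, (size (f x) <= N.+2)%N) -> measurable_fun setT (fun x => (F (f x))%:E).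
  by move=> *; apply/measurable_EFinP; exact: mF.
have mdr d (T : measurableType d) (f : T -> 'M[C]_(1 + (1 + N))) :
    (forall k l, cmeas (fun x => f x k l)) -> forall k l, cmeas (fun x => drsubmx (f x) k l).
  by move=> mf k l; under eq_fun do rewrite !mxE; exact: mf.
pose f (p : T1 * T0) := (F (rdet (W p.2 *m drsubmx (U p.1))))%:E.
have mf : measurable_fun setT f.
  apply: mF' => [|x]; last exact: size_rdet.
  by apply: pmeas_rdet; apply: cmeas_mulmx => //; exact: mdr.
have f0 p : (0 <= f p)%E by rewrite lee_fin.
pose h (p : T1 * T0) := (F (chain_step N (conjc (U p.1 0 0)) (pA (W p.2))))%:E.
have mh : measurable_fun setT h.
  apply: mF' => [|x]; last by apply: size_chain_step; exact: size_pA.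
  by apply: pmeas_chain_step; [exact: cmeasJ|exact: pmeas_pA].
have h0 p : (0 <= h p)%E by rewrite lee_fin.
(* For fixed w in SU, left multiplication by the block matrix of 1 and w is an element of SU acting
   on U. *)
have E1 : (\int[P0]_w \int[P1]_u f (u, w) = \int[P1]_u (F (pA (U u)))%:E)%E.
  transitivity (\int[P0]_w (cst (\int[P1]_u (F (pA (U u)))%:E) w))%E; last first.
    by rewrite integral_cst//= probability_setT mule1.
  apply: (ae_SU_ge0_integral hW).
  - exact: (measurable_fun_fubini_tonelli_G _ mf f0).
  - exact: measurable_cst.
  - by move=> w; exact: integral_ge0.
  - by move=> w; apply: integral_ge0 => u _; rewrite lee_fin.
  - move=> w sw.
    pose g (A : mxT R (1 + (1 + N))) := (F (pA A))%:E.
    have mg : measurable_fun setT g.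
      apply: mF' => [|x]; last exact: size_pA.
      by apply: pmeas_pA; exact: cmeas_entry.
    rewrite /cst -(haar_left hU (SU_block1 sw) mg) => [|A]; last by rewrite lee_fin.
    apply: eq_integral => u _; rewrite /f /g /pA /=; congr (F (rdet _))%:E.
    rewrite -[in RHS](submxK (U u)) mulmx_block block_mxKdr mul0mx add0r //.
rewrite -E1 -(fubini_tonelli f mf f0).
have mUS : measurable_fun setT (fun u => (\int[P0]_w h (u, w))%E).
  exact: (measurable_fun_fubini_tonelli_F _ mh h0).
apply: ge0_ae_eq_integral => //.
- exact: (measurable_fun_fubini_tonelli_F _ mf f0).
- by move=> u _; exact: integral_ge0.
- by move=> u _; apply: integral_ge0 => w _; exact: h0 (u, w).
apply: filterS2 (haar_SU hU) hU0 => u su u0 _.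
(* Here u is frozen, so Q1 and Q2 are constant matrices for the integral over w. *)
have [Q1 [Q2 [sQ1 sQ2 dE]]] := SU_trunc_decomp su u0.
pose g (A : mxT R (1 + N)) := (F (rdet ((A : 'M[C]_(1 + N)) *m Dmx N (conjc (U u 0 0)))))%:E.
have mg : measurable_fun setT g.
  apply: mF' => [|x]; last exact: size_rdet.
  by apply: pmeas_rdet; apply: cmeas_mulmx => k l; [exact: cmeas_entry|exact: cmeas_cst].
have g0 A : (0 <= g A)%E by rewrite lee_fin.
have e w : rdet (W w *m drsubmx (U u)) = rdet (Q2 *m W w *m Q1 *m Dmx N (conjc (U u 0 0))).
  have q2 : \det Q2 != 0 by rewrite (SU_det sQ2) oner_neq0.
  exact: (etrans (congr1 (fun A => rdet (W w *m A)) dE) (rdet_mul4 _ _ _ q2)).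
transitivity (\int[P0]_w g (Q2 *m W w *m Q1))%E.
  by apply: eq_integral => w _; exact: (congr1 (fun p => (F p)%:E) (e w)).
rewrite (haar_bi hW sQ2 sQ1 mg g0).
apply: (ae_SU_ge0_integral hW).
- exact: (measurableT_comp mg (haar_measurable hW)).
- apply: mF' => [|x]; last by apply: size_chain_step; exact: size_pA.
  by apply: pmeas_chain_step; [exact: cmeas_cst|apply: pmeas_pA; exact: (haar_cmeas hW)].
- by move=> w; exact: g0.
- by move=> w; exact: h0 (u, w).
- by move=> w sw; rewrite /g rdet_Dmx.
Qed.

End OneStep.

(** The expected number of events among the first n that occur is n P(A 0) and stays below c for
    every n. This yields null events from symmetry alone. *)
Lemma equiprob0 d (T : measurableType d) (P : probability T R) (A : nat -> set T) (c : R) :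
  0 <= c -> (forall k, measurable (A k)) -> (forall k, P (A k) = P (A 0%N)) ->
  {ae P, forall w n, \sum_(k < n) (\1_(A k) w : R) <= c} -> P (A 0%N) = 0%E.
Proof.
move=> c0 mA pA0 hc.
have fp : P (A 0%N) \is a fin_num by rewrite fin_num_measure.
have hn n : (n%:R%:E * P (A 0%N) <= c%:E)%E.
  have -> : (n%:R%:E * P (A 0%N) = \int[P]_w (\sum_(k < n) (\1_(A k) w : R))%:E)%E.
    transitivity (\int[P]_w (\sum_(k < n) ((\1_(A k) w : R))%:E))%E; last first.
      by apply: eq_integral => w _; rewrite sumEFin.
    rewrite ge0_integral_sum//; last by move=> k; apply/measurable_EFinP; exact: measurable_indic.
    rewrite (eq_bigr (fun=> P (A 0%N))) => [|k _].
      by rewrite -(fineK fp) sumEFin sumr_const card_ord -EFinM mulr_natl.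
    by rewrite integral_indic// setIT; exact: pA0.
  have cE : (\int[P]_w (cst c%:E w) = c%:E)%E.
    by rewrite integral_cst//= probability_setT mule1.
  rewrite -cE; apply: ae_ge0_le_integral => //.
  - by move=> w _; rewrite lee_fin sumr_ge0.
  - by apply/measurable_EFinP; apply: measurable_sum => k; exact: measurable_indic.
  - by apply: filterS hc => w hw _; rewrite lee_fin; exact: hw.
rewrite -(fineK fp) in hn *; congr (_%:E); apply/eqP; rewrite eq_le fine_ge0 ?andbT//.
rewrite leNgt; apply/negP => p0.
have := hn (Num.truncn (c / fine (P (A 0%N)))).+1; rewrite -EFinM lee_fin -ler_pdivlMr//.
by rewrite leNgt truncnS_gt.
Qed.

End Chain.

(** * Real-valued expectations *)

Section ExpectationToolkit.
Variable R : realType.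
Context d (T : measurableType d) (P : probability T R).
Implicit Types (f g : T -> R).

Definition intg f := P.-integrable setT (EFin \o f).
Definition Ex f : R := \int[P]_x f x.

Lemma intg_meas f : intg f -> measurable_fun setT f.
Proof. by move=> /measurable_int/measurable_EFinP. Qed.

Lemma intg_bdd f (c : R) : measurable_fun setT f -> (forall x, `|f x| <= c) -> intg f.
Proof.
move=> mf fc; apply: measurable_bounded_integrable => //.
  by rewrite /= probability_setT ltry.
exists c; split; first exact: num_real.
by move=> M cM x _ /=; rewrite (le_trans (fc x))// ltW.
Qed.

Lemma intg_cst (c : R) : intg (fun=> c).
Proof. by apply: (intg_bdd (c := `|c|)) => //; exact: measurable_cst. Qed.

Lemma intg_le f g : measurable_fun setT f -> intg g -> (forall x, `|f x| <= g x) -> intg f.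
Proof.
move=> mf ig fg; apply: (le_integrable _ _ _ ig) => //; first exact/measurable_EFinP.
by move=> x _ /=; rewrite lee_fin (le_trans (fg x))// ler_norm.
Qed.

Lemma intgD f g : intg f -> intg g -> intg (fun x => f x + g x).
Proof. by move=> hf hg; exact: (integrableD _ hf hg). Qed.

Lemma intgZ c f : intg f -> intg (fun x => c * f x).
Proof. by move=> hf; exact: (integrableZl _ c hf). Qed.

Lemma intgB f g : intg f -> intg g -> intg (fun x => f x - g x).
Proof. by move=> hf hg; exact: (integrableB _ hf hg). Qed.

Lemma intg_ge0 f (c : \bar R) : measurable_fun setT f -> (forall x, 0 <= f x) ->
  (\int[P]_x (f x)%:E <= c)%E -> (c < +oo)%E -> intg f.
Proof.
move=> mf f0 h c0; apply/integrableP; split; first exact/measurable_EFinP.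
under eq_integral => x _ do rewrite /= ger0_norm//.
exact: le_lt_trans h c0.
Qed.

Lemma EFin_Ex f : intg f -> ((Ex f)%:E = \int[P]_x (f x)%:E)%E.
Proof. by move=> hf; rewrite /Ex /Rintegral fineK//; exact: integrable_fin_num hf. Qed.

Lemma ExD f g : intg f -> intg g -> Ex (fun x => f x + g x) = Ex f + Ex g.
Proof. by move=> hf hg; exact: RintegralD. Qed.

Lemma ExB f g : intg f -> intg g -> Ex (fun x => f x - g x) = Ex f - Ex g.
Proof. by move=> hf hg; exact: RintegralB. Qed.

Lemma ExZ c f : intg f -> Ex (fun x => c * f x) = c * Ex f.
Proof. by move=> hf; exact: RintegralZl. Qed.

Lemma Ex_cst c : Ex (fun=> c) = c.
Proof. by rewrite /Ex Rintegral_cst//= probability_setT mulr1. Qed.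

Lemma Ex_le f g : intg f -> intg g -> (forall x, f x <= g x) -> Ex f <= Ex g.
Proof. by move=> hf hg fg; apply: le_Rintegral. Qed.

Lemma Ex_ge0 f : (forall x, 0 <= f x) -> 0 <= Ex f.
Proof. by move=> f0; apply: Rintegral_ge0. Qed.

Lemma eq_Ex f g : (forall x, f x = g x) -> Ex f = Ex g.
Proof. by move=> fg; apply: eq_Rintegral => x _; exact: fg. Qed.

Lemma Ex_le_ae f g : intg f -> intg g -> {ae P, forall x, f x <= g x} -> Ex f <= Ex g.
Proof.
move=> hf hg fg; rewrite -subr_ge0 -ExB//.
rewrite -lee_fin EFin_Ex; last exact: intgB.
have h0 : intg (fun x => Num.max 0 (g x - f x)).
  apply: (intg_le _ (g := fun x => `|g x - f x|)).
  - by apply: measurable_maxr => //; apply: measurable_funB; exact: intg_meas.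
  - by have := integrable_norm (intgB hg hf).
  - by move=> x; case: (lerP 0 (g x - f x)) => h; rewrite ?normr0 ?normr_ge0.
rewrite (@ae_eq_integral _ _ _ P setT (fun x => (Num.max 0 (g x - f x))%:E))//.
- by apply: integral_ge0 => x _; rewrite lee_fin le_max lexx.
- by apply/measurable_EFinP; apply: measurable_funB; exact: intg_meas.
- by apply/measurable_EFinP; exact: intg_meas.
- by apply: filterS fg => x h _; rewrite max_r// subr_ge0.
Qed.

Lemma Ex_ae f g : intg f -> intg g -> {ae P, forall x, f x = g x} -> Ex f = Ex g.
Proof.
move=> hf hg fg; apply/eqP; rewrite eq_le !Ex_le_ae//.
  by apply: filterS fg => x ->.
by apply: filterS fg => x ->.
Qed.

Lemma Ex_norm f : intg f -> `|Ex f| <= Ex (fun x => `|f x|).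
Proof. by move=> hf; exact: le_normr_Rintegral. Qed.

Lemma intg_norm f : intg f -> intg (fun x => `|f x|).
Proof. by move=> hf; exact: integrable_norm hf. Qed.

Lemma intg_sum (I : Type) (r : seq I) (Q : pred I) (F : I -> T -> R) :
  (forall i, intg (F i)) -> intg (fun x => \sum_(i <- r | Q i) F i x).
Proof.
move=> hF; elim: r => [|i r ih].
  by rewrite (_ : (fun x => _) = fun=> 0) ?(intg_cst 0)//; apply/funext => x; rewrite big_nil.
rewrite (_ : (fun x => _) = fun x => (if Q i then F i x + \sum_(j <- r | Q j) F j x
   else \sum_(j <- r | Q j) F j x)); last by apply/funext => x; rewrite big_cons.
by case: (Q i) => //; exact: intgD.
Qed.

Lemma Ex_sum (I : Type) (r : seq I) (Q : pred I) (F : I -> T -> R) :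
  (forall i, intg (F i)) -> Ex (fun x => \sum_(i <- r | Q i) F i x) =
  \sum_(i <- r | Q i) Ex (F i).
Proof.
move=> hF; elim: r => [|i r ih].
  by rewrite big_nil (eq_Ex (g := fun=> 0)) ?Ex_cst// => x; rewrite big_nil.
rewrite big_cons -ih; case: (boolP (Q i)) => Qi.
  by rewrite -ExD//; [apply: eq_Ex => x; rewrite big_cons Qi|exact: intg_sum].
by apply: eq_Ex => x; rewrite big_cons (negbTE Qi).
Qed.

Lemma intg_indic (A : set T) : measurable A -> intg (\1_A : T -> R).
Proof.
move=> mA; apply: (intg_bdd (c := 1)); first exact: measurable_indic.
by move=> x; rewrite indicE; case: (x \in A); rewrite ?normr1 ?normr0.
Qed.

Lemma Ex_indic (A : set T) : measurable A -> (Ex (\1_A : T -> R))%:E = P A.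
Proof. by move=> mA; rewrite EFin_Ex ?integral_indic ?setIT//; exact: intg_indic. Qed.

Lemma intgM_bdd f g c : measurable_fun setT f -> (forall x, `|f x| <= c) -> intg g ->
  intg (fun x => f x * g x).
Proof.
move=> mf fc hg; have mg := intg_meas hg.
apply: (intg_le (g := fun x => c * `|g x|)).
- exact: measurable_funM.
- by apply: intgZ; exact: intg_norm.
- by move=> x; rewrite normrM ler_wpM2r.
Qed.

End ExpectationToolkit.

(** * Moments and null events for the first column of a Haar matrix *)

Section FirstColumn.
Variable R : realType.
Local Notation C := R[i].

Lemma haar_left_Ex d (T : measurableType d) (P : probability T R) n (X : T -> 'M[C]_n)
    (hX : haar_SU_distributed P X) (V : 'M[C]_n) (g : mxT R n -> R) : SU V ->
  measurable_fun setT g -> Ex P (fun w => g (V *m X w)) = Ex P (fun w => g (X w)).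
Proof.
move=> sV mg; rewrite /Ex /Rintegral; congr fine.
have mg' : measurable_fun setT (EFin \o g) by exact/measurable_EFinP.
rewrite integralE [RHS]integralE; congr (_ - _)%E.
- transitivity (\int[P]_x ((EFin \o g)^\+%E (V *m X x)))%E; first by apply: eq_integral => x _; rewrite ?funeposE ?funenegE.
  transitivity (\int[P]_x ((EFin \o g)^\+%E (X x)))%E; last by apply: eq_integral => x _; rewrite ?funeposE ?funenegE.
  exact: (haar_left hX sV (measurable_funepos mg') (fun A => funepos_ge0 (EFin \o g) A)).
- transitivity (\int[P]_x ((EFin \o g)^\-%E (V *m X x)))%E; first by apply: eq_integral => x _; rewrite ?funeposE ?funenegE.
  transitivity (\int[P]_x ((EFin \o g)^\-%E (X x)))%E; last by apply: eq_integral => x _; rewrite ?funeposE ?funenegE.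
  exact: (haar_left hX sV (measurable_funeneg mg') (fun A => funeneg_ge0 (EFin \o g) A)).
Qed.

Lemma sqrD_le (x y : R) : (x + y) ^+ 2 <= 2 * (x ^+ 2 + y ^+ 2).
Proof. by rewrite -subr_ge0 (_ : _ - _ = (x - y) ^+ 2) ?sqr_ge0//; ring. Qed.

(** An element of SU(2) acting on the first two coordinates. *)
Definition rotmx N (a b : C) : 'M[C]_(1 + 1 + N) :=
  block_mx (block_mx a%:M b%:M (- conjc b)%:M (conjc a)%:M) 0 0 1%:M.

Lemma SU_rotmx N a b : a != 0 -> a * conjc a + b * conjc b = 1 -> SU (rotmx N a b).
Proof.
move=> a0 ab; split.
  rewrite /adjmx /rotmx map_block_mx tr_block_mx !map_mx0 !trmx0 map_mx1 trmx1.
  rewrite map_block_mx tr_block_mx !map_scalar_mx !tr_scalar_mx mulmx_block.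
  rewrite !mulmx0 !mul0mx !mulmx1 !addr0 add0r.
  rewrite mulmx_block -!scalar_mxM -!raddfD /= [Num.conj a]/(conjc a) [Num.conj b]/(conjc b).
  rewrite [Num.conj (conjc a)]conjcK [Num.conj (- conjc b)](_ : _ = - b); last first.
    by rewrite -[LHS]/(conjc (- conjc b)) raddfN /= conjcK.
  rewrite ab (_ : a * - b + b * a = 0); last by ring.
  rewrite (_ : - conjc b * conjc a + conjc a * conjc b = 0); last by ring.
  rewrite (_ : - conjc b * - b + conjc a * a = 1); last by rewrite -ab; ring.
  by rewrite (_ : (0%:M : 'M[C]_1) = 0) ?raddf0// -!scalar_mx_block.
rewrite /rotmx det_ublock det1 mulr1.
(* An LU factorisation with pivot a; this is where a is inverted. *)
have -> : block_mx a%:M b%:M (- conjc b)%:M (conjc a)%:M =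
   block_mx 1%:M 0 (- conjc b / a)%:M 1%:M *m block_mx a%:M b%:M 0 (a^-1)%:M :> 'M[C]_(1 + 1).
  rewrite mulmx_block !mul0mx !mulmx0 !mul1mx !addr0 -!scalar_mxM -raddfD /=.
  congr (block_mx _ _ _%:M _%:M); first by rewrite mulfVK.
  by apply: (mulfI a0); rewrite mulrDr mulfV// mulrCA mulrA divfK// -ab; ring.
by rewrite det_mulmx det_lblock det_ublock !det1 !det_scalar1 mul1r mul1r mulfV.
Qed.

Definition i1 N : 'I_N.+2 := lift ord0 ord0.

Lemma rotmx_row0 N a b (M : 'M[C]_N.+2) :
  (rotmx N a b *m M) 0 0 = a * M 0 0 + b * M (i1 N) 0.
Proof.
rewrite mxE big_ord_recl big_ord_recl big1 => [|i _]; last first.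
  rewrite (_ : 0 = lshift N (lshift 1 (0 : 'I_1))); last exact/val_inj.
  rewrite (_ : lift ord0 (lift ord0 i) = rshift (1 + 1) i); last exact/val_inj.
  by rewrite block_mxEur mxE mul0r.
rewrite addr0; congr (_ * _ + _ * _).
  rewrite -[X in rotmx N a b X _ = _](_ : lshift N (lshift 1 (0 : 'I_1)) = _); last exact/val_inj.
  rewrite -[X in rotmx N a b _ X = _](_ : lshift N (lshift 1 (0 : 'I_1)) = _); last exact/val_inj.
  by rewrite block_mxEul block_mxEul mxE eqxx mulr1n.
rewrite -[X in rotmx N a b X _ = _](_ : lshift N (lshift 1 (0 : 'I_1)) = _); last exact/val_inj.
rewrite -[X in rotmx N a b _ X = _](_ : lshift N (rshift 1 (0 : 'I_1)) = _); last exact/val_inj.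
by rewrite block_mxEul block_mxEur mxE eqxx mulr1n.
Qed.

Lemma rotmx_row1 N a b (M : 'M[C]_N.+2) :
  (rotmx N a b *m M) (i1 N) 0 = - conjc b * M 0 0 + conjc a * M (i1 N) 0.
Proof.
rewrite mxE big_ord_recl big_ord_recl big1 => [|i _]; last first.
  rewrite (_ : i1 N = lshift N (rshift 1 (0 : 'I_1))); last exact/val_inj.
  rewrite (_ : lift ord0 (lift ord0 i) = rshift (1 + 1) i); last exact/val_inj.
  by rewrite block_mxEur mxE mul0r.
rewrite addr0; congr (_ * _ + _ * _).
  rewrite -[X in rotmx N a b X _ = _](_ : lshift N (rshift 1 (0 : 'I_1)) = _); last exact/val_inj.
  rewrite -[X in rotmx N a b _ X = _](_ : lshift N (lshift 1 (0 : 'I_1)) = _); last exact/val_inj.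
  by rewrite block_mxEul block_mxEdl mxE eqxx mulr1n.
rewrite -[X in rotmx N a b X _ = _](_ : lshift N (rshift 1 (0 : 'I_1)) = _); last exact/val_inj.
rewrite -[X in rotmx N a b _ X = _](_ : lshift N (rshift 1 (0 : 'I_1)) = _); last exact/val_inj.
by rewrite block_mxEul block_mxEdr mxE eqxx mulr1n.
Qed.

(** A permutation matrix with its sign placed in the first row, to reach determinant 1; moduli of
    entries do not see it. *)
Definition spermx N (s : 'S_(1 + N)) : 'M[C]_(1 + N) := Dmx N ((-1) ^+ s) *m perm_mx s.

Lemma SU_spermx N (s : 'S_(1 + N)) : SU (spermx s).
Proof.
have c1 : cmod ((-1) ^+ s : C) = 1 by rewrite cmodX cmodN cmod1 expr1n.
split.
  apply: unitaryM; first exact: unitary_Dmx.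
  by rewrite /adjmx map_perm_mx tr_perm_mx -perm_mxM mulgV perm_mx1.
by rewrite det_mulmx det_Dmx det_perm -expr2 sqrr_sign.
Qed.

Lemma cmod_spermx N (s : 'S_(1 + N)) (M : 'M[C]_(1 + N)) i j :
  cmod ((spermx s *m M) i j) = cmod (M (s i) j).
Proof.
have c1 : cmod ((-1) ^+ s : C) = 1 by rewrite cmodX cmodN cmod1 expr1n.
rewrite /spermx -mulmxA -row_permE; set M' := row_perm s M.
have -> : M (s i) j = M' i j by rewrite mxE.
rewrite -[M']vsubmxK mul_block_col mul0mx mul0mx addr0 add0r mul1mx mul_scalar_mx !mxE.
by case: splitP => k _; rewrite !mxE // cmodM c1 mul1r.
Qed.

Lemma perm_two N (i j : 'I_N.+2) : i != j -> exists s : 'S_N.+2, s 0 = i /\ s (i1 N) = j.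
Proof.
move=> ij.
have k0 : tperm 0 i j != 0.
  apply/eqP => /(congr1 (tperm 0 i)); rewrite tpermK tpermL => ji.
  by rewrite ji eqxx in ij.
exists (tperm (i1 N) (tperm 0 i j) * tperm 0 i)%g; split; rewrite permM.
  by rewrite [tperm (i1 N) _ 0]tpermD// tpermL.
by rewrite tpermL tpermK.
Qed.

Context (N : nat) d (T : measurableType d) (P : probability T R)
  (U : T -> 'M[C]_(1 + (1 + N))).
Hypothesis hU : haar_SU_distributed P U.

Let q i w : R := cmod (U w i 0) ^+ 2.

Lemma col_norm w : SU (U w) -> \sum_i q i w = 1.
Proof.
move=> /SU_Vmul/matrixP/(_ 0 0); rewrite mxE [RHS]mxE eqxx mulr1n => h.
apply: (@complexI R); transitivity (1 : C); last by [].
rewrite -h rmorph_sum; apply: eq_bigr => i _.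
transitivity ((cmod (U w i 0) ^+ 2)%:C%C : C); first by [].
by rewrite -mul_conjc !mxE mulrC.
Qed.

Let mU k l : cmeas (fun w => U w k l). Proof. exact: (haar_cmeas hU). Qed.

Let mq i : measurable_fun setT (q i).
Proof. by apply: measurable_funX; exact: measurable_cmod. Qed.

(** Any two entries of the column can be moved to the first two places by a signed permutation. Only
    moduli enter, because of the sign. *)
Lemma haar_colpair (g : R -> R -> R) i j : i != j ->
  (forall (d' : measure_display) (T' : measurableType d') (f1 f2 : T' -> R), measurable_fun setT f1 ->
     measurable_fun setT f2 -> measurable_fun setT (fun x => g (f1 x) (f2 x))) ->
  Ex P (fun w => g (cmod (U w i 0)) (cmod (U w j 0))) =
  Ex P (fun w => g (cmod (U w 0 0)) (cmod (U w (i1 N) 0))).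
Proof.
move=> ij mg; have [s [s0 s1]] := perm_two ij.
pose G (A : mxT R (1 + (1 + N))) := g (cmod ((A : 'M[C]_(1 + (1 + N))) 0 0))
  (cmod ((A : 'M[C]_(1 + (1 + N))) (i1 N) 0)).
have mG : measurable_fun setT G.
  by apply: mg; apply: measurable_cmod; exact: cmeas_entry.
rewrite -(haar_left_Ex hU (SU_spermx (s : 'S_(1 + (1 + N)))) mG).
by apply: eq_Ex => w; rewrite /G !cmod_spermx s0 s1.
Qed.

Lemma haar_rot2 (g : C -> C -> R) a b : a != 0 -> a * conjc a + b * conjc b = 1 ->
  (forall (d' : measure_display) (T' : measurableType d') (f1 f2 : T' -> C), cmeas f1 ->
     cmeas f2 -> measurable_fun setT (fun x => g (f1 x) (f2 x))) ->
  Ex P (fun w => g (a * U w 0 0 + b * U w (i1 N) 0)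
     (- conjc b * U w 0 0 + conjc a * U w (i1 N) 0)) =
  Ex P (fun w => g (U w 0 0) (U w (i1 N) 0)).
Proof.
move=> a0 ab mg.
pose G (A : mxT R (1 + (1 + N))) := g ((A : 'M[C]_(1 + (1 + N))) 0 0)
  ((A : 'M[C]_(1 + (1 + N))) (i1 N) 0).
have mG : measurable_fun setT G by apply: mg; exact: cmeas_entry.
rewrite -(haar_left_Ex hU (SU_rotmx N a0 ab) mG).
by apply: eq_Ex => w; rewrite /G -rotmx_row0 -rotmx_row1.
Qed.

Let qb i w : SU (U w) -> q i w <= 1.
Proof.
move=> sw; rewrite -(col_norm sw) (bigD1 i)//= lerDl.
by apply: sumr_ge0 => j _; exact: sqr_ge0.
Qed.

Let q0 i w : 0 <= q i w. Proof. exact: sqr_ge0. Qed.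

Let iq2 i j : intg P (fun w => q i w * q j w).
Proof.
apply: (@intg_ge0 _ _ _ _ _ 1%:E); last exact: ltry.
- exact: measurable_funM.
- by move=> w; exact: mulr_ge0.
- have e1 : (\int[P]_w (cst 1%:E w) = 1%:E)%E.
    by rewrite integral_cst//= probability_setT mule1.
  rewrite -e1; apply: ae_ge0_le_integral => //.
  + by move=> w _; rewrite lee_fin mulr_ge0.
  + by apply/measurable_EFinP; exact: measurable_funM.
  + by apply: filterS (haar_SU hU) => w sw _; rewrite lee_fin mulr_ile1 ?qb.
Qed.

Let iq i : intg P (q i).
Proof.
apply: (@intg_ge0 _ _ _ _ _ 1%:E); last exact: ltry.
- exact: mq.
- by move=> w; exact: q0.
- have e1 : (\int[P]_w (cst 1%:E w) = 1%:E)%E.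
    by rewrite integral_cst//= probability_setT mule1.
  rewrite -e1; apply: ae_ge0_le_integral => //.
  + by move=> w _; rewrite lee_fin q0.
  + by apply/measurable_EFinP; exact: mq.
  + by apply: filterS (haar_SU hU) => w sw _; rewrite lee_fin qb.
Qed.

Lemma intg_corner2 : intg P (fun w => cmod (U w 0 0) ^+ 2).
Proof. exact: iq. Qed.

Lemma intg_corner4 : intg P (fun w => cmod (U w 0 0) ^+ 4).
Proof.
rewrite (_ : (fun w => _) = fun w => q 0 w * q 0 w); first exact: iq2.
by apply/funext => w; rewrite /q -exprD.
Qed.

Lemma neq_ord_pair (i : 'I_N.+2) : exists j, i != j.
Proof. by have [->|i0] := eqVneq i 0; [exists (i1 N)|exists 0]. Qed.

Lemma Ex_corner2 : Ex P (fun w => cmod (U w 0 0) ^+ 2) = N.+2%:R^-1.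
Proof.
have e i : Ex P (q i) = Ex P (q 0).
  have [j ij] := neq_ord_pair i.
  have h := @haar_colpair (fun x _ => x ^+ 2) i j ij.
  by apply: h => d' T' f1 f2 m1 _; exact: measurable_funX.
have : Ex P (fun w => \sum_i q i w) = 1.
  rewrite -(Ex_cst P 1); apply: Ex_ae; [exact: intg_sum|exact: intg_cst|].
  by apply: filterS (haar_SU hU) => w sw; exact: col_norm.
rewrite Ex_sum// (eq_bigr (fun=> Ex P (q 0))) => [|i _]; last exact: e.
rewrite sumr_const card_ord => h.
have n0 : N.+2%:R != 0 :> R by rewrite pnatr_eq0.
by apply: (mulfI n0); rewrite mulfV// mulr_natl; exact: h.
Qed.

Let cr (x : R) : C := x%:C%C.

(** With x, y the first two entries, (x + z y) / sqrt 2 has the law of x for every unit z. Averaging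
    its fourth power over the four fourth roots of unity kills the odd cross terms: 4 E|x|^4 =
    E|x|^4 + E|y|^4 + 4 E|x|^2|y|^2. *)
Lemma Ex_corner4_pair : Ex P (fun w => q 0 w * q 0 w) = 2 * Ex P (fun w => q 0 w * q (i1 N) w).
Proof.
pose s : R := Num.sqrt 2^-1.
have s2 : s ^+ 2 = 2^-1 by rewrite sqr_sqrtr// invr_ge0.
have s4 : s ^+ 4 = 4^-1 by rewrite (exprM s 2 2) s2; field.
have s0 : cr s != 0.
  rewrite -(rmorph0 (real_complex R)) (inj_eq (@complexI R)); apply/eqP => h.
  by move: s2; rewrite h expr0n /= => /eqP; rewrite eq_sym invr_eq0 pnatr_eq0.
pose F z (w : T) : R := cmod (cr s * U w 0 0 + (cr s * z) * U w (i1 N) 0) ^+ 4.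
have hF z : cmod z = 1 -> Ex P (F z) = Ex P (fun w => q 0 w * q 0 w).
  move=> z1; transitivity (Ex P (fun w => cmod (U w 0 0) ^+ 4)).
    rewrite -(@haar_rot2 (fun x _ => cmod x ^+ 4) (cr s) (cr s * z))//.
    - have e : cmod (cr s) ^+ 2 = 2^-1 by rewrite cmod_real real_normK ?num_real.
      rewrite !mul_conjc cmodM z1 mulr1 e -rmorphD /=.
      by have -> : 2^-1 + 2^-1 = 1 :> R by field.
    - by move=> *; apply: measurable_funX; exact: measurable_cmod.
  by apply: eq_Ex => w; rewrite /q -exprD.
have iF z : cmod z = 1 -> intg P (F z).
  move=> z1; have mF : measurable_fun setT (F z).
    apply: measurable_funX; apply: measurable_cmod; apply: cmeasD; apply: cmeasM => //; exact: cmeas_cst.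
  apply: (@intg_le _ _ _ _ _ (fun w => 8 * (q 0 w * q 0 w) + 8 * (q (i1 N) w * q (i1 N) w))) => //.
    by apply: intgD; apply: intgZ; exact: iq2.
  move=> w; rewrite ger0_norm ?exprn_ge0 ?cmod_ge0// /F /q.
  rewrite -!exprD -mulrDr -mulrA -mulrDr cmodM cmod_real ger0_norm ?sqrtr_ge0// -/s.
  set x := cmod (U w 0 0); set y := cmod (U w (i1 N) 0).
  have xy : cmod (U w 0 0 + z * U w (i1 N) 0) <= x + y.
    by rewrite (le_trans (cmodD _ _))// cmodM z1 mul1r.
  have x0 : 0 <= x by exact: cmod_ge0. have y0 : 0 <= y by exact: cmod_ge0.
  apply: (@le_trans _ _ ((s * (x + y)) ^+ 4)).
    by apply: lerXn2r; rewrite ?nnegrE ?mulr_ge0 ?sqrtr_ge0 ?cmod_ge0 ?addr_ge0// ler_wpM2l ?sqrtr_ge0.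
  have h1 := sqrD_le x y.
  have h2 : ((x + y) ^+ 2) ^+ 2 <= (2 * (x ^+ 2 + y ^+ 2)) ^+ 2.
    by apply: lerXn2r; rewrite ?nnegrE ?sqr_ge0 ?mulr_ge0 ?addr_ge0 ?sqr_ge0.
  rewrite exprMn s4 (exprM (x + y) 2 2) (exprM x 2 2) (exprM y 2 2).
  have h3 := sqrD_le (x ^+ 2) (y ^+ 2).
  have := sqr_ge0 (x ^+ 2); have := sqr_ge0 (y ^+ 2).
  by move: h2; rewrite exprMn; lra.
have id w : F 1 w + F (-1) w + F 'i%C w + F (- 'i%C) w =
    q 0 w * q 0 w + q (i1 N) w * q (i1 N) w + 4 * (q 0 w * q (i1 N) w).
  have FE z : F z w = 4^-1 * cmod (U w 0 0 + z * U w (i1 N) 0) ^+ 4.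
    by rewrite /F -mulrA -mulrDr cmodM cmod_real ger0_norm ?sqrtr_ge0// -/s exprMn s4.
  rewrite !FE /q.
  have e4 (z : C) : cmod z ^+ 4 = (complex.Re z ^+ 2 + complex.Im z ^+ 2) ^+ 2.
    by rewrite -cmod_sqr -exprM.
  rewrite !e4 !cmod_sqr.
  case: (U w 0 0) => a b; case: (U w (i1 N) 0) => c e /=; by field.
have i1' : cmod ('i%C : C) = 1 by rewrite /cmod /= expr0n /= add0r expr1n sqrtr1.
have in1 : cmod (- 'i%C : C) = 1 by rewrite cmodN.
have n1 : cmod (-1 : C) = 1 by rewrite cmodN cmod1.
have o1 : cmod (1 : C) = 1 by exact: cmod1.
have := eq_Ex P id; rewrite !ExD ?hF//; last 8 first.
- by apply: intgD; exact: iq2.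
- by apply: intgZ; exact: iq2.
- exact: iF.
- exact: iF.
- by apply: intgD; exact: iF.
- exact: iF.
- by apply: intgD; [apply: intgD|]; exact: iF.
- exact: iF.
have -> : Ex P (fun w => q (i1 N) w * q (i1 N) w) = Ex P (fun w => q 0 w * q 0 w).
  transitivity (Ex P (fun w => cmod (U w (i1 N) 0) ^+ 4)).
    by apply: eq_Ex => w; rewrite /q -exprD.
  rewrite (@haar_colpair (fun x _ => x ^+ 4) (i1 N) 0)//; last by move=> *; exact: measurable_funX.
  by apply: eq_Ex => w; rewrite /q -exprD.
rewrite ExZ//; lra.
Qed.

(** Expand the square of the column norm: with m = N+2 rows, m (a + (m - 1) b) = 1 and a = 2 b give
    a = 2 / (m (m + 1)). *)
Lemma Ex_corner4 : Ex P (fun w => cmod (U w 0 0) ^+ 4) <= 2 / N.+2%:R ^+ 2.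
Proof.
pose a := Ex P (fun w => q 0 w * q 0 w); pose b := Ex P (fun w => q 0 w * q (i1 N) w).
have ab : a = 2 * b by exact: Ex_corner4_pair.
have -> : Ex P (fun w => cmod (U w 0 0) ^+ 4) = a.
  by apply: eq_Ex => w; rewrite /q -exprD.
have eij i j : Ex P (fun w => q i w * q j w) = if i == j then a else b.
  have [->|ij] := eqVneq i j.
    have [k jk] := neq_ord_pair j.
    transitivity (Ex P (fun w => cmod (U w j 0) ^+ 4)).
      by apply: eq_Ex => w; rewrite /q -exprD.
    rewrite (@haar_colpair (fun x _ => x ^+ 4) j k)//; last by move=> *; exact: measurable_funX.
    by apply: eq_Ex => w; rewrite /q -exprD.
  rewrite (@haar_colpair (fun x y => x ^+ 2 * y ^+ 2) i j)// => *.
  by apply: measurable_funM; exact: measurable_funX.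
have : Ex P (fun w => \sum_i \sum_j q i w * q j w) = 1.
  rewrite -(Ex_cst P 1); apply: Ex_ae; [|exact: intg_cst|].
    by apply: intg_sum => i; apply: intg_sum => j; exact: iq2.
  apply: filterS (haar_SU hU) => w sw.
  under eq_bigr do rewrite -mulr_sumr; rewrite -mulr_suml.
  by rewrite (col_norm sw) mul1r.
rewrite Ex_sum => [|i]; last by apply: intg_sum => j; exact: iq2.
rewrite (eq_bigr (fun=> a + N.+1%:R * b)) => [|i _]; last first.
  rewrite Ex_sum// (bigD1 i)//= eij eqxx; congr (_ + _).
  rewrite (eq_bigr (fun=> b)) => [|j ji]; last by rewrite eij eq_sym (negbTE ji).
  by rewrite sumr_const cardC1 card_ord mulr_natl.
rewrite sumr_const card_ord -mulr_natl => h.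
rewrite ler_pdivlMr ?exprn_gt0 ?ltr0n//.
have m0 : (0 : R) < N.+1%:R by rewrite ltr0n.
have hm : (N.+2%:R : R) = N.+1%:R + 1 by rewrite -natr1.
have b0 : 0 <= b by apply: Ex_ge0 => w; exact: mulr_ge0.
by rewrite hm in h *; rewrite ab in h *; nra.
Qed.

Lemma sum_indic_le1 d' (T' : measurableType d') (A : nat -> set T') w n :
  (forall k l, A k w -> A l w -> k = l) -> \sum_(k < n) (\1_(A k) w : R) <= 1.
Proof.
move=> h; have [[k Ak]|nA] := pselect (exists k : 'I_n, A k w).
  rewrite (bigD1 k)//= big1 ?addr0 => [|l lk].
    by rewrite indicE mem_set.
  rewrite indicE memNset// => Al.
  by move: lk; rewrite -val_eqE /= (h _ _ Al Ak) eqxx.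
rewrite big1 => // k _; rewrite indicE memNset// => Ak.
by apply: nA; exists k.
Qed.

Let zind (x y : C) : R := ((x == 0) && (y != 0))%:R.

Let m_zind (d' : measure_display) (T' : measurableType d') (f1 f2 : T' -> C) : cmeas f1 ->
  cmeas f2 -> measurable_fun setT (fun x => zind (f1 x) (f2 x)).
Proof.
move=> m1 m2.
have mA : measurable ([set x | f1 x = 0] `&` ~` [set x | f2 x = 0]).
  apply: measurableI; first by apply: measurable_eqc => //; exact: cmeas_cst.
  by apply: measurableC; apply: measurable_eqc => //; exact: cmeas_cst.
rewrite (_ : (fun x => _) = \1_([set x | f1 x = 0] `&` ~` [set x | f2 x = 0])).
  exact: measurable_indic.
apply/funext => x; rewrite indicE /zind; congr (_%:R); congr nat_of_bool.
apply/idP/idP => [/andP[/eqP h1 /eqP h2]|/set_mem /= [/eqP -> /eqP]//].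
by apply: mem_set; split.
Qed.

(** Rotations carry the event in question to the events x + k y = 0 with y nonzero, for k = 0, 1, 2,
    .... They are equiprobable and pairwise disjoint. *)
Lemma haar_colpair0 : Ex P (fun w => zind (U w 0 0) (U w (i1 N) 0)) = 0.
Proof.
pose A (k : nat) := [set w | U w 0 0 + k%:R * U w (i1 N) 0 = 0] `&`
   ~` [set w | U w (i1 N) 0 = 0].
have mA k : measurable (A k).
  apply: measurableI; last by apply: measurableC; apply: measurable_eqc => //; exact: cmeas_cst.
  apply: measurable_eqc; last exact: cmeas_cst.
  by apply: cmeasD => //; apply: cmeasM => //; exact: cmeas_cst.
have E k : (Ex P (fun w => zind (U w 0 0) (U w (i1 N) 0)))%:E = P (A k).
  rewrite -(Ex_indic P (mA k)); congr (_%:E).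
  have kp : (0 : R) < 1 + k%:R ^+ 2 by rewrite ltr_pwDl ?sqr_ge0.
  pose a : R := (Num.sqrt (1 + k%:R ^+ 2))^-1.
  have a0 : a != 0 by rewrite invr_eq0 gt_eqF// sqrtr_gt0.
  have a2 : a ^+ 2 * (1 + k%:R ^+ 2) = 1.
    by rewrite exprVn sqr_sqrtr ?ltW// mulVf// gt_eqF.
  have ca0 : cr a != 0 by rewrite -(rmorph0 (real_complex R)) (inj_eq (@complexI R)).
  have cc : conjc (cr a * k%:R) = cr a * k%:R by rewrite conjcM conjc_real conjc_nat.
  rewrite -(@haar_rot2 zind (cr a) (cr a * k%:R) ca0); last 2 first.
  - rewrite cc conjc_real; transitivity (cr (a ^+ 2 * (1 + k%:R ^+ 2))); last by rewrite a2.
    by rewrite /cr rmorphM rmorphXn rmorphD rmorph1 rmorphXn rmorph_nat; ring.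
  - exact: m_zind.
  apply: eq_Ex => w; rewrite indicE /zind cc conjc_real; congr (_%:R); congr nat_of_bool.
  set x := U w 0 0; set y := U w (i1 N) 0.
  have -> : cr a * x + cr a * k%:R * y = cr a * (x + k%:R * y) by ring.
  rewrite mulf_eq0 (negbTE ca0) /=.
  apply/idP/idP.
    move=> /andP[/eqP xy /eqP h]; apply: mem_set; split => //= y0; apply: h.
    have {}y0 : y = 0 by [].
    by move: xy; rewrite y0 mulr0 addr0 => ->; rewrite !mulr0 addr0.
  move=> /set_mem /= [xy /eqP y0]; rewrite -/x -/y in xy y0; rewrite xy eqxx /=.
  have -> : x = - (k%:R * y) by apply/eqP; rewrite -subr_eq0 opprK xy.
  have -> : - (cr a * k%:R) * - (k%:R * y) + cr a * y = cr a * ((1 + k%:R ^+ 2) * y) by ring.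
  rewrite !mulf_neq0//.
apply: (@EFin_inj R); rewrite (E 0%N).
apply: (@equiprob0 _ _ _ _ _ 1) => //.
  by move=> k; rewrite -!E.
apply: filterS (haar_SU hU) => w _ n; apply: sum_indic_le1 => k l [/= hk y0] [/= hl _].
have : (k%:R - l%:R) * U w (i1 N) 0 = 0 :> C by rewrite mulrBl -(subrr (0 : C)) -{1}hk -hl; ring.
move=> /eqP; rewrite mulf_eq0 => /orP[|/eqP//].
by rewrite subr_eq0 eqr_nat => /eqP.
Qed.

Let zq (x y : R) : R := ((x == 0)%:R * y ^+ 2).

Let m_eq0 (d' : measure_display) (T' : measurableType d') (f : T' -> R) :
  measurable_fun setT f -> measurable_fun setT (fun x => (f x == 0)%:R : R).
Proof.
move=> mf; rewrite (_ : (fun x => _) = \1_[set x | f x = 0]).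
  by apply: measurable_indic; apply: measurable_eqr => //; exact: measurable_cst.
apply/funext => x; rewrite indicE; congr (_%:R); congr nat_of_bool.
by apply/idP/idP => [/eqP h|/set_mem /= ->//]; exact: mem_set.
Qed.

(** The column has norm 1, so the indicator of a vanishing corner is the sum over j of its products
    with |U_j0|^2. By exchangeability each of these has the mean treated in [haar_colpair0]. *)
Lemma haar_corner_eq0 : Ex P (fun w => (cmod (U w 0 0) == 0)%:R : R) = 0.
Proof.
have mc j : measurable_fun setT (fun w => cmod (U w j 0)) by exact: measurable_cmod.
have izq j : intg P (fun w => zq (cmod (U w 0 0)) (cmod (U w j 0))).
  apply: (intg_le _ (iq j)).
    by apply: measurable_funM; [exact: m_eq0|exact: measurable_funX].
  move=> w; rewrite /zq normrM ger0_norm// ger0_norm ?sqr_ge0//.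
  by rewrite /q; case: eqP => _; rewrite ?mul1r ?mul0r ?sqr_ge0.
have i0 : intg P (fun w => (cmod (U w 0 0) == 0)%:R : R).
  apply: (@intg_bdd _ _ _ P _ 1); first exact: m_eq0.
  by move=> w; case: eqP; rewrite ?normr1 ?normr0.
transitivity (Ex P (fun w => \sum_j zq (cmod (U w 0 0)) (cmod (U w j 0)))).
  apply: Ex_ae => //; first exact: intg_sum.
  apply: filterS (haar_SU hU) => w sw; rewrite -mulr_sumr.
  by rewrite -[X in _ * X]/(\sum_j q j w) col_norm// mulr1.
rewrite Ex_sum// big1// => j _.
have [->|j0] := eqVneq j 0.
  rewrite -(Ex_cst P 0); apply: eq_Ex => w; rewrite /zq.
  by case: eqP => [->|]; rewrite ?mul0r// expr0n mulr0.
rewrite (_ : Ex P _ = Ex P (fun w => zq (cmod (U w 0 0)) (cmod (U w (i1 N) 0)))); last first.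
  have h := @haar_colpair zq 0 j; apply: h; first by rewrite eq_sym.
  by move=> d' T' f1 f2 m1 m2; apply: measurable_funM; [exact: m_eq0|exact: measurable_funX].
have z0 w : 0 <= zq (cmod (U w 0 0)) (cmod (U w (i1 N) 0)).
  by rewrite mulr_ge0 ?sqr_ge0.
have iz : intg P (fun w => zind (U w 0 0) (U w (i1 N) 0)).
  apply: (@intg_bdd _ _ _ P _ 1); first exact: m_zind.
  by move=> w; rewrite /zind; case: (_ && _); rewrite ?normr1 ?normr0.
apply/eqP; rewrite eq_le Ex_ge0 ?andbT//.
rewrite -haar_colpair0; apply: Ex_le_ae => //.
apply: filterS (haar_SU hU) => w sw; rewrite /zq /zind !cmod_eq0.
case: eqP => _ /=; rewrite ?mul0r// mul1r; case: eqP => [->|_] /=.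
  by rewrite !expr0n /= addr0 sqrtr0 expr0n.
exact: (qb (i1 N) sw).
Qed.

Lemma ae_of_Ex0 (f : T -> R) : measurable_fun setT f -> (forall w, 0 <= f w) -> intg P f ->
  Ex P f = 0 -> {ae P, forall w, f w = 0}.
Proof.
move=> mf f0 hf Ef.
have [|h _] := @ae_eq_integral_abs _ _ R P setT measurableT (EFin \o f).
  exact/measurable_EFinP.
have := h _; case.
  by under eq_integral do rewrite /= ger0_norm//; rewrite -EFin_Ex// Ef.
move=> B [mB PB sB]; exists B; split => // w /= fw; apply: sB => /= hw; apply: fw.
by have := hw I => -[].
Qed.

Lemma haar_corner_neq0 : {ae P, forall w, U w 0 0 != 0}.
Proof.
have mc : measurable_fun setT (fun w => cmod (U w 0 0)) by exact: measurable_cmod.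
have /ae_of_Ex0 h := haar_corner_eq0.
apply: filterS (h _ _ _) => [w /eqP|||]; first by rewrite cmod_eq0 pnatr_eq0 eqb0.
- exact: m_eq0.
- by move=> w.
- apply: (@intg_bdd _ _ _ P _ 1); first exact: m_eq0.
  by move=> w; case: eqP; rewrite ?normr1 ?normr0.
Qed.

(** The second entry of the unit column is almost surely nonzero as well. *)
Lemma haar_corner_lt1 : {ae P, forall w, cmod (U w 0 0) < 1}.
Proof.
have mc j : measurable_fun setT (fun w => cmod (U w j 0)) by exact: measurable_cmod.
have e : Ex P (fun w => (cmod (U w (i1 N) 0) == 0)%:R : R) = 0.
  transitivity (Ex P (fun w => (cmod (U w 0 0) == 0)%:R)); last exact: haar_corner_eq0.
  have h := @haar_colpair (fun x _ => (x == 0)%:R) (i1 N) 0.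
  by apply: h => // d' T' f1 f2 m1 _; exact: m_eq0.
have /ae_of_Ex0 h := e.
apply: filterS2 (haar_SU hU) (h _ _ _) => [w sw /eqP|||].
- rewrite pnatr_eq0 eqb0 cmod_eq0 -cmod_gt0 => h1.
  have := col_norm sw; rewrite (bigD1 0)//= (bigD1 (i1 N))//= => h2.
  have h3 : 0 <= \sum_(i < 1 + (1 + N) | (i != 0) && (i != i1 N)) q i w.
    by apply: sumr_ge0 => i _; exact: q0.
  have h4 : 0 < q (i1 N) w by rewrite /q exprn_gt0.
  have h5 : q 0 w < 1 by lra.
  by rewrite -(@ltr_pXn2r _ 2)// ?nnegrE ?cmod_ge0// expr1n.
- exact: m_eq0.
- by move=> w.
- apply: (@intg_bdd _ _ _ P _ 1); first exact: m_eq0.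
  by move=> w; case: eqP; rewrite ?normr1 ?normr0.
Qed.

End FirstColumn.

(** * Herglotz, Poisson and logarithmic kernels, and a truncated x ln x *)

Section Kernels.
Variable R : realType.
Local Notation C := R[i].

Definition gmeas (g : C -> R) := forall (d : measure_display) (T : measurableType d) (f : T -> C),
  cmeas f -> measurable_fun setT (fun x => g (f x)).

(** The Herglotz kernel. Its real part [poi] is the Poisson kernel and drives Re q, while [logk] is
    the increment of ln |A(1)|. *)
Definition herg (x : C) : C := (1 + x) / (1 - x).
Definition poi (x : C) : R := complex.Re (herg x).
Definition logk (x : C) : R := ln (cmod (1 - x)).

Lemma measurable_natb d (T : measurableType d) (f : T -> bool) :
  measurable_fun setT f -> measurable_fun setT (fun x => (f x)%:R : R).
Proof.
move=> mf; rewrite (_ : (fun x => _) = fun x => if f x then 1 else 0 : R).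
  by apply: measurable_fun_ifT => //; exact: measurable_cst.
by apply/funext => x; case: (f x).
Qed.

Lemma measurable_ind_le d (T : measurableType d) (f g : T -> R) :
  measurable_fun setT f -> measurable_fun setT g ->
  measurable_fun setT (fun x => (f x <= g x)%R%:R : R).
Proof. by move=> mf mg; apply: measurable_natb; exact: measurable_fun_ler. Qed.

Lemma measurable_ind_lt d (T : measurableType d) (f g : T -> R) :
  measurable_fun setT f -> measurable_fun setT g ->
  measurable_fun setT (fun x => (f x < g x)%R%:R : R).
Proof. by move=> mf mg; apply: measurable_natb; exact: measurable_fun_ltr. Qed.

Lemma gmeas_Re : gmeas (@complex.Re R). Proof. by move=> d T f []. Qed.
Lemma cmeas_herg d (T : measurableType d) (f : T -> C) : cmeas f -> cmeas (fun x => herg (f x)).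
Proof.
move=> mf; apply: cmeasM; first by apply: cmeasD => //; exact: cmeas_cst.
by apply: cmeasV; apply: cmeasB => //; exact: cmeas_cst.
Qed.

Lemma gmeas_poi : gmeas poi.
Proof. by move=> d T f /cmeas_herg[]. Qed.

Lemma gmeas_logk : gmeas logk.
Proof.
move=> d T f mf; apply: (measurableT_comp (@measurable_ln R)).
by apply: measurable_cmod; apply: cmeasB => //; exact: cmeas_cst.
Qed.

Lemma cmod_1B (x : C) : cmod x < 1 -> 0 < 1 - cmod x <= cmod (1 - x).
Proof. by move=> x1; rewrite subr_gt0 x1/= -{1}(@cmod1 R); exact: cmodB_ge. Qed.

Lemma neq_1B (x : C) : cmod x < 1 -> 1 - x != 0.
Proof.
by move=> /cmod_1B/andP[a b]; rewrite -cmod_gt0 (lt_le_trans a).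
Qed.

Lemma neq_1D (x : C) : cmod x < 1 -> 1 + x != 0.
Proof. by rewrite -cmodN => /neq_1B; rewrite opprK. Qed.

Lemma Rec_div (x y : C) : complex.Re (x / y) =
  (complex.Re x * complex.Re y + complex.Im x * complex.Im y) / cmod y ^+ 2.
Proof.
have [->|y0] := eqVneq y 0.
  by rewrite invr0 mulr0 cmod0 expr0n invr0 mulr0.
have c0 : cmod y ^+ 2 != 0 by rewrite expf_neq0// cmod_eq0.
have -> : y^-1 = conjc y * ((cmod y ^+ 2)^-1)%:C%C.
  apply: (mulfI y0); rewrite mulfV// mulrA mul_conjc -rmorphM mulfV//.
by rewrite mulrA RecM /= mulr0 subr0 RecM RecJ ImcJ mulrN opprK.
Qed.

Lemma poiE (x : C) : poi x = (1 - cmod x ^+ 2) / cmod (1 - x) ^+ 2.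
Proof.
rewrite /poi /herg Rec_div; congr (_ / _).
by rewrite cmod_sqr !RecD !ImcD RecN ImcN /=; ring.
Qed.

Lemma poi_gt0 (x : C) : cmod x < 1 -> 0 < poi x.
Proof.
move=> x1; rewrite poiE divr_gt0//.
  by rewrite subr_gt0 expr_lt1// cmod_ge0.
by rewrite exprn_gt0// cmod_gt0 neq_1B.
Qed.

Lemma herg_sub1 (x : C) : cmod x < 1 -> herg x - 1 = 2 * (x / (1 - x)).
Proof. by move=> /neq_1B h; rewrite /herg; field. Qed.

Lemma poi_sub1 (x : C) : cmod x < 1 -> `|poi x - 1| <= 2 * (cmod x / (1 - cmod x)).
Proof.
move=> x1; have -> : poi x - 1 = complex.Re (herg x - 1) by rewrite RecD RecN.
rewrite (le_trans (Re_le_cmod _))// herg_sub1// !cmodM cmodV.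
have -> : cmod (2 : C) = 2 by rewrite -(rmorph_nat (real_complex R) 2) cmod_real ger0_norm.
have /andP[a b] := cmod_1B x1.
rewrite ler_wpM2l// ler_wpM2l ?cmod_ge0// lef_pV2//.
by rewrite posrE (lt_le_trans a).
Qed.

Lemma half_ratio (r : R) : 0 <= r -> r <= 2^-1 -> r / (1 - r) <= 2 * r.
Proof. by move=> r0 r1; rewrite ler_pdivrMr; nra. Qed.

Lemma poi_sub1_half (x : C) : cmod x <= 2^-1 -> `|poi x - 1| <= 4 * cmod x.
Proof.
move=> h; have x1 : cmod x < 1 by apply: (le_lt_trans h); lra.
apply: (le_trans (poi_sub1 x1)); have := half_ratio (cmod_ge0 x) h; lra.
Qed.

Lemma poi_ge_third (x : C) : cmod x <= 2^-1 -> 3^-1 <= poi x.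
Proof.
move=> h; rewrite poiE; set r := cmod x in h *.
have r0 : 0 <= r := cmod_ge0 x.
have x1 : cmod x < 1 by apply: (le_lt_trans h); lra.
have d0 : 0 < cmod (1 - x) by rewrite cmod_gt0 neq_1B.
have d1 : cmod (1 - x) <= 1 + r by rewrite (le_trans (cmodB _ _))// cmod1.
rewrite ler_pdivlMr ?exprn_gt0//.
have : cmod (1 - x) ^+ 2 <= (1 + r) ^+ 2 by rewrite ler_sqr ?nnegrE//; lra.
nra.
Qed.

Lemma hergD (x : C) : cmod x < 1 -> herg x + herg (- x) = 2 * herg (x ^+ 2).
Proof.
move=> x1; rewrite /herg opprK.
have h1 := neq_1B x1; have h2 := neq_1D x1.
have h3 : 1 - x ^+ 2 != 0 by rewrite -[1 in X in X != _](expr1n _ 2) subr_sqr mulf_neq0.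
by field; rewrite h3 h1 h2.
Qed.

Lemma poiD (x : C) : cmod x < 1 -> poi x + poi (- x) = 2 * poi (x ^+ 2).
Proof.
move=> /hergD h; rewrite /poi -RecD h; transitivity (complex.Re ((2:R)%:C%C * herg (x ^+ 2))).
  by rewrite rmorph_nat.
by rewrite RecM /= mul0r subr0.
Qed.

Lemma logkD (x : C) : cmod x < 1 -> logk x + logk (- x) = logk (x ^+ 2).
Proof.
move=> x1; rewrite /logk opprK -lnM ?posrE ?cmod_gt0 ?neq_1B ?neq_1D//.
by rewrite -cmodM -subr_sqr expr1n.
Qed.

Lemma ln_ge1V (t : R) : 0 < t -> 1 - t^-1 <= ln t.
Proof.
move=> t0; have := @le_ln1Dx R (t^-1 - 1).
rewrite (_ : 1 + _ = t^-1); last by ring.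
rewrite lnV ?posrE//; have : 0 < t^-1 by rewrite invr_gt0.
by move=> h1 h2; have {}h2 := h2 ltac:(lra); lra.
Qed.

Lemma ln_le_sub1 (t : R) : 0 < t -> ln t <= t - 1.
Proof. by move=> t0; have := @le_ln1Dx R (t - 1); rewrite (_ : 1 + _ = t); [apply; lra|ring]. Qed.

Lemma logk_le (x : C) : cmod x < 1 -> logk x <= cmod x.
Proof.
move=> x1; have d0 : 0 < cmod (1 - x) by rewrite cmod_gt0 neq_1B.
apply: (le_trans (ln_le_sub1 d0)).
have := cmodB 1 x; rewrite cmod1; lra.
Qed.

Lemma logk_bound (x : C) : cmod x < 1 -> `|logk x| <= cmod x / (1 - cmod x).
Proof.
move=> x1; have /andP[a b] := cmod_1B x1.
have d0 : 0 < cmod (1 - x) by rewrite cmod_gt0 neq_1B.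
have r0 := cmod_ge0 x.
rewrite ler_norml; apply/andP; split.
  apply: (@le_trans _ _ (1 - (1 - cmod x)^-1)).
    rewrite le_eqVlt; apply/orP; left; apply/eqP; field; lra.
  rewrite (le_trans (ln_ge1V a))// ler_ln ?posrE//.
apply: (le_trans (logk_le x1)).
by rewrite ler_pdivlMr//; nra.
Qed.

Lemma logk_half (x : C) : cmod x <= 2^-1 -> `|logk x| <= 2 * cmod x.
Proof.
move=> h; have x1 : cmod x < 1 by apply: (le_lt_trans h); lra.
by apply: (le_trans (logk_bound x1)); exact: half_ratio (cmod_ge0 x) h.
Qed.

(** Put D = |1 - x|^2, so that 2 [logk] x = ln D lies between 1 - 1/D and D - 1. In the half ball D
    >= 1/4 and |D - 1| <= 5/2 |x|, so the gap is at most 25 |x|^2. *)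
Lemma logk_lin (x : C) : cmod x <= 2^-1 -> `|logk x + complex.Re x| <= 13 * cmod x ^+ 2.
Proof.
move=> h; have x1 : cmod x < 1 by apply: (le_lt_trans h); lra.
have /andP[a b] := cmod_1B x1.
have d0 : 0 < cmod (1 - x) by rewrite cmod_gt0 neq_1B.
have r0 := cmod_ge0 x.
pose D := cmod (1 - x) ^+ 2.
have D0 : 0 < D by rewrite exprn_gt0.
have lD : 2 * logk x = ln D by rewrite /D lnXn// mulr_natl.
have rx := Re_le_cmod x.
set r := cmod x in h a b r0 rx *; set u := complex.Re x in rx *.
have DE : D = 1 - 2 * u + r ^+ 2.
  by rewrite /D /r /u !cmod_sqr RecD ImcD RecN ImcN /=; ring.
have D4 : 4^-1 <= D.
  have : (2^-1) ^+ 2 <= cmod (1 - x) ^+ 2 by rewrite ler_sqr ?nnegrE ?cmod_ge0//; lra.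
  by rewrite /D; apply: le_trans; lra.
have D4' : D^-1 <= 4 by rewrite -[4]invrK lef_pV2 ?posrE ?invr_gt0.
have h1 := ln_le_sub1 D0; have h2 := ln_ge1V D0.
have h3 : D - 1 - 4 * (D - 1) ^+ 2 <= 1 - D^-1.
  have -> : 1 - D^-1 = D - 1 - D^-1 * (D - 1) ^+ 2 by field; exact: lt0r_neq0.
  by rewrite lerD2l lerN2 ler_wpM2r ?sqr_ge0.
have h4 : (D - 1) ^+ 2 <= (5 / 2 * r) ^+ 2.
  rewrite -[X in X <= _]real_normK ?num_real// ler_sqr ?nnegrE//; last by lra.
  rewrite DE (_ : _ - 1 = r ^+ 2 - 2 * u); last by ring.
  by move: rx; rewrite !ler_norml => /andP[rx1 rx2]; apply/andP; split; nra.
have {}h4 : (D - 1) ^+ 2 <= 25 / 4 * r ^+ 2.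
  by rewrite (le_trans h4)// le_eqVlt; apply/orP; left; apply/eqP; field.
have rr : 0 <= r ^+ 2 by exact: sqr_ge0.
have h5 : D - 1 = r ^+ 2 - 2 * u by rewrite DE; ring.
have h6 := le_trans h3 h2; rewrite -lD in h1 h6.
move: h1 h6 h4 h5 rr; move: (D - 1) ((D - 1) ^+ 2) (r ^+ 2) (logk x) => *.
by rewrite ler_norml; apply/andP; split; lra.
Qed.

Lemma sin_abs_le (x : R) : `|sin x| <= `|x|.
Proof.
wlog x0 : x / 0 <= x.
  move=> h; case: (leP 0 x) => hx; first exact: h.
  by rewrite -normrN -sinN -[`|x|]normrN h// oppr_ge0 ltW.
have [|c _ ] := @MVT_segment R sin cos 0 x x0 (fun c _ => is_derive_sin c).
  exact/continuous_subspaceT/continuous_sin.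
rewrite sin0 !subr0 => ->; rewrite normrM ler_piMl//; exact: cos_max.
Qed.

Lemma cos_half (x : R) : cos x = 1 - 2 * sin (x / 2) ^+ 2.
Proof.
have {1}-> : x = x / 2 + x / 2 by field.
by rewrite cosD -!expr2 cos2sin2; ring.
Qed.

Lemma cos_ge_quad (x : R) : 1 - x ^+ 2 / 2 <= cos x.
Proof.
rewrite cos_half; have h := sin_abs_le (x / 2).
have : `|sin (x / 2)| ^+ 2 <= `|x / 2| ^+ 2 by rewrite ler_sqr ?nnegrE.
by rewrite !real_normK ?num_real// exprMn; move: (x ^+ 2) (sin _ ^+ 2) => a b; lra.
Qed.

Lemma sin_sub_le (x : R) : `|sin x - x| <= `|x| ^+ 3 / 2.
Proof.
wlog x0 : x / 0 <= x.
  move=> h; case: (leP 0 x) => hx; first exact: h.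
  have := h (- x); rewrite sinN normrN -opprD normrN; apply; by rewrite oppr_ge0 ltW.
have [|c] := @MVT_segment R (fun y => sin y - y) (fun y => cos y - 1) 0 x x0.
  by apply: continuous_subspaceT => c; apply: cvgB; [exact: continuous_sin|exact: cvg_id].
rewrite in_itv/= => /andP[c0 cx]; rewrite sin0 !subr0 => ->.
rewrite normrM exprS mulrC -mulrA ler_wpM2l// distrC ger0_norm; last by rewrite subr_ge0 cos_le1.
have := cos_ge_quad c; have : c ^+ 2 <= `|x| ^+ 2 by rewrite ger0_norm// ler_sqr ?nnegrE.
by move: (c ^+ 2) (`|x| ^+ 2) => a b; lra.
Qed.

Lemma sin_sub_sqr (x : R) : `|x| <= 1 -> `|sin x - x| <= x ^+ 2.
Proof.
move=> x1; apply: (le_trans (sin_sub_le x)); rewrite -[x ^+ 2]real_normK ?num_real//.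
have x0 := normr_ge0 x; rewrite exprS.
by have := sqr_ge0 `|x|; move: (`|x| ^+ 2) => a; nra.
Qed.

Lemma cos_le_quad (x : R) : `|x| <= 1 -> cos x <= 1 - x ^+ 2 / 8.
Proof.
move=> x1; rewrite cos_half.
have h := sin_sub_le (x / 2).
have y1 : `|x / 2| <= 2^-1 by rewrite normrM [`|2^-1|]ger0_norm ?invr_ge0//; lra.
have y0 := normr_ge0 (x / 2).
have h3 : `|x / 2| ^+ 3 / 2 <= `|x / 2| / 2.
  rewrite ler_wpM2r// exprS ler_piMr// exprn_ile1//; lra.
have h4 : `|x / 2| - `|sin (x / 2)| <= `|sin (x / 2) - x / 2|.
  by rewrite distrC lerB_dist.
have h5 : `|x / 2| / 2 <= `|sin (x / 2)| by lra.
have : (`|x / 2| / 2) ^+ 2 <= `|sin (x / 2)| ^+ 2.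
  by rewrite ler_sqr ?nnegrE// divr_ge0.
rewrite exprMn !real_normK ?num_real// !exprMn.
have -> : x ^+ 2 * 2^-1 ^+ 2 * 2^-1 ^+ 2 = x ^+ 2 / 16 by field.
by move: (x ^+ 2) (sin _ ^+ 2) => a b; lra.
Qed.

(* The convex conjugate-type function sup_{0 < s <= Lam} (x (1 + ln s) - s): it is x ln x up
   to Lam and affine afterwards. *)
Definition xlogx (Lam x : R) : R := x * (1 + ln (Num.min x Lam)) - Num.min x Lam.

Lemma xlogx_sup (Lam x s : R) : 0 < x -> 0 < s -> s <= Lam -> x * (1 + ln s) - s <= xlogx Lam x.
Proof.
move=> x0 s0 sL; rewrite /xlogx; set t := Num.min x Lam.
have L0 := lt_le_trans s0 sL.
have t0 : 0 < t by rewrite lt_min x0.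
have h : ln s - ln t <= s / t - 1.
  by rewrite -ln_div ?posrE//; apply: ln_le_sub1; rewrite divr_gt0.
suff : x * (ln s - ln t) <= s - t by move=> ?; lra.
have [xL|Lx] := leP x Lam.
  have tx : t = x by rewrite /t min_l.
  apply: (le_trans (ler_wpM2l (ltW x0) h)).
  by rewrite tx le_eqVlt; apply/orP; left; apply/eqP; field; rewrite lt0r_neq0.
have tL : t = Lam by rewrite /t min_r// ltW.
have lneg : ln s - ln t <= 0 by rewrite subr_le0 ler_ln ?posrE// tL.
apply: (@le_trans _ _ (t * (ln s - ln t))).
  by rewrite ler_wnM2r// tL ltW.
apply: (le_trans (ler_wpM2l (ltW t0) h)).
by rewrite le_eqVlt; apply/orP; left; apply/eqP; field; rewrite lt0r_neq0.
Qed.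

Lemma xlogx1 (Lam : R) : 1 <= Lam -> xlogx Lam 1 = 0.
Proof. by move=> h; rewrite /xlogx min_l// ln1; ring. Qed.

Lemma xlogx_geN1 (Lam x : R) : 1 <= Lam -> 0 < x -> -1 <= xlogx Lam x.
Proof.
move=> L1 x0; have := @xlogx_sup Lam x 1 x0 ltr01 L1.
by rewrite ln1; lra.
Qed.

(** A supremum of functions affine in x: the maximiser for the convex combination is a test value at
    both x and y. *)
Lemma xlogx_conv (Lam x y t : R) : 0 < Lam -> 0 < x -> 0 < y -> 0 <= t <= 1 ->
  xlogx Lam (t * x + (1 - t) * y) <= t * xlogx Lam x + (1 - t) * xlogx Lam y.
Proof.
move=> L0 x0 y0 /andP[t0 t1].
have z0 : 0 < t * x + (1 - t) * y.
  have [->|tn] := eqVneq t 0; first by rewrite mul0r add0r subr0 mul1r.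
  by rewrite ltr_pwDl// ?mulr_ge0 ?subr_ge0 ?(ltW y0)// mulr_gt0// lt_def tn.
rewrite {1}/xlogx; set s := Num.min _ _.
have s0 : 0 < s by rewrite lt_min z0.
have sL : s <= Lam by rewrite ge_min lexx orbT.
have h1 := ler_wpM2l t0 (xlogx_sup x0 s0 sL).
have t1' : 0 <= 1 - t by rewrite subr_ge0.
have h2 := ler_wpM2l t1' (xlogx_sup y0 s0 sL).
by move: h1 h2; move: (xlogx _ x) (xlogx _ y) (ln s) => a b c; nra.
Qed.

Lemma xlogx_le (Lam x : R) : 0 < Lam -> 0 < x -> xlogx Lam x <= (1 + ln Lam) * x.
Proof.
move=> L0 x0; rewrite /xlogx; set s := Num.min _ _.
have s0 : 0 < s by rewrite lt_min x0.
have sL : s <= Lam by rewrite ge_min lexx orbT.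
have : ln s <= ln Lam by rewrite ler_ln.
by move=> h; nra.
Qed.

(** The factor ln Lam is what turns a bounded mean of [xlogx] into uniform integrability, in the
    manner of de la Vallee Poussin. *)
Lemma xlogx_excess (Lam x : R) : 1 <= Lam -> 0 < x -> Num.max 0 (x - Lam) * ln Lam <= xlogx Lam x + 1.
Proof.
move=> L1 x0; have L0 : 0 < Lam by rewrite (lt_le_trans _ L1).
have l0 : 0 <= ln Lam by rewrite ln_ge0.
have [xL|Lx] := leP x Lam.
  by rewrite max_l ?subr_le0// mul0r; have := xlogx_geN1 L1 x0; lra.
rewrite max_r ?subr_ge0 ?ltW// /xlogx min_r ?ltW//; nra.
Qed.

(** Testing the supremum for y at the maximiser s1 for p y leaves the term (p - 1) y (1 + ln s1),
    and replacing s1 by the maximiser for y is of second order in p - 1. The linear term is kept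
    apart because its mean over balls vanishes when p is the Poisson kernel. *)
Lemma xlogx_mul (Lam y p : R) : 0 < Lam -> 0 < y -> 3^-1 <= p ->
  xlogx Lam (p * y) <= xlogx Lam y + (1 + ln (Num.min y Lam)) * y * (p - 1) + 3 * (p - 1) ^+ 2 * y.
Proof.
move=> L0 y0 p3; have p0 : 0 < p by rewrite (lt_le_trans _ p3)// invr_gt0.
have py0 : 0 < p * y by rewrite mulr_gt0.
rewrite {1}/xlogx; set s1 := Num.min (p * y) Lam; set s0 := Num.min y Lam.
have s1p : 0 < s1 by rewrite lt_min py0.
have s0p : 0 < s0 by rewrite lt_min y0.
have sL : s1 <= Lam by rewrite ge_min lexx orbT.
have h := xlogx_sup y0 s1p sL.
suff h2 : (p - 1) * (ln s1 - ln s0) <= 3 * (p - 1) ^+ 2.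
  have := ler_wpM2l (ltW y0) h2.
  by move: h {h2}; move: (xlogx _ _) (ln s1) (ln s0) => a b c; lra.
have [p1|p1] := leP 1 p.
  have h3 : ln s1 - ln s0 <= p - 1.
    rewrite -ln_div ?posrE//; apply: (@le_trans _ _ (ln p)); last exact: ln_le_sub1.
    rewrite ler_ln ?posrE ?divr_gt0// ler_pdivrMr// /s1 /s0.
    have [yL|yL] := leP y Lam; first by rewrite ge_min lexx.
    by rewrite ge_min [X in _ || X]ler_peMl ?orbT// ltW.
  have := ler_wpM2l (_ : 0 <= p - 1) h3; rewrite subr_ge0 => /(_ p1).
  by have := sqr_ge0 (p - 1); rewrite !expr2; lra.
have h3 : ln s0 - ln s1 <= 3 * (1 - p).
  have : ln s0 - ln s1 <= p^-1 - 1.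
    rewrite -ln_div ?posrE//; apply: (@le_trans _ _ (ln p^-1)); last first.
      by apply: ln_le_sub1; rewrite invr_gt0.
    rewrite ler_ln ?posrE ?invr_gt0 ?divr_gt0// ler_pdivrMr// ler_pdivlMl// /s1 /s0.
    rewrite le_min; apply/andP; split; first by rewrite ler_wpM2l ?(ltW p0)// ge_min lexx.
    by rewrite -[leRHS]mul1r ler_pM ?(ltW p0) ?(ltW s0p) ?(ltW p1)// ge_min lexx orbT.
  move=> h4; apply: (le_trans h4).
  have p3' : p^-1 <= 3 by rewrite -[3]invrK lef_pV2 ?posrE ?invr_gt0.
  have -> : p^-1 - 1 = p^-1 * (1 - p) by field; rewrite lt0r_neq0.
  by rewrite ler_wpM2r// subr_ge0 ltW.
have h5 := ler_wpM2l (_ : 0 <= 1 - p) h3; rewrite subr_ge0 in h5.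
by have := h5 (ltW p1); rewrite !expr2; lra.
Qed.

Lemma measurable_xlogx (Lam : R) : measurable_fun setT (xlogx Lam).
Proof.
have mm : measurable_fun setT (fun x : R => Num.min x Lam).
  by apply: measurable_minr; [exact: measurable_id|exact: measurable_cst].
apply: measurable_funB => //; apply: measurable_funM; first exact: measurable_id.
apply: measurable_funD; first exact: measurable_cst.
exact: (measurableT_comp (@measurable_ln R) mm).
Qed.

End Kernels.

(** The symmetrisation identity of [mu_doubling] for Moebius functions vanishing at 0; it feeds
    [Ex_Re_inv]. *)
Lemma mobius_even (F : fieldType) (c u v x : F) : 1 - u * x != 0 -> 1 + u * x != 0 ->
  c * v * x / (1 - u * x) + c * v * - x / (1 - u * - x) =
  2 * (c * (v * u) * x ^+ 2 / (1 - u ^+ 2 * x ^+ 2)).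
Proof.
move=> h1 h2; have -> : 1 - u ^+ 2 * x ^+ 2 = (1 - u * x) * (1 + u * x) by ring.
have -> : 1 - u * - x = 1 + u * x by ring.
by field; rewrite h1 h2.
Qed.

Lemma Re_inv_ge0 (R : realType) (z : R[i]) : 0 <= complex.Re z -> 0 <= complex.Re z^-1.
Proof. by move=> z0; rewrite -[z^-1]mul1r Rec_div /= mul1r mul0r addr0 divr_ge0 ?sqr_ge0. Qed.

(** Here x is t^2, n is 1/m, Q the second moment of [logk] on the half ball, F the probability of
    leaving that ball, and a + i b the characteristic function of one increment. As 0 <= a <= 1, one
    has a^2 <= a <= 1 - x n / 64, while |b| <= 36 n; the assumption on n makes 36^2 n^2 at most x n
    / 128. *)
Lemma charfun_arith (R : realType) (a b Q F x n : R) : 0 < x -> x <= 1 -> 0 < n ->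
  36 * (36 * n) <= x / 128 -> 4^-1 * n - 340 * n ^+ 2 <= Q -> Q <= 4 * n ->
  a <= 1 - x / 8 * Q -> 1 - x / 2 * Q - 2 * F <= a -> `|b| <= x * Q + F ->
  0 <= F -> F <= 32 * n ^+ 2 -> a ^+ 2 + b ^+ 2 <= 1 - x / 128 * n.
Proof.
move=> x0 x1 n0 nx lo up a_up a_lo b_le far0 far.
have n1 : 3000 * n <= 1 by lra.
have nn : 3000 * n ^+ 2 <= n.
  by rewrite expr2 mulrA; rewrite ler_piMl// ltW.
have n2 : 1296 * n ^+ 2 <= x * n / 128.
  by have := ler_wpM2r (ltW n0) nx; rewrite expr2; lra.
have Q1 : n / 8 <= Q by clear -lo nn n0; lra.
have Q2 : x * Q <= x * (4 * n) by rewrite ler_wpM2l// ltW.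
have Q3 : x * (n / 8) <= x * Q by rewrite ler_wpM2l// ltW.
have xn0 : 0 <= x * n by rewrite mulr_ge0// ltW.
have xn1 : x * n <= n by rewrite ler_piMl// ltW.
have a0 : 0 <= a by clear -a_lo Q2 xn1 n1 far nn n0; lra.
have a1 : a <= 1 - x * n / 64 by clear -a_up Q3; lra.
have b1 : `|b| <= 36 * n by clear -b_le Q2 far nn xn1 n0; lra.
have b2 : b ^+ 2 <= 1296 * n ^+ 2.
  rewrite -real_normK ?num_real//; have : `|b| ^+ 2 <= (36 * n) ^+ 2.
    by rewrite ler_sqr ?nnegrE// mulr_ge0// ltW.
  by rewrite exprMn -natrX.
have a2 : a ^+ 2 <= a by rewrite expr2 ler_piMr//; clear -a1 xn0; lra.
by clear -a1 a2 b2 n2; lra.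
Qed.

(** * Estimates for a rotation invariant coefficient with known second and fourth moments *)

Section RotationInvariant.
Variable R : realType.
Local Notation C := R[i].
Context d (T : measurableType d) (P : probability T R) (mu : T -> C) (m : R).
Hypotheses (m_ge1 : 1 <= m) (mmu : cmeas mu) (mu_lt1 : forall w, cmod (mu w) < 1)
  (mu_rot : forall g, gmeas g -> forall z, cmod z = 1 ->
     Ex P (fun w => g (z * mu w)) = Ex P (fun w => g (mu w)))
  (mu_sqr : Ex P (fun w => cmod (mu w) ^+ 2) = m^-1)
  (mu_four : Ex P (fun w => cmod (mu w) ^+ 4) <= 2 / m ^+ 2).
Local Notation E := (Ex P).
Local Notation r w := (cmod (mu w)).

Let m_gt0 : 0 < m. Proof. exact: lt_le_trans m_ge1. Qed.
Let mr : measurable_fun setT (fun w => r w). Proof. exact: measurable_cmod. Qed.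
Let r0 w : 0 <= r w. Proof. exact: cmod_ge0. Qed.

Lemma intg_mu_bdd (g : C -> R) c : gmeas g -> (forall x, cmod x < 1 -> `|g x| <= c) ->
  intg P (fun w => g (mu w)).
Proof. by move=> mg gc; apply: (@intg_bdd _ _ _ P _ c) => [|w]; [exact: mg|exact: gc]. Qed.

Lemma Ex_cstB c (f : T -> R) : intg P f -> E (fun w => c - f w) = c - E f.
Proof. by move=> hf; rewrite ExB// ?Ex_cst//; exact: intg_cst. Qed.

Lemma intg_cstB c (f : T -> R) : intg P f -> intg P (fun w => c - f w).
Proof. by move=> hf; apply: intgB => //; exact: intg_cst. Qed.

Lemma norm_natb_le1 (a : bool) : `|a%:R : R| <= 1.
Proof. by case: a; rewrite ?normr1 ?normr0. Qed.

Lemma gmeas_ball (rho : R) : gmeas (fun x => (cmod x <= rho)%R%:R : R).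
Proof.
by move=> d' T' f mf; apply: measurable_ind_le; [exact: measurable_cmod|exact: measurable_cst].
Qed.

Lemma gmeasM (f g : C -> R) : gmeas f -> gmeas g -> gmeas (fun x => f x * g x).
Proof. by move=> mf mg d' T' h mh; apply: measurable_funM; [exact: mf|exact: mg]. Qed.

Lemma ratio_le (s t : R) : s <= t -> t < 1 -> s / (1 - s) <= t / (1 - t).
Proof. by move=> st t1; rewrite ler_pdivrMr ?subr_gt0 ?(le_lt_trans st)// mulrAC ler_pdivlMr; nra. Qed.

(** A substitute for the mean value property of harmonic functions vanishing at 0. Rotating [mu] by
    a 2^k-th root of -1 and averaging replaces f_k(mu^(2^k)) by f_(k+1)(mu^(2^(k+1))). On a ball of
    radius rho < 1 these arguments tend to 0, and the bound on f_k follows them. *)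
Lemma mu_doubling (f : nat -> C -> R) (K rho : R) : 0 <= K -> 0 <= rho -> rho < 1 ->
  (forall k, gmeas (f k)) ->
  (forall k x, cmod x < 1 -> f k x + f k (- x) = 2 * f k.+1 (x ^+ 2)) ->
  (forall k x, cmod x < 1 -> `|f k x| <= K * (cmod x / (1 - cmod x))) ->
  E (fun w => f 0%N (mu w) * (r w <= rho)%R%:R) = 0.
Proof.
move=> K0 rho0 rho1 mf fD fb.
pose g k x := f k (x ^+ (2 ^ k)) * (cmod x <= rho)%R%:R.
have mg k : gmeas (g k).
  by apply: gmeasM; [move=> d' T' h mh; apply: mf; exact: cmeasX|exact: gmeas_ball].
have gb k x : cmod x < 1 -> `|g k x| <= K / (1 - rho) * rho ^+ (2 ^ k).
  move=> x1; rewrite /g; case: (lerP (cmod x) rho) => h; last first.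
    by rewrite mulr0 normr0 mulr_ge0 ?exprn_ge0// divr_ge0// subr_ge0 ltW.
  have xk : cmod (x ^+ (2 ^ k)) <= rho ^+ (2 ^ k) by rewrite cmodX lerXn2r ?nnegrE ?cmod_ge0.
  have rk : rho ^+ (2 ^ k) <= rho.
    by rewrite -[leRHS]expr1 ler_wiXn2l// ?expn_gt0// ltW.
  rewrite mulr1 (le_trans (fb _ _ _))//; first by rewrite (le_lt_trans xk)// (le_lt_trans rk).
  rewrite -mulrA ler_wpM2l// (le_trans (ratio_le xk _))//; first by rewrite (le_lt_trans rk).
  rewrite mulrC ler_wpM2r ?exprn_ge0// lef_pV2 ?posrE; lra.
have ig k : intg P (fun w => g k (mu w)) by apply: intg_mu_bdd (mg k) (gb k).
pose a k := E (fun w => g k (mu w)).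
have aS k : a k = a k.+1.
  (* Chosen so that z^(2^k) = -1. *)
  pose z := expi (pi / (2 ^ k)%:R : R).
  have z1 : cmod z = 1 by exact: cmod_expi.
  have zk : z ^+ (2 ^ k) = -1.
    rewrite /z -expiMn -[X in expi X]mulr_natr divfK ?expi_pi//.
  have ig' : intg P (fun w => g k (z * mu w)).
    apply: (@intg_mu_bdd (fun x => g k (z * x)) (K / (1 - rho) * rho ^+ (2 ^ k))).
      by move=> d' T' h mh; apply: mg; apply: cmeasM => //; exact: cmeas_cst.
    by move=> x x1; apply: gb; rewrite cmodM z1 mul1r.
  have h : 2 * a k = E (fun w => g k (mu w) + g k (z * mu w)).
    by rewrite ExD// (mu_rot (mg k) z1) mulrDl mul1r.
  apply: (@mulfI _ 2); first by rewrite pnatr_eq0.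
  rewrite h /a -ExZ//; apply: eq_Ex => w.
  rewrite /g cmodM z1 mul1r exprMn zk mulN1r -mulrDl fD; last first.
    by rewrite cmodX exprn_ilt1// -lt0n expn_gt0.
  by rewrite -exprM -expnSr mulrA.
have a0 k : a k = a 0%N by elim: k => // k <-; rewrite -aS.
have ab k : `|a 0%N| <= geometric (K / (1 - rho)) rho k.
  rewrite -(a0 k) (le_trans (Ex_norm (ig k)))//.
  rewrite -[leRHS](Ex_cst P); apply: Ex_le; [exact: intg_norm|exact: intg_cst|].
  move=> w; rewrite (le_trans (gb k _ (mu_lt1 w)))// /geometric /= ler_wpM2l ?divr_ge0 ?subr_ge0 ?(ltW rho1)//.
  by rewrite ler_wiXn2l// ?(ltW rho1)// ltnW// ltn_expl.
have cg : geometric (K / (1 - rho)) rho @ \oo --> (0 : R).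
  by apply: cvg_geometric; rewrite ger0_norm.
have : `|a 0%N| <= 0.
  rewrite -(cvg_lim _ cg)//; apply: limr_ge; first by apply/cvg_ex; exists 0.
  by near=> k; exact: ab.
by rewrite normr_le0 => /eqP a00; rewrite -[RHS]a00 /a /g; apply: eq_Ex => w; rewrite expr1.
Unshelve. all: by end_near. Qed.

Lemma intg_poi_ball rho : rho < 1 -> intg P (fun w => poi (mu w) * (r w <= rho)%R%:R).
Proof.
move=> rho1; apply: (@intg_mu_bdd (fun x => poi x * (cmod x <= rho)%R%:R) (1 + 2 * (`|rho| / (1 - rho)))).
  by apply: gmeasM; [exact: gmeas_poi|exact: gmeas_ball].
move=> x x1; have t0 : 0 <= `|rho| / (1 - rho) by rewrite divr_ge0// subr_ge0 ltW.
case: (lerP (cmod x) rho) => h; last by rewrite mulr0 normr0; lra.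
have rho0 : 0 <= rho by rewrite (le_trans (cmod_ge0 x)).
rewrite mulr1 -[poi x](subrK 1) (le_trans (ler_normD _ _))// normr1 addrC lerD2l.
rewrite (le_trans (poi_sub1 x1))// ler_wpM2l// ger0_norm//; exact: ratio_le.
Qed.

Lemma intg_ball rho : intg P (fun w => (r w <= rho)%R%:R : R).
Proof.
apply: (@intg_mu_bdd (fun x => (cmod x <= rho)%R%:R) 1); first exact: gmeas_ball.
by move=> x _; exact: norm_natb_le1.
Qed.

Lemma Ex_poi_sub1_ball rho : 0 <= rho -> rho < 1 ->
  E (fun w => (poi (mu w) - 1) * (r w <= rho)%R%:R) = 0.
Proof.
move=> rho0 rho1; apply: (@mu_doubling (fun _ x => poi x - 1) 2) => //.
- by move=> _ d' T' f mf; apply: measurable_funB; [exact: gmeas_poi|exact: measurable_cst].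
- by move=> _ x x1; have := poiD x1; lra.
- by move=> _ x x1; exact: poi_sub1.
Qed.

Lemma Ex_poi_ball rho : 0 <= rho -> rho < 1 ->
  E (fun w => poi (mu w) * (r w <= rho)%R%:R) = E (fun w => (r w <= rho)%R%:R).
Proof.
move=> rho0 rho1; apply/eqP; rewrite -subr_eq0 -ExB; [|exact: intg_poi_ball|exact: intg_ball].
rewrite -[X in _ == X](Ex_poi_sub1_ball rho0 rho1); apply/eqP; apply: eq_Ex => w; ring.
Qed.

Lemma Ex_logk_ball rho : 0 <= rho -> rho < 1 ->
  E (fun w => logk (mu w) * (r w <= rho)%R%:R) = 0.
Proof.
move=> rho0 rho1.
have h := @mu_doubling (fun k x => (2 ^+ k)^-1 * logk x) 1 rho.
rewrite -[RHS]h//; first by apply: eq_Ex => w; rewrite expr0 invr1 mul1r.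
- by move=> k d' T' f mf; apply: measurable_funM; [exact: measurable_cst|exact: gmeas_logk].
- move=> k x x1; rewrite -mulrDr logkD// mulrA; congr (_ * _).
  by rewrite exprS invfM mulrA mulfV ?mul1r// pnatr_eq0.
- move=> k x x1; rewrite mul1r normrM (le_trans _ (logk_bound x1))//.
  rewrite ler_piMl// ger0_norm ?invr_ge0 ?exprn_ge0// invf_le1 ?exprn_gt0// exprn_ege1//; lra.
Qed.

Lemma rho_n_bounds n : 0 <= 1 - n.+1%:R^-1 :> R /\ 1 - n.+1%:R^-1 < 1 :> R.
Proof.
by rewrite subr_ge0 invf_le1// ler1n ltrBlDr ltrDl invr_gt0 ltr0n.
Qed.

Lemma ball_cvg w : \forall n \near \oo, r w <= 1 - n.+1%:R^-1.
Proof.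
have h : 0 < 1 - r w by rewrite subr_gt0.
have := near_infty_natSinv_lt (PosNum h).
apply: filterS => n hn; have {}hn : n.+1%:R^-1 < 1 - r w by [].
by rewrite lerBrDr -lerBrDl ltW.
Qed.

(** The kernels are unbounded near the unit circle. Balls of radius 1 - 1/(n+1) exhaust the open
    disc, and monotone convergence carries the bounds over. *)
Lemma ball_exhaust (g : T -> R) (c : R) : measurable_fun setT g -> (forall w, 0 <= g w) ->
  (forall n, \int[P]_w (g w * (r w <= 1 - n.+1%:R^-1)%R%:R)%:E <= c%:E)%E ->
  (\int[P]_w (g w)%:E <= c%:E)%E.
Proof.
move=> mg g0 h.
pose f n w := (g w * (r w <= 1 - n.+1%:R^-1)%R%:R)%:E.
have -> : (\int[P]_w (g w)%:E = \int[P]_w limn (f ^~ w))%E.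
  apply: eq_integral => w _; apply/esym/cvg_lim => //.
  apply: cvg_near_cst; have := ball_cvg w; apply: filterS => n hn.
  by rewrite /f hn mulr1.
have mf n : measurable_fun setT (f n).
  apply/measurable_EFinP; apply: measurable_funM => //.
  by apply: measurable_ind_le => //; exact: measurable_cst.
have f0 n w : setT w -> (0 <= f n w)%E by rewrite lee_fin mulr_ge0.
have fn w : setT w -> nondecreasing_seq (f ^~ w).
  move=> _ a b ab; rewrite lee_fin ler_wpM2l// ler_nat.
  have : (a.+1%:R : R) <= b.+1%:R by rewrite ler_nat ltnS.
  move=> ab'; have : (b.+1%:R : R)^-1 <= a.+1%:R^-1 by rewrite lef_pV2 ?posrE.
  move=> h'; case: (lerP (r w) (1 - a.+1%:R^-1)) => // hh.
  by rewrite (le_trans hh)// lerD2l lerN2.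
rewrite monotone_convergence//; apply: lime_le.
  apply: ereal_nondecreasing_is_cvgn => a b ab; apply: ge0_le_integral => //.
  - by move=> w _; exact: f0.
  - by move=> w _; exact: fn.
by near=> n; exact: h.
Unshelve. all: by end_near. Qed.

Lemma intg_poi : intg P (fun w => poi (mu w)) /\ E (fun w => poi (mu w)) <= 1.
Proof.
have p0 w : 0 <= poi (mu w) by rewrite ltW// poi_gt0.
have mp : measurable_fun setT (fun w => poi (mu w)) by exact: gmeas_poi.
have h : (\int[P]_w (poi (mu w))%:E <= 1%:E)%E.
  apply: ball_exhaust => // n; have [n0 n1] := rho_n_bounds n.
  rewrite -(EFin_Ex (intg_poi_ball n1)) lee_fin Ex_poi_ball//.
  rewrite -[leRHS](Ex_cst P); apply: Ex_le; [exact: intg_ball|exact: intg_cst|].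
  by move=> w; rewrite (le_trans (ler_norm _))// norm_natb_le1.
have hi : intg P (fun w => poi (mu w)) by apply: intg_ge0 h _ => //; rewrite ltry.
by split => //; rewrite -lee_fin EFin_Ex.
Qed.

Lemma intg_ball' (rho : R) : intg P (fun w => (rho < r w)%R%:R : R).
Proof.
apply: (@intg_mu_bdd (fun x => (rho < cmod x)%R%:R) 1).
  by move=> d' T' f mf; apply: measurable_ind_lt; [exact: measurable_cst|exact: measurable_cmod].
by move=> x _; exact: norm_natb_le1.
Qed.

Lemma intg_rX k : intg P (fun w => r w ^+ k).
Proof.
apply: (@intg_mu_bdd (fun x => cmod x ^+ k) 1).
  by move=> d' T' f mf; apply: measurable_funX; exact: measurable_cmod.
by move=> x x1; rewrite normrX ger0_norm ?cmod_ge0// exprn_ile1 ?cmod_ge0// ltW.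
Qed.

Lemma Ex_far : E (fun w => (2^-1 < r w)%R%:R) <= 32 / m ^+ 2.
Proof.
apply: (@le_trans _ _ (16 * E (fun w => r w ^+ 4))).
  rewrite -ExZ; last exact: intg_rX.
  apply: Ex_le; [exact: intg_ball'|by apply: intgZ; exact: intg_rX|].
  move=> w; case: (ltP 2^-1 (r w)) => h; last by rewrite mulr_ge0// exprn_ge0.
  have : (2^-1) ^+ 4 <= r w ^+ 4 by rewrite lerXn2r ?nnegrE// ?ltW// invr_gt0.
  by rewrite exprVn -natrX /=; lra.
apply: (@le_trans _ _ (16 * (2 / m ^+ 2))); first by rewrite ler_wpM2l.
by rewrite mulrA -natrM.
Qed.

Lemma half_split w : (r w <= 2^-1)%R%:R = 1 - (2^-1 < r w)%R%:R :> R.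
Proof. by case: (ltP 2^-1 (r w)) => h; rewrite ?subr0 ?subrr. Qed.

(** Within the half ball the Poisson kernel integrates to the probability of that ball, and its
    total mean is at most 1. So the part outside has at most the probability of the complement,
    although [poi] is unbounded there. *)
Lemma Ex_poi_far : intg P (fun w => poi (mu w) * (2^-1 < r w)%R%:R) /\
  E (fun w => poi (mu w) * (2^-1 < r w)%R%:R) <= 32 / m ^+ 2.
Proof.
have [ip Ep] := intg_poi.
have h01 : 0 <= 2^-1 :> R by rewrite invr_ge0.
have h11 : 2^-1 < 1 :> R by lra.
have ib := intg_poi_ball h11.
have e : (fun w => poi (mu w) * (2^-1 < r w)%R%:R) =
   (fun w => poi (mu w) - poi (mu w) * (r w <= 2^-1)%R%:R).
  by apply/funext => w; rewrite half_split; ring.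
rewrite e; split; first exact: intgB.
rewrite ExB// Ex_poi_ball//.
have -> : E (fun w => (r w <= 2^-1)%R%:R) = 1 - E (fun w => (2^-1 < r w)%R%:R).
  transitivity (E (fun w => 1 - (2^-1 < r w)%R%:R)); last first.
    by rewrite ExB ?Ex_cst//; [exact: intg_cst|exact: intg_ball'].
  by apply: eq_Ex => w; rewrite half_split.
have := Ex_far; lra.
Qed.

(** In the half ball |poi - 1| <= 4 |mu| and g moves by at most 2 kap |mu|, so their product has
    mean at most 8 kap / m, while g(s) (poi - 1) integrates to 0. Outside, the loss is at most the
    far probability, because g <= 1 and poi >= 0. *)
Lemma Ex_poi_decor (g : R -> R) (kap s : R) : 0 <= kap -> measurable_fun setT g ->
  (forall x, 0 <= g x <= 1) -> (forall x y, `|g x - g y| <= kap * `|x - y|) ->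
  [/\ intg P (fun w => poi (mu w) * g (s + logk (mu w))),
      intg P (fun w => g (s + logk (mu w))) &
  E (fun w => g (s + logk (mu w))) - 8 * kap / m - 32 / m ^+ 2 <=
  E (fun w => poi (mu w) * g (s + logk (mu w)))].
Proof.
move=> kap0 mg g01 gL.
have [ip Ep] := intg_poi.
have mL : measurable_fun setT (fun w => logk (mu w)) by exact: gmeas_logk.
have mgL : measurable_fun setT (fun w => g (s + logk (mu w))).
  by apply: (measurableT_comp mg); apply: measurable_funD => //; exact: measurable_cst.
have gb x : `|g x| <= 1 by have /andP[g0 g1] := g01 x; rewrite ger0_norm.
have ig : intg P (fun w => g (s + logk (mu w))) by apply: (@intg_bdd _ _ _ P _ 1).
have ipg : intg P (fun w => poi (mu w) * g (s + logk (mu w))).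
  rewrite (_ : (fun w => _) = fun w => g (s + logk (mu w)) * poi (mu w)); last by apply/funext => w; rewrite mulrC.
  by apply: (@intgM_bdd _ _ _ P _ _ 1).
split => //.
have h11 : 2^-1 < 1 :> R by lra.
have h01 : 0 <= 2^-1 :> R by lra.
have i1 : intg P (fun w => (poi (mu w) - 1) * (r w <= 2^-1)%R%:R).
  rewrite (_ : (fun w => _) = fun w => poi (mu w) * (r w <= 2^-1)%R%:R - (r w <= 2^-1)%R%:R).
    by apply: intgB; [exact: intg_poi_ball|exact: intg_ball].
  by apply/funext => w; ring.
have i2 : intg P (fun w => 8 * kap * r w ^+ 2) by apply: intgZ; exact: intg_rX.
have i3 := intg_ball' 2^-1.
have : 0 <= E (fun w => poi (mu w) * g (s + logk (mu w)) - g (s + logk (mu w))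
   - g s * ((poi (mu w) - 1) * (r w <= 2^-1)%R%:R) + 8 * kap * r w ^+ 2 + (2^-1 < r w)%R%:R).
  apply: Ex_ge0 => w; have /andP[g0 g1] := g01 (s + logk (mu w)).
  have p0 := poi_gt0 (mu_lt1 w).
  case: (leP (r w) 2^-1) => hr /=.
    have h1 := poi_sub1_half hr; have h2 := logk_half hr.
    have h3 : `|g (s + logk (mu w)) - g s| <= kap * (2 * r w).
      by rewrite (le_trans (gL _ _))// addrAC subrr add0r ler_wpM2l.
    have h4 : `|(poi (mu w) - 1) * (g (s + logk (mu w)) - g s)| <= 4 * r w * (kap * (2 * r w)).
      by rewrite normrM ler_pM.
    move: h4; rewrite ler_norml => /andP[h4 _].
    rewrite addr0 mulr1; nra.
  have r20 := sqr_ge0 (r w).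
  have := mulr_ge0 kap0 r20; have := mulr_ge0 (ltW p0) g0.
  rewrite mulr0 mulr0; lra.
have i4 := intgB ipg ig.
have i5 := intgZ (g s) i1.
rewrite ExD//; last by apply: intgD => //; exact: intgB.
rewrite ExD//; last exact: intgB.
rewrite ExB// ExB// !ExZ//; last exact: intg_rX.
rewrite Ex_poi_sub1_ball// mu_sqr mulr0 subr0.
have := Ex_far; rewrite -[8 * kap / m]mulrA; lra.
Qed.

(** Rotation by i exchanges the squares of real and imaginary parts. *)
Lemma Ex_Re_sqr_ball : intg P (fun w => complex.Re (mu w) ^+ 2 * (r w <= 2^-1)%R%:R) /\
  E (fun w => complex.Re (mu w) ^+ 2 * (r w <= 2^-1)%R%:R) =
  2^-1 * E (fun w => r w ^+ 2 * (r w <= 2^-1)%R%:R).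
Proof.
have mg : gmeas (fun x : C => complex.Re x ^+ 2 * (cmod x <= 2^-1)%R%:R).
  apply: gmeasM; last exact: gmeas_ball.
  by move=> d' T' f mf; apply: measurable_funX; exact: gmeas_Re.
have ci : cmod ('i%C : C) = 1.
  by apply/eqP; rewrite -(@eqrXn2 _ 2)// ?cmod_ge0// cmod_sqr /= expr0n add0r expr1n.
have b1 (x : C) (t : R) : cmod x < 1 -> `|t| <= cmod x -> `|t ^+ 2 * (cmod x <= 2^-1)%R%:R| <= 1.
  move=> x1 tx; rewrite normrM ger0_norm ?sqr_ge0// -[leRHS]mulr1 ler_pM ?sqr_ge0//; last exact: norm_natb_le1.
  by rewrite -real_normK ?num_real// exprn_ile1// (le_trans tx)// ltW.
have h := mu_rot mg ci.
have i1 : intg P (fun w => complex.Re (mu w) ^+ 2 * (r w <= 2^-1)%R%:R).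
  by apply: (intg_mu_bdd mg (c := 1)) => x x1; apply: b1 => //; exact: Re_le_cmod.
have e w : complex.Re ('i%C * mu w) = - complex.Im (mu w).
  by rewrite RecM /= mul0r mul1r sub0r.
have i2 : intg P (fun w => complex.Re ('i%C * mu w) ^+ 2 * (cmod ('i%C * mu w) <= 2^-1)%R%:R).
  apply: (@intg_bdd _ _ _ P _ 1).
    by apply: mg; apply: cmeasM => //; exact: cmeas_cst.
  by move=> w; apply: b1; rewrite ?Re_le_cmod// cmodM ci mul1r.
split => //; apply: (@mulfI _ 2); first by rewrite pnatr_eq0.
rewrite mulrA mulfV ?pnatr_eq0// mul1r mulrDl mul1r -{1}h -ExD//.
apply: eq_Ex => w; rewrite e cmodM ci mul1r sqrrN -mulrDl cmod_sqr; congr (_ * _).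
by rewrite addrC.
Qed.

(** Near 0 the kernel is -Re mu up to a quadratic error, and the mean of (Re mu)^2 is half that of
    |mu|^2. *)
Lemma Ex_logk_sqr_ball : intg P (fun w => logk (mu w) ^+ 2 * (r w <= 2^-1)%R%:R) /\
  (4 * m)^-1 - 340 / m ^+ 2 <= E (fun w => logk (mu w) ^+ 2 * (r w <= 2^-1)%R%:R) <= 4 / m.
Proof.
have mg : gmeas (fun x : C => logk x ^+ 2 * (cmod x <= 2^-1)%R%:R).
  apply: gmeasM; last exact: gmeas_ball.
  by move=> d' T' f mf; apply: measurable_funX; exact: gmeas_logk.
have up (x : C) : logk x ^+ 2 * (cmod x <= 2^-1)%R%:R <= 4 * cmod x ^+ 2.
  have x0 := sqr_ge0 (cmod x).
  case: (leP (cmod x) 2^-1) => h; last by rewrite mulr0 mulr_ge0.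
  have := logk_half h; rewrite mulr1 -real_normK ?num_real// => hl.
  have : `|logk x| ^+ 2 <= (2 * cmod x) ^+ 2 by rewrite ler_sqr ?nnegrE// mulr_ge0// cmod_ge0.
  by rewrite exprMn -natrX.
have lo0 (x : C) : 0 <= logk x ^+ 2 * (cmod x <= 2^-1)%R%:R by rewrite mulr_ge0 ?sqr_ge0.
have i1 : intg P (fun w => logk (mu w) ^+ 2 * (r w <= 2^-1)%R%:R).
  apply: (intg_mu_bdd mg (c := 4)) => x x1; rewrite ger0_norm// (le_trans (up _))//.
  by rewrite -[leRHS]mulr1 ler_wpM2l// exprn_ile1 ?cmod_ge0// ltW.
split => //; apply/andP; split; last first.
  rewrite -mu_sqr -ExZ; last exact: intg_rX.
  by apply: Ex_le => //; apply: intgZ; exact: intg_rX.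
have [i2 e2] := Ex_Re_sqr_ball.
have i3 : intg P (fun w => r w ^+ 2 * (r w <= 2^-1)%R%:R).
  rewrite (_ : (fun w => _) = fun w => (r w <= 2^-1)%R%:R * r w ^+ 2); last by apply/funext => w; rewrite mulrC.
  apply: (@intgM_bdd _ _ _ P _ _ 1); last exact: intg_rX.
    by apply: measurable_ind_le => //; exact: measurable_cst.
  by move=> w; exact: norm_natb_le1.
have h1 : m^-1 - 4 * (2 / m ^+ 2) <= E (fun w => r w ^+ 2 * (r w <= 2^-1)%R%:R).
  rewrite -mu_sqr; apply: (@le_trans _ _ (E (fun w => r w ^+ 2 - 4 * r w ^+ 4))).
    rewrite ExB; [|exact: intg_rX|by apply: intgZ; exact: intg_rX].
    rewrite ExZ; last exact: intg_rX.
    by rewrite lerD2l lerN2 ler_wpM2l.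
  apply: Ex_le => //; first by apply: intgB; [|apply: intgZ]; exact: intg_rX.
  move=> w; have r4 : r w ^+ 4 = (r w ^+ 2) ^+ 2 by rewrite -exprM.
  have q0 := sqr_ge0 (r w); have q1 := sqr_ge0 (r w ^+ 2).
  case: (leP (r w) 2^-1) => h; first by rewrite mulr1 r4; lra.
  rewrite mulr0 r4; have h2 : 4^-1 <= r w ^+ 2.
    have : (2^-1) ^+ 2 <= r w ^+ 2 by rewrite ler_sqr ?nnegrE// ?ltW// invr_gt0.
    by apply: le_trans; lra.
  by move: q0 h2; move: (r w ^+ 2) => q *; nra.
(* From (e - x)^2 >= x^2 / 2 - e^2. The constant 340 is 2, lost in restricting |mu|^2 to the half
   ball, plus 2 times 169, the square of 13 from [logk_lin] against the fourth moment. *)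
apply: (@le_trans _ _ (E (fun w => 2^-1 * (complex.Re (mu w) ^+ 2 * (r w <= 2^-1)%R%:R) - 169 * r w ^+ 4))).
  rewrite ExB; [|exact: intgZ|by apply: intgZ; exact: intg_rX].
  rewrite !ExZ//; last exact: intg_rX.
  rewrite e2.
  have -> : (4 * m)^-1 = 4^-1 * m^-1 by rewrite invfM.
  move: h1 mu_four; rewrite -![_ / m ^+ 2]/(_ * (m ^+ 2)^-1).
  move: (m^-1) ((m ^+ 2)^-1) (E _) (E _) => a b e4 e3; lra.
apply: Ex_le => //.
  by apply: intgB; [exact: intgZ|apply: intgZ; exact: intg_rX].
move=> w; case: (leP (r w) 2^-1) => h; last first.
  have : 0 <= r w ^+ 4 by rewrite exprn_ge0.
  by rewrite !mulr0; lra.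
rewrite !mulr1; have := logk_lin h; set e := logk _ + _ => he.
have hee : e ^+ 2 <= 169 * r w ^+ 4.
  rewrite -real_normK ?num_real//.
  have : `|e| ^+ 2 <= (13 * r w ^+ 2) ^+ 2 by rewrite ler_sqr ?nnegrE// mulr_ge0// sqr_ge0.
  by rewrite exprMn -exprM -natrX.
have -> : logk (mu w) = e - complex.Re (mu w) by rewrite /e; ring.
apply: (@le_trans _ _ (2^-1 * complex.Re (mu w) ^+ 2 - e ^+ 2)); first by lra.
by move: (complex.Re _) e {he hee} => a e; have := sqr_ge0 (a - 2 * e); nra.
Qed.

(** Since [logk] has mean 0 over the half ball, the sine has no first-order term and contributes
    O(1/m^2) to the squared modulus; the cosine loses a multiple of t^2 / m. The lower bound on m
    lets the cosine win. *)
Lemma charfun_step (t : R) : 0 < t -> t <= 1 -> 36 * 36 * 128 / t ^+ 2 <= m ->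
  E (fun w => cos (t * logk (mu w))) ^+ 2 + E (fun w => sin (t * logk (mu w))) ^+ 2 <=
  1 - t ^+ 2 / 128 / m.
Proof.
move=> t0 t1 mt.
have [i2 /andP[lo up]] := Ex_logk_sqr_ball.
set Q := E (fun w => logk (mu w) ^+ 2 * _) in lo up.
have mL : measurable_fun setT (fun w => t * logk (mu w)).
  by apply: measurable_funM; [exact: measurable_cst|exact: gmeas_logk].
have ic : intg P (fun w => cos (t * logk (mu w))).
  apply: (@intg_bdd _ _ _ P _ 1); last by move=> w; exact: cos_max.
  by apply: (measurableT_comp _ mL); apply: continuous_measurable_fun; exact: continuous_cos.
have isn : intg P (fun w => sin (t * logk (mu w))).
  apply: (@intg_bdd _ _ _ P _ 1); last by move=> w; exact: sin_max.
  by apply: (measurableT_comp _ mL); apply: continuous_measurable_fun; exact: continuous_sin.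
have h01 : 0 <= 2^-1 :> R by lra.
have h11 : 2^-1 < 1 :> R by lra.
have il : intg P (fun w => logk (mu w) * (r w <= 2^-1)%R%:R).
  apply: (@intg_mu_bdd (fun x => logk x * (cmod x <= 2^-1)%R%:R) 1).
    by apply: gmeasM; [exact: gmeas_logk|exact: gmeas_ball].
  move=> x x1; case: (leP (cmod x) 2^-1) => h; last by rewrite mulr0 normr0.
  by rewrite mulr1 (le_trans (logk_half h))//; lra.
have i3 := intg_ball' 2^-1.
have small w : r w <= 2^-1 -> `|t * logk (mu w)| <= 1.
  move=> h; have hl := logk_half h; rewrite normrM gtr0_norm//.
  have l1 : `|logk (mu w)| <= 1 by lra.
  by rewrite -[leRHS]mulr1 ler_pM ?(ltW t0).
set a := E _; set b := E _.
have a_up : a <= 1 - t ^+ 2 / 8 * Q.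
  rewrite /a /Q -ExZ// -Ex_cstB; last exact: intgZ.
  apply: Ex_le => //; first by apply: intg_cstB; exact: intgZ.
  move=> w; case: (leP (r w) 2^-1) => h; last by rewrite !mulr0 subr0 cos_le1.
  have := cos_le_quad (small w h); rewrite exprMn mulr1.
  by move: (t ^+ 2) (logk _ ^+ 2) => x y; lra.
have a_lo : 1 - t ^+ 2 / 2 * Q - 2 * E (fun w => (2^-1 < r w)%R%:R) <= a.
  have id : intg P (fun w => t ^+ 2 / 2 * (logk (mu w) ^+ 2 * (r w <= 2^-1)%R%:R) +
      2 * (2^-1 < r w)%R%:R) by apply: intgD; exact: intgZ.
  have -> : 1 - t ^+ 2 / 2 * Q - 2 * E (fun w => (2^-1 < r w)%R%:R) =
     E (fun w => 1 - (t ^+ 2 / 2 * (logk (mu w) ^+ 2 * (r w <= 2^-1)%R%:R) +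
      2 * (2^-1 < r w)%R%:R)).
    by rewrite Ex_cstB// ExD ?ExZ//; [rewrite opprD addrA|exact: intgZ|exact: intgZ].
  apply: Ex_le => //; first exact: intg_cstB.
  move=> w; case: (leP (r w) 2^-1) => h.
    have := cos_ge_quad (t * logk (mu w)); rewrite exprMn mulr1 mulr0 addr0.
    by move: (t ^+ 2) (logk _ ^+ 2) => x y; lra.
  by have := cos_geN1 (t * logk (mu w)); rewrite !mulr0 add0r mulr1; lra.
have b_le : `|b| <= t ^+ 2 * Q + E (fun w => (2^-1 < r w)%R%:R).
  have -> : b = E (fun w => sin (t * logk (mu w)) - t * (logk (mu w) * (r w <= 2^-1)%R%:R)).
    by rewrite ExB//; [rewrite ExZ// Ex_logk_ball// mulr0 subr0|exact: intgZ].
  have id : intg P (fun w => sin (t * logk (mu w)) - t * (logk (mu w) * (r w <= 2^-1)%R%:R)).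
    by apply: intgB => //; exact: intgZ.
  rewrite (le_trans (Ex_norm id))// /Q -ExZ// -ExD//; last exact: intgZ.
  apply: Ex_le; [exact: intg_norm|by apply: intgD => //; exact: intgZ|].
  move=> w; case: (leP (r w) 2^-1) => h.
    by rewrite !mulr1 addr0; have := sin_sub_sqr (small w h); rewrite exprMn.
  by rewrite !mulr0 subr0 add0r sin_max.
have far0 : 0 <= E (fun w => (2^-1 < r w)%R%:R) by apply: Ex_ge0.
have far := Ex_far.
move: a b Q (E _) lo up a_up a_lo b_le far0 far => a b Q F lo up a_up a_lo b_le far0 far.
have t20 : 0 < t ^+ 2 by rewrite exprn_gt0.
have t21 : t ^+ 2 <= 1 by rewrite exprn_ile1// ltW.
move: mt; rewrite ler_pdivrMr//; move: (t ^+ 2) t20 t21 a_up a_lo b_le => x x0 x1 a_up a_lo b_le mt.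
have nm : m^-1 * m = 1 by rewrite mulVf// lt0r_neq0.
have m2 : (m ^+ 2)^-1 = m^-1 ^+ 2 by rewrite exprVn.
move: lo up far; rewrite m2 invfM => lo up far.
apply: (charfun_arith x0 x1 _ _ lo up a_up a_lo b_le far0 far); first by rewrite invr_gt0.
rewrite ler_pdivlMr// -(ler_pM2r m_gt0) [x * m]mulrC; apply: le_trans mt.
by rewrite (_ : _ * m = 36 * 36 * 128 * (m^-1 * m)); [rewrite nm mulr1|ring].
Qed.

(** In [xlogx_mul] the linear term integrates to 0 over the half ball, and the quadratic one is at
    most 3 times 16 |mu|^2 y, whence 48 / m. Outside, the affine bound [xlogx_le] meets
    [Ex_poi_far]. *)
Lemma Ex_xlogx_mul (Lam y : R) : 1 <= Lam -> 0 < y ->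
  intg P (fun w => xlogx Lam (poi (mu w) * y)) /\
  E (fun w => xlogx Lam (poi (mu w) * y)) <=
  xlogx Lam y + 48 / m * y + 32 / m ^+ 2 * (1 + (1 + ln Lam) * y).
Proof.
move=> L1 y0; have L0 : 0 < Lam by rewrite (lt_le_trans _ L1).
have l0 : 0 <= ln Lam by rewrite ln_ge0.
have [ip Ep] := intg_poi; have [ipf Epf] := Ex_poi_far.
have mp : measurable_fun setT (fun w => poi (mu w)) by exact: gmeas_poi.
have mx : measurable_fun setT (fun w => xlogx Lam (poi (mu w) * y)).
  apply: (measurableT_comp (measurable_xlogx Lam)).
  by apply: measurable_funM => //; exact: measurable_cst.
have pp w : 0 < poi (mu w) by exact: poi_gt0.
have py w : 0 < poi (mu w) * y by rewrite mulr_gt0.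
have ix : intg P (fun w => xlogx Lam (poi (mu w) * y)).
  apply: (intg_le mx (g := fun w => 1 + (1 + ln Lam) * y * poi (mu w))).
    by apply: intgD; [exact: intg_cst|exact: intgZ].
  move=> w; have h1 := xlogx_geN1 L1 (py w); have h2 := xlogx_le L0 (py w).
  have h3 : 0 <= (1 + ln Lam) * y * poi (mu w) by rewrite !mulr_ge0// ?ltW//; lra.
  by rewrite ler_norml; apply/andP; split; lra.
split => //.
have h11 : 2^-1 < 1 :> R by lra.
have h01 : 0 <= 2^-1 :> R by lra.
have i1 : intg P (fun w => (poi (mu w) - 1) * (r w <= 2^-1)%R%:R).
  rewrite (_ : (fun w => _) = fun w => poi (mu w) * (r w <= 2^-1)%R%:R - (r w <= 2^-1)%R%:R).
    by apply: intgB; [exact: intg_poi_ball|exact: intg_ball].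
  by apply/funext => w; ring.
have i3 := intg_ball' 2^-1.
set X := xlogx Lam y; set c := (1 + ln (Num.min y Lam)) * y.
have X1 : -1 <= X by exact: xlogx_geN1.
have ir := intg_rX 2.
have ptw w : xlogx Lam (poi (mu w) * y) <= X + (2^-1 < r w)%R%:R +
   c * ((poi (mu w) - 1) * (r w <= 2^-1)%R%:R) + 48 * y * r w ^+ 2 +
   (1 + ln Lam) * y * (poi (mu w) * (2^-1 < r w)%R%:R).
  case: (leP (r w) 2^-1) => h /=.
    have := xlogx_mul L0 y0 (poi_ge_third h); rewrite -/X -/c.
    have : (poi (mu w) - 1) ^+ 2 <= 16 * r w ^+ 2.
      rewrite -real_normK ?num_real//.
      have : `|poi (mu w) - 1| ^+ 2 <= (4 * r w) ^+ 2.
        by rewrite ler_sqr ?nnegrE ?mulr_ge0// poi_sub1_half.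
      by rewrite exprMn -natrX.
    move=> /(ler_wpM2r (ltW y0)); rewrite !mulr1 !mulr0 !addr0.
    by move: ((poi (mu w) - 1) ^+ 2) (r w ^+ 2) => u v; lra.
  have := xlogx_le L0 (py w); have := mulr_ge0 (ltW y0) (sqr_ge0 (r w)).
  rewrite !mulr0 !mulr1 addr0; lra.
have := Ex_le ix _ ptw; set rhs := (X in E _ <= X).
have j1 : intg P (fun w => X + (2^-1 < r w)%R%:R) by apply: intgD => //; exact: intg_cst.
have j2 : intg P (fun w => X + (2^-1 < r w)%R%:R + c * ((poi (mu w) - 1) * (r w <= 2^-1)%R%:R)).
  by apply: intgD => //; exact: intgZ.
have j3 : intg P (fun w => X + (2^-1 < r w)%R%:R + c * ((poi (mu w) - 1) * (r w <= 2^-1)%R%:R)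
   + 48 * y * r w ^+ 2) by apply: intgD => //; exact: intgZ.
have j4 : intg P (fun w => (1 + ln Lam) * y * (poi (mu w) * (2^-1 < r w)%R%:R)) by exact: intgZ.
move=> h; apply: (le_trans (h (intgD j3 j4))).
rewrite {h}/rhs ExD// ExD//; last exact: intgZ.
rewrite ExD//; last exact: intgZ.
rewrite ExD//; last exact: intg_cst.
rewrite !ExZ// Ex_cst Ex_poi_sub1_ball// mu_sqr mulr0 addr0.
have k0 : 0 <= (1 + ln Lam) * y by rewrite mulr_ge0// ?ltW//; lra.
have := ler_wpM2l k0 Epf; have := Ex_far; rewrite -![_ / m]/(_ * m^-1).
by move: (E _) (E _) (32 / m ^+ 2) (m^-1) => a b e f; lra.
Qed.

(** The integrand is a positive harmonic function of mu in the disc, with the left side as its value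
    at 0. As a Moebius function it is 1/Q + c mu / (1 - kap mu) with |kap| <= 1, so [mu_doubling]
    gives the mean value property on balls; dropping the positive part outside a ball leaves an
    inequality. *)
Lemma Ex_Re_inv (s b y : R) : 0 < s -> 0 < b ->
  complex.Re (((s + b) +i* y)%C^-1) <=
  E (fun w => complex.Re ((s%:C%C + b%:C%C * herg (mu w) + (0 +i* y)%C)^-1)).
Proof.
move=> s0 b0; set Q : C := ((s + b) +i* y)%C.
pose kap : C := (Q - 2 * b%:C%C) / Q.
have Q0 : Q != 0.
  by apply/eqP => /(congr1 (@complex.Re R)) /=; lra.
have kap1 : cmod kap <= 1.
  rewrite /kap cmodM cmodV ler_pdivrMr ?cmod_gt0// mul1r.
  rewrite -(@ler_pXn2r _ 2)// ?nnegrE ?cmod_ge0// !cmod_sqr.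
  rewrite RecD ImcD RecN ImcN -(rmorph_nat (real_complex R) 2) RecM ImcM /=.
  by rewrite !mulr0 !mul0r !subr0 !addr0 !oppr0 ?addr0; nra.
have [c cE] : exists c : C, c = (kap - 1) / Q by eexists.
pose f k (x : C) := complex.Re (c * kap ^+ (2 ^ k).-1 * x / (1 - kap ^+ (2 ^ k) * x)).
pose F w := complex.Re ((s%:C%C + b%:C%C * herg (mu w) + (0 +i* y)%C)^-1).
have kk k : cmod (kap ^+ k) <= 1 by rewrite cmodX exprn_ile1// cmod_ge0.
have kx k (x : C) : cmod x < 1 -> 1 - kap ^+ k * x != 0.
  move=> x1; apply: neq_1B; rewrite cmodM (le_lt_trans _ x1)//.
  by rewrite ler_piMl ?cmod_ge0.
have FE w : F w = complex.Re Q^-1 + f 0%N (mu w).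
  rewrite /F /f expr0 mulr1 expr1 -RecD; congr complex.Re.
  have h1 := neq_1B (mu_lt1 w); have h2 := kx 1%N _ (mu_lt1 w); rewrite expr1 in h2.
  have QE : Q = s%:C%C + b%:C%C + (0 +i* y)%C by apply: complexP; rewrite ?RecD ?ImcD /=; ring.
  have h3 : Q - (Q - 2 * b%:C%C) * mu w != 0.
    have -> : Q - (Q - 2 * b%:C%C) * mu w = Q * (1 - kap * mu w) by rewrite /kap; field.
    by rewrite mulf_neq0.
  have -> : s%:C%C + b%:C%C * herg (mu w) + (0 +i* y)%C =
     (Q - (Q - 2 * b%:C%C) * mu w) / (1 - mu w).
    by rewrite /herg QE; field.
  by rewrite cE /kap; field; rewrite Q0 h3 h1.
have iff_ n : intg P (fun w => f 0%N (mu w) * (r w <= 1 - n.+1%:R^-1)%R%:R) /\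
   E (fun w => f 0%N (mu w) * (r w <= 1 - n.+1%:R^-1)%R%:R) = 0.
  have [n0 n1] := rho_n_bounds n.
  have mf k : gmeas (f k).
    move=> d' T' h mh; have [] // := @cmeasM R d' T' (fun t => c * kap ^+ (2 ^ k).-1 * h t)
      (fun t => (1 - kap ^+ (2 ^ k) * h t)^-1).
      by apply: cmeasM => //; exact: cmeas_cst.
    apply: cmeasV; apply: cmeasB; first exact: cmeas_cst.
    by apply: cmeasM => //; exact: cmeas_cst.
  have fb k (x : C) : cmod x < 1 -> `|f k x| <= cmod c * (cmod x / (1 - cmod x)).
    move=> x1; rewrite (le_trans (Re_le_cmod _))// !cmodM cmodV -!mulrA ler_wpM2l ?cmod_ge0//.
    rewrite mulrA ler_pM ?mulr_ge0 ?invr_ge0 ?cmod_ge0//.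
      by rewrite ler_piMl ?cmod_ge0.
    have /andP[h1 h2] := cmod_1B x1.
    rewrite lef_pV2 ?posrE ?cmod_gt0 ?kx//.
    have := cmodB_ge 1 (kap ^+ (2 ^ k) * x); rewrite cmod1 cmodM.
    by have := ler_wpM2r (cmod_ge0 x) (kk (2 ^ k)%N); lra.
  split.
    apply: (@intg_mu_bdd (fun x => f 0%N x * (cmod x <= 1 - n.+1%:R^-1)%R%:R)
      (cmod c * ((1 - n.+1%:R^-1) / (1 - (1 - n.+1%:R^-1))))).
      by apply: gmeasM => //; exact: gmeas_ball.
    move=> x x1; case: (leP (cmod x) (1 - n.+1%:R^-1)) => h; last first.
      by rewrite mulr0 normr0 mulr_ge0 ?cmod_ge0// divr_ge0// subr_ge0 (ltW n1).
    by rewrite mulr1 (le_trans (fb _ _ x1))// ler_wpM2l ?cmod_ge0// ratio_le.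
  apply: (@mu_doubling f (cmod c)) => //; first exact: cmod_ge0.
  move=> k x x1; rewrite /f -RecD.
  have p2 : (0 < 2 ^ k)%N by rewrite expn_gt0.
  have -> : kap ^+ (2 ^ k.+1) = (kap ^+ (2 ^ k)) ^+ 2 by rewrite -exprM -expnSr.
  have -> : kap ^+ (2 ^ k.+1).-1 = kap ^+ (2 ^ k).-1 * kap ^+ (2 ^ k).
    by rewrite -exprD expnS mul2n -addnn; congr (_ ^+ _); case: (2 ^ k)%N p2.
  transitivity (complex.Re ((2:R)%:C%C * (c * (kap ^+ (2 ^ k).-1 * kap ^+ (2 ^ k)) * x ^+ 2 /
    (1 - (kap ^+ (2 ^ k)) ^+ 2 * x ^+ 2)))); last by rewrite RecM /= mul0r subr0.
  congr complex.Re; rewrite rmorph_nat.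
  have h1 := kx (2 ^ k)%N _ x1; have h2 : 1 - kap ^+ (2 ^ k) * - x != 0 by apply: kx; rewrite cmodN.
  by rewrite mulrN opprK in h2; rewrite mobius_even.
have Fpos w : 0 <= F w.
  rewrite /F; set z := _ + _; have zr : s <= complex.Re z.
    rewrite /z !RecD RecM /= mul0r subr0 addr0 lerDl mulr_ge0 ?ltW// poi_gt0//.
  by apply: Re_inv_ge0; rewrite (le_trans (ltW s0)).
have Fb w : F w <= s^-1.
  rewrite /F; set z := _ + _; have zr : s <= complex.Re z.
    rewrite /z !RecD RecM /= mul0r subr0 addr0 lerDl mulr_ge0 ?ltW// poi_gt0//.
  rewrite (le_trans (ler_norm _))// (le_trans (Re_le_cmod _))// cmodV lef_pV2 ?posrE//.
    by rewrite (le_trans zr)// (le_trans (ler_norm _))// Re_le_cmod.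
  rewrite cmod_gt0; apply/eqP => z0; move: zr; rewrite z0 /=; lra.
have mF : measurable_fun setT F.
  have [] // : cmeas (fun w => (s%:C%C + b%:C%C * herg (mu w) + (0 +i* y)%C)^-1).
  apply: cmeasV; apply: cmeasD; last exact: cmeas_cst.
  apply: cmeasD; first exact: cmeas_cst.
  by apply: cmeasM; [exact: cmeas_cst|exact: cmeas_herg].
have iF : intg P F by apply: (@intg_bdd _ _ _ P _ s^-1) => // w; rewrite ger0_norm.
have Qpos : 0 <= complex.Re Q^-1.
  by apply: Re_inv_ge0 => /=; lra.
rewrite -lee_fin.
have -> : ((complex.Re Q^-1)%:E = \int[P]_w (complex.Re Q^-1)%:E)%E.
  by rewrite integral_cst//= probability_setT mule1.
apply: ball_exhaust => // n.
have [ifn Ef] := iff_ n.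
rewrite -EFin_Ex; last by apply: intgZ; exact: intg_ball.
rewrite lee_fin.
have -> : E (fun w => complex.Re Q^-1 * (r w <= 1 - n.+1%:R^-1)%R%:R) =
  E (fun w => complex.Re Q^-1 * (r w <= 1 - n.+1%:R^-1)%R%:R +
     f 0%N (mu w) * (r w <= 1 - n.+1%:R^-1)%R%:R).
  by rewrite ExD ?Ef ?addr0//; apply: intgZ; exact: intg_ball.
apply: Ex_le => //; first by apply: intgD => //; apply: intgZ; exact: intg_ball.
move=> w; rewrite -mulrDl -FE -/(F w); case: (cmod (mu w) <= _)%R; rewrite ?mulr1 ?mulr0; [exact: lexx|exact: Fpos].
Qed.

End RotationInvariant.

(** * The chain (ln |A(1)|, q) and its transition *)

Section OnePoint.
Variable R : realType.
Local Notation C := R[i].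

Definition lq (m : nat) (p : {poly C}) : C := m%:R - 2 * (p^`().[1] / p.[1]).
(** The bound 1 is an invariant: the recursion starts at q = 1, and a step takes Re q to 1 plus a
    nonnegative multiple of a Poisson kernel. Off this event, [Sx] and [qx] take the values of the
    chain at order 1, so that Re [qx] >= 1 holds everywhere. *)
Definition good (m : nat) (p : {poly C}) : bool := (0 < cmod p.[1]) && (1 <= complex.Re (lq m p)).
Definition Sx (m : nat) (p : {poly C}) : R := if good m p then ln (cmod p.[1]) else 0.
Definition qx (m : nat) (p : {poly C}) : C := if good m p then lq m p else 1.
Definition qnext (q x : C) : C := 1 + (complex.Re q)%:C%C * herg x + (0 +i* complex.Im q)%C.

Lemma Re_qnext q x : complex.Re (qnext q x) = 1 + complex.Re q * poi x.
Proof. by rewrite /qnext !RecD RecM /= mul0r subr0 addr0. Qed.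

Lemma Re_qx m p : 1 <= complex.Re (qx m p).
Proof. by rewrite /qx; case: ifP => // /andP[]. Qed.

(** The phase z = csgn conj(a) / a, with a = p(1), depends on p alone. A rotation invariant
    coefficient absorbs it, and then the law of the new state depends on p only through the old
    state. *)
Lemma chain_step_state N (p : {poly C}) : (size p <= N.+1)%N -> good N.+1 p ->
  exists z : C, cmod z = 1 /\ (forall mu, cmod mu < 1 ->
    good N.+2 (chain_step N mu p) /\
    Sx N.+2 (chain_step N mu p) = Sx N.+1 p + logk (z * mu) /\
    qx N.+2 (chain_step N mu p) = qnext (qx N.+1 p) (z * mu)).
Proof.
move=> sp gp; have /andP[a0 b1] := gp.
set a := p.[1] in a0 b1; set D := p^`().[1].
have an0 : a != 0 by rewrite -cmod_gt0.
have c11 : cmod (1 : C) = 1 by rewrite cmod1.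
exists (csgn R N * conjc a / a); split.
  rewrite !cmodM cmodV cmod_conj mulfK ?gt_eqF// /csgn cmodX cmodN c11 expr1n//.
move=> mu mu1; set v := _ * mu.
have vE : mu * csgn R N * conjc a = v * a by rewrite /v; field.
have v1 : cmod v < 1.
  rewrite /v !cmodM cmodV cmod_conj /csgn cmodX cmodN c11 expr1n mul1r mulfV ?mul1r//.
  by rewrite gt_eqF.
have sp' : (size p <= N.+2)%N by rewrite (leq_trans sp).
have ra : (revp N.+1 p).[1] = conjc a.
  by rewrite horner_revp_circle// expr1n mul1r.
have rD : (revp N.+1 p)^`().[1] = N.+1%:R * conjc a - conjc D.
  by have := deriv_revp_circle sp' c11; rewrite expr1n !mul1r => ->.
have a' : (chain_step N mu p).[1] = a * (1 - v).
  by rewrite hornerD hornerN hornerZ ra vE /a; ring.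
pose q := lq N.+1 p.
have DE : D = a * ((N.+1%:R - q) / 2) by rewrite /q /lq -/a -/D; field.
have cD : mu * csgn R N * conjc D = v * a * ((N.+1%:R - conjc q) / 2).
  have c2 : conjc (2 : C) = 2 by rewrite conjc_nat.
  have cM : conjc (N.+1%:R : C) = N.+1%:R by rewrite conjc_nat.
  have := congr1 (fun t => mu * csgn R N * conjc (2 * t)) DE.
  have -> : 2 * (a * ((N.+1%:R - q) / 2)) = a * (N.+1%:R - q) by field.
  rewrite !conjcM conjcB c2 cM [in RHS]mulrA vE => h.
  apply: (@mulfI _ 2); first by rewrite pnatr_eq0.
  by rewrite mulrCA h; field.
have D' : (chain_step N mu p)^`().[1] = D - (N.+1%:R * (v * a) - v * a * ((N.+1%:R - conjc q) / 2)).
  rewrite derivB derivZ hornerD hornerN hornerZ rD mulrBr cD -/D mulrCA vE.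
  by [].
have v0 := neq_1B v1.
have qE : q = (complex.Re q)%:C%C + (0 +i* complex.Im q)%C.
  by apply: complexP; rewrite ?RecD ?ImcD /= ?addr0 ?add0r.
have qJ : conjc q = (complex.Re q)%:C%C - (0 +i* complex.Im q)%C.
  by apply: complexP; rewrite ?RecJ ?ImcJ ?RecD ?ImcD ?RecN ?ImcN /= ?subr0 ?sub0r.
have lq' : lq N.+2 (chain_step N mu p) = qnext q v.
  rewrite /lq a' D' DE /qnext /herg qJ.
  have -> : N.+2%:R = N.+1%:R + 1 :> C by rewrite -addn1 natrD.
  rewrite [in (_ - q) / 2]qE.
  move: (complex.Re q)%:C%C ((0 +i* complex.Im q)%C : C) => b y.
  by field; rewrite an0 v0.
have qx1 : qx N.+1 p = q by rewrite /qx gp.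
have g' : good N.+2 (chain_step N mu p).
  rewrite /good lq' Re_qnext a' cmodM mulr_gt0 ?cmod_gt0//=.
  by rewrite lerDl mulr_ge0 ?ltW ?poi_gt0// (lt_le_trans ltr01).
split => //; split; last by rewrite {1}/qx g' qx1.
by rewrite /Sx g' gp a' cmodM lnM ?posrE ?cmod_gt0.
Qed.

Lemma cmeas_lq d (T : measurableType d) k m (f : T -> {poly C}) :
  (forall x, (size (f x) <= k)%N) -> pmeas f -> cmeas (fun x => lq m (f x)).
Proof.
move=> fk mf; apply: cmeasB; first exact: cmeas_cst.
apply: cmeasM; first exact: cmeas_cst.
apply: cmeasM.
  apply: (@cmeas_horner _ _ _ k (fun x => (f x)^`()) (fun=> 1)) => //.
  - by move=> x; rewrite (leq_trans (leq_trans (size_poly _ _) (leq_pred _))).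
  - exact: pmeas_deriv.
apply: cmeasV; apply: (@cmeas_horner _ _ _ k f (fun=> 1)) => //; exact: cmeas_cst.
Qed.

Lemma measurable_good d (T : measurableType d) k m (f : T -> {poly C}) :
  (forall x, (size (f x) <= k)%N) -> pmeas f -> measurable_fun setT (fun x => good m (f x)).
Proof.
move=> fk mf; apply: measurable_and.
  apply: measurable_fun_ltr; first exact: measurable_cst.
  by apply: measurable_cmod; apply: (@cmeas_horner _ _ _ k f (fun=> 1)) => //; exact: cmeas_cst.
apply: measurable_fun_ler; first exact: measurable_cst.
by have [] := @cmeas_lq _ _ k m f fk mf.
Qed.

Lemma measurable_Sx d (T : measurableType d) k m (f : T -> {poly C}) :
  (forall x, (size (f x) <= k)%N) -> pmeas f -> measurable_fun setT (fun x => Sx m (f x)).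
Proof.
move=> fk mf; apply: measurable_fun_ifT; [exact: measurable_good fk mf| |exact: measurable_cst].
apply: (measurableT_comp (@measurable_ln R)); apply: measurable_cmod.
by apply: (@cmeas_horner _ _ _ k f (fun=> 1)) => //; exact: cmeas_cst.
Qed.

Lemma cmeas_qx d (T : measurableType d) k m (f : T -> {poly C}) :
  (forall x, (size (f x) <= k)%N) -> pmeas f -> cmeas (fun x => qx m (f x)).
Proof.
move=> fk mf; have [h1 h2] := @cmeas_lq _ _ k m f fk mf.
split; rewrite /qx.
  rewrite (_ : (fun x => _) = fun x => if good m (f x) then complex.Re (lq m (f x)) else 1).
    by apply: measurable_fun_ifT; [exact: measurable_good fk mf| |exact: measurable_cst].
  by apply/funext => x; case: ifP.
rewrite (_ : (fun x => _) = fun x => if good m (f x) then complex.Im (lq m (f x)) else 0).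
  by apply: measurable_fun_ifT; [exact: measurable_good fk mf| |exact: measurable_cst].
by apply/funext => x; case: ifP.
Qed.

Lemma cmeas_qnext d (T : measurableType d) (q x : T -> C) : cmeas q -> cmeas x ->
  cmeas (fun t => qnext (q t) (x t)).
Proof.
move=> mq mx; apply: cmeasD; last by apply: cmeas_pair; [exact: measurable_cst|case: mq].
apply: cmeasD; first exact: cmeas_cst.
by apply: cmeasM; [apply: cmeas_real; case: mq|exact: cmeas_herg].
Qed.

Section Corner.
Context N d (T : measurableType d) (P : probability T R) (U : T -> 'M[C]_(1 + (1 + N))).
Hypothesis hU : haar_SU_distributed P U.

(** Conjugation matches the coefficient of [haar_chain]. The default 0 keeps every value in the open
    disc, alters the corner entry on a null event only, and commutes with rotations. *)
Definition mu_of (x : C) : C := if cmod x < 1 then conjc x else 0.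
Definition corner (w : T) : C := mu_of (U w 0 0).

Lemma cmeas_mu_of d' (T' : measurableType d') (f : T' -> C) : cmeas f -> cmeas (fun w => mu_of (f w)).
Proof.
move=> mf; have [h1 h2] := cmeasJ mf.
have mb : measurable_fun setT (fun w => cmod (f w) < 1).
  by apply: measurable_fun_ltr; [exact: measurable_cmod|exact: measurable_cst].
split; rewrite /mu_of.
  rewrite (_ : (fun x => _) = fun x => if cmod (f x) < 1 then complex.Re (conjc (f x)) else 0).
    by apply: measurable_fun_ifT => //; exact: measurable_cst.
  by apply/funext => x; case: ifP.
rewrite (_ : (fun x => _) = fun x => if cmod (f x) < 1 then complex.Im (conjc (f x)) else 0).
  by apply: measurable_fun_ifT => //; exact: measurable_cst.
by apply/funext => x; case: ifP.
Qed.

Lemma cmeas_corner : cmeas corner.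
Proof. by apply: cmeas_mu_of; exact: (haar_cmeas hU). Qed.

Lemma corner_lt1 w : cmod (corner w) < 1.
Proof. by rewrite /corner /mu_of; case: ifP => h; rewrite ?cmod_conj ?cmod0. Qed.

Lemma corner_ae : {ae P, forall w, cmod (U w 0 0) < 1 /\ corner w = conjc (U w 0 0)}.
Proof.
by apply: filterS (haar_corner_lt1 hU) => w h; rewrite /corner /mu_of h.
Qed.

Lemma mu_ofZ z x : cmod z = 1 -> mu_of (conjc z * x) = z * mu_of x.
Proof.
move=> z1; rewrite /mu_of cmodM cmod_conj z1 mul1r conjcM conjcK.
by case: ifP => //; rewrite mulr0.
Qed.

(** The matrix diag(conj z, z, 1, ..., 1) is in SU and rotates the corner. *)
Lemma corner_rot_ge0 (g : C -> \bar R) (z : C) : cmod z = 1 -> (forall x, 0 <= g x)%E ->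
  (forall (d' : measure_display) (T' : measurableType d') (f : T' -> C), cmeas f ->
     measurable_fun setT (fun x => g (f x))) ->
  (\int[P]_w g (z * corner w)%R = \int[P]_w g (corner w))%E.
Proof.
move=> z1 g0 mg.
pose G (A : mxT R (1 + (1 + N))) := g (mu_of ((A : 'M[C]_(1 + (1 + N))) 0 0)).
have mG : measurable_fun setT G by apply: mg; apply: cmeas_mu_of; exact: cmeas_entry.
have cz : cmod (conjc z) = 1 by rewrite cmod_conj.
have cz0 := unit_neq0 cz.
have cz2 : conjc z * conjc (conjc z) + 0 * conjc 0 = 1 by rewrite mul_conjc cz expr1n mul0r addr0.
rewrite -[RHS]/(\int[P]_w G (U w))%E -(haar_left hU (SU_rotmx N cz0 cz2) mG) => [|A]; last exact: g0.
by apply: eq_integral => w _; rewrite /G rotmx_row0 mul0r addr0 mu_ofZ.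
Qed.

Lemma corner_rot (g : C -> R) : gmeas g -> forall z, cmod z = 1 ->
  Ex P (fun w => g (z * corner w)) = Ex P (fun w => g (corner w)).
Proof.
move=> mg z z1.
pose G (A : mxT R (1 + (1 + N))) := g (mu_of ((A : 'M[C]_(1 + (1 + N))) 0 0)).
have mG : measurable_fun setT G by apply: mg; apply: cmeas_mu_of; exact: cmeas_entry.
have cz : cmod (conjc z) = 1 by rewrite cmod_conj.
have cz0 := unit_neq0 cz.
have cz2 : conjc z * conjc (conjc z) + 0 * conjc 0 = 1 by rewrite mul_conjc cz expr1n mul0r addr0.
rewrite -[RHS]/(Ex P (fun w => G (U w))) -(haar_left_Ex hU (SU_rotmx N cz0 cz2) mG)//.
by apply: eq_Ex => w; rewrite /G rotmx_row0 mul0r addr0 mu_ofZ.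
Qed.

Let iX k : intg P (fun w => cmod (corner w) ^+ k).
Proof. exact: (intg_rX P cmeas_corner corner_lt1). Qed.

Lemma corner_sqr : Ex P (fun w => cmod (corner w) ^+ 2) = N.+2%:R^-1.
Proof.
rewrite -(Ex_corner2 hU); apply: Ex_ae => //; first exact: intg_corner2.
by apply: filterS corner_ae => w [_ ->]; rewrite cmod_conj.
Qed.

Lemma corner_four : Ex P (fun w => cmod (corner w) ^+ 4) <= 2 / N.+2%:R ^+ 2.
Proof.
apply: le_trans (Ex_corner4 hU); apply: Ex_le_ae => //; first exact: intg_corner4.
by apply: filterS corner_ae => w [_ ->]; rewrite cmod_conj.
Qed.

End Corner.

Section Chain.
Context (d : nat -> measure_display) (T : forall N, measurableType (d N))
  (P : forall N, probability (T N) R) (X : forall N, T N -> 'M[C]_N.+1).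
Hypothesis hX : forall N, haar_SU_distributed (P N) (@X N).

Definition Sw N (w : T N) : R := Sx N.+1 (pA (X w)).
Definition qw N (w : T N) : C := qx N.+1 (pA (X w)).
(** [X N] has order N+1; the step from level N to level N+1 takes its coefficient from the corner of
    [X N.+1], a matrix of order N+2. *)
Definition mw N (w : T N.+1) : C := @corner N _ _ (@X N.+1) w.

Let mp N : pmeas (fun w : T N => pA (X w)).
Proof. by apply: pmeas_pA => k l; exact: haar_cmeas. Qed.

(** Induction on N: the indicator of the bad event is a functional to which [haar_chain] applies,
    and a step with |mu| < 1 preserves goodness. *)
Lemma pA_good N : {ae P N, forall w, good N.+1 (pA (X w))}.
Proof.
elim: N => [|N ih].
  apply: filterS (haar_SU (hX 0)) => w _.
  have -> : pA (X w) = 1 by rewrite /pA /rdet det_mx00.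
  by rewrite /good /lq derivC !hornerC mul0r mulr0 subr0 cmod1 ltr01 /= lexx.
pose F (p : {poly C}) : R := (~~ good N.+2 p)%:R.
have mF : polymeas N.+2 F.
  by move=> d' T' f mf fk; apply: measurable_natb; apply: measurable_neg; exact: measurable_good fk mf.
have F0 p : 0 <= F p by [].
have iF : intg (P N.+1) (fun w => F (pA (X w))).
  apply: (@intg_bdd _ _ _ (P N.+1) _ 1); last by move=> w; exact: norm_natb_le1.
  by apply: mF => // w; exact: size_pA.
have EF : Ex (P N.+1) (fun w => F (pA (X w))) = 0.
  apply: (@EFin_inj R); rewrite EFin_Ex//.
  rewrite (haar_chain (hX N.+1) (hX N) (haar_corner_neq0 (hX N.+1)) mF F0).
  have h0 u : cmod (@X N.+1 u 0 0) < 1 ->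
     (\int[P N]_w (F (chain_step N (conjc (@X N.+1 u 0 0)) (pA (@X N w))))%:E = 0)%E.
    move=> u1; rewrite (@ge0_ae_eq_integral _ _ _ _ _ _ (cst 0%E)) ?integral0//.
    - apply/measurable_EFinP; apply: mF.
        by apply: pmeas_chain_step => //; exact: cmeas_cst.
      by move=> w; apply: size_chain_step; exact: size_pA.
    - by move=> w _; rewrite lee_fin.
    - apply: filterS ih => w gw _ /=.
      have [z [_]] := chain_step_state (size_pA _) gw.
      move=> /(_ (conjc (@X N.+1 u 0 0))); rewrite cmod_conj => /(_ u1) [g' _]; by rewrite /F g'.
  rewrite (@ge0_ae_eq_integral _ _ _ _ _ _ (cst 0%E)) ?integral0//.
  - pose G (uw : T N.+1 * T N) := (F (chain_step N (conjc (@X N.+1 uw.1 0 0)) (pA (@X N uw.2))))%:E.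
    have mG : measurable_fun setT G.
      apply/measurable_EFinP; apply: mF; last by move=> uw; apply: size_chain_step; exact: size_pA.
      apply: pmeas_chain_step.
        apply: cmeasJ; exact: (cmeas_comp measurable_fst (haar_cmeas (hX N.+1) 0 0)).
      by apply: pmeas_pA => k l; exact: (cmeas_comp measurable_snd (haar_cmeas (hX N) k l)).
    have G0 x : (0 <= G x)%E by rewrite lee_fin.
    exact: (measurable_fun_fubini_tonelli_F G mG G0).
  - by move=> u _; apply: integral_ge0 => w _; rewrite lee_fin.
  - by apply: filterS (haar_corner_lt1 (hX N.+1)) => u u1 _; exact: h0.
have /ae_of_Ex0 h := EF.
apply: filterS (h _ _ iF) => [w /eqP||]; last 2 first.
- exact: intg_meas iF.
- by [].
by rewrite pnatr_eq0 eqb0 negbK.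
Qed.

Definition smeas (F : R -> C -> R) := forall (d' : measure_display) (T' : measurableType d')
  (f : T' -> R) (g : T' -> C), measurable_fun setT f -> cmeas g ->
  measurable_fun setT (fun x => F (f x) (g x)).

Lemma measurable_Sw N : measurable_fun setT (@Sw N).
Proof. by apply: (measurable_Sx _ (k := N.+1)) => // w; exact: size_pA. Qed.

Lemma cmeas_qw N : cmeas (@qw N).
Proof. by apply: (cmeas_qx _ (k := N.+1)) => // w; exact: size_pA. Qed.

Lemma cmeas_mw N : cmeas (@mw N).
Proof. exact: (cmeas_corner (hX N.+1)). Qed.

Lemma smeas_step (F : R -> C -> R) N : smeas F ->
  measurable_fun setT (fun wu : T N * T N.+1 =>
    F (Sw wu.1 + logk (mw wu.2)) (qnext (qw wu.1) (mw wu.2))).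
Proof.
have mm : cmeas (fun wu : T N * T N.+1 => mw wu.2) by exact: (cmeas_comp measurable_snd (@cmeas_mw N)).
move=> mF; apply: mF.
  apply: measurable_funD; last exact: gmeas_logk.
  exact: (measurableT_comp (@measurable_Sw N) measurable_fst).
by apply: cmeas_qnext => //; exact: (cmeas_comp measurable_fst (@cmeas_qw N)).
Qed.

(** The Markov property, stated in law because the spaces [T N] are unrelated: the state at level
    N+1 is distributed as one step from the state at level N with an independent coefficient. The
    phase from [chain_step_state] is removed by rotation invariance. *)
Lemma chain_ge0 N (F : R -> C -> R) : smeas F -> (forall s q, 0 <= F s q) ->
  (\int[P N.+1]_u (F (Sw u) (qw u))%:E =
   \int[P N]_w \int[P N.+1]_u (F (Sw w + logk (mw u)) (qnext (qw w) (mw u)))%:E)%E.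
Proof.
move=> mF F0.
pose F' (p : {poly C}) := F (Sx N.+2 p) (qx N.+2 p).
have mF' : polymeas N.+2 F'.
  by move=> d' T' f mf fk; apply: mF; [exact: measurable_Sx fk mf|exact: cmeas_qx fk mf].
have F'0 p : 0 <= F' p by exact: F0.
rewrite -[LHS]/(\int[P N.+1]_u (F' (pA (X u)))%:E)%E (haar_chain (hX N.+1) (hX N) (haar_corner_neq0 (hX N.+1)) mF' F'0).
pose G (uw : T N.+1 * T N) := (F' (chain_step N (conjc (@X N.+1 uw.1 0 0)) (pA (@X N uw.2))))%:E.
have mG : measurable_fun setT G.
  apply/measurable_EFinP; apply: mF'; last by move=> uw; apply: size_chain_step; exact: size_pA.
  apply: pmeas_chain_step.
    apply: cmeasJ; exact: (cmeas_comp measurable_fst (haar_cmeas (hX N.+1) 0 0)).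
  by apply: pmeas_pA => k l; exact: (cmeas_comp measurable_snd (haar_cmeas (hX N) k l)).
have G0 x : (0 <= G x)%E by rewrite lee_fin.
rewrite (fubini_tonelli G mG G0).
apply: ge0_ae_eq_integral; first exact: measurableT.
- exact: (measurable_fun_fubini_tonelli_G G mG G0).
- have mS : measurable_fun setT (EFin \o (fun wu : T N * T N.+1 =>
    F (Sw wu.1 + logk (mw wu.2)) (qnext (qw wu.1) (mw wu.2)))).
    by apply/measurable_EFinP; exact: smeas_step.
  by apply: (measurable_fun_fubini_tonelli_F _ mS) => x; rewrite lee_fin.
- by move=> w _; apply: integral_ge0 => u _; exact: (G0 (u, w)).
- by move=> w _; apply: integral_ge0 => u _; rewrite lee_fin F0.
apply: filterS (pA_good N) => w gw _.
have [z [z1 hz]] := chain_step_state (size_pA _) gw.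
pose g (x : C) := (F (Sw w + logk x) (qnext (qw w) x))%:E.
have mg (d' : measure_display) (T' : measurableType d') (f : T' -> C) : cmeas f ->
     measurable_fun setT (fun x => g (f x)).
  move=> mf; apply/measurable_EFinP; apply: mF.
    by apply: measurable_funD; [exact: measurable_cst|exact: gmeas_logk].
  by apply: cmeas_qnext => //; exact: cmeas_cst.
have g0 x : (0 <= g x)%E by rewrite lee_fin.
rewrite -[RHS]/(\int[P N.+1]_u g (@mw N u))%E.
rewrite -(corner_rot_ge0 (hX N.+1) z1 g0 mg).
apply: ge0_ae_eq_integral; first exact: measurableT.
- exact: (measurableT_comp mG (measurable_pair2 w)).
- by apply: mg; apply: cmeasM; [exact: cmeas_cst|exact: cmeas_mw].
- by move=> u _; exact: (G0 (u, w)).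
- by move=> u _; exact: g0.
apply: filterS (corner_ae (hX N.+1)) => u [u1 uE] _.
rewrite /G /g /= uE /F'; have := hz (conjc (@X N.+1 u 0 0)).
by rewrite cmod_conj => /(_ u1) [_ [-> ->]].
Qed.

End Chain.
End OnePoint.

(** * Harmonic numbers: slow growth and divergence *)

Section Harmonic.
Variable R : realType.

Definition harm (N : nat) : R := \sum_(k < N.+1) k.+1%:R^-1.

Lemma harmS N : harm N.+1 = harm N + N.+2%:R^-1.
Proof. by rewrite /harm big_ord_recr. Qed.

Lemma harm_ge0 N : 0 <= harm N.
Proof. by apply: sumr_ge0 => k _; rewrite invr_ge0. Qed.

Lemma harm_le_size N : harm N <= N.+1%:R.
Proof.
rewrite -[leRHS]mulr1 mulr_natl -[N.+1 in leRHS]card_ord -sumr_const.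
by apply: ler_sum => k _; rewrite invf_le1// ler1n.
Qed.

(** Terms of index below K are at most 1, the others at most 1/K. *)
Lemma harm_le N (K : nat) : (0 < K)%N -> harm N <= K%:R + N.+1%:R / K%:R.
Proof.
move=> K0; have K0' : (0 : R) < K%:R by rewrite ltr0n.
elim: N => [|N ih].
  rewrite /harm big_ord_recl big_ord0 addr0 invr1 (@le_trans _ _ K%:R) ?ler1n// lerDl.
  by rewrite divr_ge0.
have [KN|NK] := leqP K N.+2.
  rewrite harmS -[N.+2%:R in leRHS](natr1) mulrDl addrA lerD// mul1r lef_pV2 ?posrE ?ltr0n//.
  by rewrite ler_nat.
by rewrite (le_trans (harm_le_size _))// (@le_trans _ _ K%:R) ?ler_nat 1?ltnW// lerDl divr_ge0.
Qed.

Lemma harm_o (eps : R) : 0 < eps -> exists N0, forall N, (N0 <= N)%N -> harm N <= eps * N.+1%:R.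
Proof.
move=> e0; pose K := (Num.truncn (2 / eps)).+1.
have K0 : (0 : R) < K%:R by rewrite ltr0n.
have Ke : 2 / eps < K%:R by exact: truncnS_gt.
exists (Num.truncn (2 * K%:R / eps)) => N hN.
apply: (le_trans (harm_le N (isT : (0 < K)%N))).
have h1 : K%:R <= eps / 2 * N.+1%:R.
  rewrite -ler_pdivrMl ?divr_gt0// invf_div mulrAC -[leLHS]mulrA -[K%:R / _]mulrC mulrA ltW//.
  rewrite [_ / eps * K%:R]mulrAC (lt_le_trans (truncnS_gt _))// ler_nat ltnS//.
have h2 : N.+1%:R / K%:R <= eps / 2 * N.+1%:R.
  rewrite mulrC ler_wpM2r// -[leRHS]invrK lef_pV2 ?posrE ?invr_gt0 ?divr_gt0// invf_div.
  exact: ltW.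
lra.
Qed.

(** Each dyadic block contributes at least 1/2. *)
Lemma harm_pow k : k%:R / 2 <= harm (2 ^ k).-1.
Proof.
elim: k => [|k ih]; first by rewrite mul0r harm_ge0.
have p2 : (0 < 2 ^ k)%N by rewrite expn_gt0.
have hs n l : harm n + l%:R * (n + l).+1%:R^-1 <= harm (n + l)%N.
  elim: l => [|l ihl]; first by rewrite mul0r addr0 addn0.
  rewrite addnS harmS -natr1 mulrDl mul1r addrA lerD2r (le_trans _ ihl)// lerD2l ler_wpM2l//.
  by rewrite lef_pV2 ?posrE ?ltr0n// ler_nat.
have := hs (2 ^ k).-1 (2 ^ k)%N.
have -> : ((2 ^ k).-1 + 2 ^ k)%N = (2 ^ k.+1).-1.
  by rewrite expnS mul2n -addnn; case: (2 ^ k)%N p2.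
have -> : ((2 ^ k.+1).-1.+1)%N = (2 ^ k.+1)%N by rewrite prednK// expn_gt0.
have -> : (2 ^ k)%:R * (2 ^ k.+1)%:R^-1 = 2^-1 :> R.
  by rewrite expnS natrM invfM mulrCA mulfV ?mulr1// pnatr_eq0 -lt0n.
by rewrite -[k.+1%:R]natr1; lra.
Qed.

Lemma harm_mono N M : (N <= M)%N -> harm N <= harm M.
Proof.
move=> /subnKC <-; elim: (M - N)%N => [|l ih]; first by rewrite addn0.
by rewrite addnS harmS (le_trans ih)// lerDl invr_ge0.
Qed.

Lemma harm_infty (A : R) : exists N0, forall N, (N0 <= N)%N -> A <= harm N.
Proof.
exists (2 ^ (Num.truncn (2 * A)).+1)%N => N hN.
apply: (le_trans _ (harm_mono (leq_trans (leq_pred _) hN))).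
apply: (le_trans _ (harm_pow _)); have := truncnS_gt (2 * A); lra.
Qed.

(** The product D_N (1 + c H_N) is nonincreasing, because (1 - x)(h + x) <= h whenever h >= 1 and x
    >= 0; the divergence of H_N then forces D_N to 0. *)
Lemma prod_decay (D : nat -> R) (c : R) (N0 : nat) : 0 < c ->
  (forall N, 0 <= D N) -> (forall N, (N0 <= N)%N -> c / N.+2%:R <= 1 /\ D N.+1 <= (1 - c / N.+2%:R) * D N) ->
  forall eps : R, 0 < eps -> exists N1, forall N, (N1 <= N)%N -> D N <= eps.
Proof.
move=> c0 D0 hD eps e0.
have key N : (N0 <= N)%N -> D N * (1 + c * harm N) <= D N0 * (1 + c * harm N0).
  move=> /subnKC <-; elim: (N - N0)%N => [|l ih]; first by rewrite addn0.
  rewrite addnS; set k := (N0 + l)%N in ih *.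
  have [h1 h2] := hD k (leq_addr _ _).
  apply: (le_trans _ ih); rewrite harmS [c * (_ + _)]mulrDr addrA.
  set x := c / k.+2%:R in h1 h2 *; set H := 1 + c * harm k.
  have x0 : 0 <= x by rewrite divr_ge0// ltW.
  have H1 : 1 <= H by rewrite /H lerDl mulr_ge0 ?harm_ge0// ltW.
  have Hx : 0 <= H + x by lra.
  apply: (le_trans (ler_wpM2r Hx h2)).
  rewrite -mulrA mulrCA ler_wpM2l ?D0//; nra.
pose A := D N0 * (1 + c * harm N0) / (eps * c).
have [N1 hN1] := harm_infty A.
exists (maxn N0 N1) => N; rewrite geq_max => /andP[n0 n1].
have H0 : 0 < 1 + c * harm N by rewrite ltr_pwDl// mulr_ge0 ?harm_ge0// ltW.
rewrite -(ler_pM2r H0) (le_trans (key _ n0))//.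
have := hN1 _ n1; rewrite /A ler_pdivrMr ?mulr_gt0// => h.
by apply: (le_trans h); lra.
Qed.

End Harmonic.

Lemma affine_scale (F : fieldType) (m n p b : F) : n != 0 -> m != 0 ->
  m^-1 + n / m * (p * (b / n)) = (1 + b * p) / m.
Proof. by move=> n0 m0; field; rewrite n0 m0. Qed.

Lemma avg_arith (F : fieldType) (m e : F) : m != 0 -> m^-1 ^+ 2 * (m * (1 + m * e)) = m^-1 + e.
Proof. by move=> m0; field; rewrite m0. Qed.

Lemma decor_arith (R : realType) (n x2 x3 x4 z kap v : R) :
  n * x3 - 8 * kap * n - 32 * x4 <= x2 -> z <= 8 * kap + 32 * v ->
  (n + 1) * x3 - 8 * kap * (n + 1) - 32 * (x4 + v) <= x3 + x2 - z.
Proof. lra. Qed.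

(** * Mean, tail, decorrelation, uniform integrability and anticoncentration along the chain *)

Section ChainConsequences.
Variable R : realType.
Local Notation C := R[i].
Context (d : nat -> measure_display) (T : forall N, measurableType (d N))
  (P : forall N, probability (T N) R) (X : forall N, T N -> 'M[C]_N.+1).
Hypothesis hX : forall N, haar_SU_distributed (P N) (@X N).
Local Notation Sw := (@Sw R d T X _).
Local Notation qw := (@qw R d T X _).
Local Notation mw := (@mw R d T X _).
Local Notation bw w := (complex.Re (qw w)).

Let mwm N : cmeas (fun u : T N.+1 => mw u). Proof. exact: (@cmeas_mw R d T P X hX N). Qed.
Let mw1 N (u : T N.+1) : cmod (mw u) < 1. Proof. exact: corner_lt1. Qed.
Let mwr N (g : C -> R) : gmeas g -> forall z, cmod z = 1 ->
  Ex (P N.+1) (fun u => g (z * mw u)) = Ex (P N.+1) (fun u => g (mw u)).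
Proof. exact: (corner_rot (hX N.+1)). Qed.
Let mw2 N : Ex (P N.+1) (fun u => cmod (mw u) ^+ 2) = N.+2%:R^-1.
Proof. exact: (corner_sqr (hX N.+1)). Qed.
Let mw4 N : Ex (P N.+1) (fun u => cmod (mw u) ^+ 4) <= 2 / N.+2%:R ^+ 2.
Proof. exact: (corner_four (hX N.+1)). Qed.
Let mS N : measurable_fun setT (fun w : T N => Sw w). Proof. exact: measurable_Sw. Qed.
Let mq N : cmeas (fun w : T N => qw w). Proof. exact: cmeas_qw. Qed.
Let mb N : measurable_fun setT (fun w : T N => bw w). Proof. by case: (@mq N). Qed.
Lemma bw_ge1 N (w : T N) : 1 <= bw w. Proof. exact: Re_qx. Qed.

Lemma Re_qnext_ge1 (q x : C) : 1 <= complex.Re q -> cmod x < 1 -> 1 <= complex.Re (qnext q x).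
Proof.
by move=> q1 x1; rewrite Re_qnext lerDl mulr_ge0 ?ltW ?poi_gt0// (lt_le_trans ltr01).
Qed.

Lemma state0 (w : T 0) : qw w = 1 /\ Sw w = 0.
Proof.
have e : pA (X w) = 1 by rewrite /pA /rdet det_mx00.
have g : good 1 (pA (X w)).
  by rewrite e /good /lq derivC !hornerC mul0r mulr0 subr0 cmod1 ltr01 /= lexx.
by rewrite /qw /Sw /qx /Sx g e /lq derivC !hornerC mul0r mulr0 subr0 cmod1 ln1.
Qed.

Lemma measurable_ExU N (F : R -> C -> R) : smeas F -> (forall s q, 0 <= F s q) ->
  measurable_fun setT (fun w : T N => Ex (P N.+1) (fun u => F (Sw w + logk (mw u)) (qnext (qw w) (mw u)))).
Proof.
move=> mF F0.
have mS' : measurable_fun setT (EFin \o (fun wu : T N * T N.+1 =>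
    F (Sw wu.1 + logk (mw wu.2)) (qnext (qw wu.1) (mw wu.2)))).
  by apply/measurable_EFinP; exact: (smeas_step hX).
have h := @measurable_fun_fubini_tonelli_F _ _ _ _ R (P N.+1) _ mS' (fun x => _).
apply: (measurableT_comp (fine_measurable measurableT)).
by apply: h => x; rewrite lee_fin.
Qed.

Lemma eq_lee (x y : \bar R) : x = y -> (x <= y)%E.
Proof. by move=> ->. Qed.

Lemma chain_Ex N (F : R -> C -> R) (B : T N -> R) : smeas F -> (forall s q, 0 <= F s q) ->
  (forall w : T N, intg (P N.+1) (fun u => F (Sw w + logk (mw u)) (qnext (qw w) (mw u)))) ->
  (forall w : T N, Ex (P N.+1) (fun u => F (Sw w + logk (mw u)) (qnext (qw w) (mw u))) <= B w) ->
  intg (P N) B ->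
  [/\ intg (P N.+1) (fun u => F (Sw u) (qw u)),
     intg (P N) (fun w : T N => Ex (P N.+1) (fun u => F (Sw w + logk (mw u)) (qnext (qw w) (mw u)))) &
     Ex (P N.+1) (fun u => F (Sw u) (qw u)) =
     Ex (P N) (fun w : T N => Ex (P N.+1) (fun u => F (Sw w + logk (mw u)) (qnext (qw w) (mw u))))].
Proof.
move=> mF F0 iu EB iB.
have i1 : intg (P N) (fun w : T N => Ex (P N.+1) (fun u => F (Sw w + logk (mw u)) (qnext (qw w) (mw u)))).
  apply: (intg_le _ iB); first exact: measurable_ExU.
  by move=> w; rewrite ger0_norm ?EB//; apply: Ex_ge0.
have e : (\int[P N.+1]_u (F (Sw u) (qw u))%:E =
   (Ex (P N) (fun w : T N => Ex (P N.+1) (fun u => F (Sw w + logk (mw u)) (qnext (qw w) (mw u)))))%:E)%E.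
  rewrite (chain_ge0 hX N mF F0) EFin_Ex//; apply: eq_integral => w _.
  by rewrite -EFin_Ex.
have i2 : intg (P N.+1) (fun u => F (Sw u) (qw u)).
  apply: (@intg_ge0 _ _ _ (P N.+1) _ _ _ _ (eq_lee e)) => //.
  - by apply: mF => //; exact: mq.
  - by rewrite ltry.
split => //.
by apply: (@EFin_inj R); rewrite EFin_Ex.
Qed.

(** Adding the constant c reduces a bounded functional to a nonnegative one. *)
Lemma chain_bdd N (F : R -> C -> R) (c : R) : smeas F -> (forall s q, `|F s q| <= c) ->
  Ex (P N.+1) (fun u => F (Sw u) (qw u)) =
     Ex (P N) (fun w : T N => Ex (P N.+1) (fun u => F (Sw w + logk (mw u)) (qnext (qw w) (mw u)))) /\
  intg (P N) (fun w : T N => Ex (P N.+1) (fun u => F (Sw w + logk (mw u)) (qnext (qw w) (mw u)))).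
Proof.
move=> mF Fc.
have iu (w : T N) : intg (P N.+1) (fun u => F (Sw w + logk (mw u)) (qnext (qw w) (mw u))).
  apply: (@intg_bdd _ _ _ _ _ c) => //; apply: mF.
    by apply: measurable_funD; [exact: measurable_cst|exact: gmeas_logk].
  by apply: cmeas_qnext => //; exact: cmeas_cst.
have iF : intg (P N.+1) (fun u => F (Sw u) (qw u)).
  by apply: (@intg_bdd _ _ _ _ _ c) => //; apply: mF.
pose G s q := c + F s q.
have mG : smeas G by move=> d' T' f g mf mg; apply: measurable_funD; [exact: measurable_cst|exact: mF].
have G0 s q : 0 <= G s q by have := Fc s q; rewrite ler_norml /G => /andP[]; lra.
have E1 (w : T N) : Ex (P N.+1) (fun u => G (Sw w + logk (mw u)) (qnext (qw w) (mw u))) =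
   c + Ex (P N.+1) (fun u => F (Sw w + logk (mw u)) (qnext (qw w) (mw u))).
  by rewrite /G ExD ?Ex_cst//; exact: intg_cst.
have [w|w||i1 i2 e] := @chain_Ex N G (fun=> 2 * c) mG G0.
- by apply: intgD => //; exact: intg_cst.
- rewrite E1; suff : Ex (P N.+1) (fun u => F (Sw w + logk (mw u)) (qnext (qw w) (mw u))) <= c by lra.
  rewrite -[leRHS](Ex_cst (P N.+1)); apply: Ex_le => //; first exact: intg_cst.
  by move=> u; rewrite (le_trans (ler_norm _)).
- exact: intg_cst.
have i3 : intg (P N) (fun w : T N => Ex (P N.+1) (fun u => F (Sw w + logk (mw u)) (qnext (qw w) (mw u)))).
  rewrite (_ : (fun w => _) = fun w => Ex (P N.+1) (fun u => G (Sw w + logk (mw u)) (qnext (qw w) (mw u))) - c).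
    by apply: intgB => //; exact: intg_cst.
  by apply/funext => w; rewrite E1 addrAC subrr add0r.
split => //; apply: (addrI c).
have <- : Ex (P N.+1) (fun u => G (Sw u) (qw u)) = c + Ex (P N.+1) (fun u => F (Sw u) (qw u)).
  by rewrite /G ExD ?Ex_cst//; exact: intg_cst.
by rewrite e (eq_Ex _ E1) ExD ?Ex_cst//; exact: intg_cst.
Qed.

(** The absolute value makes the functional nonnegative on the whole plane; on states it is Re q. *)
Lemma smeas_Re : @smeas R (fun (_ : R) (q : C) => `|complex.Re q|).
Proof. by move=> d' T' f g mf [mg _]; apply: measurableT_comp. Qed.

(** The Poisson kernel has mean at most 1, so each step adds at most 1. *)
Lemma Ex_b N : intg (P N) (fun w => bw w) /\ Ex (P N) (fun w => bw w) <= N.+1%:R.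
Proof.
elim: N => [|N [ib Eb]].
  have e : (fun w : T 0 => bw w) = fun=> 1 by apply/funext => w; have [-> _] := state0 w.
  by rewrite e Ex_cst; split => //; exact: intg_cst.
have [ip Ep] := intg_poi (@mwm N) (@mw1 N) (@mwr N).
have iu (w : T N) : intg (P N.+1) (fun u => 1 + bw w * poi (mw u)).
  by apply: intgD; [exact: intg_cst|exact: intgZ].
have Eu (w : T N) : Ex (P N.+1) (fun u => `|complex.Re (qnext (qw w) (mw u))|) =
    Ex (P N.+1) (fun u => 1 + bw w * poi (mw u)).
  apply: eq_Ex => u; rewrite ger0_norm ?Re_qnext//.
  by rewrite -Re_qnext (le_trans ler01)// Re_qnext_ge1// bw_ge1.
have Ele (w : T N) : Ex (P N.+1) (fun u => 1 + bw w * poi (mw u)) <= 1 + bw w.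
  rewrite ExD ?Ex_cst ?ExZ//; [|exact: intg_cst|exact: intgZ].
  by rewrite lerD2l ler_piMr// (le_trans ler01)// bw_ge1.
have [w|w||i1 i2 e] := @chain_Ex N _ (fun w => 1 + bw w) smeas_Re (fun _ _ => normr_ge0 _).
- apply: (intg_le _ (iu w)).
    have [h _] : cmeas (fun u : T N.+1 => qnext (qw w) (mw u)) by apply: cmeas_qnext => //; exact: cmeas_cst.
    exact: measurableT_comp.
  move=> u; rewrite normr_id -Re_qnext ger0_norm//.
  by rewrite (le_trans ler01)// Re_qnext_ge1// bw_ge1.
- by rewrite Eu.
- by apply: intgD => //; exact: intg_cst.
have bE : (fun u : T N.+1 => `|bw u|) = fun u => bw u.
  by apply/funext => u; rewrite ger0_norm// (le_trans ler01)// bw_ge1.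
rewrite bE in i1 e; split => //; rewrite e.
apply: (@le_trans _ _ (Ex (P N) (fun w => 1 + bw w))).
  by apply: Ex_le => //; [apply: intgD => //; exact: intg_cst|move=> w; rewrite Eu].
by rewrite ExD ?Ex_cst//; [rewrite -[N.+2%:R]natr1 addrC lerD2r|exact: intg_cst].
Qed.

Lemma Re_inv_pos (s : R) (q : C) : 0 < s -> 0 <= complex.Re q ->
  0 <= complex.Re ((s%:C%C + q)^-1) /\ complex.Re ((s%:C%C + q)^-1) <= s^-1.
Proof.
move=> s0 q0; have zr : s <= complex.Re (s%:C%C + q) by rewrite RecD /= lerDl.
split; first by apply: Re_inv_ge0; exact: le_trans (ltW s0) zr.
rewrite (le_trans (ler_norm _))// (le_trans (Re_le_cmod _))// cmodV lef_pV2 ?posrE//.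
  by rewrite (le_trans zr)// (le_trans (ler_norm _))// Re_le_cmod.
rewrite cmod_gt0; apply/eqP => z0; move: zr; rewrite z0 /=; lra.
Qed.

Lemma cmeas_sq d' (T' : measurableType d') (s : R) (g : T' -> C) : cmeas g ->
  measurable_fun setT (fun x => complex.Re ((s%:C%C + g x)^-1)).
Proof.
move=> mg; have [] // : cmeas (fun x => (s%:C%C + g x)^-1).
by apply: cmeasV; apply: cmeasD => //; exact: cmeas_cst.
Qed.

Lemma intg_Re_inv N (s : R) : 0 < s -> intg (P N) (fun w => complex.Re ((s%:C%C + qw w)^-1)).
Proof.
move=> s0; apply: (@intg_bdd _ _ _ _ _ s^-1); first exact: cmeas_sq.
move=> w; have [h1 h2] := Re_inv_pos s0 (le_trans ler01 (bw_ge1 w)).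
by rewrite ger0_norm.
Qed.

(** By [Ex_Re_inv], one step with parameter s dominates the previous level with parameter s + 1, the
    1 coming from [qnext]. Descending to order 1, where q = 1, leaves 1 / (N + 1 + s). *)
Lemma Ex_Re_inv_ge N (s : R) : 0 < s ->
  (N.+1%:R + s)^-1 <= Ex (P N) (fun w => complex.Re ((s%:C%C + qw w)^-1)).
Proof.
elim: N s => [|N ih] s s0.
  rewrite (_ : (fun w : T 0 => _) = fun=> (1 + s)^-1); first by rewrite Ex_cst.
  apply/funext => w; have [-> _] := state0 w.
  have -> : s%:C%C + 1 = (1 + s)%:C%C :> C by rewrite rmorphD rmorph1 addrC.
  by rewrite -fmorphV.
have s1 : 0 < s + 1 by lra.
(* Made bounded and nonnegative for every q; on states it is Re 1/(s + q). *)
pose F (_ : R) (q : C) := Num.min s^-1 `|complex.Re ((s%:C%C + q)^-1)|.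
have FE q : 0 <= complex.Re q -> forall t, F t q = complex.Re ((s%:C%C + q)^-1).
  move=> q0 t; have [h1 h2] := Re_inv_pos s0 q0.
  by rewrite /F ger0_norm// min_r.
have mF : smeas F.
  move=> d' T' f g _ mg; apply: measurable_minr; first exact: measurable_cst.
  by apply: measurableT_comp => //; exact: cmeas_sq.
have Fb t q : `|F t q| <= s^-1.
  rewrite ger0_norm; first by rewrite ge_min lexx.
  by rewrite le_min invr_ge0 (ltW s0)/=.
have [e i1] := @chain_bdd N F s^-1 mF Fb.
have -> : Ex (P N.+1) (fun w => complex.Re ((s%:C%C + qw w)^-1)) =
   Ex (P N.+1) (fun w => F (Sw w) (qw w)).
  by apply: eq_Ex => w; rewrite FE// (le_trans ler01)// bw_ge1.
rewrite e.
have -> : N.+2%:R + s = N.+1%:R + (s + 1) by rewrite -[N.+2%:R]natr1; ring.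
apply: (le_trans (ih _ s1)); apply: Ex_le => //; first exact: intg_Re_inv.
move=> w; have b1 := bw_ge1 w.
have b0 : 0 < bw w by lra.
have := Ex_Re_inv (@mwm N) (@mw1 N) (@mwr N) (complex.Im (qw w)) s1 b0.
have -> : ((s + 1 + bw w) +i* complex.Im (qw w))%C = (s + 1)%:C%C + qw w :> C.
  by apply: complexP; rewrite ?RecD ?ImcD /= ?add0r.
move=> /le_trans; apply; rewrite le_eqVlt; apply/orP; left; apply/eqP; apply: eq_Ex => u.
rewrite FE; last by rewrite (le_trans ler01)// Re_qnext_ge1.
congr (complex.Re (_^-1)); rewrite /qnext rmorphD rmorph1 !addrA.
by [].
Qed.

(** If |q| >= s then |s + q|^2 >= 2 s (s + Re q), so 1 - s Re 1/(s + q) is at least 1/2 there and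
    nonnegative everywhere. The resolvent is used because the mean of Re q says nothing about Im
    q. *)
Lemma q_tail N (s : R) : 0 < s ->
  intg (P N) (fun w => (s <= cmod (qw w))%R%:R) /\
  Ex (P N) (fun w => (s <= cmod (qw w))%R%:R) <= 2 * (N.+1%:R / (N.+1%:R + s)).
Proof.
move=> s0.
have i1 : intg (P N) (fun w => (s <= cmod (qw w))%R%:R).
  apply: (@intg_bdd _ _ _ _ _ 1); last by move=> w; exact: norm_natb_le1.
  by apply: measurable_ind_le; [exact: measurable_cst|exact: measurable_cmod].
split => //.
have h := Ex_Re_inv_ge N s0.
have i2 := intg_Re_inv N s0.
have Ns : 0 < N.+1%:R + s :> R by rewrite addr_gt0.
apply: (@le_trans _ _ (2 * (1 - s * Ex (P N) (fun w => complex.Re ((s%:C%C + qw w)^-1))))); last first.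
  rewrite ler_wpM2l//; have -> : N.+1%:R / (N.+1%:R + s) = 1 - s * (N.+1%:R + s)^-1 :> R.
    by move: (N.+1%:R : R) Ns => n Ns; field; rewrite lt0r_neq0.
  by rewrite lerD2l lerN2 ler_wpM2l// ltW.
have -> : 2 * (1 - s * Ex (P N) (fun w => complex.Re ((s%:C%C + qw w)^-1))) =
   Ex (P N) (fun w => 2 * (1 - s * complex.Re ((s%:C%C + qw w)^-1))).
  rewrite ExZ; last by apply: intg_cstB; exact: intgZ.
  by rewrite Ex_cstB ?ExZ//; exact: intgZ.
apply: Ex_le => //; first by apply: intgZ; apply: intg_cstB; exact: intgZ.
  move=> w; have b1 := bw_ge1 w.
  rewrite -[_^-1]mul1r Rec_div /= mul1r mul0r addr0 RecD /=.
  have zE : cmod (s%:C%C + qw w) ^+ 2 = (s + bw w) ^+ 2 + complex.Im (qw w) ^+ 2.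
    by rewrite cmod_sqr RecD ImcD /= add0r.
  have z0 : 0 < cmod (s%:C%C + qw w) ^+ 2.
    by rewrite zE ltr_pwDl ?sqr_ge0// exprn_gt0//; lra.
  have y0 := sqr_ge0 (complex.Im (qw w)).
  case: (leP s (cmod (qw w))) => hs /=.
    have : s ^+ 2 <= bw w ^+ 2 + complex.Im (qw w) ^+ 2.
      by rewrite -cmod_sqr ler_sqr ?nnegrE ?cmod_ge0// ltW.
    move=> h2; suff : s * ((s + bw w) / cmod (s%:C%C + qw w) ^+ 2) <= 2^-1 by lra.
    rewrite mulrA ler_pdivrMr// zE; nra.
  rewrite mulr_ge0// subr_ge0 mulrA ler_pdivrMr// mul1r zE; nra.
Qed.

Lemma lip_measurable (g : R -> R) (kap : R) : 0 <= kap ->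
  (forall x y, `|g x - g y| <= kap * `|x - y|) -> measurable_fun setT g.
Proof.
move=> k0 gL; apply: continuous_measurable_fun => x.
apply/cvgrPdist_le => /= e e0; near=> y.
apply: (le_trans (gL x y)).
apply: (@le_trans _ _ ((kap + 1) * `|x - y|)); first by rewrite ler_wpM2r// lerDl.
rewrite mulrC -ler_pdivlMr; last by rewrite ltr_wpDl.
near: y; apply: cvgr_dist_le => //; rewrite divr_gt0// ltr_wpDl//.
Unshelve. all: by end_near. Qed.

(** Induction on N for all g at once: averaging g over one increment keeps its range and its
    Lipschitz constant, so the induction hypothesis applies to the average. *)
Lemma decorrelation N (g : R -> R) (kap : R) : 0 <= kap ->
  (forall x, 0 <= g x <= 1) -> (forall x y, `|g x - g y| <= kap * `|x - y|) ->
  [/\ intg (P N) (fun w => g (Sw w)), intg (P N) (fun w => bw w * g (Sw w)) &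
  N.+1%:R * Ex (P N) (fun w => g (Sw w)) - 8 * kap * N.+1%:R - 32 * harm R N <=
  Ex (P N) (fun w => bw w * g (Sw w))].
Proof.
elim: N g => [|N ih] g k0 g01 gL; have mg := lip_measurable k0 gL.
  have gb x : `|g x| <= 1 by have /andP[g0 g1] := g01 x; rewrite ger0_norm.
  have e : (fun w : T 0 => bw w * g (Sw w)) = fun w => g (Sw w).
    by apply/funext => w; have [-> _] := state0 w; rewrite mul1r.
  have i1 : intg (P 0) (fun w : T 0 => g (Sw w)).
    by apply: (@intg_bdd _ _ _ _ _ 1) => //; exact: measurableT_comp.
  rewrite e mul1r; split => //.
  by have := harm_ge0 R 0; lra.
have gb x : `|g x| <= 1 by have /andP[g0 g1] := g01 x; rewrite ger0_norm.
have [ib Eb] := Ex_b N.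
pose g' s := Ex (P N.+1) (fun u => g (s + logk (mw u))).
have mL : measurable_fun setT (fun u : T N.+1 => logk (mw u)) by exact: gmeas_logk.
have ig s : intg (P N.+1) (fun u => g (s + logk (mw u))).
  apply: (@intg_bdd _ _ _ _ _ 1) => //; apply: (measurableT_comp mg).
  by apply: measurable_funD => //; exact: measurable_cst.
have g'01 s : 0 <= g' s <= 1.
  apply/andP; split; first by apply: Ex_ge0 => u; have /andP[] := g01 (s + logk (mw u)).
  rewrite -[leRHS](Ex_cst (P N.+1)); apply: Ex_le => //; first exact: intg_cst.
  by move=> u; have /andP[] := g01 (s + logk (mw u)).
have g'L x y : `|g' x - g' y| <= kap * `|x - y|.
  rewrite -ExB// (le_trans (Ex_norm (intgB (ig x) (ig y))))//.
  rewrite -[leRHS](Ex_cst (P N.+1)); apply: Ex_le => //; [|exact: intg_cst|].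
    by apply: intg_norm; exact: intgB.
  move=> u; rewrite (le_trans (gL _ _))// ler_wpM2l//.
  by rewrite (_ : x + _ - _ = x - y)//; ring.
have [ig' ibg' hN] := ih g' k0 g'01 g'L.
have mF1 : smeas (fun s (_ : C) => g s) by move=> d' T' f q mf _; exact: measurableT_comp.
have [e1 _] := @chain_bdd N _ 1 mF1 (fun s _ => gb s).
rewrite -[X in _ = X]/(Ex (P N) (fun w => g' (Sw w))) in e1.
have ig1 : intg (P N.+1) (fun w => g (Sw w)).
  by apply: (@intg_bdd _ _ _ _ _ 1) => //; exact: measurableT_comp.
pose F s (q : C) := `|complex.Re q| * g s.
have mF : smeas F.
  move=> d' T' f q mf mq'; apply: measurable_funM; last exact: measurableT_comp.
  by apply: measurableT_comp => //; case: mq'.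
have F0 s q : 0 <= F s q by rewrite mulr_ge0//; have /andP[] := g01 s.
have FE (w : T N) (u : T N.+1) : F (Sw w + logk (mw u)) (qnext (qw w) (mw u)) =
    g (Sw w + logk (mw u)) + bw w * (poi (mw u) * g (Sw w + logk (mw u))).
  rewrite /F ger0_norm; last by rewrite (le_trans ler01)// Re_qnext_ge1// bw_ge1.
  by rewrite Re_qnext; ring.
have dec s := @Ex_poi_decor _ _ _ _ _ _ (@mwm N) (@mw1 N) (@mwr N) (@mw2 N) (@mw4 N) g kap s k0 mg g01 gL.
have [ip Ep] := intg_poi (@mwm N) (@mw1 N) (@mwr N).
have Enext (w : T N) : Ex (P N.+1) (fun u => F (Sw w + logk (mw u)) (qnext (qw w) (mw u))) =
   g' (Sw w) + bw w * Ex (P N.+1) (fun u => poi (mw u) * g (Sw w + logk (mw u))).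
  have [j1 j2 _] := dec (Sw w).
  rewrite (eq_Ex _ (FE w)) ExD//; last exact: intgZ.
  by rewrite ExZ.
have [w|w||i1 i2 e] := @chain_Ex N F (fun w => 1 + bw w) mF F0.
- have [j1 j2 _] := dec (Sw w).
  rewrite (_ : (fun u => _) = fun u => g (Sw w + logk (mw u)) + bw w * (poi (mw u) * g (Sw w + logk (mw u)))).
    by apply: intgD => //; exact: intgZ.
  by apply/funext => u; exact: FE.
- have [j1 j2 _] := dec (Sw w).
  rewrite Enext lerD//; first by have /andP[] := g'01 (Sw w).
  rewrite ler_piMr//; first by rewrite (le_trans ler01)// bw_ge1.
  apply: (le_trans _ Ep); apply: Ex_le => // u.
  have p0 := ltW (poi_gt0 (mw1 u)); have /andP[_ g1] := g01 (Sw w + logk (mw u)).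
  by rewrite ler_piMr.
- by apply: intgD => //; exact: intg_cst.
have bE : (fun u : T N.+1 => F (Sw u) (qw u)) = fun u => bw u * g (Sw u).
  by apply/funext => u; rewrite /F ger0_norm// (le_trans ler01)// bw_ge1.
rewrite bE in i1 e; split => //; rewrite e e1.
set m : R := N.+2%:R.
have m0 : 0 < m by rewrite ltr0n.
(* The loss of one step per unit of Re q. As the mean of Re q is at most m, a step costs 8 kap + 32
   / m, and the second part sums to the harmonic number. *)
pose c := 8 * kap / m + 32 / m ^+ 2.
have c0 : 0 <= c by rewrite addr_ge0// divr_ge0 ?sqr_ge0 ?(ltW m0)// mulr_ge0.
have low : Ex (P N) (fun w => g' (Sw w) + bw w * g' (Sw w) - c * bw w) <=
   Ex (P N) (fun w => Ex (P N.+1) (fun u => F (Sw w + logk (mw u)) (qnext (qw w) (mw u)))).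
  apply: Ex_le => //; first by apply: intgB; [exact: intgD|exact: intgZ].
  move=> w; rewrite Enext; have [_ _ hd] := dec (Sw w).
  rewrite -/m -/(g' (Sw w)) in hd.
  have b0 : 0 <= bw w by rewrite (le_trans ler01)// bw_ge1.
  have := ler_wpM2l b0 hd; rewrite /c; move: (8 * kap / m) (32 / m ^+ 2) => x y.
  lra.
apply: (le_trans _ low); rewrite ExB//; [|exact: intgD|exact: intgZ].
rewrite ExD// ExZ// harmS.
have cE : c * Ex (P N) (fun w => bw w) <= 8 * kap + 32 * m^-1.
  have mE : Ex (P N) (fun w => bw w) <= m by rewrite (le_trans Eb)// ler_nat.
  apply: (le_trans (ler_wpM2l c0 mE)).
  by rewrite /c le_eqVlt; apply/orP; left; apply/eqP; field; rewrite lt0r_neq0.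
move: hN cE; rewrite -/m -[m]natr1 -/m.
move: (Ex _ _) (Ex _ _) (Ex _ _) (harm R N) => x1 x2 x3 x4.
exact: decor_arith.
Qed.

(** At the new order m the ratio Re q / m is a convex combination of 1, where [xlogx] vanishes, and
    of the Poisson kernel times the old ratio. By convexity m E xlogx grows by at most 48 + 32 (2 +
    ln Lam) / m per step. *)
Lemma xlogx_bound N (Lam : R) : 1 <= Lam ->
  intg (P N) (fun w => xlogx Lam (bw w / N.+1%:R)) /\
  N.+1%:R * Ex (P N) (fun w => xlogx Lam (bw w / N.+1%:R)) <=
  48 * N.+1%:R + 32 * (2 + ln Lam) * harm R N.
Proof.
move=> L1; have L0 : 0 < Lam by rewrite (lt_le_trans _ L1).
have l0 : 0 <= ln Lam by rewrite ln_ge0.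
elim: N => [|N [ix ih]].
  rewrite (_ : (fun w : T 0 => _) = fun=> 0); last first.
    by apply/funext => w; have [-> _] := state0 w; rewrite /= divr1 xlogx1.
  rewrite Ex_cst mulr0; split; first exact: intg_cst.
  by rewrite addr_ge0// !mulr_ge0 ?harm_ge0//; lra.
have [ib Eb] := Ex_b N.
set m : R := N.+2%:R; have m0 : 0 < m by rewrite ltr0n.
have n0 : 0 < N.+1%:R :> R by rewrite ltr0n.
have mn : m = N.+1%:R + 1 by rewrite /m natr1.
(* [xlogx] is at least -1, so adding 1 makes it nonnegative on states. *)
pose F (_ : R) (q : C) := `|xlogx Lam (complex.Re q / m) + 1|.
have mF : smeas F.
  move=> d' T' f q _ [mq' _]; apply: measurableT_comp => //.
  apply: measurable_funD; last exact: measurable_cst.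
  apply: (measurableT_comp (measurable_xlogx Lam)).
  by apply: measurable_funM => //; exact: measurable_cst.
have FE t q : 0 < complex.Re q -> F t q = xlogx Lam (complex.Re q / m) + 1.
  move=> q0; rewrite /F ger0_norm//.
  by have := @xlogx_geN1 _ Lam (complex.Re q / m) L1 (divr_gt0 q0 m0); lra.
pose y (w : T N) := bw w / N.+1%:R.
have y0 w : 0 < y w by rewrite divr_gt0// (lt_le_trans ltr01)// bw_ge1.
have xm w := @Ex_xlogx_mul _ _ _ _ _ _ (@mwm N) (@mw1 N) (@mwr N) (@mw2 N) (@mw4 N) _ _ L1 (y0 w).
have Fle (w : T N) (u : T N.+1) : F (Sw w + logk (mw u)) (qnext (qw w) (mw u)) <=
    1 + N.+1%:R / m * xlogx Lam (poi (mw u) * y w).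
  rewrite FE; last by rewrite (lt_le_trans ltr01)// Re_qnext_ge1// bw_ge1.
  have py0 : 0 < poi (mw u) * y w by rewrite mulr_gt0// poi_gt0.
  have t01 : 0 <= m^-1 <= 1 by rewrite invr_ge0 ltW//= invf_le1// mn lerDr ltW.
  have := xlogx_conv L0 ltr01 py0 t01; rewrite xlogx1// mulr0 add0r mulr1.
  have -> : 1 - m^-1 = N.+1%:R / m by rewrite -[N.+1%:R](addrK 1) -mn mulrBl mulfV ?lt0r_neq0// mul1r.
  have -> : m^-1 + N.+1%:R / m * (poi (mw u) * y w) = complex.Re (qnext (qw w) (mw u)) / m.
    by rewrite Re_qnext /y affine_scale// lt0r_neq0.
  by move=> ?; rewrite addrC lerD2l.
have iFu (w : T N) : intg (P N.+1) (fun u => 1 + N.+1%:R / m * xlogx Lam (poi (mw u) * y w)).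
  by have [j _] := xm w; apply: intgD; [exact: intg_cst|exact: intgZ].
pose B (w : T N) := 1 + N.+1%:R / m * (xlogx Lam (y w) + 48 / m * y w +
     32 / m ^+ 2 * (1 + (1 + ln Lam) * y w)).
have F0 t q : 0 <= F t q by exact: normr_ge0.
have iFF (w : T N) : intg (P N.+1) (fun u => F (Sw w + logk (mw u)) (qnext (qw w) (mw u))).
  apply: (intg_le _ (iFu w)); last by move=> u; rewrite ger0_norm.
  apply: mF; first by apply: measurable_funD; [exact: measurable_cst|exact: gmeas_logk].
  by apply: cmeas_qnext => //; exact: cmeas_cst.
have iy : intg (P N) y.
  rewrite (_ : y = fun w => N.+1%:R^-1 * bw w); first exact: intgZ.
  by apply/funext => w; rewrite /y mulrC.
have Ey : Ex (P N) y <= 1.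
  rewrite (_ : y = fun w => N.+1%:R^-1 * bw w); last by apply/funext => w; rewrite /y mulrC.
  by rewrite ExZ// ler_pdivrMl// mulr1.
have iB : intg (P N) B.
  apply: intgD; first exact: intg_cst.
  apply: intgZ; apply: intgD; first by apply: intgD => //; exact: intgZ.
  by apply: intgZ; apply: intgD; [exact: intg_cst|exact: intgZ].
have [w||i1 i2 e] := @chain_Ex N F B mF F0 iFF.
- have [j1 j2] := xm w.
  apply: (@le_trans _ _ (Ex (P N.+1) (fun u => 1 + N.+1%:R / m * xlogx Lam (poi (mw u) * y w)))).
    by apply: Ex_le.
  rewrite ExD ?Ex_cst ?ExZ//; [|exact: intg_cst|exact: intgZ].
  by rewrite /B lerD2l ler_wpM2l// divr_ge0// ltW.
- exact: iB.
have bE : (fun u : T N.+1 => F (Sw u) (qw u)) = fun u => xlogx Lam (bw u / m) + 1.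
  by apply/funext => u; rewrite FE// (lt_le_trans ltr01)// bw_ge1.
rewrite bE in i1 e.
have ix' : intg (P N.+1) (fun u => xlogx Lam (bw u / m)).
  rewrite (_ : (fun u => _) = fun u => (xlogx Lam (bw u / m) + 1) - 1).
    by apply: intgB => //; exact: intg_cst.
  by apply/funext => u; ring.
split => //.
have EB : Ex (P N.+1) (fun u => xlogx Lam (bw u / m)) + 1 <= Ex (P N) B.
  have <- : Ex (P N.+1) (fun u => xlogx Lam (bw u / m) + 1) =
     Ex (P N.+1) (fun u => xlogx Lam (bw u / m)) + 1.
    by rewrite ExD ?Ex_cst//; exact: intg_cst.
  rewrite e; apply: Ex_le => // w; have [j1 j2] := xm w.
  apply: (@le_trans _ _ (Ex (P N.+1) (fun u => 1 + N.+1%:R / m * xlogx Lam (poi (mw u) * y w)))).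
    by apply: Ex_le.
  rewrite ExD ?Ex_cst ?ExZ//; [|exact: intg_cst|exact: intgZ].
  by rewrite /B lerD2l ler_wpM2l// divr_ge0// ltW.
have EBE : Ex (P N) B = 1 + N.+1%:R / m * (Ex (P N) (fun w => xlogx Lam (y w)) + 48 / m * Ex (P N) y +
     32 / m ^+ 2 * (1 + (1 + ln Lam) * Ex (P N) y)).
  have k1 : intg (P N) (fun w => 1 + (1 + ln Lam) * y w) by apply: intgD; [exact: intg_cst|exact: intgZ].
  have k2 : intg (P N) (fun w => xlogx Lam (y w) + 48 / m * y w) by apply: intgD => //; exact: intgZ.
  rewrite /B ExD ?Ex_cst//; [|exact: intg_cst|by apply: intgZ; apply: intgD => //; exact: intgZ].
  rewrite ExZ; last by apply: intgD => //; exact: intgZ.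
  rewrite ExD//; last exact: intgZ.
  rewrite ExD//; last exact: intgZ.
  rewrite (ExZ _ iy) (ExZ _ k1).
  have -> : Ex (P N) (fun w => 1 + (1 + ln Lam) * y w) = 1 + (1 + ln Lam) * Ex (P N) y; last by [].
  by rewrite ExD ?Ex_cst ?ExZ//; [exact: intg_cst|exact: intgZ].
rewrite -/y in ih.
have step : m * Ex (P N.+1) (fun u => xlogx Lam (bw u / m)) <=
   N.+1%:R * (Ex (P N) (fun w => xlogx Lam (y w)) + 48 / m + 32 / m ^+ 2 * (2 + ln Lam)).
  have EB' : Ex (P N.+1) (fun u => xlogx Lam (bw u / m)) <= Ex (P N) B - 1 by rewrite lerBrDr.
  apply: (le_trans (ler_wpM2l (ltW m0) EB')).
  rewrite EBE addrAC subrr add0r mulrA mulrCA mulfV ?mulr1 ?lt0r_neq0//.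
  rewrite ler_wpM2l ?(ltW n0)// -!addrA lerD2l lerD//.
    by rewrite ler_piMr// divr_ge0// ltW.
  rewrite ler_wpM2l ?divr_ge0 ?sqr_ge0//.
  have : (1 + ln Lam) * Ex (P N) y <= 1 + ln Lam by rewrite ler_piMr//; lra.
  lra.
rewrite -/m harmS -/m; apply: (le_trans step).
have nm : N.+1%:R / m <= 1 by rewrite ler_pdivrMr// mul1r mn lerDl.
have h1 : N.+1%:R * (48 / m) <= 48.
  rewrite mulrCA ler_piMr//.
have h2 : N.+1%:R * (32 / m ^+ 2 * (2 + ln Lam)) <= 32 * (2 + ln Lam) * m^-1.
  have -> : N.+1%:R * (32 / m ^+ 2 * (2 + ln Lam)) = (32 * (2 + ln Lam) * m^-1) * (N.+1%:R / m).
    by rewrite expr2 invfM; move: (N.+1%:R : R) (m^-1) => n v; ring.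
  rewrite ler_piMr// !mulr_ge0// ?invr_ge0 ?(ltW m0)//; lra.
have h3 : 48 * m = 48 * N.+1%:R + 48 by rewrite mn; ring.
rewrite h3 mulrDr [X in _ <= _ + X]mulrDr [X in X + _ <= _]mulrDr.
by rewrite -addrA [leRHS]addrACA; exact: (lerD ih (lerD h1 h2)).
Qed.

(** [xlogx_excess] multiplied by the order; 49 is the 48 of [xlogx_bound] plus the 1 added to
    [xlogx]. *)
Lemma b_excess N (Lam : R) : 1 < Lam ->
  intg (P N) (fun w => Num.max 0 (bw w - Lam * N.+1%:R)) /\
  Ex (P N) (fun w => Num.max 0 (bw w - Lam * N.+1%:R)) * ln Lam <=
  49 * N.+1%:R + 32 * (2 + ln Lam) * harm R N.
Proof.
move=> L1; have L1' := ltW L1.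
have l0 : 0 < ln Lam by rewrite ln_gt0.
have n0 : 0 < N.+1%:R :> R by rewrite ltr0n.
have [ib Eb] := Ex_b N; have [ix hx] := @xlogx_bound N Lam L1'.
have i1 : intg (P N) (fun w => Num.max 0 (bw w - Lam * N.+1%:R)).
  apply: (intg_le _ ib).
    apply: measurable_maxr; first exact: measurable_cst.
    by apply: measurable_funB => //; exact: measurable_cst.
  move=> w; have b1 := bw_ge1 w; rewrite ger0_norm ?le_max ?lexx//.
  rewrite ge_max; apply/andP; split; first by lra.
  by rewrite lerBlDr lerDl mulr_ge0//; lra.
split => //.
apply: (@le_trans _ _ (N.+1%:R * (Ex (P N) (fun w => xlogx Lam (bw w / N.+1%:R)) + 1))); last first.
  by rewrite mulrDr mulr1; lra.
have <- : Ex (P N) (fun w => xlogx Lam (bw w / N.+1%:R) + 1) =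
     Ex (P N) (fun w => xlogx Lam (bw w / N.+1%:R)) + 1.
  by rewrite ExD ?Ex_cst//; exact: intg_cst.
rewrite mulrC -!ExZ//; last by apply: intgD => //; exact: intg_cst.
apply: Ex_le; [exact: intgZ|by apply: intgZ; apply: intgD => //; exact: intg_cst|].
move=> w; have y0 : 0 < bw w / N.+1%:R by rewrite divr_gt0// (lt_le_trans ltr01)// bw_ge1.
have := ler_wpM2l (ltW n0) (xlogx_excess L1' y0); apply: le_trans.
rewrite mulrA mulrC ler_wpM2r ?(ltW l0)//.
rewrite maxr_pMr ?(ltW n0)// mulr0 mulrBr mulrCA mulfV ?mulr1 ?lt0r_neq0//.
by rewrite [N.+1%:R * Lam]mulrC.
Qed.

Definition chf_c N (t : R) := Ex (P N) (fun w => cos (t * Sw w)).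
Definition chf_s N (t : R) := Ex (P N) (fun w => sin (t * Sw w)).

Lemma measurable_cosr : measurable_fun setT (@cos R).
Proof. by apply: continuous_measurable_fun; exact: continuous_cos. Qed.

Lemma measurable_sinr : measurable_fun setT (@sin R).
Proof. by apply: continuous_measurable_fun; exact: continuous_sin. Qed.

Lemma intg_cos d' (T' : measurableType d') (P' : probability T' R) (f : T' -> R) (t : R) :
  measurable_fun setT f -> intg P' (fun w => cos (t * f w)).
Proof.
move=> mf; apply: (@intg_bdd _ _ _ _ _ 1); last by move=> w; exact: cos_max.
apply: (measurableT_comp measurable_cosr); apply: measurable_funM => //; exact: measurable_cst.
Qed.

Lemma intg_sin d' (T' : measurableType d') (P' : probability T' R) (f : T' -> R) (t : R) :
  measurable_fun setT f -> intg P' (fun w => sin (t * f w)).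
Proof.
move=> mf; apply: (@intg_bdd _ _ _ _ _ 1); last by move=> w; exact: sin_max.
apply: (measurableT_comp measurable_sinr); apply: measurable_funM => //; exact: measurable_cst.
Qed.

(** A step multiplies the characteristic function by that of an increment whose law does not depend
    on the state; this is the complex product in real coordinates. *)
Lemma charfun_chain N t :
  let a := Ex (P N.+1) (fun u => cos (t * logk (mw u))) in
  let b := Ex (P N.+1) (fun u => sin (t * logk (mw u))) in
  chf_c N.+1 t = chf_c N t * a - chf_s N t * b /\
  chf_s N.+1 t = chf_s N t * a + chf_c N t * b.
Proof.
move=> a b.
have mL : measurable_fun setT (fun u : T N.+1 => logk (mw u)) by exact: gmeas_logk.
have ia := @intg_cos _ _ (P N.+1) _ t mL; have ib := @intg_sin _ _ (P N.+1) _ t mL.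
have iu := @intg_cos _ _ (P N) _ t (@mS N); have iv := @intg_sin _ _ (P N) _ t (@mS N).
have m1 : smeas (fun s (_ : C) => cos (t * s)).
  move=> d' T' f g mf _; apply: (measurableT_comp measurable_cosr).
  by apply: measurable_funM => //; exact: measurable_cst.
have m2 : smeas (fun s (_ : C) => sin (t * s)).
  move=> d' T' f g mf _; apply: (measurableT_comp measurable_sinr).
  by apply: measurable_funM => //; exact: measurable_cst.
have [e1 _] := @chain_bdd N _ 1 m1 (fun s _ => cos_max _).
have [e2 _] := @chain_bdd N _ 1 m2 (fun s _ => sin_max _).
split; rewrite /chf_c /chf_s ?e1 ?e2.
  transitivity (Ex (P N) (fun w => a * cos (t * Sw w) - b * sin (t * Sw w))).
    apply: eq_Ex => w; rewrite /a /b [Ex _ _ * _]mulrC [X in _ - X]mulrC -!ExZ//.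
    rewrite -ExB; [|exact: intgZ|exact: intgZ].
    by apply: eq_Ex => u; rewrite mulrDr cosD.
  by rewrite ExB; [rewrite !ExZ//; ring|exact: intgZ|exact: intgZ].
transitivity (Ex (P N) (fun w => a * sin (t * Sw w) + b * cos (t * Sw w))).
  apply: eq_Ex => w; rewrite /a /b [Ex _ _ * _]mulrC [X in _ + X]mulrC -!ExZ//.
  rewrite -ExD; [|exact: intgZ|exact: intgZ].
  by apply: eq_Ex => u; rewrite mulrDr sinD.
by rewrite ExD; [rewrite !ExZ//; ring|exact: intgZ|exact: intgZ].
Qed.

Lemma charfun_decay t : 0 < t -> t <= 1 -> forall eps : R, 0 < eps ->
  exists N1, forall N, (N1 <= N)%N -> chf_c N t ^+ 2 + chf_s N t ^+ 2 <= eps.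
Proof.
move=> t0 t1; have t20 : 0 < t ^+ 2 by rewrite exprn_gt0.
apply: (@prod_decay _ _ (t ^+ 2 / 128) (Num.truncn (36 * 36 * 128 / t ^+ 2))).
- by rewrite divr_gt0.
- by move=> N; rewrite addr_ge0 ?sqr_ge0.
move=> N hN.
have m1 : 1 <= N.+2%:R :> R by rewrite ler1n.
have m0 : 0 < N.+2%:R :> R by rewrite ltr0n.
split.
  rewrite ler_pdivrMr// mul1r (le_trans _ m1)// ler_pdivrMr// mul1r.
  by rewrite (@le_trans _ _ 1)// ?exprn_ile1// ?ltW// ltr1n.
have hm : 36 * 36 * 128 / t ^+ 2 <= N.+2%:R.
  by rewrite ltW// (lt_le_trans (truncnS_gt _))// ler_nat ltnW// !ltnS.
have h := charfun_step m1 (@mwm N) (@mw1 N) (@mwr N) (@mw2 N) (@mw4 N) t0 t1 hm.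
have [-> ->] := charfun_chain N t.
set a := Ex _ _ in h *; set b := Ex _ _ in h *.
have -> : (chf_c N t * a - chf_s N t * b) ^+ 2 + (chf_s N t * a + chf_c N t * b) ^+ 2 =
  (a ^+ 2 + b ^+ 2) * (chf_c N t ^+ 2 + chf_s N t ^+ 2) by ring.
by rewrite ler_wpM2r// addr_ge0 ?sqr_ge0.
Qed.

(** A translation only rotates the characteristic function, so by Cauchy-Schwarz its modulus bounds
    all of these means, uniformly in x. *)
Lemma charfun_shift N t x (eta : R) : 0 <= eta -> chf_c N t ^+ 2 + chf_s N t ^+ 2 <= eta ^+ 2 ->
  `|Ex (P N) (fun w => cos (t * (Sw w - x)))| <= eta.
Proof.
move=> e0 h; have iu := @intg_cos _ _ (P N) _ t (@mS N); have iv := @intg_sin _ _ (P N) _ t (@mS N).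
have -> : Ex (P N) (fun w => cos (t * (Sw w - x))) =
   cos (t * x) * chf_c N t + sin (t * x) * chf_s N t.
  rewrite /chf_c /chf_s -!ExZ// -ExD; [|exact: intgZ|exact: intgZ].
  by apply: eq_Ex => w; rewrite mulrBr cosB; ring.
rewrite -(@ler_pXn2r _ 2)// ?nnegrE// real_normK ?num_real//.
apply: (le_trans _ h); have := cos2Dsin2 (t * x).
move: (cos _) (sin _) (chf_c _ _) (chf_s _ _) => c s u v cs.
rewrite -[leRHS]mul1r -cs.
have -> : (c ^+ 2 + s ^+ 2) * (u ^+ 2 + v ^+ 2) = (c * u + s * v) ^+ 2 + (c * v - s * u) ^+ 2 by ring.
by rewrite lerDl sqr_ge0.
Qed.

(** Let A be the average of cos(l del (S - x)) over l < M. Its second moment is at most 1/M + eta,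
    since products of distinct cosines are governed by the characteristic function at nonzero
    multiples of del. On |S - x| <= K every cosine is at least 7/8, so 2 A^2 >= 1 there. *)
Lemma anticoncentration (K eps : R) : 1 <= K -> 0 < eps ->
  exists N1, forall N, (N1 <= N)%N -> forall x,
    Ex (P N) (fun w => (`|Sw w - x| <= K)%R%:R) <= eps.
Proof.
move=> K1 e0; have K0 : 0 < K by rewrite (lt_le_trans _ K1).
pose M := (Num.truncn (4 / eps)).+1; have M0 : 0 < M%:R :> R by rewrite ltr0n.
have ME : M%:R^-1 <= eps / 4.
  rewrite -[leRHS]invrK lef_pV2 ?posrE ?invr_gt0 ?divr_gt0// invf_div ltW//; exact: truncnS_gt.
(* Chosen so that M del K = 1/2. Since K >= 1, the multiples of del up to 2 M stay within (0, 1],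
   the range of [charfun_decay]. *)
pose del : R := (2 * M%:R * K)^-1.
have MK0 : 0 < 2 * M%:R * K by rewrite !mulr_gt0.
have del0 : 0 < del by rewrite invr_gt0.
pose eta := eps / 4; have eta0 : 0 < eta by rewrite divr_gt0.
have [N1 hN1] : exists N1, forall N, (N1 <= N)%N -> forall k, (0 < k <= M.*2)%N ->
    chf_c N (k%:R * del) ^+ 2 + chf_s N (k%:R * del) ^+ 2 <= eta ^+ 2.
  have : (M.*2 <= M.*2)%N by []. move: {1 3}(M.*2) => n; elim: n => [|n ihn] nM.
    by exists 0%N => N _ [|k].
  have [N1 h1] := ihn (ltnW nM).
  have t0 : 0 < n.+1%:R * del by rewrite mulr_gt0// ltr0n.
  have t1 : n.+1%:R * del <= 1.
    rewrite ler_pdivrMr// mul1r (@le_trans _ _ (2 * M%:R))//.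
      by rewrite -natrM ler_nat mul2n.
    by rewrite ler_peMr// mulr_ge0// ltW.
  have [N2 h2] := charfun_decay t0 t1 (exprn_gt0 2 eta0).
  exists (maxn N1 N2) => N; rewrite geq_max => /andP[n1 n2] k /andP[k0].
  by rewrite leq_eqVlt ltnS => /orP[/eqP->|kn]; [exact: h2|apply: h1 => //; rewrite k0].
exists N1 => N hN x.
have ch k : (0 < k <= M.*2)%N -> `|Ex (P N) (fun w => cos (k%:R * del * (Sw w - x)))| <= eta.
  by move=> hk; apply: charfun_shift; [exact: ltW|exact: hN1].
pose c (l : nat) (w : T N) := cos (l%:R * del * (Sw w - x)).
have mSx : measurable_fun setT (fun w : T N => Sw w - x) by apply: measurable_funB => //; exact: measurable_cst.
have mc l : measurable_fun setT (c l : T N -> R).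
  by apply: (measurableT_comp measurable_cosr); apply: measurable_funM => //; exact: measurable_cst.
have icc (l k : nat) : intg (P N) (fun w => c l w * c k w).
  apply: (@intg_bdd _ _ _ _ _ 1); first exact: measurable_funM.
  by move=> w; rewrite normrM -[leRHS]mulr1 ler_pM// cos_max.
have ct (l k : 'I_M) : Ex (P N) (fun w => c l w * c k w) <= (l == k)%:R + eta.
  have [->|lk] := eqVneq l k.
    apply: (@le_trans _ _ 1); last by rewrite lerDl ltW.
    rewrite -[leRHS](Ex_cst (P N)); apply: Ex_le => //; first exact: intg_cst.
    by move=> w; rewrite (le_trans (ler_norm _))// normrM -[leRHS]mulr1 ler_pM// cos_max.
  rewrite add0r.
  have key (i j : nat) : (i < j < M)%N -> Ex (P N) (fun w => c i w * c j w) <= eta.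
    move=> /andP[ij jM].
    have h1 : (0 < i + j <= M.*2)%N.
      rewrite addn_gt0 (leq_ltn_trans (leq0n _) ij) orbT /= -addnn leq_add// ltnW//.
      exact: ltn_trans jM.
    have h2 : (0 < j - i <= M.*2)%N.
      by rewrite subn_gt0 ij /= (leq_trans (leq_subr _ _))// -addnn (leq_trans (ltnW jM))// leq_addr.
    have e (w : T N) : c i w * c j w = 2^-1 * (cos ((i + j)%:R * del * (Sw w - x)) + cos ((j - i)%:R * del * (Sw w - x))).
      by rewrite natrD natrB ?(ltnW ij)// !mulrDl !mulNr cosD cosB /c; field.
    rewrite (eq_Ex _ e) ExZ; last by apply: intgD; exact: intg_cos.
    rewrite ExD; [|exact: intg_cos|exact: intg_cos].
    have := ler_norm (Ex (P N) (fun w => cos ((i + j)%:R * del * (Sw w - x)))).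
    have := ler_norm (Ex (P N) (fun w => cos ((j - i)%:R * del * (Sw w - x)))).
    have := ch _ h1; have := ch _ h2; lra.
  have := lk; rewrite -val_eqE neq_ltn => /orP[h|h]; first by apply: key; rewrite h /=.
  by rewrite (eq_Ex _ (fun w => mulrC _ _)); apply: key; rewrite h /=.
pose A (w : T N) := M%:R^-1 * \sum_(l < M) c l w.
have AE w : A w ^+ 2 = M%:R^-1 ^+ 2 * \sum_(l < M) \sum_(k < M) c l w * c k w.
  by rewrite exprMn; congr (_ * _); rewrite expr2 mulr_suml; apply: eq_bigr => l _; rewrite mulr_sumr.
have iA : intg (P N) (fun w => A w ^+ 2).
  rewrite (_ : (fun w => _) = fun w => M%:R^-1 ^+ 2 * \sum_(l < M) \sum_(k < M) c l w * c k w); last exact/funext.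
  by apply: intgZ; apply: intg_sum => l; apply: intg_sum => k; exact: icc.
have EA : Ex (P N) (fun w => A w ^+ 2) <= M%:R^-1 + eta.
  rewrite (eq_Ex _ AE) ExZ; last by apply: intg_sum => l; apply: intg_sum => k; exact: icc.
  rewrite Ex_sum; last by move=> l; apply: intg_sum => k; exact: icc.
  apply: (@le_trans _ _ (M%:R^-1 ^+ 2 * \sum_(l < M) (1 + M%:R * eta))).
    rewrite ler_wpM2l ?sqr_ge0//; apply: ler_sum => l _.
    rewrite Ex_sum; last by move=> k; exact: icc.
    apply: (@le_trans _ _ (\sum_(k < M) ((l == k)%:R + eta))); first by apply: ler_sum => k _; exact: ct.
    rewrite big_split /= sumr_const card_ord mulr_natl lerD2r.
    by rewrite (bigD1 l)//= eqxx big1 ?addr0// => k /negPf; rewrite eq_sym => ->.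
  rewrite sumr_const card_ord -(mulr_natl (1 + M%:R * eta) M).
  by rewrite avg_arith// lt0r_neq0.
have i1 : intg (P N) (fun w => (`|Sw w - x| <= K)%R%:R).
  apply: (@intg_bdd _ _ _ _ _ 1); last by move=> w; exact: norm_natb_le1.
  apply: measurable_ind_le; last exact: measurable_cst.
  exact: measurableT_comp.
apply: (@le_trans _ _ (Ex (P N) (fun w => 2 * A w ^+ 2))); last first.
  by rewrite ExZ//; have := EA; rewrite /eta; lra.
apply: Ex_le => //; first exact: intgZ.
move=> w; case: (leP `|Sw w - x| K) => h /=; last by rewrite mulr_ge0// sqr_ge0.
have cl (l : 'I_M) : 7 / 8 <= c l w.
  apply: (le_trans _ (cos_ge_quad _)).
  have : `|l%:R * del * (Sw w - x)| <= 2^-1.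
    rewrite normrM ger0_norm ?mulr_ge0 ?(ltW del0)//.
    apply: (@le_trans _ _ (M%:R * del * K)).
      by rewrite ler_pM ?mulr_ge0 ?(ltW del0)// ler_wpM2r ?(ltW del0)// ler_nat ltnW.
    rewrite /del le_eqVlt; apply/orP; left; apply/eqP.
    by move: (M%:R : R) M0 => m m0; field; rewrite !lt0r_neq0.
  rewrite -(@ler_pXn2r _ 2)// ?nnegrE ?invr_ge0// real_normK ?num_real// => h2.
  have : (2^-1 : R) ^+ 2 = 4^-1 by rewrite exprVn -natrX.
  by move: h2; move: (_ ^+ 2) (_ ^+ 2) => u v; lra.
have hA : 7 / 8 <= A w.
  rewrite /A ler_pdivlMl//; apply: (@le_trans _ _ (\sum_(l < M) (7 / 8))).
    by rewrite sumr_const card_ord -(mulr_natl (7 / 8) M) lexx.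
  by apply: ler_sum => l _; exact: cl.
have : (7 / 8) ^+ 2 <= A w ^+ 2 by rewrite ler_sqr ?nnegrE//; lra.
rewrite expr2; move: (A w ^+ 2) => u; lra.
Qed.

End ChainConsequences.

(** * Sign changes on a grid and zeros on the circle *)

Section SignChanges.
Variable R : realType.
Local Notation C := R[i].

Lemma sum_blocks (a : nat -> R) (L M : nat) :
  \sum_(k < L) \sum_(j < M) a (k * M + j)%N = \sum_(i < L * M) a i.
Proof.
elim: L => [|L ih]; first by rewrite !big_ord0.
rewrite big_ord_recr /= ih mulSnr big_split_ord /=; congr (_ + _).
Qed.

Lemma sum_periodic (a : nat -> R) (T m : nat) : (forall i, a (i + T)%N = a i) ->
  \sum_(i < m * T) a i = m%:R * \sum_(i < T) a i.
Proof.
move=> aT; have aTk k i : a (k * T + i)%N = a i.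
  by elim: k => // k ih; rewrite mulSnr -addnA [(T + i)%N]addnC addnA aT.
rewrite -sum_blocks; under eq_bigr => k _ do under eq_bigr => j _ do rewrite aTk.
by rewrite sumr_const card_ord mulr_natl.
Qed.

Lemma sum_shift_periodic (a : nat -> R) (T s : nat) : (forall i, a (i + T)%N = a i) ->
  \sum_(i < T) a (s + i)%N = \sum_(i < T) a i.
Proof.
move=> aT; elim: s => [|s ih]; first by apply: eq_bigr => i _.
rewrite -ih; case: T aT {ih} => [|T] aT; first by rewrite !big_ord0.
rewrite big_ord_recr [RHS]big_ord_recl /= addn0 addrC; congr (_ + _).
  by rewrite addSnnS aT.
by apply: eq_bigr => i _; rewrite /bump /= add1n addSnnS.
Qed.

Lemma count_lt (T : nat) (Y : R) : Y <= T%:R -> Y <= \sum_(s < T) (s%:R < Y)%R%:R.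
Proof.
suff h : Num.min Y T%:R <= \sum_(s < T) (s%:R < Y)%R%:R.
  by move=> YT; move: h; rewrite min_l.
elim: T => [|T ih]; first by rewrite big_ord0 ge_min lexx orbT.
rewrite big_ord_recr /=; case: (ltP T%:R Y) => TY.
  have : Num.min Y T.+1%:R <= T%:R + 1 by rewrite natr1 ge_min lexx orbT.
  by move: ih; rewrite (min_r (ltW TY)) -[true%:R]/(1 : R); lra.
rewrite addr0 (le_trans _ ih)// le_min !ge_min lexx TY /= ?orbT//.
Qed.

Lemma polarP (z : C) : z != 0 -> exists t, - pi <= t <= pi /\ z = (cmod z)%:C%C * expi t.
Proof.
move=> z0; have c0 : cmod z != 0 by rewrite cmod_eq0.
have c0' : (cmod z)%:C%C != 0 :> C by rewrite -(rmorph0 (real_complex R)) (inj_eq (@complexI R)).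
have [|t [t1 t2 tE]] := @cmod1_expi R (z / (cmod z)%:C%C).
  by rewrite cmodM cmodV cmod_real ger0_norm ?cmod_ge0// mulfV.
by exists t; rewrite t1 t2 -tE mulrC divfK.
Qed.

Definition schange (x y : R) : R := (x * y < 0)%R%:R.

Lemma schangeC x y : schange x y = schange y x. Proof. by rewrite /schange mulrC. Qed.

Section PhaseCount.
Variable T : nat.
Hypothesis T0 : (0 < T)%N.
Let T0' : 0 < T%:R :> R. Proof. by rewrite ltr0n. Qed.

Definition phase (i : nat) : R := pi * (i%:R / T%:R).

(** The sign changes at each grid phase lying strictly between a and a + del, and an interval of
    length del contains at least T del / pi - 1 points of spacing pi / T. *)
Lemma phase_count_angle (a del : R) : 0 <= a -> 0 <= del -> del <= pi ->
  T%:R * del / pi - 1 <= \sum_(i < T) schange (sin (a - phase i)) (sin (a + del - phase i)).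
Proof.
move=> a0 d0 dpi; have p0 := @pi_gt0 R.
pose s i := schange (sin (a - phase i)) (sin (a + del - phase i)).
have sT i : s (i + T)%N = s i.
  have pT : phase (i + T) = phase i + pi.
    rewrite /phase natrD (_ : (_ + _) / _ = i%:R / T%:R + 1); first by rewrite mulrDr mulr1.
    by rewrite mulrDl mulfV// lt0r_neq0.
  have sN (x : R) : sin (x - (phase i + pi)) = - sin (x - phase i).
    rewrite (_ : x - (phase i + pi) = (x - phase i) - pi); last by ring.
    by rewrite sinB sinpi cospi; ring.
  by rewrite /s /schange pT !sN mulrNN.
rewrite -[leRHS]/(\sum_(i < T) s i).
(* The first index whose phase exceeds a. The summand has period T, so the T indices from i0 on may
   be counted instead. *)
pose i0 := (Num.truncn (T%:R * a / pi)).+1.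
rewrite -(sum_shift_periodic i0 sT).
have Ta0 : 0 <= T%:R * a / pi by rewrite divr_ge0 ?mulr_ge0// ?ltW.
have h1 : T%:R * a / pi < i0%:R by exact: truncnS_gt.
have h2 : i0%:R <= T%:R * a / pi + 1.
  by rewrite /i0 -natr1 lerD2r truncn_le.
pose Y := T%:R * (a + del) / pi - i0%:R.
have Td : T%:R * del / pi <= T%:R by rewrite ler_pdivrMr// ler_wpM2l// ltW.
have YE : T%:R * (a + del) / pi = T%:R * a / pi + T%:R * del / pi by rewrite mulrDr mulrDl.
have YT : Y <= T%:R by rewrite /Y YE; lra.
apply: (@le_trans _ _ Y); first by rewrite /Y YE; lra.
apply: (le_trans (count_lt YT)); apply: ler_sum => k _.
case: (ltP k%:R Y) => kY; last by rewrite /s /schange ler0n.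
have x1 : a < phase (i0 + k).
  rewrite /phase natrD mulrA ltr_pdivlMr//; move: h1; rewrite ltr_pdivrMr//.
  have : 0 <= pi * k%:R :> R by rewrite mulr_ge0// ltW.
  lra.
have x2 : phase (i0 + k) < a + del.
  rewrite /phase natrD mulrA ltr_pdivrMr//; move: kY; rewrite /Y ltrBrDr ltr_pdivlMr//.
  lra.
rewrite /s /schange; set x := phase _ in x1 x2 *.
have y1 : sin (a - x) < 0.
  by rewrite -opprB sinN oppr_lt0 sin_gt0_pi//; apply/andP; split; lra.
have y2 : 0 < sin (a + del - x) by rewrite sin_gt0_pi//; apply/andP; split; lra.
by rewrite nmulr_rlt0 ?y2.
Qed.

(** The angle between E0 and E1 enters only through its sine, which does not exceed it in modulus;
    this keeps the bound algebraic in E0 and E1. *)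
Lemma phase_count (E0 E1 : C) : E0 != 0 -> E1 != 0 ->
  T%:R * (`|complex.Im (conjc E0 * E1)| / (cmod E0 * cmod E1)) / pi - 1 <=
  \sum_(i < T) schange (complex.Im (expi (- phase i) * E0)) (complex.Im (expi (- phase i) * E1)).
Proof.
move=> e0 e1; have p0 := @pi_gt0 R.
have c0 : 0 < cmod E0 by rewrite cmod_gt0.
have c1 : 0 < cmod E1 by rewrite cmod_gt0.
have [t [/andP[t1 t2] E0E]] := polarP e0.
have d0 : conjc E0 * E1 != 0.
  by rewrite mulf_neq0// -cmod_eq0 cmod_conj cmod_eq0.
have [del [/andP[d1 d2] dE]] := polarP d0.
(* Shifted by a full turn, so that both a and a + del are nonnegative even when del is negative. *)
pose a := t + pi *+ 2.
have aE : expi a = expi t by rewrite /a expiD expi_2pi mulr1.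
have E0a : E0 = (cmod E0)%:C%C * expi a by rewrite aE.
have c0' : (cmod E0)%:C%C != 0 :> C by rewrite -(rmorph0 (real_complex R)) (inj_eq (@complexI R)) gt_eqF.
have E1a : E1 = (cmod E1)%:C%C * expi (a + del).
  have h : E0 * (conjc E0 * E1) = E0 * ((cmod E0 * cmod E1)%:C%C * expi del).
    by congr (_ * _); rewrite [LHS]dE cmodM cmod_conj.
  have {}h : (cmod E0 ^+ 2)%:C%C * E1 = (cmod E0)%:C%C * expi a * ((cmod E0 * cmod E1)%:C%C * expi del).
    by rewrite -E0a -h mulrA mul_conjc.
  have c2 : (cmod E0 ^+ 2)%:C%C != 0 :> C.
    by rewrite -(rmorph0 (real_complex R)) (inj_eq (@complexI R)) expf_neq0// gt_eqF.
  apply: (mulfI c2); rewrite h (expiD a del).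
  have -> : (cmod E0 ^+ 2)%:C%C = (cmod E0)%:C%C ^+ 2 :> C by rewrite rmorphXn.
  have -> : (cmod E0 * cmod E1)%:C%C = (cmod E0)%:C%C * (cmod E1)%:C%C :> C by rewrite rmorphM.
  ring.
have ImE : complex.Im (conjc E0 * E1) = cmod E0 * cmod E1 * sin del.
  by rewrite dE cmodM cmod_conj ImcM /= mul0r addr0.
have -> : `|complex.Im (conjc E0 * E1)| / (cmod E0 * cmod E1) = `|sin del|.
  by rewrite ImE normrM gtr0_norm ?mulr_gt0// [_ * `|_|]mulrC mulfK// gt_eqF// mulr_gt0.
have Imx x (E : C) c : 0 < c -> E = c%:C%C * expi x -> forall i,
   complex.Im (expi (- phase i) * E) = c * sin (x - phase i).
  move=> cp -> i; rewrite mulrCA -expiD addrC ImcM /= mul0r addr0//.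
have scM (u v x y : R) : 0 < u -> 0 < v -> schange (u * x) (v * y) = schange x y.
  move=> u0 v0; rewrite /schange mulrACA pmulr_rlt0// mulr_gt0//.
under eq_bigr => i _ do rewrite (Imx _ _ _ c0 E0a) (Imx _ _ _ c1 E1a) scM//.
have sd : `|sin del| <= `|del| by exact: sin_abs_le.
apply: (@le_trans _ _ (T%:R * `|del| / pi - 1)).
  by rewrite lerD2r ler_wpM2r ?invr_ge0 ?(ltW p0)// ler_wpM2l.
have a0 : 0 <= a by rewrite /a mulr2n; lra.
case: (leP 0 del) => hd.
  by rewrite ger0_norm// phase_count_angle.
rewrite ltr0_norm//; have h := @phase_count_angle (a + del) (- del).
under eq_bigr => i _ do rewrite schangeC.
rewrite addrK in h; apply: h; rewrite /a ?mulr2n; lra.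
Qed.

End PhaseCount.

Lemma expi_eq1 (t : R) : `|t| < pi *+ 2 -> expi t = 1 -> t = 0.
Proof.
move=> tp /(congr1 (@complex.Re R)) /=; rewrite cos_half => h.
have s0 : sin (t / 2) = 0.
  have : sin (t / 2) ^+ 2 = 0 by lra.
  by move=> /eqP; rewrite sqrf_eq0 => /eqP.
have p2 : pi *+ 2 = 2 * pi :> R by rewrite mulr_natl.
apply/eqP; apply: contraT => tn; case: (ltgtP t 0) tn => // ht _.
  have : 0 < sin (- (t / 2)).
    by apply: sin_gt0_pi; rewrite ltr0_norm// p2 in tp; apply/andP; split; lra.
  by rewrite sinN s0 oppr0 ltxx.
have : 0 < sin (t / 2).
  by apply: sin_gt0_pi; rewrite gtr0_norm// p2 in tp; apply/andP; split; lra.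
by rewrite s0 ltxx.
Qed.

Lemma expi_inj (s t : R) : `|s - t| < pi *+ 2 -> expi s = expi t -> s = t.
Proof.
move=> st e; apply/eqP; rewrite -subr_eq0; apply/eqP; apply: expi_eq1 => //.
by rewrite expiD e expiMN.
Qed.

Definition grid (phi : R) (L k : nat) : R := phi + k%:R * (pi *+ 2 / L%:R).

(** The intermediate value theorem puts a zero strictly inside each cell with a sign change. The
    cells are disjoint within one period, so these angles give distinct points of the circle. *)
Lemma ncard_sign_changes (F : C -> C) (f : R -> R) (phi : R) (L : nat) : (0 < L)%N ->
  continuous f -> (forall t, f t = 0 -> F (expi t) = 0) ->
  ((\sum_(k < L) schange (f (grid phi L k)) (f (grid phi L k.+1)))%:E <= nzeros_circle F)%E.
Proof.
move=> L0 cf fF; set th := grid phi L; pose h : R := pi *+ 2 / L%:R.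
have L0' : 0 < L%:R :> R by rewrite ltr0n.
have h0 : 0 < h by rewrite divr_gt0// mulr2n addr_gt0// pi_gt0.
have thS k : th k.+1 = th k + h by rewrite /th /grid -natr1 mulrDl mul1r addrA.
have thm j k : (j <= k)%N -> th j <= th k.
  by move=> jk; rewrite /th /grid lerD2l ler_wpM2r ?(ltW h0)// ler_nat.
have zero (k : nat) : exists t, f (th k) * f (th k.+1) < 0 -> th k < t < th k.+1 /\ f t = 0.
  case: (ltP (f (th k) * f (th k.+1)) 0) => hk; last by exists 0 => hk'.
  have le : th k <= th k.+1 by rewrite thS lerDl ltW.
  have [||c] := @IVT R f (th k) (th k.+1) 0 le.
  - exact: continuous_subspaceT.
  - apply/andP; split.
      rewrite ge_min; apply: contraT; rewrite negb_or -!ltNge => /andP[x y].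
      by have := lt_trans (mulr_gt0 x y) hk; rewrite ltxx.
    rewrite le_max; apply: contraT; rewrite negb_or -!ltNge => /andP[x y].
    by have := lt_trans (_ : 0 < f (th k) * f (th k.+1)) hk; rewrite ltxx nmulr_rgt0// y => /(_ isT).
  rewrite in_itv /= => /andP[c1 c2] fc; exists c => _; split => //.
  rewrite !lt_neqAle c1 c2 !andbT; apply/andP; split; apply/eqP => e.
    by move: hk; rewrite e fc mul0r ltxx.
  by move: hk; rewrite -e fc mulr0 ltxx.
have [t tP] := choice zero.
pose s := [seq expi (t (val k)) | k : 'I_L <- enum 'I_L & (f (th (val k)) * f (th (val k).+1) < 0)%R].
apply: ereal_sup_ubound => /=; exists s.
  split.
    rewrite map_inj_in_uniq; first by rewrite filter_uniq// enum_uniq.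
    move=> j k.
    rewrite !mem_filter => /andP[hj _] /andP[hk _] e.
    have [/andP[j1 j2] _] := tP _ hj; have [/andP[k1 k2] _] := tP _ hk.
    have bnd (i : 'I_L) : th 0%N <= th i /\ th i.+1 <= th 0%N + pi *+ 2.
      split; first exact: thm.
      have -> : th 0%N + pi *+ 2 = th L by rewrite /th /grid mul0r addr0 mulrC divfK// gt_eqF.
      by apply: thm; exact: ltn_ord.
    have [b1 b2] := bnd j; have [b3 b4] := bnd k.
    have tt : t j = t k.
      apply: expi_inj e; rewrite ltr_norml; apply/andP; split; lra.
    apply/val_inj => /=; apply/eqP; rewrite eqn_leq; apply/andP; split; rewrite leqNgt; apply/negP => jk.
      by have := thm _ _ jk; lra.
    by have := thm _ _ jk; lra.
  move=> z /mapP[k]; rewrite mem_filter => /andP[hk _] ->.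
  have [_ ft] := tP _ hk; split; last exact: fF.
  by rewrite /unit_circle /= cmodE cmod_expi.
rewrite size_map size_filter; congr (_%:E).
rewrite -sum1_count natr_sum big_mkcond /= big_enum /=.
by apply: eq_bigr => k _; rewrite /schange; case: ifP.
Qed.

End SignChanges.

(** * The phase of z^(-m/2) p(z) and its speed at 1 *)

Section RotatedPolynomial.
Variable R : realType.
Local Notation C := R[i].

(** This is z^(-m/2) p(z) as a function of the angle, because for odd m the power is not single
    valued on the circle. *)
Definition rotB (m : nat) (p : {poly C}) (t : R) : C := expi (- (m%:R / 2 * t)) * p.[expi t].

Lemma rotB0 m p : rotB m p 0 = p.[1].
Proof. by rewrite /rotB mulr0 oppr0 expi0 mul1r. Qed.

Definition freq (m i : nat) : R := i%:R - m%:R / 2.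

Lemma rotB_sum m (p : {poly C}) t : (size p <= m)%N ->
  rotB m p t = \sum_(i < m) p`_i * expi (freq m i * t).
Proof.
move=> pm; rewrite /rotB (horner_coef_wide _ pm) mulr_sumr; apply: eq_bigr => i _.
rewrite mulrCA -expiMn -expiD; congr (_ * expi _).
by rewrite /freq -(mulr_natl t i); ring.
Qed.

Definition trig (c : C) (a t : R) : R := complex.Re c * sin (a * t) + complex.Im c * cos (a * t).

Lemma Im_rotB m (p : {poly C}) (k : C) t : (size p <= m)%N ->
  complex.Im (k * rotB m p t) = \sum_(i < m) trig (k * p`_i) (freq m i) t.
Proof.
move=> pm; rewrite rotB_sum// mulr_sumr raddf_sum /=; apply: eq_bigr => i _.
by rewrite mulrA /trig ImcM.
Qed.

Lemma is_derive_trig (c : C) (a t : R) :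
  is_derive t 1 (trig c a) (a * (complex.Re c * cos (a * t) - complex.Im c * sin (a * t))).
Proof.
have d1 : is_derive t 1 (fun x : R => a * x) a.
  by apply: is_derive_eq; rewrite [LHS]mulr1.
have ds : is_derive t 1 (fun x => sin (a * x)) (cos (a * t) * a).
  exact: (is_derive1_comp (is_derive_sin _) d1).
have dc : is_derive t 1 (fun x => cos (a * x)) (- sin (a * t) * a).
  exact: (is_derive1_comp (is_derive_cos _) d1).
rewrite /trig; apply: is_derive_eq; rewrite /GRing.scale /=; ring.
Qed.

Lemma is_derive_Im_rotB m (p : {poly C}) (k : C) (t : R) : (size p <= m)%N ->
  is_derive t 1 (fun x : R => complex.Im (k * rotB m p x))
    (\sum_(i < m) freq m i * (complex.Re (k * p`_i) * cos (freq m i * t) -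
       complex.Im (k * p`_i) * sin (freq m i * t))).
Proof.
move=> pm.
have -> : (fun t => complex.Im (k * rotB m p t)) = \sum_(i < m) trig (k * p`_i) (freq m i).
  by rewrite fct_sumE; apply/funext => x; exact: Im_rotB.
by apply: is_derive_sum => i; exact: is_derive_trig.
Qed.

Lemma continuous_Im_rotB m (p : {poly C}) (k : C) : (size p <= m)%N ->
  continuous (fun t => complex.Im (k * rotB m p t)).
Proof.
move=> pm t; apply: differentiable_continuous; apply/derivable1_diffP.
by have [] := is_derive_Im_rotB k t pm.
Qed.

Lemma continuous_cmod_rotB m (p : {poly C}) : (size p <= m)%N ->
  continuous (fun t => cmod (rotB m p t)).
Proof.
move=> pm.
have -> : (fun t => cmod (rotB m p t)) =
   (fun t => Num.sqrt (complex.Im ('i%C * rotB m p t) * complex.Im ('i%C * rotB m p t) +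
     complex.Im (1 * rotB m p t) * complex.Im (1 * rotB m p t))).
  by apply/funext => t; rewrite mul1r ImcM /= mul0r mul1r add0r -!expr2 -cmod_sqr sqrtr_sqr ger0_norm// cmod_ge0.
move=> t; apply: continuous_comp; last exact: sqrt_continuous.
by apply: cvgD; apply: cvgM; exact: continuous_Im_rotB.
Qed.

(** Minus twice the derivative at 0 of the argument of [rotB m p]. Zeros come once per half turn, so
    a circle of length 2 pi carries twice the angular rate. *)
Definition speed (m : nat) (p : {poly C}) : R := m%:R - 2 * complex.Re (p^`().[1] / p.[1]).

Definition cell (L : nat) : R := pi *+ 2 / L.+1%:R.

Lemma cell_cvg : cell @ \oo --> (0 : R).
Proof.
have -> : cell = (fun n => (pi *+ 2) * harmonic n).
  by apply/funext => n.
rewrite -(mulr0 (pi *+ 2 : R)); apply: cvgM; [exact: cvg_cst|exact: cvg_harmonic].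
Qed.

Lemma cell_gt0 L : 0 < cell L.
Proof. by rewrite divr_gt0// mulr2n addr_gt0// pi_gt0. Qed.

(** The modulus of the sine of the angle turned over one cell; it is 0 if [rotB] vanishes at an end,
    by the convention on inverses. *)
Definition turn (m : nat) (p : {poly C}) (L : nat) : R :=
  `|complex.Im (conjc (rotB m p 0) * rotB m p (cell L))| / (cmod (rotB m p 0) * cmod (rotB m p (cell L))).

Lemma cell_arith (F : numFieldType) (l g v p : F) : p != 0 ->
  l * (g * v) / p = 2 * (l / (p *+ 2) * g) * v.
Proof. by move=> p0; rewrite -(mulr_natl p 2); field. Qed.

(** With B0 = p(1), the function Im(conj B0 rotB) vanishes at 0 with derivative -|B0|^2 speed / 2,
    and a cell has length 2 pi / (L + 1). *)
Lemma turn_cvg m (p : {poly C}) : (size p <= m)%N -> p.[1] != 0 ->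
  (fun L => L.+1%:R * turn m p L / pi) @ \oo --> `|speed m p|.
Proof.
move=> pm p1; set B0 := p.[1]; have p0 := @pi_gt0 R.
pose G t := complex.Im (conjc B0 * rotB m p t).
have c0 : 0 < cmod B0 by rewrite cmod_gt0.
have G0 : G 0 = 0 by rewrite /G rotB0 mulrC mul_conjc.
have dG : is_derive (0 : R) 1 G (- (cmod B0 ^+ 2 * speed m p / 2)).
  have := is_derive_Im_rotB (conjc B0) 0 pm; set D := \sum_(i < m) _.
  suff -> : D = - (cmod B0 ^+ 2 * speed m p / 2) by [].
  have -> : D = complex.Re (conjc B0 * (p^`().[1] - (m%:R / 2) * p.[1])).
    have hd := horner_deriv_wide 1 pm; rewrite mul1r in hd.
    rewrite hd (horner_coef_wide _ pm) mulr_sumr -sumrB mulr_sumr raddf_sum /=.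
    apply: eq_bigr => i _; rewrite mulr0 cos0 sin0 mulr1 mulr0 subr0 !expr1n !mulr1.
    have -> : conjc B0 * (i%:R * p`_i - m%:R / 2 * p`_i) = (freq m i)%:C%C * (conjc B0 * p`_i).
      by rewrite -mulrBl mulrCA; congr (_ * _); rewrite /freq rmorphB rmorphM fmorphV !rmorph_nat.
    by rewrite [in RHS]RecM [complex.Im (_%:C)%C]/(0 : R) mul0r subr0.
  rewrite -/B0; have e : p^`().[1] = (p^`().[1] / B0) * B0 by rewrite divfK.
  rewrite {1}e -mulrBl mulrCA [conjc B0 * B0]mulrC mul_conjc RecM /= mulr0 subr0.
  have -> : (m%:R / 2 : C) = (m%:R / 2 : R)%:C%C by rewrite rmorphM fmorphV !rmorph_nat.
  by rewrite RecD RecN /= /speed -/B0; field.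
have cG : (fun L => (cell L)^-1 * G (cell L)) @ \oo --> - (cmod B0 ^+ 2 * speed m p / 2).
  case: dG => dG1 <-.
  have hcv : (fun h : R => h^-1 *: ((G \o shift 0) (h *: 1) - G 0)) @ 0^' --> 'D_1 G 0 by exact: dG1.
  have h := (@cvgr_dnbhsP R _ _ _).1 hcv cell.
  have e : (fun L => (cell L)^-1 * G (cell L)) =
     (fun L => (cell L)^-1 *: ((G \o shift 0) (cell L *: 1) - G 0)).
    by apply/funext => L; rewrite /= G0 subr0 addr0 [cell L *: 1]mulr1.
  rewrite e; apply: h; split; last exact: cell_cvg.
  by move=> L; rewrite gt_eqF// cell_gt0.
have cc : (fun L => cmod (rotB m p (cell L))) @ \oo --> cmod B0.
  have -> : cmod B0 = cmod (rotB m p 0) by rewrite rotB0.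
  exact: (cvg_comp _ _ cell_cvg (@continuous_cmod_rotB m p pm 0)).
have E L : L.+1%:R * turn m p L / pi = 2 * `|(cell L)^-1 * G (cell L)| / (cmod B0 * cmod (rotB m p (cell L))).
  rewrite /turn rotB0 -/B0 -/(G _) normrM normfV [`|cell L|]gtr0_norm ?cell_gt0//.
  move: `|G _| (cmod B0 * _)^-1 => g v; rewrite /cell invf_div.
  by apply: cell_arith; rewrite gt_eqF.
under eq_fun => L do rewrite E.
have -> : `|speed m p| = 2 * `|- (cmod B0 ^+ 2 * speed m p / 2)| / (cmod B0 * cmod B0).
  have n2 : `|2 : R| = 2 by rewrite ger0_norm.
  rewrite normrN normrM normrM normfV n2 (ger0_norm (sqr_ge0 (cmod B0))).
  by field; rewrite gt_eqF.
apply: cvgM.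
  by apply: cvgM; [exact: cvg_cst|apply: cvg_norm].
apply: cvgV; first by rewrite mulf_neq0 ?gt_eqF.
by apply: cvgM => //; exact: cvg_cst.
Qed.

End RotatedPolynomial.

(** * The joint law of the independent Haar matrices *)

Section JointLaw.
Variable R : realType.
Local Notation C := R[i].
Context (n N : nat) d (T : measurableType d) (P : probability T R) (U : 'I_n -> T -> 'M[C]_N).
Hypotheses (hU : forall j, haar_SU_distributed P (U j)) (hI : mutually_independent P U).

(** The pi-system of measurable rectangles, on which independence determines the joint law. *)
Definition rect : set (set ('I_n -> mxT R N)) := [set S | exists B : 'I_n -> set (mxT R N),
  (forall j, measurable (B j)) /\ S = [set x | forall j, B j (x j)]].
Definition tupT := g_sigma_algebraType rect.

Lemma rectI : setI_closed rect.
Proof.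
move=> _ _ [A [mA ->]] [B [mB ->]]; exists (fun j => A j `&` B j); split.
  by move=> j; exact: measurableI.
by apply/seteqP; split => x /=; [move=> [h1 h2] j|move=> h; split => j; have [] := h j].
Qed.

Lemma measurable_tupP d' (T' : measurableType d') (f : T' -> tupT) :
  (forall j, measurable_fun setT (fun x => (f x : 'I_n -> mxT R N) j)) -> measurable_fun setT f.
Proof.
move=> mf; apply: (@measurability _ _ T' tupT setT f rect erefl).
move=> _ [_ [B [mB ->]] <-]; rewrite setTI.
have -> : f @^-1` [set x | forall j, B j (x j)] =
    \bigcap_(j in [set: 'I_n]) ((fun x => (f x : 'I_n -> mxT R N) j) @^-1` B j).
  by apply/seteqP; split => x /= h j; [move=> _|]; exact: h.
apply: fin_bigcap_measurable => [|j _]; first exact: finite_finset.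
by rewrite -[_ @^-1` _]setTI; exact: mf.
Qed.

Lemma measurable_coord j : measurable_fun setT (fun x : tupT => (x : 'I_n -> mxT R N) j).
Proof.
move=> _ B mB; rewrite setTI; apply: sub_sigma_algebra.
exists (fun i => if i == j then B else setT); split; first by move=> i; case: ifP.
apply/seteqP; split => x /=; last by move=> /(_ j); rewrite eqxx.
by move=> h i; case: eqP => // ->.
Qed.

Lemma cmeas_coord j k l : cmeas (fun x : tupT => ((x : 'I_n -> mxT R N) j : 'M[C]_N) k l).
Proof. exact: (cmeas_comp (measurable_coord j) (@cmeas_entry R N k l)). Qed.

Let mU j : measurable_fun setT (U j : T -> mxT R N). Proof. exact: haar_measurable. Qed.

(** On rectangles independence factors the probability, and each factor is invariant by the Haar
    property. *)
Lemma joint_left (V : 'I_n -> 'M[C]_N) (g : tupT -> \bar R) : (forall j, SU (V j)) ->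
  measurable_fun setT g -> (forall x, 0 <= g x)%E ->
  (\int[P]_w g (fun j => V j *m U j w) = \int[P]_w g (fun j => U j w))%E.
Proof.
move=> sV mg g0.
have mV j : measurable_fun setT (fun A : mxT R N => (V j *m A : mxT R N)).
  by apply: measurable_mxP; apply: cmeas_mulmx => k l; [exact: cmeas_cst|exact: cmeas_entry].
have mZ : measurable_fun setT (fun w => (fun j => U j w) : tupT) by exact: measurable_tupP.
have mZ' : measurable_fun setT (fun w => (fun j => V j *m U j w) : tupT).
  by apply: measurable_tupP => j; exact: (measurableT_comp (mV j) (mU j)).
transitivity (\int[pushforward P (fun w => (fun j => V j *m U j w) : tupT)]_x g x)%E.
  by rewrite ge0_integral_pushforward// preimage_setT.
transitivity (\int[pushforward P (fun w => (fun j => U j w) : tupT)]_x g x)%E; last first.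
  by rewrite ge0_integral_pushforward// preimage_setT.
apply: eq_measure_integral => A mA _.
apply: (@measure_unique _ R tupT rect (fun=> setT)) => //.
- exact: rectI.
- by move=> _; exists (fun=> setT); split => //; apply/seteqP; split.
- by rewrite bigcup_const.
- move=> _ [B [mB ->]]; rewrite /pushforward.
  pose B' j : set 'M[C]_N := [set A | B j (V j *m A)].
  have mB' j : mx_borel (B' j).
    by have := mV j measurableT _ (mB j); rewrite setTI.
  have e1 : (fun w => (fun j => V j *m U j w) : tupT) @^-1` [set x | forall j, B j (x j)] =
      \bigcap_(j in [set: 'I_n]) (U j @^-1` B' j).
    by apply/seteqP; split => w /= h j; [move=> _|]; exact: h.
  have e2 : (fun w => (fun j => U j w) : tupT) @^-1` [set x | forall j, B j (x j)] =
      \bigcap_(j in [set: 'I_n]) (U j @^-1` B j).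
    by apply/seteqP; split => w /= h j; [move=> _|]; exact: h.
  transitivity (P (\bigcap_(j in [set: 'I_n]) (U j @^-1` B' j))); first by rewrite -e1.
  transitivity (P (\bigcap_(j in [set: 'I_n]) (U j @^-1` B j))); last by rewrite -e2.
  rewrite hI// hI//; apply: eq_bigr => j _.
  by have [_ [_ h]] := hU j; exact: (h _ (sV j) _ (mB j)).
- by move=> _; apply: le_lt_trans (probability_le1 P _) _; rewrite ?ltry// -[_ @^-1` _]setTI; exact: mZ'.
Qed.

(** The factorisation with the whole space in place j identifies the product over the other indices
    with the probability of E. *)
Lemma others_indep j (B : 'I_n -> set 'M[C]_N) (A : set 'M[C]_N) :
  (forall k, mx_borel (B k)) -> mx_borel A ->
  let E := [set w | forall k, k != j -> B k (U k w)] in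
  P (U j @^-1` A `&` E) = (P (U j @^-1` A) * P E)%E.
Proof.
move=> mB mA E.
have key D : mx_borel D -> P (U j @^-1` D `&` E) =
   (P (U j @^-1` D) * \prod_(k < n | k != j) P (U k @^-1` B k))%E.
  move=> mD; pose B' k := if k == j then D else B k.
  have -> : U j @^-1` D `&` E = \bigcap_(k in [set: 'I_n]) (U k @^-1` B' k).
    apply/seteqP; split => w /=.
      by move=> [h1 h2] k _; rewrite /B' /=; case: eqP => [->//|/eqP]; exact: h2.
    move=> h; split; first by have := h j I; rewrite /B' /= eqxx.
    by move=> k kj; have := h k I; rewrite /B' /= (negbTE kj).
  rewrite hI; last by move=> k; rewrite /B'; case: ifP.
  rewrite (bigD1 j)//= {1}/B' eqxx; congr (_ * _)%E.
  by apply: eq_bigr => k /negbTE kj; rewrite /B' kj.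
have mT : mx_borel (setT : set 'M[C]_N) by exact: (@measurableT _ (mxT R N)).
rewrite key//; congr (_ * _)%E.
by have := key _ mT; rewrite preimage_setT setTI probability_setT mul1e.
Qed.

Lemma measurable_others j (B : 'I_n -> set 'M[C]_N) : (forall k, mx_borel (B k)) ->
  measurable [set w | forall k, k != j -> B k (U k w)].
Proof.
move=> mB.
have -> : [set w | forall k, k != j -> B k (U k w)] =
    \bigcap_(k in [set: 'I_n]) (U k @^-1` (if k == j then setT else B k)).
  apply/seteqP; split => w /= h k; first by move=> _; case: eqP => // /eqP; exact: h.
  by move=> kj; have := h k I; rewrite (negbTE kj).
apply: fin_bigcap_measurable => [|k _]; first exact: finite_finset.
rewrite -[_ @^-1` _]setTI; apply: mU => //; case: ifP => // _; exact: mB.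
Qed.

End JointLaw.

(** The integral of a nonnegative function is a supremum over simple functions below it, so it is
    monotone for arbitrary functions. This lets the number of zeros be integrated without a proof of
    its measurability. *)
Lemma ge0_le_integral_any (R : realType) d (T : measurableType d) (mu : {measure set T -> \bar R})
    (f g : T -> \bar R) : (forall w, 0 <= f w)%E -> (forall w, f w <= g w)%E ->
  (\int[mu]_w f w <= \int[mu]_w g w)%E.
Proof.
move=> f0 fg; have g0 w : (0 <= g w)%E by exact: le_trans (f0 w) (fg w).
rewrite !ge0_integralTE//; apply: le_ereal_sup => _ [h hf <-]; exists h => //.
by move=> w; exact: le_trans (hf w) (fg w).
Qed.

Lemma limn_einf_le (R : realType) (u : (\bar R)^nat) (v : \bar R) :
  (forall k, u k <= v)%E -> (limn_einf u <= v)%E.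
Proof.
move=> uv; rewrite limn_einf_lim; apply: lime_le; first exact: is_cvg_einfs.
apply: nearW => k; apply: le_trans (uv k); apply: ereal_inf_lbound.
by exists k => /=.
Qed.

Lemma phase_arith1 (F : numFieldType) (m l p j : F) : m != 0 -> l != 0 ->
  m / 2 * (p *+ 2 * j / (m * (l * l))) = p * (j / (l * l)).
Proof. by move=> m0 l0; rewrite -(mulr_natl p 2); field; rewrite m0 l0. Qed.

Lemma phase_arith2 (F : numFieldType) (m l p k : F) : l != 0 ->
  m / 2 * (k * (p *+ 2 / l)) = p * (k * (m * l) / (l * l)).
Proof. by move=> l0; rewrite -(mulr_natl p 2); field. Qed.

Lemma average_arith (R : realFieldType) (m l e r : R) : 0 < m -> 0 < l ->
  m * e <= m * l * r -> e / l <= r.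
Proof.
move=> m0 l0 h; rewrite ler_pdivrMr// mulrC -(ler_pM2l m0) mulrA; exact: h.
Qed.

Lemma scale_arith (R : realFieldType) (l t p s : R) : 0 < l ->
  l * l * t / p - 1 <= s -> l * t / p - l^-1 <= s / l.
Proof.
move=> l0 h; rewrite ler_pdivlMr// mulrBl mulVf ?gt_eqF// (le_trans _ h)// lerD2r.
by rewrite (_ : l * t / p * l = l * l * t / p)//; move: p^-1 => q; ring.
Qed.

(** * The Kac-Rice lower bound *)

Section KacRice.
Variable R : realType.
Local Notation C := R[i].
Context (n N : nat) (b : 'I_n -> R).

Definition lincomb (x : 'I_n -> 'M[C]_N.+1) : {poly C} := \sum_(j < n) ((b j)%:C)%C *: pA (x j).

Definition comb_charpoly (x : 'I_n -> 'M[C]_N.+1) (z : C) : C :=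
  \sum_(j < n) ((b j)%:C)%C * charpoly_det (x j) z.

Lemma size_lincomb x : (size (lincomb x) <= N.+1)%N.
Proof.
apply: (leq_trans (size_sum _ _ _)); apply/bigmax_leqP => j _.
exact: leq_trans (size_scale_leq _ _) (size_pA _).
Qed.

Lemma horner_lincomb x z : (lincomb x).[z] = \sum_(j < n) ((b j)%:C)%C * (pA (x j)).[z].
Proof. by rewrite /lincomb horner_sum; apply: eq_bigr => j _; rewrite hornerZ. Qed.

Lemma pmeas_lincomb d (T : measurableType d) (f : T -> 'I_n -> 'M[C]_N.+1) :
  (forall j k l, cmeas (fun w => f w j k l)) -> pmeas (fun w => lincomb (f w)).
Proof.
by move=> mf; apply: pmeas_sum => j; apply: pmeasZ; [exact: cmeas_cst|exact: pmeas_pA].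
Qed.

Lemma comb_charpoly_circle x z : (forall j, SU (x j)) -> cmod z = 1 ->
  comb_charpoly x z = (lincomb x).[z] - csgn R N * z ^+ N.+1 * conjc (lincomb x).[z].
Proof.
move=> sx z1; rewrite horner_lincomb conjc_sum mulr_sumr -sumrB; apply: eq_bigr => j _.
by rewrite (charpoly_circle (sx j) z1) conjcM conjc_real mulrBr mulrCA.
Qed.

(** A square root of [csgn]; it fixes the line that the phase has to hit. *)
Definition kph : C := if odd N then 'i%C else 1.

Lemma kph_sqr : kph * kph = csgn R N.
Proof.
rewrite /kph /csgn -signr_odd; case: (odd N); rewrite ?mulr1 ?expr0 ?expr1//.
by rewrite -expr2 sqr_i.
Qed.

Lemma cmod_kph : cmod kph = 1.
Proof.
apply/eqP; rewrite -sqrp_eq1 ?cmod_ge0// -cmodX expr2 kph_sqr /csgn cmodX cmodN cmod1 expr1n//.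
Qed.

Definition rfun (x : 'I_n -> 'M[C]_N.+1) (t : R) : R :=
  complex.Im (conjc kph * rotB N.+1 (lincomb x) t).

(** If conj(kph) z^(-(N+1)/2) AA(z) is real then AA(z) = kph^2 z^(N+1) conj(AA(z)), and this is the
    vanishing of the combination. *)
Lemma rfun_zero x t : (forall j, SU (x j)) -> rfun x t = 0 -> comb_charpoly x (expi t) = 0.
Proof.
move=> sx f0; rewrite comb_charpoly_circle ?cmod_expi//; apply/eqP; rewrite subr_eq0; apply/eqP.
pose e := expi (N.+1%:R / 2 * t).
have eE : expi (- (N.+1%:R / 2 * t)) = conjc e by rewrite expiN.
have e2 : e * e = expi t ^+ N.+1.
  by rewrite -expiD -expiMn; congr expi; rewrite -(mulr_natl t); move: (N.+1%:R : R) => c; field.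
have ee : e * conjc e = 1 by rewrite -expiN expiMN.
have kk : kph * conjc kph = 1 by rewrite mul_conjc cmod_kph expr1n.
have E : conjc kph * (conjc e * (lincomb x).[expi t]) = kph * (e * conjc (lincomb x).[expi t]).
  have : conjc kph * rotB N.+1 (lincomb x) t = conjc (conjc kph * rotB N.+1 (lincomb x) t).
    by apply: complexP; rewrite ?RecJ ?ImcJ// -/(rfun x t) f0 oppr0.
  by rewrite /rotB !conjcM conjcK eE conjcK.
rewrite -e2 -kph_sqr; move: E; move: (lincomb x).[expi t] => a; move: (conjc a) => a' E.
have -> : kph * kph * (e * e) * a' = (kph * e) * (kph * (e * a')) by ring.
by rewrite -E; transitivity ((kph * conjc kph) * (e * conjc e) * a); [rewrite kk ee !mul1r|ring].
Qed.

Definition rotV (th : R) : 'M[C]_N.+1 := expi th *: Dmx N (expi (- (N.+1%:R * th))).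

Lemma SU_rotV th : SU (rotV th).
Proof.
split; last first.
  by rewrite detZ det_Dmx -expiMn -(mulr_natl th) expiMN.
have adjZ c (A : 'M[C]_N.+1) : adjmx (c *: A) = conjc c *: adjmx A.
  by apply/matrixP => i j; rewrite !mxE [Num.conj _]conjcM.
rewrite /rotV adjZ -scalemxAl -scalemxAr scalerA mul_conjc cmod_expi expr1n scale1r.
by apply: unitary_Dmx; rewrite cmod_expi.
Qed.

Lemma drsubmx_Dmx c (W : 'M[C]_(1 + N)) : drsubmx (Dmx N c *m W) = drsubmx W.
Proof.
by rewrite -[W in LHS]submxK /Dmx mulmx_block !mul0mx !mul1mx !add0r block_mxKdr.
Qed.

Lemma pA_rotV th (M : 'M[C]_N.+1) z : (pA (rotV th *m M)).[z] = (pA M).[expi th * z].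
Proof.
rewrite /pA !horner_rdet; congr (\det (_ - _)).
have -> : drsubmx (rotV th *m M : 'M[C]_(1 + N)) = expi th *: drsubmx (M : 'M[C]_(1 + N)).
  rewrite /rotV -scalemxAl -[in RHS](drsubmx_Dmx (expi (- (N.+1%:R * th))) M).
  by apply/matrixP => i j; rewrite !mxE.
by rewrite scalerA mulrC.
Qed.

Lemma rfun_rotV th x t :
  rfun x (th + t) =
  complex.Im (expi (- (N.+1%:R / 2 * th)) *
    (conjc kph * rotB N.+1 (lincomb (fun j => rotV th *m x j)) t)).
Proof.
rewrite /rfun; congr complex.Im; rewrite [RHS]mulrCA; congr (conjc kph * _).
rewrite /rotB !horner_lincomb.
under [in RHS]eq_bigr => j _ do rewrite pA_rotV -expiD.
by rewrite [RHS]mulrA -expiD -opprD -mulrDr.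
Qed.

(* The event that [rfun] changes sign between [th] and [th + cell L], after
   rotating by [th]. *)
Definition flip (L : nat) (ph : R) (x : 'I_n -> 'M[C]_N.+1) : R :=
  schange (complex.Im (expi (- ph) * (conjc kph * rotB N.+1 (lincomb x) 0)))
          (complex.Im (expi (- ph) * (conjc kph * rotB N.+1 (lincomb x) (cell R L)))).

Lemma flip_ge0 L ph x : 0 <= flip L ph x. Proof. exact: ler0n. Qed.

Lemma flip_le1 L ph x : `|flip L ph x| <= 1. Proof. exact: norm_natb_le1. Qed.

(** Half a turn negates both values, so the phase only matters modulo pi. *)
Lemma flip_pi L ph x : flip L (ph + pi) x = flip L ph x.
Proof.
rewrite /flip /schange opprD (expiD (- ph)) (expiN pi) expi_pi.
have -> : conjc (-1 : C) = -1 by rewrite [LHS](rmorphN1 (@Num.conj C)).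
by rewrite mulrN1 !mulNr !ImcN mulrNN.
Qed.

Lemma turn_flip L T x : (0 < T)%N ->
  Num.max 0 (T%:R * turn N.+1 (lincomb x) L / pi - 1) <= \sum_(i < T) flip L (phase R T i) x.
Proof.
move=> T0; rewrite ge_max sumr_ge0/= => [|i _]; last exact: flip_ge0.
rewrite /turn; set B0 := rotB _ _ 0; set B1 := rotB _ _ _.
have ge : 0 <= \sum_(i < T) flip L (phase R T i) x by apply: sumr_ge0 => i _; exact: flip_ge0.
have [->|b0] := eqVneq B0 0; first by rewrite cmod0 (mul0r (cmod B1)) invr0 !mulr0 mul0r sub0r (le_trans _ ge)// lerN10.
have [->|b1] := eqVneq B1 0; first by rewrite cmod0 (mulr0 (cmod B0)) invr0 !mulr0 mul0r sub0r (le_trans _ ge)// lerN10.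
have k0 : conjc kph != 0 by rewrite -cmod_gt0 cmod_conj cmod_kph.
have := phase_count T0 (mulf_neq0 k0 b0) (mulf_neq0 k0 b1).
rewrite !cmodM cmod_conj cmod_kph !mul1r conjcM conjcK.
have -> : kph * conjc B0 * (conjc kph * B1) = (kph * conjc kph) * (conjc B0 * B1) by ring.
by rewrite mul_conjc cmod_kph expr1n mul1r.
Qed.

Lemma measurable_flip d (T : measurableType d) (f : T -> 'I_n -> 'M[C]_N.+1) L ph :
  (forall j k l, cmeas (fun w => f w j k l)) -> measurable_fun setT (fun w => flip L ph (f w)).
Proof.
move=> mf; rewrite /flip /schange.
have m1 t : measurable_fun setT (fun w => complex.Im (expi (- ph) * (conjc kph * rotB N.+1 (lincomb (f w)) t))).
  have [] // : cmeas (fun w => expi (- ph) * (conjc kph * rotB N.+1 (lincomb (f w)) t)).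
  do 3![apply: cmeasM; first exact: cmeas_cst].
  apply: (@cmeas_horner _ _ _ N.+1); [by move=> w; exact: size_lincomb|exact: pmeas_lincomb|exact: cmeas_cst].
by apply: measurable_ind_lt => //; exact: measurable_funM.
Qed.

Lemma measurable_turn d (T : measurableType d) (f : T -> 'I_n -> 'M[C]_N.+1) L :
  (forall j k l, cmeas (fun w => f w j k l)) ->
  measurable_fun setT (fun w => turn N.+1 (lincomb (f w)) L).
Proof.
move=> mf; have m1 t : cmeas (fun w => rotB N.+1 (lincomb (f w)) t).
  apply: cmeasM; first exact: cmeas_cst.
  apply: (@cmeas_horner _ _ _ N.+1); [by move=> w; exact: size_lincomb|exact: pmeas_lincomb|exact: cmeas_cst].
rewrite /turn; apply: measurable_funM.
  apply: (measurableT_comp (@normr_measurable R setT)).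
  by have [] := cmeasM (cmeasJ (m1 0)) (m1 (cell R L)).
apply: (measurableT_comp (@measurable_invr R)).
by apply: measurable_funM; exact: measurable_cmod.
Qed.

Context d (T : measurableType d) (P : probability T R) (U : 'I_n -> T -> 'M[C]_N.+1).
Hypotheses (hU : forall j, haar_SU_distributed P (U j)) (hI : mutually_independent P U).
Local Notation Uw w := (fun j : 'I_n => U j w).

Let mUe j k l : cmeas (fun w => U j w k l). Proof. exact: (haar_cmeas (hU j)). Qed.

Lemma joint_SU : {ae P, forall w, forall j, SU (U j w)}.
Proof. by apply: filter_forall => j; exact: haar_SU. Qed.

Lemma Ex_flip_rot L th :
  Ex P (fun w => schange (rfun (Uw w) th) (rfun (Uw w) (th + cell R L))) =
  Ex P (fun w => flip L (N.+1%:R / 2 * th) (Uw w)).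
Proof.
have h w : schange (rfun (Uw w) th) (rfun (Uw w) (th + cell R L)) =
    flip L (N.+1%:R / 2 * th) (fun j => rotV th *m U j w).
  by rewrite -{1}(addr0 th) !rfun_rotV.
transitivity (Ex P (fun w => flip L (N.+1%:R / 2 * th) (fun j => rotV th *m U j w))).
  by apply: eq_Ex => w; exact: h.
have key : (\int[P]_w (flip L (N.+1%:R / 2 * th) (fun j => rotV th *m U j w))%:E =
    \int[P]_w (flip L (N.+1%:R / 2 * th) (Uw w))%:E)%E.
  apply: (@joint_left _ _ _ _ _ _ _ hU hI (fun=> rotV th)
    (fun x : tupT R n N.+1 => (flip L (N.+1%:R / 2 * th) x)%:E)).
  - by move=> j; exact: SU_rotV.
  - by apply/measurable_EFinP; apply: measurable_flip => j k l; exact: cmeas_coord.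
  - by move=> x; rewrite lee_fin flip_ge0.
exact: (congr1 fine key).
Qed.

Let nz w := nzeros_circle (comb_charpoly (Uw w)).

(** Sign changes at different grid points are compared with one model event at the origin: rotation
    invariance turns the position into a phase. *)
Lemma grid_bound L phi :
  ((\sum_(k < L.+1) Ex P (fun w => flip L (N.+1%:R / 2 * grid phi L.+1 k) (Uw w)))%:E <=
   \int[P]_w nz w)%E.
Proof.
have iG k : intg P (fun w => flip L (N.+1%:R / 2 * grid phi L.+1 k) (Uw w)).
  by apply: (@intg_bdd _ _ _ _ _ 1); [exact: measurable_flip|move=> w; exact: flip_le1].
have gS (k : nat) : grid phi L.+1 k + cell R L = grid phi L.+1 k.+1.
  by rewrite /grid /cell -[k.+1%:R]natr1 (mulrDl k%:R 1) mul1r addrA.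
have mr t : measurable_fun setT (fun w => rfun (Uw w) t).
  have [] // : cmeas (fun w => conjc kph * rotB N.+1 (lincomb (Uw w)) t).
  do 2![apply: cmeasM; first exact: cmeas_cst].
  apply: (@cmeas_horner _ _ _ N.+1); [by move=> w; exact: size_lincomb|exact: pmeas_lincomb|exact: cmeas_cst].
pose S w := \sum_(k < L.+1) schange (rfun (Uw w) (grid phi L.+1 k)) (rfun (Uw w) (grid phi L.+1 k.+1)).
have iS k : intg P (fun w => schange (rfun (Uw w) (grid phi L.+1 k)) (rfun (Uw w) (grid phi L.+1 k.+1))).
  apply: (@intg_bdd _ _ _ _ _ 1); last by move=> w; exact: norm_natb_le1.
  by apply: measurable_ind_lt => //; exact: measurable_funM.
have -> : \sum_(k < L.+1) Ex P (fun w => flip L (N.+1%:R / 2 * grid phi L.+1 k) (Uw w)) = Ex P S.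
  rewrite Ex_sum//; apply: eq_bigr => k _; rewrite -Ex_flip_rot; apply: eq_Ex => w.
  by congr (schange _ (rfun _ _)); rewrite gS.
rewrite EFin_Ex; last exact: intg_sum.
have S0 w : 0 <= S w by apply: sumr_ge0 => k _; exact: ler0n.
(* The counting inequality holds for samples in SU only; multiplying by the indicator of this almost
   sure event makes it hold everywhere. *)
pose A : set T := [set w | forall j, SU (U j w)].
have mA : measurable A.
  have -> : A = \bigcap_(j in [set: 'I_n]) (U j @^-1` (@SU R N.+1)).
    by apply/seteqP; split => w /= h j; [move=> _|]; exact: h.
  apply: fin_bigcap_measurable => [|j _]; first exact: finite_finset.
  by rewrite -[_ @^-1` _]setTI; apply: (haar_measurable (hU j)) => //; exact: measurable_SU.
rewrite (@ge0_ae_eq_integral _ _ _ P setT _ (fun w => (S w * \1_A w)%:E))//.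
- apply: ge0_le_integral_any => w; first by rewrite lee_fin mulr_ge0.
  rewrite indicE; case: (boolP (w \in A)) => wA; last first.
    by rewrite mulr0; apply: ereal_sup_ubound; exists [::].
  rewrite mulr1; apply: ncard_sign_changes => //.
    by apply: continuous_Im_rotB; exact: size_lincomb.
  by move=> t; apply: rfun_zero; move: wA; rewrite inE.
- by apply/measurable_EFinP; apply: intg_meas; exact: intg_sum.
- apply/measurable_EFinP; apply: measurable_funM; last exact: measurable_indic.
  by apply: intg_meas; exact: intg_sum.
- by move=> w _; rewrite lee_fin.
- by move=> w _; rewrite lee_fin mulr_ge0.
- by apply: filterS joint_SU => w sw _; rewrite indicE mem_set// mulr1.
Qed.

Let Z L w : R := Num.max 0 (L.+1%:R * turn N.+1 (lincomb (Uw w)) L / pi - L.+1%:R^-1).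

Let mZ L : measurable_fun setT (Z L).
Proof.
apply: measurable_maxr; first exact: measurable_cst.
apply: measurable_funB; last exact: measurable_cst.
apply: measurable_funM; last exact: measurable_cst.
apply: measurable_funM; [exact: measurable_cst|exact: measurable_turn].
Qed.

(** Average over Q = (N+1)(L+1) offsets. The phases met are pi i / M with M = (L+1)^2, where i = k Q
    + j runs through N+1 periods of length M. This leaves a count over phases for one fixed sample,
    which is [turn_flip]. *)
Lemma turn_bound L : (\int[P]_w (Z L w)%:E <= \int[P]_w nz w)%E.
Proof.
have nz0 : (0 <= \int[P]_w nz w)%E.
  by apply: integral_ge0 => w _; apply: ereal_sup_ubound; exists [::].
move: (@grid_bound L) nz0; case: (\int[P]_w nz w)%E => [r|_ _|]//; last by rewrite leey.
move=> h _; pose M := (L.+1 * L.+1)%N; pose Q := (N.+1 * L.+1)%N.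
have L0 : 0 < L.+1%:R :> R by rewrite ltr0n.
have N0 : 0 < N.+1%:R :> R by rewrite ltr0n.
have l0 : L.+1%:R != 0 :> R by rewrite gt_eqF.
have n0 : N.+1%:R != 0 :> R by rewrite gt_eqF.
have M0 : (0 < M)%N by rewrite muln_gt0.
pose a i := Ex P (fun w => flip L (phase R M i) (Uw w)).
have ia i : intg P (fun w => flip L (phase R M i) (Uw w)).
  by apply: (@intg_bdd _ _ _ _ _ 1); [exact: measurable_flip|move=> w; exact: flip_le1].
have aM i : a (i + M)%N = a i.
  apply: eq_Ex => w; rewrite -[in RHS]flip_pi; congr (flip _ _ _).
  by rewrite /phase (natrD R i M) (mulrDl i%:R M%:R) (mulfV (x := M%:R)) ?pnatr_eq0 -?lt0n// mulrDr mulr1.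
have hj j : \sum_(k < L.+1) a (k * Q + j)%N <= r.
  (* The offset whose multiple by (N+1)/2 is the phase of index j. *)
  have := h (pi *+ 2 * j%:R / (N.+1%:R * (L.+1%:R * L.+1%:R))); rewrite lee_fin.
  apply: le_trans; apply: ler_sum => k _; rewrite le_eqVlt; apply/orP; left; apply/eqP.
  apply: eq_Ex => w; congr (flip _ _ _).
  rewrite /grid mulrDr phase_arith1// phase_arith2// /phase natrD !natrM -mulrDr -mulrDl [_ + j%:R]addrC.
  by [].
have hs : \sum_(j < Q) \sum_(k < L.+1) a (k * Q + j)%N <= N.+1%:R * L.+1%:R * r.
  rewrite -natrM -/Q mulr_natl -[Q in leRHS]card_ord -sumr_const.
  by apply: ler_sum => j _; exact: hj.
rewrite exchange_big /= sum_blocks in hs.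
have qM : (L.+1 * Q = N.+1 * M)%N by rewrite /Q /M mulnCA mulnA.
rewrite qM sum_periodic// in hs.
have {}hs := average_arith N0 L0 hs.
have iW : intg P (fun w => (\sum_(i < M) flip L (phase R M i) (Uw w)) * L.+1%:R^-1).
  rewrite (_ : (fun w => _) = fun w => L.+1%:R^-1 * \sum_(i < M) flip L (phase R M i) (Uw w)).
    by apply: intgZ; exact: intg_sum.
  by apply/funext => w; rewrite mulrC.
apply: (@le_trans _ _ (\int[P]_w ((\sum_(i < M) flip L (phase R M i) (Uw w)) * L.+1%:R^-1)%:E)%E).
  apply: ge0_le_integral_any => w; first by rewrite lee_fin le_max lexx.
  have := turn_flip L (Uw w) M0; rewrite lee_fin ge_max => /andP[h1 h2].
  rewrite /Z ge_max mulr_ge0 ?invr_ge0 ?(ltW L0)//=.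
  by apply: scale_arith => //; rewrite -natrM.
rewrite -EFin_Ex// lee_fin (_ : Ex P _ = (\sum_(i < M) a i) / L.+1%:R)//.
transitivity (Ex P (fun w => L.+1%:R^-1 * \sum_(i < M) flip L (phase R M i) (Uw w))).
  by apply: eq_Ex => w; rewrite mulrC.
by rewrite ExZ ?Ex_sum 1?mulrC//; exact: intg_sum.
Qed.

(** Fatou's lemma is applied to the turning counts [Z]; for each L their integral is at most that of
    the number of zeros, so only the left side varies with L. *)
Lemma kac_rice (h : T -> R) : (forall w, 0 <= h w) ->
  (forall w, h w <= `|speed N.+1 (lincomb (Uw w))|) ->
  (forall w, (lincomb (Uw w)).[1] = 0 -> h w = 0) ->
  (\int[P]_w (h w)%:E <= \int[P]_w nz w)%E.
Proof.
move=> h0 hs hz.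
apply: (@le_trans _ _ (\int[P]_w limn_einf (fun L => (Z L w)%:E))%E); last first.
  apply: (le_trans (fatou P measurableT (f := fun L w => (Z L w)%:E) _ _)).
  - by move=> L; exact/measurable_EFinP.
  - by move=> L w _; rewrite lee_fin le_max lexx.
  - by apply: limn_einf_le => L; exact: turn_bound.
apply: ge0_le_integral_any => w; first by rewrite lee_fin.
suff [l [lh lc]] : exists l, h w <= l /\ (fun L => (Z L w)%:E) @ \oo --> l%:E.
  by rewrite (cvg_limn_einf_sup lc).1 lee_fin.
(* If AA(1) = 0 then [turn] is 0 by convention and [Z] vanishes, which is why h has to vanish as
   well. *)
have [e|e] := eqVneq ((lincomb (Uw w)).[1]) 0.
  exists 0; rewrite hz//; split => //.
  rewrite (_ : (fun L => _) = fun=> 0%E); first exact: cvg_cst.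
  apply/funext => L; rewrite /Z /turn rotB0 e cmod0 mul0r invr0 !mulr0 mul0r sub0r max_l//.
exists `|speed N.+1 (lincomb (Uw w))|; split => //; apply: cvg_EFin; first exact: nearW.
rewrite (_ : `|_| = Num.max 0 (`|speed N.+1 (lincomb (Uw w))| - 0)); last by rewrite subr0 max_r.
have maxE y : Num.max 0 y = (y + `|y|) / 2 :> R by rewrite maxr_absE add0r sub0r normrN.
rewrite maxE (_ : fine \o _ = fun L => (Z L w)%R)//; rewrite /Z; under eq_fun => L do rewrite maxE.
apply: cvgM; last exact: cvg_cst.
suff c : L.+1%:R * turn N.+1 (lincomb (Uw w)) L / pi - L.+1%:R^-1 @[L --> \oo] -->
    `|speed N.+1 (lincomb (Uw w))| - 0 by apply: cvgD => //; exact: cvg_norm.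
apply: cvgB; last exact: cvg_harmonic.
by apply: turn_cvg => //; exact: size_lincomb.
Qed.

End KacRice.

Lemma trace_arith (F : comNzRingType) (b z u zc c1 t r : F) :
  b * (z * u + (zc * c1 + t)) + r = b * (z * u + zc * c1) + (t * b + r).
Proof. ring. Qed.

Lemma root_arith (F : comNzRingType) (b z u c1 c0 zc : F) : z * zc = 1 ->
  (b * u * z + c0) * z + b * c1 = z * (b * (z * u + zc * c1) + c0).
Proof.
move=> h; transitivity (b * (z * z * u + z * zc * c1) + z * c0); last by ring.
by rewrite h; ring.
Qed.

(** * The upper bound: the combination is almost surely a nonzero polynomial *)

Section ZeroCount.
Variable R : realType.
Local Notation C := R[i].

Lemma mxtrace_rotmx N (a : C) (M : 'M[C]_(1 + 1 + N)) :
  \tr (rotmx N a 0 *m M) = a * M 0 0 + (conjc a * \tr (drsubmx (ulsubmx M)) + \tr (drsubmx M)).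
Proof.
rewrite /rotmx conjc0 oppr0 raddf0 -[M in LHS]submxK mulmx_block !mul0mx !addr0 !add0r mul1mx.
rewrite mxtrace_block -[ulsubmx M in LHS]submxK mulmx_block !mul0mx !addr0 !add0r.
rewrite mxtrace_block !mul_scalar_mx !mxtraceZ ?mul1r addrA; congr (_ * _ + _ + _).
rewrite /mxtrace big_ord1 !mxE; congr (M _ _); exact/val_inj.
Qed.

Section FixedDegree.
Context (n N : nat) (b : 'I_n -> R).
Local Notation m := N.+2.

Definition cpoly (x : 'I_n -> 'M[C]_m) : {poly C} := \sum_(j < n) ((b j)%:C)%C *: rdet (x j).

Lemma horner_cpoly x z : (cpoly x).[z] = comb_charpoly b x z.
Proof.
rewrite /cpoly horner_sum; apply: eq_bigr => j _.
by rewrite hornerZ horner_rdet.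
Qed.

Lemma size_cpoly x : (size (cpoly x) <= m.+1)%N.
Proof.
apply: (leq_trans (size_sum _ _ _)); apply/bigmax_leqP => j _.
exact: leq_trans (size_scale_leq _ _) (size_rdet _).
Qed.

Lemma nzeros_le x : cpoly x != 0 -> (nzeros_circle (comb_charpoly b x) <= m%:R%:E)%E.
Proof.
move=> p0; apply: ub_ereal_sup => _ [s [us hs] <-]; rewrite lee_fin ler_nat -ltnS.
apply: leq_trans (size_cpoly x); apply: max_poly_roots => //.
by apply/allP => z zs; rewrite /root horner_cpoly; have [_ ->] := hs z zs.
Qed.

Definition ctrace (x : 'I_n -> 'M[C]_m) : C := \sum_(j < n) ((b j)%:C)%C * \tr (x j).

(** Reversal turns the combination into one of characteristic polynomials, whose subleading
    coefficient is minus the weighted trace. The leading coefficient, the sum of the b_j, may itself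
    be 0. *)
Lemma cpoly_eq0 x : cpoly x = 0 -> ctrace x = 0.
Proof.
move=> p0; have : \sum_(j < n) ((b j)%:C)%C *: char_poly (x j) = 0.
  apply: poly_eq_off0 => z z0; rewrite horner0 horner_sum.
  have := horner_cpoly x z^-1; rewrite p0 horner0 => /esym h.
  transitivity (z ^+ m * comb_charpoly b x z^-1); last by rewrite h mulr0.
  rewrite mulr_sumr; apply: eq_bigr => j _; rewrite hornerZ mulrCA; congr (_ * _).
  rewrite /charpoly_det -detZ scalerBr scalerA mulfV// scale1r scalemx1.
  rewrite /char_poly -[LHS]/(horner_eval z _) -det_map_mx; congr (\det _).
  apply/matrixP => i k; rewrite !mxE /= /horner_eval hornerD hornerN hornerC.
  by rewrite hornerMn hornerX.
move=> /(congr1 (fun p : {poly C} => p`_m.-1)); rewrite coef0 coef_sum.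
under eq_bigr => j _ do rewrite coefZ char_poly_trace// mulrN.
by rewrite sumrN => /eqP; rewrite oppr_eq0 => /eqP.
Qed.

Context d (T : measurableType d) (P : probability T R) (U : 'I_n -> T -> 'M[C]_m).
Hypotheses (hU : forall j, haar_SU_distributed P (U j)) (hI : mutually_independent P U).
Hypotheses (n0 : (0 < n)%N) (b0 : forall j, b j != 0).
Local Notation Uw w := (fun j : 'I_n => U j w).

Lemma cmeas_ctrace d' (T' : measurableType d') (f : T' -> 'I_n -> 'M[C]_m) :
  (forall j k l, cmeas (fun w => f w j k l)) -> cmeas (fun w => ctrace (f w)).
Proof.
move=> mf; apply: cmeas_sum => j; apply: cmeasM; first exact: cmeas_cst.
by apply: cmeas_sum => i; exact: mf.
Qed.

Let mUe j k l : cmeas (fun w => U j w k l). Proof. exact: (haar_cmeas (hU j)). Qed.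

(** The rotations by z_k and conj(z_k) give equiprobable events. Multiplied by z_k, the rotated
    trace is a quadratic polynomial in z_k with leading coefficient b times the corner, almost
    surely nonzero. Hence at most two of the events hold at once. *)
Lemma ctrace_neq0 : P [set w | ctrace (Uw w) = 0] = 0%E.
Proof.
pose j0 : 'I_n := Ordinal n0.
pose z k : C := expi (k.+1%:R^-1).
have zi : injective z.
  move=> k l /expi_inj h; have {h} : k.+1%:R^-1 = l.+1%:R^-1 :> R.
    apply: h; have p2 := @pi_ge2 R.
    have bd (i : nat) : 0 < i.+1%:R^-1 :> R /\ i.+1%:R^-1 <= 1 :> R.
      by rewrite invr_gt0 ltr0n invf_le1 ?ltr0n// ler1n.
    have [x1 x2] := bd k; have [y1 y2] := bd l.
    move: (k.+1%:R^-1 : R) (l.+1%:R^-1 : R) x1 x2 y1 y2 => x y x1 x2 y1 y2.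
    by rewrite ltr_norml -(mulr_natl pi 2); apply/andP; split; lra.
  by move=> /invr_inj/eqP; rewrite eqr_nat => /eqP[].
have z1 k : cmod (z k) = 1 by exact: cmod_expi.
pose V k (j : 'I_n) : 'M[C]_m := if j == j0 then rotmx N (z k) 0 else 1%:M.
have sV k j : SU (V k j).
  rewrite /V; case: ifP => _; last exact: SU1.
  by apply: SU_rotmx; rewrite ?unit_neq0// mul_conjc z1 expr1n mul0r addr0.
pose A k : set T := [set w | ctrace (fun j => V k j *m U j w) = 0].
have mVU k j i l : cmeas (fun w => (V k j *m U j w) i l).
  by apply: cmeas_mulmx => i' l' //; exact: cmeas_cst.
have mA k : measurable (A k).
  by apply: measurable_eqc; [exact: (cmeas_ctrace (mVU k))|exact: cmeas_cst].
have mA' : measurable [set w | ctrace (Uw w) = 0].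
  by apply: measurable_eqc; [exact: cmeas_ctrace|exact: cmeas_cst].
pose B : set (tupT R n m) := [set x | ctrace x = 0].
have mB : measurable B.
  apply: measurable_eqc; last exact: cmeas_cst.
  by apply: cmeas_ctrace => j k l; exact: cmeas_coord.
have PA k : P (A k) = P [set w | ctrace (Uw w) = 0].
  transitivity (\int[P]_w (\1_B ((fun j => V k j *m U j w) : tupT R n m) : R)%:E)%E.
    transitivity (\int[P]_w (\1_(A k) w : R)%:E)%E; first by rewrite integral_indic// setIT.
    by apply: eq_integral => w _; rewrite !indicE.
  transitivity (\int[P]_w (\1_B ((fun j => U j w) : tupT R n m) : R)%:E)%E.
    apply: (@joint_left _ _ _ _ _ _ _ hU hI (V k) (fun x : tupT R n m => (\1_B x : R)%:E)) => //.
    by apply/measurable_EFinP; exact: measurable_indic.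
  transitivity (\int[P]_w (\1_[set w | ctrace (Uw w) = 0] w : R)%:E)%E; last by rewrite integral_indic// setIT.
  by apply: eq_integral => w _; rewrite !indicE.
have PA0 k : P (A k) = P (A 0%N) by exact: (etrans (PA k) (esym (PA 0%N))).
rewrite -(PA 0%N); apply: (@equiprob0 R _ _ P A 2 (ler0n _ _) mA PA0).
apply: filterS (haar_corner_neq0 (hU j0)) => w u0 K.
pose c1 := \tr (drsubmx (ulsubmx (U j0 w : 'M[C]_(1 + 1 + N)))).
pose c0 := \tr (drsubmx (U j0 w : 'M[C]_(1 + 1 + N))) * (b j0)%:C%C +
   \sum_(j < n | j != j0) ((b j)%:C)%C * \tr (U j w).
have cE k : ctrace (fun j => V k j *m U j w) =
    (b j0)%:C%C * (z k * U j0 w 0 0 + conjc (z k) * c1) + c0.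
  rewrite /ctrace (bigD1 j0)//= {1}/V eqxx mxtrace_rotmx.
  rewrite (eq_bigr (fun j => ((b j)%:C)%C * \tr (U j w))).
    exact: trace_arith.
  by move=> j /negbTE jj; rewrite /V jj mul1mx.
pose q : {poly C} := Poly [:: (b j0)%:C%C * c1; c0; (b j0)%:C%C * U j0 w 0 0].
have bj0 : (b j0)%:C%C != 0 :> C by rewrite -(rmorph0 (real_complex R)) (inj_eq (@complexI R)) b0.
have q0 : q != 0.
  apply/eqP => /(congr1 (fun p : {poly C} => p`_2)); rewrite coef0 coef_Poly /= => /eqP.
  by rewrite mulf_eq0 (negbTE bj0) (negbTE u0).
have sq : (size q <= 3)%N by exact: size_Poly.
have rq k : A k w -> root q (z k).
  rewrite /A /= cE => h; rewrite /root horner_Poly /= mul0r add0r.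
  by rewrite (root_arith _ _ _ _ (zc := conjc (z k))) ?h ?mulr0// mul_conjc z1 expr1n.
pose s := [seq z (val k) | k : 'I_K <- enum 'I_K & w \in A (val k)].
have : (size s < 3)%N.
  apply: leq_trans sq; apply: max_poly_roots => //.
    by apply/allP => y /mapP[k]; rewrite mem_filter => /andP[/set_mem hk _] ->; exact: rq.
  have si : injective (fun k : 'I_K => z (val k)) by move=> k l /zi h; exact/val_inj.
  by rewrite (map_inj_uniq si) filter_uniq// enum_uniq.
rewrite ltnS -(ler_nat R) => hs; apply: le_trans hs.
rewrite size_map size_filter -sum1_count natr_sum le_eqVlt; apply/orP; left; apply/eqP.
rewrite [RHS]big_mkcond /= big_enum /=; apply: eq_bigr => k _; rewrite indicE.
by case: (_ \in _).
Qed.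

Lemma nzeros_ub : (\int[P]_w nzeros_circle (comb_charpoly b (Uw w)) <= m%:R%:E)%E.
Proof.
pose A : set T := [set w | ctrace (Uw w) = 0].
have mA : measurable A.
  by apply: measurable_eqc; [exact: cmeas_ctrace|exact: cmeas_cst].
(* On the null event the number of zeros may be infinite, so it is bounded there by +oo, at no cost
   for the integral. *)
pose g w : \bar R := ((\1_A w : R)%:E * +oo)%E.
have g0 w : (0 <= g w)%E by rewrite mule_ge0// ?lee_fin.
have mg : measurable_fun setT g.
  by apply: emeasurable_funM => //; apply/measurable_EFinP; exact: measurable_indic.
apply: (@le_trans _ _ (\int[P]_w (m%:R%:E + g w))%E).
  apply: ge0_le_integral_any => w; first by apply: ereal_sup_ubound; exists [::].
  rewrite /g indicE; case: (boolP (w \in A)) => [_|wA]; first by rewrite mul1e addey// leey.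
  rewrite mul0e adde0; apply: nzeros_le; apply: contraNneq wA => /cpoly_eq0 h.
  by rewrite inE.
rewrite ge0_integralD//.
rewrite integral_cst//= probability_setT mule1.
rewrite (@ge0_ae_eq_integral _ _ _ P setT _ (cst 0%E)) ?integral0 ?adde0//.
exists A; split => //; first exact: ctrace_neq0.
by move=> w /= h; apply: contrapT => wA; apply: h => _; rewrite /g indicE memNset// mul0e.
Qed.

End FixedDegree.
End ZeroCount.

Lemma forall_prodb (R : realType) (I : finType) (Q : pred I) :
  ([forall k, Q k]%:R : R) = \prod_k (Q k)%:R.
Proof.
case: (boolP [forall k, Q k]) => [/forallP h|]; first by rewrite big1// => k _; rewrite h.
by move=> /forallPn[k /negbTE hk]; rewrite (bigD1 k)//= hk mul0r.
Qed.

Lemma quot_arith (F : fieldType) (b p p' : F) : p != 0 -> b * p * (2 * (p' / p)) = 2 * (b * p').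
Proof. by move=> p0; field. Qed.

(** * Weighted means with one dominating weight *)

Section Dominance.
Variable R : realType.
Local Notation C := R[i].

Lemma cmod_sum (I : Type) (r : seq I) (Q : pred I) (f : I -> C) :
  cmod (\sum_(i <- r | Q i) f i) <= \sum_(i <- r | Q i) cmod (f i).
Proof.
elim/big_rec2 : _ => [|i x y _ h]; first by rewrite cmod0.
by apply: le_trans (cmodD _ _) _; rewrite lerD2l.
Qed.

(** The deviation from q_j is the sum of a_k (q_j - q_k) divided by the total weight. The numerator
    is at most 2 Q n c |a_j| and the total weight is at least |a_j| / 2. *)
Lemma weighted_mean_dominant n (a q : 'I_n -> C) (j : 'I_n) (c Q : R) :
  a j != 0 -> 0 <= c -> n%:R * c <= 2^-1 ->
  (forall k, k != j -> cmod (a k) <= c * cmod (a j)) -> (forall k, cmod (q k) <= Q) ->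
  \sum_k a k != 0 /\
  complex.Re (q j) - 4 * (n%:R * c) * Q <= complex.Re ((\sum_k a k * q k) / \sum_k a k).
Proof.
move=> aj c0 nc ha hq; set eta := n%:R * c.
have aj0 : 0 < cmod (a j) by rewrite cmod_gt0.
have Q0 : 0 <= Q by exact: le_trans (cmod_ge0 _) (hq j).
have eta0 : 0 <= eta by rewrite mulr_ge0.
have card_le (x : R) : 0 <= x -> \sum_(k < n | k != j) x <= n%:R * x.
  move=> x0; rewrite mulr_natl -[X in _ *+ X](card_ord n) -sumr_const.
  by rewrite [leRHS](bigD1 j)//= lerDr.
have s1 : cmod (\sum_(k < n | k != j) a k) <= eta * cmod (a j).
  apply: le_trans (cmod_sum _ _ _) _; apply: le_trans (ler_sum _ ha) _.
  by rewrite /eta -mulrA; apply: card_le; rewrite mulr_ge0// ltW.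
have sE : \sum_k a k = a j + \sum_(k < n | k != j) a k by rewrite (bigD1 j).
have lb : 2^-1 * cmod (a j) <= cmod (\sum_k a k).
  rewrite sE -[X in a j + X]opprK; apply: le_trans (cmodB_ge _ _); rewrite cmodN.
  have : eta * cmod (a j) <= 2^-1 * cmod (a j) by rewrite ler_wpM2r// ltW.
  lra.
have S0 : 0 < cmod (\sum_k a k) by apply: lt_le_trans lb; rewrite mulr_gt0.
split; first by rewrite -cmod_gt0.
set S := \sum_k a k in S0 lb sE *.
have Sn0 : S != 0 by rewrite -cmod_gt0.
have e : (\sum_k a k * q k) / S = q j - (\sum_(k < n | k != j) a k * (q j - q k)) / S.
  set D := \sum_(k < n | k != j) _.
  have eD : D = \sum_k a k * (q j - q k).
    by rewrite [RHS](bigD1 j)//= subrr mulr0 add0r.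
  have -> : \sum_k a k * q k = q j * S - D.
    by rewrite eD /S mulr_sumr -sumrB; apply: eq_bigr => k _; ring.
  by rewrite mulrBl mulfK.
have s2 : cmod (\sum_(k < n | k != j) a k * (q j - q k)) <= eta * (2 * Q * cmod (a j)).
  apply: le_trans (cmod_sum _ _ _) _.
  apply: (@le_trans _ _ (\sum_(k < n | k != j) c * (2 * Q * cmod (a j)))).
    apply: ler_sum => k kj; rewrite cmodM.
    have h1 : cmod (q j - q k) <= 2 * Q.
      by apply: le_trans (cmodB _ _) _; have := hq j; have := hq k; lra.
    rewrite (_ : c * (2 * Q * cmod (a j)) = c * cmod (a j) * (2 * Q)); last by ring.
    by apply: ler_pM; rewrite ?cmod_ge0// ha.
  by rewrite /eta -(mulrA n%:R c); apply: card_le; rewrite !mulr_ge0// ltW.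
rewrite e RecD RecN lerD2l lerN2.
apply: le_trans (ler_norm _) _; apply: le_trans (Re_le_cmod _) _.
rewrite cmodM cmodV ler_pdivrMr//; apply: le_trans s2 _.
have -> : eta * (2 * Q * cmod (a j)) = 4 * eta * Q * (2^-1 * cmod (a j)) by field.
by rewrite ler_wpM2l// !mulr_ge0.
Qed.

(** With the other coordinates frozen, leading them is a half-line condition on the remaining one;
    the second case arises when there is no competitor. *)
Lemma threshold_shape n (x : 'I_n -> R) (j : 'I_n) :
  (exists y, forall s, [forall k, (k != j) ==> (x k <= s)] = (y <= s)) \/
  (forall s, [forall k, (k != j) ==> (x k <= s)]).
Proof.
case: (pickP (fun k => k != j)) => [k0 hk0|none]; last first.
  by right => s; apply/forallP => k; rewrite none.
left; have [i ij hi] := @arg_maxP _ R 'I_n k0 (fun k => k != j) x hk0.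
exists (x i) => s; apply/idP/idP => [/forallP/(_ i)|h]; first by rewrite ij.
by apply/forallP => k; apply/implyP => kj; exact: le_trans (hi k kj) h.
Qed.

End Dominance.

(** * Conditioning on all coordinates but one *)

Section Mixing.
Variable R : realType.
Local Notation C := R[i].
Context (n N : nat) d (T : measurableType d) (P : probability T R) (U : 'I_n -> T -> 'M[C]_N).
Hypotheses (hU : forall j, haar_SU_distributed P (U j)) (hI : mutually_independent P U).

Definition mix (j : 'I_n) (w' w : T) : tupT R n N := fun k => if k == j then U j w else U k w'.

(* Resampling one coordinate independently of the others preserves the joint law. *)
Lemma joint_mix j (g : tupT R n N -> \bar R) : measurable_fun setT g -> (forall x, 0 <= g x)%E ->
  (\int[P]_w g (fun j => U j w) = \int[P]_w' \int[P]_w g (mix j w' w))%E.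
Proof.
move=> mg g0.
have mU k : measurable_fun setT (U k : T -> mxT R N) by exact: haar_measurable.
have mZ : measurable_fun setT (fun w => (fun j => U j w) : tupT R n N) by exact: measurable_tupP.
have mZ' : measurable_fun setT (fun z : T * T => mix j z.1 z.2).
  apply: measurable_tupP => k; rewrite /mix; case: (k == j).
    exact: (measurableT_comp (mU j) measurable_snd).
  exact: (measurableT_comp (mU k) measurable_fst).
transitivity (\int[pushforward P (fun w => (fun j => U j w) : tupT R n N)]_x g x)%E.
  by rewrite ge0_integral_pushforward// preimage_setT.
transitivity (\int[(P \x P)%E]_z g (mix j z.1 z.2))%E; last first.
  by rewrite (fubini_tonelli1 (fun z : T * T => g (mix j z.1 z.2)))//; exact: measurableT_comp.
transitivity (\int[pushforward (P \x P)%E (fun z : T * T => mix j z.1 z.2)]_x g x)%E; last first.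
  by rewrite ge0_integral_pushforward// preimage_setT.
apply: eq_measure_integral => A mA _.
apply: (@measure_unique _ R (tupT R n N) (@rect R n N) (fun=> setT)) => //.
- exact: rectI.
- by move=> _; exists (fun=> setT); split => //; apply/seteqP; split.
- by rewrite bigcup_const.
- move=> _ [B [mB ->]].
  pose E := [set w | forall k, k != j -> B k (U k w)].
  have mE : measurable E by exact: (measurable_others hU).
  have mUB : measurable (U j @^-1` B j).
    by rewrite -[_ @^-1` _]setTI; exact: mU.
  transitivity (P (U j @^-1` B j `&` E)).
    congr (P _); apply/seteqP; split => w /=; first by move=> h; split => // k _; exact: h.
    by move=> [h1 h2] k; have [->//|kj] := eqVneq k j; exact: h2.
  rewrite (others_indep hI j mB (mB j)).
  transitivity ((P \x P)%E (E `*` (U j @^-1` B j))); first by rewrite product_measure1E// muleC.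
  congr ((P \x P)%E _); apply/seteqP; split => -[w' w] /=.
    by move=> [h1 h2] k; rewrite /mix /=; case: eqP => [->//|/eqP]; exact: h1.
  move=> h; split; last by have := h j; rewrite /mix /= eqxx.
  by move=> k kj; have := h k; rewrite /mix /= (negbTE kj).
- move=> _; apply: le_lt_trans (probability_le1 P _) _; rewrite ?ltry//.
  by rewrite -[_ @^-1` _]setTI; exact: mZ.
Qed.

Lemma mix_le j (g1 g2 : tupT R n N -> R) : measurable_fun setT g1 -> measurable_fun setT g2 ->
  (forall x, 0 <= g1 x) -> (forall x, 0 <= g2 x) ->
  intg P (fun w => g1 (fun j => U j w)) -> intg P (fun w => g2 (fun j => U j w)) ->
  (forall w', \int[P]_w (g1 (mix j w' w))%:E <= \int[P]_w (g2 (mix j w' w))%:E)%E ->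
  Ex P (fun w => g1 (fun j => U j w)) <= Ex P (fun w => g2 (fun j => U j w)).
Proof.
move=> m1 m2 p1 p2 i1 i2 h; rewrite -lee_fin !EFin_Ex//.
have E (g : tupT R n N -> R) : measurable_fun setT g -> (forall x, 0 <= g x) ->
    (\int[P]_w (g (fun j => U j w))%:E = \int[P]_w' \int[P]_w (g (mix j w' w))%:E)%E.
  move=> mg g0; apply: (joint_mix j (g := fun x => (g x)%:E)); first exact/measurable_EFinP.
  by move=> x; rewrite lee_fin.
rewrite (E _ m1 p1) (E _ m2 p2).
apply: ge0_le_integral_any => // w'.
by apply: integral_ge0 => w _; rewrite lee_fin.
Qed.

End Mixing.

(** * The event that one index leads *)

Section LowerBound.
Variable R : realType.
Local Notation C := R[i].
Context (n N : nat) (b : 'I_n -> R).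
Local Notation m := (N.+1%:R : R).

Definition slog (j : 'I_n) (x : 'I_n -> 'M[C]_N.+1) : R := Sx N.+1 (pA (x j)) + ln `|b j|.
Definition dlog (j : 'I_n) (x : 'I_n -> 'M[C]_N.+1) : C := qx N.+1 (pA (x j)).
Definition leads (l : R) (j : 'I_n) (x : 'I_n -> 'M[C]_N.+1) : bool :=
  [forall k, (k != j) ==> (slog k x + l <= slog j x)].

Section Measurability.
Context d (T : measurableType d) (f : T -> 'I_n -> 'M[C]_N.+1).
Hypothesis mf : forall j k l, cmeas (fun w => f w j k l).

Lemma measurable_slog j : measurable_fun setT (fun w => slog j (f w)).
Proof.
apply: measurable_funD; last exact: measurable_cst.
by apply: (@measurable_Sx _ _ _ N.+1); [move=> w; exact: size_pA|exact: pmeas_pA].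
Qed.

Lemma cmeas_dlog j : cmeas (fun w => dlog j (f w)).
Proof. by apply: (@cmeas_qx _ _ _ N.+1); [move=> w; exact: size_pA|exact: pmeas_pA]. Qed.

Lemma measurable_leads l j : measurable_fun setT (fun w => (leads l j (f w))%:R : R).
Proof.
rewrite /leads; under eq_fun => w do rewrite forall_prodb.
apply: measurable_prod => k _; case: (k != j) => /=; last exact: measurable_cst.
apply: measurable_ind_le; last exact: measurable_slog.
by apply: measurable_funD; [exact: measurable_slog|exact: measurable_cst].
Qed.

Lemma measurable_all_good :
  measurable_fun setT (fun w => [forall k, good N.+1 (pA (f w k))]%:R : R).
Proof.
under eq_fun => w do rewrite forall_prodb.
apply: measurable_prod => k _; apply: measurable_natb.
by apply: (@measurable_good _ _ _ N.+1); [move=> w; exact: size_pA|exact: pmeas_pA].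
Qed.

End Measurability.

Lemma speed_leads (l Q : R) (j : 'I_n) (x : 'I_n -> 'M[C]_N.+1) : (forall k, b k != 0) ->
  n%:R * expR (- l) <= 2^-1 ->
  (forall k, good N.+1 (pA (x k))) -> leads l j x -> (forall k, cmod (dlog k x) <= Q) ->
  (lincomb b x).[1] != 0 /\
  complex.Re (dlog j x) - 4 * (n%:R * expR (- l)) * Q <= speed N.+1 (lincomb b x).
Proof.
move=> b0 hl gx /forallP lead hq.
pose a k : C := ((b k)%:C)%C * (pA (x k)).[1].
have p0 k : (pA (x k)).[1] != 0 by rewrite -cmod_gt0; have /andP[] := gx k.
have bk0 k : (b k)%:C%C != 0 :> C.
  by rewrite -(rmorph0 (real_complex R)) (inj_eq (@complexI R)) b0.
have ca k : cmod (a k) = expR (slog k x).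
  rewrite /a cmodM cmod_real /slog /Sx gx expRD !lnK ?posrE ?normr_gt0 ?cmod_gt0//.
  by rewrite mulrC.
have a0 : a j != 0 by rewrite mulf_neq0.
have ha k : k != j -> cmod (a k) <= expR (- l) * cmod (a j).
  move=> kj; rewrite !ca -expRD ler_expR; have := lead k; by rewrite kj /=; lra.
have [h1 h2] := weighted_mean_dominant a0 (expR_ge0 _) hl ha hq.
have A1 : (lincomb b x).[1] = \sum_k a k by exact: horner_lincomb.
split; first by rewrite A1.
suff -> : speed N.+1 (lincomb b x) = complex.Re ((\sum_k a k * dlog k x) / \sum_k a k) by [].
have dE : (lincomb b x)^`().[1] = \sum_k ((b k)%:C)%C * (pA (x k))^`().[1].
  by rewrite /lincomb raddf_sum /= horner_sum; apply: eq_bigr => k _; rewrite derivZ hornerZ.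
have -> : \sum_k a k * dlog k x = N.+1%:R * (\sum_k a k) - 2 * (lincomb b x)^`().[1].
  rewrite dE !mulr_sumr -sumrB; apply: eq_bigr => k _.
  rewrite /dlog /qx gx /lq /a mulrBr mulrC; congr (_ - _).
  exact: quot_arith.
rewrite mulrBl mulfK// RecD RecN -mulrA [X in X - _](_ : _ = N.+1%:R); last first.
  by rewrite -[N.+1%:R]/(N.+1%:R : C) -(rmorph_nat (real_complex R)).
rewrite /speed A1; congr (_ - _).
by rewrite !mulr_natl raddfMn.
Qed.

(** Let j maximise [slog]: either it leads by l, or some other index is within l of it and the
    double sum is at least 1. *)
Lemma leads_or_close (l : R) (x : 'I_n -> 'M[C]_N.+1) : (0 < n)%N ->
  1 - \sum_j \sum_(k < n | k != j) (`|slog j x - slog k x| <= l)%R%:R <= \sum_j (leads l j x)%:R :> R.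
Proof.
move=> n0; pose s k := slog k x.
have [j _ hj] := @arg_maxP _ R 'I_n (Ordinal n0) xpredT s isT.
have pos (Q : 'I_n -> bool) : 0 <= \sum_i (Q i)%:R :> R by apply: sumr_ge0 => i _; exact: ler0n.
have posd : 0 <= \sum_j \sum_(k < n | k != j) (`|slog j x - slog k x| <= l)%R%:R :> R.
  by apply: sumr_ge0 => i _; apply: sumr_ge0 => k _; exact: ler0n.
case: (boolP (leads l j x)) => [lj|/forallPn[k]].
  apply: (@le_trans _ _ 1); first by rewrite gerDl oppr_le0.
  by rewrite (bigD1 j)//= lj lerDl; apply: sumr_ge0 => i _; exact: ler0n.
rewrite negb_imply -ltNge => /andP[kj lt].
apply: le_trans (pos _); rewrite subr_le0 (bigD1 j)//= (bigD1 k)//=.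
have -> : (`|slog j x - slog k x| <= l)%R.
  have /= h := hj k isT; rewrite ger0_norm ?subr_ge0//.
  by rewrite lerBlDl ltW.
rewrite -addrA lerDl addr_ge0//; first by apply: sumr_ge0 => i _; exact: ler0n.
by apply: sumr_ge0 => i _; apply: sumr_ge0 => i' _; exact: ler0n.
Qed.

End LowerBound.

(** The 5 is 1 for the absence of a leader, 2 for the two losses t m per index, and 2 for the
    tails. *)
Lemma lower_arith (R : realFieldType) (n t m sD sG x : R) : 1 <= n -> 0 <= t -> 0 <= m ->
  1 - n * (n * t) <= sD -> m * sD - n * (t * m) - n * (t * m) - n * (n * (2 * t * m)) <= x ->
  (1 - 5 * n ^+ 2 * t) * m <= x.
Proof.
move=> n1 t0 m0 h1 h2; apply: le_trans h2.
have h3 : m * (1 - n * (n * t)) <= m * sD by rewrite ler_wpM2l.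
have h4 : n * (t * m) <= n * (n * (t * m)).
  by rewrite ler_wpM2l ?ler_peMl ?mulr_ge0//; exact: le_trans ler01 n1.
have e1 : m * (1 - n * (n * t)) = m - n * (n * (t * m)) by ring.
have e2 : n * (n * (2 * t * m)) = 2 * (n * (n * (t * m))) by ring.
have e3 : (1 - 5 * n ^+ 2 * t) * m = m - 5 * (n * (n * (t * m))) by ring.
by rewrite e1 in h3; rewrite e2 e3; lra.
Qed.

(** * The lower bound at a fixed order, from quantitative hypotheses *)

Section FixedSizeLowerBound.
Variable R : realType.
Local Notation C := R[i].
Context (n N : nat) (b : 'I_n -> R).
Context d (T : measurableType d) (P : probability T R) (U : 'I_n -> T -> 'M[C]_N.+1).
Hypotheses (hU : forall j, haar_SU_distributed P (U j)) (hI : mutually_independent P U).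
Hypotheses (n0 : (0 < n)%N) (b0 : forall j, b j != 0).
Local Notation m := (N.+1%:R : R).
Local Notation Uw w := (fun j : 'I_n => U j w).
Local Notation S j w := (Sx N.+1 (pA (U j w))).
Local Notation q j w := (qx N.+1 (pA (U j w))).
Local Notation beta j w := (complex.Re (qx N.+1 (pA (U j w)))).
Context (t Lam Y l : R).
Hypotheses (t0 : 0 <= t) (Lam0 : 0 <= Lam) (l0 : 0 < l) (Y0 : 0 <= Y).
Hypothesis (hgood : forall j, {ae P, forall w, good N.+1 (pA (U j w))}).
Hypothesis (ib : forall j, intg P (fun w => beta j w)).
Hypothesis (hall : forall j, m <= Ex P (fun w => beta j w) + t * m).
Hypothesis (hthr : forall j x,
  m * Ex P (fun w => (x <= S j w)%R%:R) <= Ex P (fun w => (x <= S j w)%R%:R * beta j w) + t * m).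
Hypothesis (hac : forall j x, Ex P (fun w => (`|S j w - x| <= l)%R%:R) <= t).
Hypothesis (hq : forall j, Ex P (fun w => (Y * m <= cmod (q j w))%R%:R) <= 2 / (1 + Y)).
Hypothesis (iex : forall j, intg P (fun w => Num.max 0 (beta j w - Lam * m))).
Hypothesis (hex : forall j, Ex P (fun w => Num.max 0 (beta j w - Lam * m)) <= t * m).
Hypotheses (hY : Lam * (2 / (1 + Y)) <= t) (hl : 4 * (n%:R * expR (- l)) * Y <= t)
  (hl2 : n%:R * expR (- l) <= 2^-1).

Let mU j k i : cmeas (fun w => U j w k i). Proof. exact: (haar_cmeas (hU j)). Qed.
Let m0 : 0 <= m. Proof. by []. Qed.
Let ms j : measurable_fun setT (fun w => slog b j (Uw w)). Proof. exact: measurable_slog. Qed.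
Let mq j : cmeas (fun w => q j w). Proof. exact: (@cmeas_dlog R n N _ _ (fun w => Uw w)). Qed.
Let mS j : measurable_fun setT (fun w => S j w).
Proof. by apply: (@measurable_Sx _ _ _ N.+1); [move=> w; exact: size_pA|exact: pmeas_pA]. Qed.

Let intg_natb (Q : T -> bool) : measurable_fun setT (fun w => (Q w)%:R : R) ->
  intg P (fun w => (Q w)%:R).
Proof. by move=> mQ; apply: (@intg_bdd _ _ _ _ _ 1) => // w; exact: norm_natb_le1. Qed.

Let intg_natbM (Q : T -> bool) j : measurable_fun setT (fun w => (Q w)%:R : R) ->
  intg P (fun w => (Q w)%:R * beta j w).
Proof. by move=> mQ; apply: (@intgM_bdd _ _ _ _ _ _ 1) => // w; exact: norm_natb_le1. Qed.

Let il j : intg P (fun w => (leads b l j (Uw w))%:R).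
Proof. by apply: intg_natb; exact: measurable_leads. Qed.

Let ilb j : intg P (fun w => (leads b l j (Uw w))%:R * beta j w).
Proof. by apply: intg_natbM; exact: measurable_leads. Qed.

Let leads_mix j w' w : leads b l j (mix U j w' w) =
  [forall k, (k != j) ==> (slog b k (Uw w') + l - ln `|b j| <= S j w)].
Proof.
apply: eq_forallb => k; case: (boolP (k == j)) => //= kj.
by rewrite /slog /mix eqxx (negbTE kj) lerBlDr.
Qed.

(** With the other matrices frozen, [leads] becomes a threshold event for S_j, and [hthr] applies;
    without a competitor it is the whole space, and [hall] applies. *)
Lemma leads_weight j :
  m * Ex P (fun w => (leads b l j (Uw w))%:R) <= Ex P (fun w => (leads b l j (Uw w))%:R * beta j w) + t * m.
Proof.
have mc (j' : 'I_n) (i i' : 'I_N.+1) : cmeas (fun x : tupT R n N.+1 => (x : 'I_n -> 'M[C]_N.+1) j' i i').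
  exact: cmeas_coord.
have md := @cmeas_dlog R n N _ _ (fun x : tupT R n N.+1 => (x : 'I_n -> 'M[C]_N.+1)) mc j.
have ml := @measurable_leads R n N b _ _ (fun x : tupT R n N.+1 => (x : 'I_n -> 'M[C]_N.+1)) mc l j.
have tm : 0 <= t * m by rewrite mulr_ge0.
have beta0 (x : 'I_n -> 'M[C]_N.+1) : 0 <= complex.Re (dlog j x) by exact: le_trans ler01 (Re_qx _ _).
rewrite -ExZ//.
apply: (@le_trans _ _ (Ex P (fun w => (leads b l j (Uw w))%:R * beta j w + t * m))); last first.
  by rewrite ExD ?Ex_cst//; exact: intg_cst.
apply: (@mix_le R n N.+1 _ _ P U hU hI j
  (fun x => m * (leads b l j x)%:R) (fun x => (leads b l j x)%:R * complex.Re (dlog j x) + t * m)).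
- by apply: measurable_funM; [exact: measurable_cst|exact: ml].
- by apply: measurable_funD; [apply: measurable_funM; [exact: ml|case: md]|exact: measurable_cst].
- by move=> x; rewrite mulr_ge0.
- by move=> x; rewrite addr_ge0// mulr_ge0// beta0.
- exact: intgZ.
- by apply: intgD => //; exact: intg_cst.
move=> w'.
have dE w : complex.Re (dlog j (mix U j w' w)) = beta j w by rewrite /dlog /mix eqxx.
pose x k := slog b k (Uw w') + l - ln `|b j|.
have key (D : R -> bool) : (forall w, leads b l j (mix U j w' w) = D (S j w)) ->
    measurable_fun setT (fun w => (D (S j w))%:R : R) ->
    m * Ex P (fun w => (D (S j w))%:R) <= Ex P (fun w => (D (S j w))%:R * beta j w) + t * m ->
    (\int[P]_w (m * (leads b l j (mix U j w' w))%:R)%:E <=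
     \int[P]_w ((leads b l j (mix U j w' w))%:R * complex.Re (dlog j (mix U j w' w)) + t * m)%:E)%E.
  move=> DE mD h.
  under eq_integral => w _ do rewrite DE.
  under [in leRHS]eq_integral => w _ do rewrite DE dE.
  rewrite -EFin_Ex; last by apply: intgZ; exact: intg_natb.
  rewrite -EFin_Ex; last by apply: intgD; [exact: intg_natbM|exact: intg_cst].
  rewrite lee_fin ExZ; last exact: intg_natb.
  by rewrite ExD ?Ex_cst//; [exact: intg_natbM|exact: intg_cst].
have [[y hy]|hT] := threshold_shape x j.
  apply: (key (fun s => y <= s)) => [w||].
  - by rewrite leads_mix; exact: hy.
  - by apply: measurable_ind_le => //; exact: measurable_cst.
  - exact: hthr.
apply: (key (fun=> true)) => [w||].
- by rewrite leads_mix; exact: hT.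
- exact: measurable_cst.
- rewrite Ex_cst mulr1 (_ : (fun w => true%:R * _) = fun w => beta j w)//.
  by apply/funext => w; rewrite mul1r.
Qed.

(** Freezing index k makes its logarithm a constant, to which anticoncentration of index j
    applies. *)
Lemma close_prob j k : k != j ->
  Ex P (fun w => (`|slog b j (Uw w) - slog b k (Uw w)| <= l)%R%:R) <= t.
Proof.
move=> kj.
have mc (j' : 'I_n) (i i' : 'I_N.+1) : cmeas (fun x : tupT R n N.+1 => (x : 'I_n -> 'M[C]_N.+1) j' i i').
  exact: cmeas_coord.
have mS' j' := @measurable_slog R n N b _ _ (fun x : tupT R n N.+1 => (x : 'I_n -> 'M[C]_N.+1)) mc j'.
rewrite -[leRHS](Ex_cst P t).
apply: (@mix_le R n N.+1 _ _ P U hU hI j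
  (fun x => (`|slog b j x - slog b k x| <= l)%R%:R) (fun=> t)).
- apply: measurable_ind_le; last exact: measurable_cst.
  apply: (measurableT_comp (@normr_measurable R setT)).
  by apply: measurable_funB; exact: mS'.
- exact: measurable_cst.
- by move=> x; exact: ler0n.
- by [].
- apply: intg_natb; apply: measurable_ind_le; last exact: measurable_cst.
  apply: (measurableT_comp (@normr_measurable R setT)).
  by apply: measurable_funB; exact: ms.
- exact: intg_cst.
move=> w'; rewrite integral_cst//= probability_setT mule1.
pose x := slog b k (Uw w') - ln `|b j|.
rewrite (eq_integral (fun w => ((`|S j w - x| <= l)%R%:R : R)%:E)); last first.
  move=> w _; rewrite /slog /mix eqxx (negbTE kj) /x /slog.
  by rewrite (_ : forall a c e : R, a + c - e = a - (e - c))// => a c e; ring.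
rewrite -EFin_Ex ?lee_fin ?hac//.
apply: intg_natb; apply: measurable_ind_le; last exact: measurable_cst.
apply: (measurableT_comp (@normr_measurable R setT)).
by apply: measurable_funB; [exact: mS|exact: measurable_cst].
Qed.

Let big j w : bool := (Y * m <= cmod (q j w))%R.

Let mbig j : measurable_fun setT (fun w => (big j w)%:R : R).
Proof. by apply: measurable_ind_le; [exact: measurable_cst|exact: measurable_cmod]. Qed.

(** Re q_j is at most Lam m plus its excess over Lam m: the first part costs Lam m times the tail
    probability of index k, the second its own mean, each at most t m. *)
Lemma tail_weight j k : Ex P (fun w => (big k w)%:R * beta j w) <= 2 * t * m.
Proof.
apply: (@le_trans _ _ (Ex P (fun w => Lam * m * (big k w)%:R + Num.max 0 (beta j w - Lam * m)))).
  apply: Ex_le; first exact: intg_natbM.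
    by apply: intgD => //; apply: intgZ; exact: intg_natb.
  move=> w; case: (big k w); rewrite ?mul1r ?mul0r ?mulr1 ?mulr0.
    by have : beta j w - Lam * m <= Num.max 0 (beta j w - Lam * m); [rewrite le_max lexx orbT|lra].
  by rewrite add0r le_max lexx.
rewrite ExD ?ExZ//; [|exact: intg_natb|by apply: intgZ; exact: intg_natb].
have h1 := hq k; have h2 := hex j.
have h3 : Lam * m * Ex P (fun w => (big k w)%:R) <= m * (Lam * (2 / (1 + Y))).
  by rewrite mulrAC mulrC ler_wpM2l// ler_wpM2l.
have h4 : m * (Lam * (2 / (1 + Y))) <= m * t by rewrite ler_wpM2l.
by move: h2 h3 h4; rewrite /big; lra.
Qed.

Lemma nzeros_lb : (((1 - 5 * n%:R ^+ 2 * t) * m)%:E <=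
  \int[P]_w nzeros_circle (comb_charpoly b (Uw w)))%E.
Proof.
(* Positive only if some index leads and no |q_k| is large: without a leader all summands are
   nonpositive, and one large |q_k| takes away all of Re q_j. The term t m pays for the influence of
   the dominated indices on the speed. *)
pose g w := \sum_j ((leads b l j (Uw w))%:R * beta j w - t * m - \sum_k (big k w)%:R * beta j w).
have ig : intg P g.
  apply: intg_sum => j; apply: intgB; last by apply: intg_sum => k; exact: intg_natbM.
  by apply: intgB => //; exact: intg_cst.
have bet1 j w : 1 <= beta j w by exact: Re_qx.
have bet0 j w : 0 <= beta j w by exact: le_trans ler01 (bet1 j w).
have tm0 : 0 <= t * m by rewrite mulr_ge0.
have sb0 j w : 0 <= \sum_k (big k w)%:R * beta j w by apply: sumr_ge0 => k _; rewrite mulr_ge0.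
have uniq j k w : leads b l j (Uw w) -> leads b l k (Uw w) -> j = k.
  move=> /forallP/(_ k) hj /forallP/(_ j) hk; apply/eqP; apply: contraT => jk.
  suff : (0 : R) < 0 by rewrite ltxx.
  by move: hj hk; rewrite jk [k == j]eq_sym jk /=; move: l0; lra.
pose G w : R := [forall k, good N.+1 (pA (U k w))]%:R.
have mG : measurable_fun setT G by exact: (@measurable_all_good R n N _ _ (fun w => Uw w)).
(* The admissible minorant for [kac_rice]: wherever it is positive, AA(1) is nonzero and the speed
   is at least g. *)
pose h w := G w * Num.max 0 (g w).
have gub w : [forall k, good N.+1 (pA (U k w))] -> 0 < g w ->
    (lincomb b (Uw w)).[1] != 0 /\ g w <= speed N.+1 (lincomb b (Uw w)).
  move=> /forallP gw g0.
  have term0 i : ~~ leads b l i (Uw w) ->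
      (leads b l i (Uw w))%:R * beta i w - t * m - \sum_k (big k w)%:R * beta i w <= 0.
    by move=> /negbTE ->; rewrite mul0r; have := sb0 i w; move: tm0; lra.
  case: (pickP (fun j => leads b l j (Uw w))) => [j lj|none]; last first.
    have : g w <= 0 by apply: sumr_le0 => i _; apply: term0; rewrite none.
    by move=> /(lt_le_trans g0); rewrite ltxx.
  have gle : g w <= beta j w - t * m - \sum_k (big k w)%:R * beta j w.
    rewrite /g (bigD1 j)//= lj mul1r gerDl; apply: sumr_le0 => i ij; apply: term0.
    by apply: contra ij => li; apply/eqP; exact: uniq li lj.
  case: (pickP (fun k => big k w)) => [k bk|nbig].
    have : beta j w <= \sum_k (big k w)%:R * beta j w.
      rewrite (bigD1 k)//= bk mul1r lerDl; apply: sumr_ge0 => i _; exact: mulr_ge0.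
    by move: gle g0 tm0; lra.
  have hQ k : cmod (dlog k (Uw w)) <= Y * m.
    by have := nbig k; rewrite /big => /negbT; rewrite -ltNge => /ltW.
  have [h1 h2] := speed_leads b0 hl2 gw lj hQ; split => //.
  have h3 : 4 * (n%:R * expR (- l)) * (Y * m) <= t * m by rewrite mulrA ler_wpM2r.
  have h4 := sb0 j w; have {}h2 : beta j w - 4 * (n%:R * expR (- l)) * (Y * m) <= speed N.+1 (lincomb b (Uw w)) by [].
  by move: gle h2 h3 h4; lra.
have ih : intg P h.
  apply: (@intg_le _ _ _ _ _ (fun w => `|g w|)); last 2 first.
  - exact: intg_norm.
  - move=> w; rewrite /h normrM -[leRHS]mul1r; apply: ler_pM => //; first exact: norm_natb_le1.
    by rewrite ger0_norm ?le_max ?lexx// ge_max normr_ge0 ler_norm.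
  by apply: measurable_funM => //; apply: measurable_maxr; [exact: measurable_cst|exact: (intg_meas ig)].
apply: (@le_trans _ _ (\int[P]_w (h w)%:E)%E); last first.
  apply: (kac_rice hU hI).
  - by move=> w; rewrite mulr_ge0 ?ler0n// le_max lexx.
  - move=> w; rewrite /h /G; case: (boolP [forall k, _]) => gw; last by rewrite mul0r.
    rewrite mul1r ge_max normr_ge0 /=; case: (ltP 0 (g w)) => g0; last exact: le_trans g0 _.
    by have [_ h2] := gub w gw g0; exact: le_trans h2 (ler_norm _).
  - move=> w e; rewrite /h /G; case: (boolP [forall k, _]) => gw; last by rewrite mul0r.
    rewrite mul1r; case: (ltP 0 (g w)) => // g0.
    by have [] := gub w gw g0; rewrite e eqxx.
rewrite -EFin_Ex// lee_fin; apply: (@le_trans _ _ (Ex P g)); last first.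
  apply: Ex_le_ae => //.
  have hg : {ae P, forall w, forall j, good N.+1 (pA (U j w))} by exact: filter_forall.
  apply: filterS hg => w gw; rewrite /h /G.
  have -> : [forall k, good N.+1 (pA (U k w))] by apply/forallP.
  by rewrite mul1r le_max lexx orbT.
have n1 : 1 <= n%:R :> R by rewrite ler1n.
have sumc (c : R) : \sum_(j < n) c = n%:R * c by rewrite sumr_const card_ord mulr_natl.
apply: (@lower_arith _ n%:R t m (\sum_j Ex P (fun w => (leads b l j (Uw w))%:R))) => //.
  rewrite -Ex_sum//.
  have ic j k : intg P (fun w => (`|slog b j (Uw w) - slog b k (Uw w)| <= l)%R%:R).
    apply: intg_natb; apply: measurable_ind_le; last exact: measurable_cst.
    apply: (measurableT_comp (@normr_measurable R setT)).
    by apply: measurable_funB; exact: ms.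
  have ics j : intg P (fun w => \sum_(k < n | k != j) (`|slog b j (Uw w) - slog b k (Uw w)| <= l)%R%:R).
    exact: intg_sum.
  apply: le_trans (Ex_le _ _ (fun w => leads_or_close b l (Uw w) n0)); last 2 first.
  - by apply: intg_cstB; exact: intg_sum.
  - exact: intg_sum.
  rewrite Ex_cstB; last exact: intg_sum.
  rewrite lerD2l lerN2 Ex_sum// -sumc; apply: ler_sum => j _; rewrite Ex_sum//.
  apply: (@le_trans _ _ (\sum_(k < n | k != j) t)).
    by apply: ler_sum => k kj; exact: close_prob.
  by rewrite -sumc [leRHS](bigD1 j)//= lerDr.
have -> : Ex P g = \sum_j (Ex P (fun w => (leads b l j (Uw w))%:R * beta j w) - t * m -
    \sum_k Ex P (fun w => (big k w)%:R * beta j w)).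
  have i1 j : intg P (fun w => (leads b l j (Uw w))%:R * beta j w - t * m).
    by apply: intgB => //; exact: intg_cst.
  have i2 j : intg P (fun w => \sum_k (big k w)%:R * beta j w).
    by apply: intg_sum => k; exact: intg_natbM.
  rewrite Ex_sum; last by move=> j; exact: intgB.
  apply: eq_bigr => j _; rewrite (ExB (i1 j) (i2 j)) (ExB (ilb j) (intg_cst P (t * m))) Ex_cst.
  have es : Ex P (fun w => \sum_k (big k w)%:R * beta j w) = \sum_k Ex P (fun w => (big k w)%:R * beta j w).
    by apply: Ex_sum => k; exact: intg_natbM.
  by rewrite es.
rewrite mulr_sumr -!sumc -!sumrB; apply: ler_sum => j _.
have h1 := leads_weight j.
have h2 : \sum_k Ex P (fun w => (big k w)%:R * beta j w) <= \sum_(k < n) 2 * t * m.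
  by apply: ler_sum => k _; exact: tail_weight.
by move: h1 h2; lra.
Qed.

End FixedSizeLowerBound.

(** * A Lipschitz ramp *)

Section Clip.
Variable R : realType.

Definition clip (u : R) : R := Num.max 0 (Num.min 1 u).

Lemma clipP u : [\/ u <= 0 /\ clip u = 0, 0 <= u <= 1 /\ clip u = u | 1 <= u /\ clip u = 1].
Proof.
rewrite /clip; case/orP: (le_total u 0) => u0.
  by apply: Or31; rewrite min_r ?max_l//; exact: le_trans u0 ler01.
case/orP: (le_total u 1) => u1; last by apply: Or33; rewrite min_l// max_r.
by apply: Or32; rewrite u0 u1 min_r// max_r.
Qed.

Lemma clip_ge0 u : 0 <= clip u.
Proof. by case: (clipP u) => -[h ->] //; case/andP: h. Qed.

Lemma clip_le1 u : clip u <= 1.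
Proof. by case: (clipP u) => -[h ->] //; case/andP: h. Qed.

Lemma clip_lip u v : `|clip u - clip v| <= `|u - v|.
Proof.
have h1 := ler_norm (u - v); have h2 : v - u <= `|u - v| by rewrite distrC ler_norm.
have h3 := normr_ge0 (u - v).
move: `|u - v| h1 h2 h3 => a h1 h2 h3; rewrite ler_norml.
case: (clipP u) => -[hu ->]; case: (clipP v) => -[hv ->];
  try case/andP: hu => hu1 hu2; try case/andP: hv => hv1 hv2; apply/andP; split; lra.
Qed.

End Clip.

(** * Decorrelation for threshold events *)

Section Threshold.
Variable R : realType.
Local Notation C := R[i].
Context (d : nat -> measure_display) (T : forall N, measurableType (d N))
  (P : forall N, probability (T N) R) (X : forall N, T N -> 'M[C]_N.+1).
Hypothesis hX : forall N, haar_SU_distributed (P N) (@X N).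
Local Notation Sw := (@Sw R d T X _).
Local Notation qw := (@qw R d T X _).
Local Notation bw w := (complex.Re (qw w)).

Lemma threshold_arith (m a e x k y t ha : R) : 0 < m -> a <= e + x -> x <= t / 3 ->
  8 * k <= t / 3 -> 32 * ha <= t / 3 * m -> m * e - 8 * k * m - 32 * ha <= y ->
  m * a <= y + t * m.
Proof.
move=> m0 h1 h2 h3 h4 h5.
have h6 : m * a <= m * (e + x) by rewrite ler_wpM2l// ltW.
have h7 : m * x <= m * (t / 3) by rewrite ler_wpM2l// ltW.
have h8 : 8 * k * m <= t / 3 * m by rewrite ler_wpM2r// ltW.
rewrite mulrDr in h6; lra.
Qed.

(** The indicator of x <= S lies above the ramp clip((S - x) / K) and exceeds it at most on |S - x|
    <= K, an event of small probability uniformly in x; [decorrelation] applies to the ramp. The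
    constant function 1 gives the first claim. *)
Lemma threshold_weight (t : R) : 0 < t -> exists N1, forall N, (N1 <= N)%N ->
  N.+1%:R <= Ex (P N) (fun w => bw w) + t * N.+1%:R /\
  forall x, N.+1%:R * Ex (P N) (fun w => (x <= Sw w)%R%:R) <=
    Ex (P N) (fun w => (x <= Sw w)%R%:R * bw w) + t * N.+1%:R.
Proof.
move=> t0; pose K : R := 1 + 24 / t.
have K1 : 1 <= K by rewrite lerDl divr_ge0// ltW.
have K0 : 0 < K by exact: lt_le_trans ltr01 K1.
have t3 : 0 < t / 3 by rewrite divr_gt0.
have [N1 h1] := anticoncentration hX K1 t3.
have [|N2 h2] := @harm_o R (t / 96); first by rewrite divr_gt0.
have kE : 8 * K^-1 <= t / 3.
  have e : t * K = t + 24 by rewrite mulrDr mulr1 [t * (_ / _)]mulrC divfK// gt_eqF.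
  by rewrite -[_^-1]mul1r mulrA ler_pdivrMr// mulr1 mulrAC e; lra.
exists (maxn N1 N2) => N; rewrite geq_max => /andP[N1N N2N].
have m0 : 0 < N.+1%:R :> R by rewrite ltr0n.
have hh : 32 * harm R N <= t / 3 * N.+1%:R by have := h2 N N2N; lra.
have bge (w : T N) : 0 <= bw w by exact: le_trans ler01 (Re_qx _ _).
split.
  have h01 (x : R) : 0 <= (1 : R) <= 1 by rewrite ler01 lexx.
  have [|i1 i2 h] := @decorrelation R d T P X hX N (fun=> 1) 0 (lexx _) h01.
    by move=> x y; rewrite subrr normr0 mul0r.
  rewrite Ex_cst mulr1 mulr0 mul0r subr0 in h.
  have e : Ex (P N) (fun w => bw w * 1) = Ex (P N) (fun w => bw w).
    by apply: eq_Ex => w; rewrite mulr1.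
  rewrite e in h; have : 0 <= t * N.+1%:R by rewrite mulr_ge0// ltW.
  by clear h01; lra.
move=> x; pose g s := clip (K^-1 * (s - x)).
have g01 s : 0 <= g s <= 1 by rewrite clip_ge0 clip_le1.
have kv0 : 0 <= K^-1 by rewrite invr_ge0 ltW.
have gl s s' : `|g s - g s'| <= K^-1 * `|s - s'|.
  apply: le_trans (clip_lip _ _) _; rewrite -mulrBr normrM ger0_norm//.
  by rewrite opprB addrA subrK.
have [i1 i2 h] := @decorrelation R d T P X hX N g _ kv0 g01 gl.
have mS : measurable_fun setT (fun w : T N => Sw w) by exact: measurable_Sw.
have mI : measurable_fun setT (fun w : T N => (x <= Sw w)%R%:R : R).
  by apply: measurable_ind_le => //; exact: measurable_cst.
have mA : measurable_fun setT (fun w : T N => (`|Sw w - x| <= K)%R%:R : R).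
  apply: measurable_ind_le; last exact: measurable_cst.
  apply: (measurableT_comp (@normr_measurable R setT)).
  by apply: measurable_funB => //; exact: measurable_cst.
have iI : intg (P N) (fun w => (x <= Sw w)%R%:R).
  by apply: (@intg_bdd _ _ _ _ _ 1) => // w; exact: norm_natb_le1.
have iA : intg (P N) (fun w => (`|Sw w - x| <= K)%R%:R).
  by apply: (@intg_bdd _ _ _ _ _ 1) => // w; exact: norm_natb_le1.
have [ib _] := @Ex_b R d T P X hX N.
have iIb : intg (P N) (fun w => (x <= Sw w)%R%:R * bw w).
  by apply: (@intgM_bdd _ _ _ _ _ _ 1) => // w; exact: norm_natb_le1.
have a1 : Ex (P N) (fun w => (x <= Sw w)%R%:R) <= Ex (P N) (fun w => g (Sw w)) +
    Ex (P N) (fun w => (`|Sw w - x| <= K)%R%:R).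
  rewrite -ExD//; apply: Ex_le => //; first exact: intgD.
  move=> w; have /andP[g0 g1] := g01 (Sw w); case: (leP x (Sw w)) => xs; last by rewrite addr_ge0.
  case: (leP `|Sw w - x| K) => hK; first by rewrite lerDr.
  rewrite addr0 /g; have hu : 1 <= K^-1 * (Sw w - x).
    rewrite ger0_norm ?subr_ge0// in hK.
    by rewrite mulrC ler_pdivlMr// mul1r ltW.
  case: (clipP (K^-1 * (Sw w - x))) => -[h' ->] //.
  by have := le_trans hu h'; rewrite ler10.
have a2 : Ex (P N) (fun w => bw w * g (Sw w)) <= Ex (P N) (fun w => (x <= Sw w)%R%:R * bw w).
  apply: Ex_le => // w; rewrite mulrC ler_wpM2r//.
  case: (leP x (Sw w)) => xs; first by have /andP[] := g01 (Sw w).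
  rewrite /g; case: (clipP (K^-1 * (Sw w - x))) => -[h' ->] //.
    case/andP: h' => h' _; move: h'; rewrite pmulr_rge0 ?invr_gt0// subr_ge0 => h'.
    by have := lt_le_trans xs h'; rewrite ltxx.
  have : K^-1 * (Sw w - x) <= 0 by rewrite pmulr_rle0 ?invr_gt0// subr_le0 ltW.
  by move=> h''; have := le_trans h' h''; rewrite ler10.
exact: threshold_arith m0 a1 (h1 N N1N x) kE hh (le_trans h a2).
Qed.

End Threshold.

(** * Choice of the parameters and passage to large N *)

Section Asymptotics.
Variable R : realType.
Local Notation C := R[i].
Context (n : nat) (b : 'I_n -> R).
Context (d : nat -> measure_display) (T : forall N, measurableType (d N))
  (P : forall N, probability (T N) R) (U : forall N, 'I_n -> T N -> 'M[C]_N.+1).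
Hypotheses (hU : forall N j, haar_SU_distributed (P N) (@U N j))
  (hI : forall N, mutually_independent (P N) (@U N)).
Hypotheses (n0 : (0 < n)%N) (b0 : forall j, b j != 0).

Lemma near_of_ex (Q : nat -> Prop) : (exists N1, forall N, (N1 <= N)%N -> Q N) ->
  \forall N \near \oo, Q N.
Proof. by move=> [N1 h]; exists N1. Qed.

Lemma excess_arith (m e L ha t : R) : 0 < t -> L = 98 / t -> e * L <= 49 * m + 32 * (2 + L) * ha ->
  32 * (2 + L) * ha <= 49 * m -> e <= t * m.
Proof.
move=> t0 LE h1 h2; have : e * L <= 98 * m by lra.
rewrite LE mulrA ler_pdivrMr// => h3; lra.
Qed.

Lemma tail_arith (m Y : R) : 0 < m -> 2 * (m / (m + Y * m)) = 2 / (1 + Y).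
Proof.
move=> m0; congr (2 * _); have -> : m + Y * m = m * (1 + Y) by ring.
by rewrite invfM mulrA divff ?gt_eqF// mul1r.
Qed.

Lemma expected_zeros_lb (eps : R) : 0 < eps -> \forall N \near \oo,
  (((1 - eps) * N.+1%:R)%:E <=
   \int[P N]_w nzeros_circle (comb_charpoly b (fun j => U j w)))%E.
Proof.
move=> e0; have n1 : 1 <= n%:R :> R by rewrite ler1n.
have np : 0 < n%:R :> R by rewrite ltr0n.
pose t := eps / (5 * n%:R ^+ 2).
have n2 : 0 < 5 * n%:R ^+ 2 :> R by rewrite mulr_gt0// exprn_gt0.
have t0 : 0 < t by rewrite divr_gt0.
have tE : 5 * n%:R ^+ 2 * t = eps by rewrite /t mulrC divfK// gt_eqF.
(* Once the harmonic term is below 49 m, the mean excess times ln Lam is at most 98 m. *)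
pose Lam := expR (98 / t).
have Lam1 : 1 < Lam by rewrite expR_gt1 divr_gt0.
have Lam0 : 0 < Lam by exact: expR_gt0.
have lnL : ln Lam = 98 / t by exact: expRK.
(* Makes Lam times the tail bound 2 / (1 + Y) at most t. *)
pose Y := 2 * Lam / t.
have Y0 : 0 < Y by rewrite divr_gt0// mulr_gt0.
have hY : Lam * (2 / (1 + Y)) <= t.
  rewrite mulrA ler_pdivrMr ?addr_gt0// (mulrDr t 1) mulr1.
  have -> : t * Y = 2 * Lam by rewrite /Y mulrC divfK// gt_eqF.
  lra.
(* The required gap is l = ln E: the summand 2 n gives n / E <= 1/2, the last one gives 4 n Y / E <=
   t, and the 1 makes l positive. *)
pose E := 1 + 2 * n%:R + 4 * n%:R * Y / t.
have nY : 0 <= 4 * n%:R * Y / t.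
  by apply: divr_ge0; [apply: mulr_ge0; [exact: mulr_ge0|exact: ltW]|exact: ltW].
have E1 : 1 < E by rewrite /E; lra.
have E0 : 0 < E by exact: lt_trans ltr01 E1.
pose l := ln E.
have l0 : 0 < l by exact: ln_gt0.
have eE : expR (- l) = E^-1 by rewrite expRN lnK.
have hl : 4 * (n%:R * expR (- l)) * Y <= t.
  rewrite eE (_ : 4 * (n%:R / E) * Y = 4 * n%:R * Y / E); last by move: E^-1 => v; ring.
  have tE' : t * E = t * (1 + 2 * n%:R) + 4 * n%:R * Y.
    by rewrite /E (mulrDr t (1 + 2 * n%:R)) [t * (_ / t)]mulrC divfK// gt_eqF.
  by rewrite (ler_pdivrMr _ _ E0) tE' lerDr mulr_ge0 ?(ltW t0)//; lra.
have hl2 : n%:R * expR (- l) <= 2^-1.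
  rewrite eE ler_pdivrMr// /E; move: nY; lra.
have L2 : 0 < 32 * (2 + ln Lam) by rewrite lnL mulr_gt0// addr_gt0// divr_gt0.
have harm_near : \forall N \near \oo, 32 * (2 + ln Lam) * harm R N <= 49 * N.+1%:R.
  have [|N1 h] := @harm_o R (49 / (32 * (2 + ln Lam))); first by rewrite divr_gt0.
  apply: near_of_ex; exists N1 => N /h; rewrite mulrAC ler_pdivlMr//.
  by rewrite mulrC.
have thr_near : \forall N \near \oo, forall j : 'I_n,
    N.+1%:R <= Ex (P N) (fun w => complex.Re (qx N.+1 (pA (U j w)))) + t * N.+1%:R /\
    forall x, N.+1%:R * Ex (P N) (fun w => (x <= Sx N.+1 (pA (U j w)))%R%:R) <=
      Ex (P N) (fun w => (x <= Sx N.+1 (pA (U j w)))%R%:R * complex.Re (qx N.+1 (pA (U j w)))) + t * N.+1%:R.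
  apply: filter_forall => j; apply: near_of_ex.
  exact: (@threshold_weight R d T P (fun N => @U N j) (fun N => hU N j) t t0).
(* The gap is enlarged to l + 1 because [anticoncentration] asks for a window of at least 1. *)
have ac_near : \forall N \near \oo, forall (j : 'I_n) x,
    Ex (P N) (fun w => (`|Sx N.+1 (pA (U j w)) - x| <= l + 1)%R%:R) <= t.
  apply: filter_forall => j; apply: near_of_ex.
  have l1 : 1 <= l + 1 by rewrite lerDr ltW.
  exact: (@anticoncentration R d T P (fun N => @U N j) (fun N => hU N j) _ t l1 t0).
near=> N.
have hh : 32 * (2 + ln Lam) * harm R N <= 49 * N.+1%:R by near: N.
have ht := near thr_near N; have {ht}ht : forall j : 'I_n,
    N.+1%:R <= Ex (P N) (fun w => complex.Re (qx N.+1 (pA (U j w)))) + t * N.+1%:R /\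
    forall x, N.+1%:R * Ex (P N) (fun w => (x <= Sx N.+1 (pA (U j w)))%R%:R) <=
      Ex (P N) (fun w => (x <= Sx N.+1 (pA (U j w)))%R%:R * complex.Re (qx N.+1 (pA (U j w)))) + t * N.+1%:R.
  by near: N.
have ha : forall (j : 'I_n) x,
    Ex (P N) (fun w => (`|Sx N.+1 (pA (U j w)) - x| <= l + 1)%R%:R) <= t by near: N.
have m0 : 0 < N.+1%:R :> R by rewrite ltr0n.
rewrite -tE.
have mS j : measurable_fun setT (fun w : T N => Sx N.+1 (pA (U j w))).
  exact: (@measurable_Sw R d T P (fun N => @U N j) (fun N => hU N j) N).
refine (@nzeros_lb R n N b (d N) (T N) (P N) (@U N) (hU N) (@hI N) n0 b0 t Lam Y l (ltW t0) (ltW Lam0) l0 _ _ _ _ _ _ _ _ hY hl hl2).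
- by move=> j; exact: (@pA_good R d T P (fun N => @U N j) (fun N => hU N j) N).
- by move=> j; have [] := @Ex_b R d T P (fun N => @U N j) (fun N => hU N j) N.
- by move=> j; have [] := ht j.
- by move=> j; have [] := ht j.
- move=> j x; apply: le_trans (ha j x).
  have mi c : measurable_fun setT (fun w : T N => (`|Sx N.+1 (pA (U j w)) - x| <= c)%R%:R : R).
    apply: measurable_ind_le; last exact: measurable_cst.
    apply: (measurableT_comp (@normr_measurable R setT)).
    by apply: measurable_funB => //; exact: measurable_cst.
  have ii c : intg (P N) (fun w => (`|Sx N.+1 (pA (U j w)) - x| <= c)%R%:R).
    by apply: (@intg_bdd _ _ _ _ _ 1) => // w; exact: norm_natb_le1.
  apply: Ex_le => // w; rewrite ler_nat.
  case: (leP `|Sx N.+1 (pA (U j w)) - x| l) => // h.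
  by rewrite (le_trans h)// lerDl.
- move=> j; have [|_] := @q_tail R d T P (fun N => @U N j) (fun N => hU N j) N (Y * N.+1%:R).
    by rewrite mulr_gt0.
  move=> h; apply: le_trans h _.
  by rewrite tail_arith.
- by move=> j; have [] := @b_excess R d T P (fun N => @U N j) (fun N => hU N j) N Lam Lam1.
- move=> j; have [_] := @b_excess R d T P (fun N => @U N j) (fun N => hU N j) N Lam Lam1.
  by move=> h; exact: (excess_arith t0 lnL h hh).
Unshelve. all: by end_near. Qed.

End Asymptotics.

Theorem theorem1 (R : realType) (n : nat) (b : 'I_n -> R)
  (d : nat -> measure_display) (Omega : forall N : nat, measurableType (d N))
  (P : forall N : nat, probability (Omega N) R)
  (U : forall N : nat, 'I_n -> Omega N -> 'M[R[i]]_N) :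
  (0 < n)%N ->
  (forall j, b j != 0) ->
  (forall N, (0 < N)%N -> forall j, haar_SU_distributed (P N) (U N j)) ->
  (forall N, (0 < N)%N -> mutually_independent (P N) (U N)) ->
  forall eps : R, 0 < eps ->
    \forall N \near \oo,
      (`| \int[P N]_w
            nzeros_circle (fun z : R[i] =>
              (\sum_(j < n) ((b j)%:C)%C * charpoly_det (U N j w) z)%R)
          - (N%:R)%:E | <= (eps * N%:R)%:E)%E.
Proof.
move=> n0 b0 hU hI eps e0.
(* The lower bound is indexed by the order minus one, so all sequences are shifted by one. *)
have [N0 _ hN0] := @expected_zeros_lb R n b (fun N => d N.+1) (fun N => Omega N.+1)
  (fun N => P N.+1) (fun N => U N.+1) (fun N => hU N.+1 isT) (fun N => hI N.+1 isT) n0 b0 eps e0.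
(* The upper bound is stated for orders N+2, so orders 0 and 1 are discarded; order N+2 is index N+1
   of the shifted sequence. *)
exists N0.+2 => // -[|[|N]] // hN; have {}hN : (N0 <= N)%N := hN.
have lb := hN0 N.+1 (leqW hN).
have ub := @nzeros_ub R n N b _ _ (P N.+2) (U N.+2) (hU N.+2 isT) (hI N.+2 isT) n0 b0.
rewrite [X in (`|X - _| <= _)%E](_ : _ =
  \int[P N.+2]_w nzeros_circle (comb_charpoly b (fun j => U N.+2 j w)))%E//.
move: lb ub; case: (\int[P N.+2]_w _)%E => [r||] //.
rewrite !lee_fin => lb ub.
suff h : `|r - N.+2%:R| <= eps * N.+2%:R by rewrite -lee_fin in h; exact: h.
have e1 : 0 <= eps * N.+2%:R by rewrite mulr_ge0// ltW.
rewrite mulrBl mul1r in lb; rewrite ler_norml; apply/andP; split; lra.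
Qed.
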